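(* Consider the shock interaction problem on $T_\varepsilon$ described in the context (with given pressure law, given states ahead on $D^{(1)},D^{(2)}$, and given solution of the jump conditions at the interaction point satisfying the determinism conditions). Then there exists $\varepsilon_0>0$ such that for every $0<\varepsilon\le\varepsilon_0$ the shock interaction problem on $T_\varepsilon$ possesses a solution $(\alpha,\beta,t,x)$ with $\alpha,\beta,t,x\in C^2(T_\varepsilon)$. Also, for $\varepsilon$ sufficiently small, the Jacobian $\frac{\partial(t,x)}{\partial(u,v)}$ of this solution does not vanish in $T_\varepsilon$, which implies that $\alpha,\beta$ are $C^2$ functions of $(t,x)$ on the image of $T_\varepsilon$ under the map $(u,v)\mapsto(t(u,v),x(u,v))$.
   Context: FLUID. $p=p(\rho)$ is a given smooth function of the density $\rho>0$ with $\frac{dp}{d\rho}>0$; $\eta(\rho)=\sqrt{dp/d\rho}$ is the sound speed; $w$ is the velocity. Equations of motion: $\partial_t\rho+\partial_x(\rho w)=0$, $\partial_tw+w\,\partial_xw=-\frac1\rho\partial_xp$. Riemann invariants: $\alpha=\int^\rho\frac{\eta(\rho')}{\rho'}d\rho'+w$, $\beta=\int^\rho\frac{\eta(\rho')}{\rho'}d\rho'-w$ (same fixed lower limit of integration). Thus $\rho=\rho(\alpha,\beta)$ and $w=w(\alpha,\beta)=(\alpha-\beta)/2$ are smooth functions of $(\alpha,\beta)$, and so are the characteristic speeds $c_{\rm out}(\alpha,\beta)=w+\eta$ and $c_{\rm in}(\alpha,\beta)=w-\eta$. JUMPS. For a state behind (index $+$) and a state ahead (index $-$), $[f]=f_+-f_-$.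 Put $J(\alpha_+,\beta_+,\alpha_-,\beta_-)=[\rho w]^2-[\rho w^2+p][\rho]$, with $\rho_\pm=\rho(\alpha_\pm,\beta_\pm)$, $w_\pm=w(\alpha_\pm,\beta_\pm)$. The jump conditions $[\rho]V=[\rho w]$, $[\rho w]V=[\rho w^2+p]$ across a shock of speed $V$ are equivalent to $V=[\rho w]/[\rho]$ together with $J=0$. STATES AHEAD. Superscript $(1)$ refers to the left moving shock, $(2)$ to the right moving shock. Data at $t=0$ for $x\le 0$ ($i=1$) and for $x\ge0$ ($i=2$) have future developments: smooth solutions $(\rho^{*(i)},w^{*(i)})(t,x)$ of the equations of motion on $D^{(i)}$, where $D^{(1)}$ is bounded by $t=0$, $t=T^{(1)}$ ($T^{(1)}>0$) and on the right by the left moving characteristic ($dx/dt=c_{\rm in}$ of this solution) from $(0,0)$, and $D^{(2)}$ is bounded by $t=0$, $t=T^{(2)}$ ($T^{(2)}>0$) and on the left by the right moving characteristic ($dx/dt=c_{\rm out}$ of this solution) from $(0,0)$. $\alpha^{*(i)},\beta^{*(i)}$ are the corresponding Riemann invariants as functions of $(t,x)$, and $\alpha^{(i)}_{-0}=\alpha^{*(i)}(0,0)$, $\beta^{(i)}_{-0}=\beta^{*(i)}(0,0)$. ASSUMPTION AT THE INTERACTION POINT $(t,x)=(0,0)$. There are $\rho_0>0$ and $V_0^{(1)},V_0^{(2)}$ such that, with common state behind $\rho_+=\rho_0$, $w_+=w_0=0$ and with states ahead $\rho^{*(i)}(0,0),w^{*(i)}(0,0)$, the jump conditions hold with speed $V_0^{(i)}$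 for $i=1,2$. With $\eta_0=\eta(\rho_0)$ the determinism conditions hold: $-\eta_0<V_0^{(1)}<w^{*(1)}(0,0)-\eta(\rho^{*(1)}(0,0))$ and $w^{*(2)}(0,0)+\eta(\rho^{*(2)}(0,0))<V_0^{(2)}<\eta_0$; moreover $V_0^{(1)}<0<V_0^{(2)}$. CONSTANTS. $\beta_0=\alpha_0$ is the common value of both Riemann invariants at $\rho=\rho_0,w=0$. $$a=\frac{\eta_0+V_0^{(1)}}{\eta_0-V_0^{(1)}}\cdot\frac{\eta_0-V_0^{(2)}}{\eta_0+V_0^{(2)}}\in(0,1),\qquad \Gamma_0=-\frac{\eta_0+V_0^{(1)}}{\eta_0-V_0^{(1)}}<0 .$$ By the implicit function theorem there are smooth functions $H^{(1)}(\beta_+,\alpha_-,\beta_-)$ near $(\beta_0,\alpha^{(1)}_{-0},\beta^{(1)}_{-0})$ and $H^{(2)}(\alpha_+,\alpha_-,\beta_-)$ near $(\beta_0,\alpha^{(2)}_{-0},\beta^{(2)}_{-0})$, both with value $\beta_0$ at these points, such that $J(H^{(1)}(\beta_+,\alpha_-,\beta_-),\beta_+,\alpha_-,\beta_-)=0$ and $J(\alpha_+,H^{(2)}(\alpha_+,\alpha_-,\beta_-),\alpha_-,\beta_-)=0$. Let $F^{(i)}_0,M^{(i)}_{10},M^{(i)}_{20}$ be the partial derivatives of $H^{(i)}$ with respect to its first, second, third argument at these points (one has $F_0^{(1)}F_0^{(2)}=a^2$). With $s_1=1,s_2=a$ put $$A_i=\partial_t\alpha^{*(i)}(0,0)\tfrac1{\eta_0}\big(1-\tfrac{s_i}{\Gamma_0}\big)+\partial_x\alpha^{*(i)}(0,0)\big(\tfrac{s_i}{\Gamma_0}+1\big),$$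 $$B_i=\partial_t\beta^{*(i)}(0,0)\tfrac1{\eta_0}\big(1-\tfrac{s_i}{\Gamma_0}\big)+\partial_x\beta^{*(i)}(0,0)\big(\tfrac{s_i}{\Gamma_0}+1\big).$$ The constants $\alpha_0',\beta_0'$ are defined as the unique solution of the linear system $\alpha_0'-F_0^{(1)}\beta_0'=M^{(1)}_{10}A_1+M^{(1)}_{20}B_1$, $\;-aF_0^{(2)}\alpha_0'+\beta_0'=M^{(2)}_{10}A_2+M^{(2)}_{20}B_2$ (determinant $1-a^3>0$). DOMAIN. For $\varepsilon>0$, $T_\varepsilon=\{(u,v)\in\mathbb R^2:0\le u\le v\le \frac ua\le\varepsilon\}$; $u=v$ represents the left moving shock, $u=av$ the right moving shock. $C^2(T_\varepsilon)$ means twice continuously differentiable up to the boundary. SHOCK INTERACTION PROBLEM on $T_\varepsilon$: find functions $\alpha,\beta,t,x$ of $(u,v)\in T_\varepsilon$ such that: (i) in $T_\varepsilon$: $\frac{\partial x}{\partial u}=c_{\rm in}\frac{\partial t}{\partial u}$, $\frac{\partial x}{\partial v}=c_{\rm out}\frac{\partial t}{\partial v}$, $\frac{\partial\alpha}{\partial v}=0$, $\frac{\partial\beta}{\partial u}=0$, where $c_{\rm in},c_{\rm out}$ are evaluated at $(\alpha(u,v),\beta(u,v))$; (ii) for $f\in\{\alpha,\beta,t,x\}$ put $f^{(1)}_+(u)=f(u,u)$, $u\in[0,a\varepsilon]$, and $f^{(2)}_+(v)=f(av,v)$, $v\in[0,\varepsilon]$; the curves $(t^{(i)}_+,x^{(i)}_+)$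 lie in $D^{(i)}$, and one puts $\alpha^{(i)}_-=\alpha^{*(i)}(t^{(i)}_+,x^{(i)}_+)$, $\beta^{(i)}_-=\beta^{*(i)}(t^{(i)}_+,x^{(i)}_+)$, $\rho^{(i)}_\pm=\rho(\alpha^{(i)}_\pm,\beta^{(i)}_\pm)$, $w^{(i)}_\pm=w(\alpha^{(i)}_\pm,\beta^{(i)}_\pm)$, $V^{(i)}=[\rho^{(i)}w^{(i)}]/[\rho^{(i)}]$, for $i=1,2$; (iii) boundary conditions: $\frac{dx^{(1)}_+}{du}=V^{(1)}\frac{dt^{(1)}_+}{du}$ on $[0,a\varepsilon]$ and $\frac{dx^{(2)}_+}{dv}=V^{(2)}\frac{dt^{(2)}_+}{dv}$ on $[0,\varepsilon]$; (iv) jump conditions: $J(\alpha^{(i)}_+,\beta^{(i)}_+,\alpha^{(i)}_-,\beta^{(i)}_-)=0$, $i=1,2$; (v) at the interaction point: $\alpha(0,0)=\beta(0,0)=\beta_0$, $\frac{\partial\alpha}{\partial u}(0,0)=\alpha_0'$, $\frac{\partial\beta}{\partial v}(0,0)=\beta_0'$, $V^{(i)}(0)=V^{(i)}_0$ ($i=1,2$), and (normalization of the coordinates) $t(0,0)=x(0,0)=0$, $\frac{\partial x}{\partial v}(0,0)=1$; (vi) determinism conditions: $c_{\rm in}(\alpha^{(1)}_+,\beta^{(1)}_+)<V^{(1)}<c_{\rm in}(\alpha^{(1)}_-,\beta^{(1)}_-)$ on $[0,a\varepsilon]$ and $c_{\rm out}(\alpha^{(2)}_-,\beta^{(2)}_-)<V^{(2)}<c_{\rm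 out}(\alpha^{(2)}_+,\beta^{(2)}_+)$ on $[0,\varepsilon]$. *)

(* Defs.v *)
From Stdlib Require Export Reals ClassicalEpsilon.
From Coquelicot Require Export Coquelicot.

Set Implicit Arguments.
Open Scope R_scope.

(** * Differentiability up to the boundary *)

(** [dwithin D f z] is the differential at [z] of the restriction of [f] to [D]
    (increments are taken inside [D]).  It is a total operator, in the style of
    [Derive]: junk when there is no differential.  The differential is unique
    at the points where [D] has a tangent direction in each dimension, e.g. at
    the corners of a nondegenerate triangle, where difference quotients along
    the coordinate axes may leave [D]. *)
Definition dwithin {V : NormedModule R_AbsRing} (D : V -> Prop) (f : V -> R)
    (z : V) : V -> R :=
  epsilon (inhabits (fun _ : V => 0))
    (fun l => filterdiff f (within D (locally z)) l).

Fixpoint Ck {V : NormedModule R_AbsRing} (k : nat) (D : V -> Prop)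
    (f : V -> R) : Prop :=
  match k with
  | O => continuous_on D f
  | S k' =>
      (forall z, D z -> ex_filterdiff f (within D (locally z))) /\
      (forall h : V, Ck k' D (fun z => dwithin D f z h))
  end.

Definition smooth_on {V : NormedModule R_AbsRing} (D : V -> Prop) (f : V -> R)
    : Prop :=
  forall k, Ck k D f.

Definition d1 (D : R * R -> Prop) (f : R * R -> R) (z : R * R) : R :=
  dwithin D f z (1, 0).
Definition d2 (D : R * R -> Prop) (f : R * R -> R) (z : R * R) : R :=
  dwithin D f z (0, 1).

Definition Icc (a b : R) (s : R) : Prop := a <= s <= b.

(** One-sided at the end points of an interval [D]. *)
Definition deriv_on (D : R -> Prop) (f : R -> R) (s : R) : R := dwithin D f s 1.

(** * The fluid *)

Definition pressure_law (p : R -> R) : Prop :=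
  (forall n r, 0 < r -> ex_derive_n p n r) /\
  (forall r, 0 < r -> 0 < Derive p r).

Definition eta (p : R -> R) (r : R) : R := sqrt (Derive p r).

(** [rs] is the fixed lower limit of integration. *)
Definition Phi (p : R -> R) (rs r : R) : R := RInt (fun s => eta p s / s) rs r.

Definition alpha_of (p : R -> R) (rs r w : R) : R := Phi p rs r + w.
Definition beta_of (p : R -> R) (rs r w : R) : R := Phi p rs r - w.

(** The pairs of values taken by the Riemann invariants at states with positive
    density. *)
Definition physical (p : R -> R) (rs al be : R) : Prop :=
  exists r, 0 < r /\ Phi p rs r = (al + be) / 2.

(** As [Phi] is strictly increasing, this is the inverse of
    [(r, w) |-> (alpha, beta)] on physical pairs, and junk elsewhere. *)
Definition rho (p : R -> R) (rs al be : R) : R :=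
  epsilon (inhabits rs) (fun r => 0 < r /\ Phi p rs r = (al + be) / 2).
Definition vel (al be : R) : R := (al - be) / 2.

Definition c_out (p : R -> R) (rs al be : R) : R :=
  vel al be + eta p (rho p rs al be).
Definition c_in (p : R -> R) (rs al be : R) : R :=
  vel al be - eta p (rho p rs al be).

(** * Jumps *)

Definition jump_conditions (p : R -> R) (rp wp rm wm V : R) : Prop :=
  (rp - rm) * V = rp * wp - rm * wm /\
  (rp * wp - rm * wm) * V = (rp * wp ^ 2 + p rp) - (rm * wm ^ 2 + p rm).

Definition J (p : R -> R) (rs ap bp am bm : R) : R :=
  let rp := rho p rs ap bp in let wp := vel ap bp in
  let rm := rho p rs am bm in let wm := vel am bm in
  (rp * wp - rm * wm) ^ 2
  - ((rp * wp ^ 2 + p rp) - (rm * wm ^ 2 + p rm)) * (rp - rm).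

Definition shock_speed (p : R -> R) (rs ap bp am bm : R) : R :=
  let rp := rho p rs ap bp in let wp := vel ap bp in
  let rm := rho p rs am bm in let wm := vel am bm in
  (rp * wp - rm * wm) / (rp - rm).

(** * States ahead *)

(** Points of the plane are pairs [(t, x)]. *)
Record ahead := Ahead {
  dom : R * R -> Prop;
  dens : R * R -> R;
  veloc : R * R -> R
}.

Definition astar (p : R -> R) (rs : R) (S : ahead) (z : R * R) : R :=
  alpha_of p rs (dens S z) (veloc S z).
Definition bstar (p : R -> R) (rs : R) (S : ahead) (z : R * R) : R :=
  beta_of p rs (dens S z) (veloc S z).

Definition smooth_flow (p : R -> R) (S : ahead) : Prop :=
  let D := dom S in let r := dens S in let w := veloc S in
  smooth_on D r /\ smooth_on D w /\
  forall z, D z ->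
    0 < r z /\
    d1 D r z + d2 D (fun y => r y * w y) z = 0 /\
    d1 D w z + w z * d2 D w z = - (1 / r z) * d2 D (fun y => p (r y)) z.

(** [X] is the integral curve from the origin, on the time interval [0, T], of
    the speed field [c]. *)
Definition characteristic (c : R * R -> R) (T : R) (X : R -> R) : Prop :=
  X 0 = 0 /\
  forall s, Icc 0 T s ->
    filterdiff X (within (Icc 0 T) (locally s)) (fun h => scal h (c (s, X s))).

Definition ahead_left (p : R -> R) (S : ahead) : Prop :=
  exists T X, 0 < T /\
    (forall z, dom S z <-> 0 <= fst z <= T /\ snd z <= X (fst z)) /\
    characteristic (fun z => veloc S z - eta p (dens S z)) T X /\
    smooth_flow p S.

Definition ahead_right (p : R -> R) (S : ahead) : Prop :=
  exists T X, 0 < T /\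
    (forall z, dom S z <-> 0 <= fst z <= T /\ X (fst z) <= snd z) /\
    characteristic (fun z => veloc S z + eta p (dens S z)) T X /\
    smooth_flow p S.

(** The interaction point is the origin; the state behind is [(r0, 0)]. *)
Definition interaction_point (p : R -> R) (S1 S2 : ahead) (r0 V1 V2 : R)
    : Prop :=
  let o := (0, 0) in
  0 < r0 /\
  jump_conditions p r0 0 (dens S1 o) (veloc S1 o) V1 /\
  jump_conditions p r0 0 (dens S2 o) (veloc S2 o) V2 /\
  - eta p r0 < V1 < veloc S1 o - eta p (dens S1 o) /\
  veloc S2 o + eta p (dens S2 o) < V2 < eta p r0 /\
  V1 < 0 < V2.

(** * Constants *)

Definition a_const (eta0 V1 V2 : R) : R :=
  (eta0 + V1) / (eta0 - V1) * ((eta0 - V2) / (eta0 + V2)).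
Definition Gamma0 (eta0 V1 : R) : R := - ((eta0 + V1) / (eta0 - V1)).

(** The germ of [H] at [(b0, am, bm)] is determined by these conditions. *)
Definition implicit_left (p : R -> R) (rs b0 am bm : R) (H : R * R * R -> R)
    : Prop :=
  H (b0, am, bm) = b0 /\
  exists r, 0 < r /\
    smooth_on (ball ((b0, am, bm) : R * R * R) r) H /\
    forall bp a b, ball ((b0, am, bm) : R * R * R) r (bp, a, b) ->
      J p rs (H (bp, a, b)) bp a b = 0.

Definition implicit_right (p : R -> R) (rs b0 am bm : R) (H : R * R * R -> R)
    : Prop :=
  H (b0, am, bm) = b0 /\
  exists r, 0 < r /\
    smooth_on (ball ((b0, am, bm) : R * R * R) r) H /\
    forall ap a b, ball ((b0, am, bm) : R * R * R) r (ap, a, b) ->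
      J p rs ap (H (ap, a, b)) a b = 0.

Definition F0 (H : R * R * R -> R) (b0 am bm : R) : R :=
  Derive (fun y => H (y, am, bm)) b0.
Definition M10 (H : R * R * R -> R) (b0 am bm : R) : R :=
  Derive (fun y => H (b0, y, bm)) am.
Definition M20 (H : R * R * R -> R) (b0 am bm : R) : R :=
  Derive (fun y => H (b0, am, y)) bm.

(** At the origin one has [t_v = 1 / eta0], [x_v = 1], [x_u = 1 / G] and
    [t_u = - x_u / eta0], so this is the derivative of [f (t, x)] along the left
    shock [(u, u)] for [s = 1] and along the right shock [(a v, v)] for
    [s = a]. *)
Definition along_shock (D : R * R -> Prop) (f : R * R -> R) (eta0 G s : R) : R :=
  d1 D f (0, 0) * (1 / eta0) * (1 - s / G) + d2 D f (0, 0) * (s / G + 1).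

(** [da] and [db] stand for [alpha_0'] and [beta_0']. *)
Definition initial_slopes (p : R -> R) (rs : R) (S1 S2 : ahead) (r0 V1 V2 : R)
    (H1 H2 : R * R * R -> R) (da db : R) : Prop :=
  let o := (0, 0) in
  let eta0 := eta p r0 in
  let a := a_const eta0 V1 V2 in
  let G := Gamma0 eta0 V1 in
  let b0 := beta_of p rs r0 0 in
  let am1 := astar p rs S1 o in let bm1 := bstar p rs S1 o in
  let am2 := astar p rs S2 o in let bm2 := bstar p rs S2 o in
  let A1 := along_shock (dom S1) (astar p rs S1) eta0 G 1 in
  let B1 := along_shock (dom S1) (bstar p rs S1) eta0 G 1 in
  let A2 := along_shock (dom S2) (astar p rs S2) eta0 G a in
  let B2 := along_shock (dom S2) (bstar p rs S2) eta0 G a in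
  da - F0 H1 b0 am1 bm1 * db = M10 H1 b0 am1 bm1 * A1 + M20 H1 b0 am1 bm1 * B1 /\
  - a * F0 H2 b0 am2 bm2 * da + db
    = M10 H2 b0 am2 bm2 * A2 + M20 H2 b0 am2 bm2 * B2.

(** * The shock interaction problem *)

(** The side [u = v] represents the left moving shock, [u = a v] the right
    moving one. *)
Definition Tri (a eps : R) (z : R * R) : Prop :=
  0 <= fst z /\ fst z <= snd z /\ snd z <= fst z / a /\ fst z / a <= eps.

(** Shock speed at the parameter [z], with the state ahead [S] evaluated at
    [(t z, x z)]; meaningful for [z] on the boundary line representing the
    shock. *)
Definition speed_at (p : R -> R) (rs : R) (S : ahead)
    (al be t x : R * R -> R) (z : R * R) : R :=
  shock_speed p rs (al z) (be z)
    (astar p rs S (t z, x z)) (bstar p rs S (t z, x z)).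

Record shock_interaction (p : R -> R) (rs : R) (S1 S2 : ahead)
    (a b0 da db V1 V2 eps : R) (al be t x : R * R -> R) : Prop := {
  si_physical : forall z, Tri a eps z -> physical p rs (al z) (be z);

  si_x_u : forall z, Tri a eps z ->
    d1 (Tri a eps) x z = c_in p rs (al z) (be z) * d1 (Tri a eps) t z;
  si_x_v : forall z, Tri a eps z ->
    d2 (Tri a eps) x z = c_out p rs (al z) (be z) * d2 (Tri a eps) t z;
  si_alpha_v : forall z, Tri a eps z -> d2 (Tri a eps) al z = 0;
  si_beta_u : forall z, Tri a eps z -> d1 (Tri a eps) be z = 0;

  si_dom1 : forall u, Icc 0 (a * eps) u -> dom S1 (t (u, u), x (u, u));
  si_dom2 : forall v, Icc 0 eps v -> dom S2 (t (a * v, v), x (a * v, v));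

  si_bdry1 : forall u, Icc 0 (a * eps) u ->
    deriv_on (Icc 0 (a * eps)) (fun s => x (s, s)) u
    = speed_at p rs S1 al be t x (u, u)
      * deriv_on (Icc 0 (a * eps)) (fun s => t (s, s)) u;
  si_bdry2 : forall v, Icc 0 eps v ->
    deriv_on (Icc 0 eps) (fun s => x (a * s, s)) v
    = speed_at p rs S2 al be t x (a * v, v)
      * deriv_on (Icc 0 eps) (fun s => t (a * s, s)) v;

  si_jump1 : forall u, Icc 0 (a * eps) u ->
    let z := (u, u) in
    J p rs (al z) (be z)
      (astar p rs S1 (t z, x z)) (bstar p rs S1 (t z, x z)) = 0;
  si_jump2 : forall v, Icc 0 eps v ->
    let z := (a * v, v) in
    J p rs (al z) (be z)
      (astar p rs S2 (t z, x z)) (bstar p rs S2 (t z, x z)) = 0;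

  si_alpha0 : al (0, 0) = b0;
  si_beta0 : be (0, 0) = b0;
  si_dalpha0 : d1 (Tri a eps) al (0, 0) = da;
  si_dbeta0 : d2 (Tri a eps) be (0, 0) = db;
  si_V1 : speed_at p rs S1 al be t x (0, 0) = V1;
  si_V2 : speed_at p rs S2 al be t x (0, 0) = V2;
  si_t0 : t (0, 0) = 0;
  si_x0 : x (0, 0) = 0;
  si_dx0 : d2 (Tri a eps) x (0, 0) = 1;

  si_det1 : forall u, Icc 0 (a * eps) u ->
    let z := (u, u) in
    c_in p rs (al z) (be z) < speed_at p rs S1 al be t x z
    < c_in p rs (astar p rs S1 (t z, x z)) (bstar p rs S1 (t z, x z));
  si_det2 : forall v, Icc 0 eps v ->
    let z := (a * v, v) in
    c_out p rs (astar p rs S2 (t z, x z)) (bstar p rs S2 (t z, x z))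
    < speed_at p rs S2 al be t x z < c_out p rs (al z) (be z)
}.

Definition jacobian (D : R * R -> Prop) (t x : R * R -> R) (z : R * R) : R :=
  d1 D t z * d2 D x z - d2 D t z * d1 D x z.

Definition image2 (D : R * R -> Prop) (t x : R * R -> R) (y : R * R) : Prop :=
  exists z, D z /\ y = (t z, x z).

(** [f], given on [D], is a C^2 function of [(t, x)] on the image of [D]. *)
Definition C2_function_of (D : R * R -> Prop) (t x f : R * R -> R) : Prop :=
  exists g : R * R -> R,
    Ck 2 (image2 D t x) g /\ forall z, D z -> f z = g (t z, x z).

(* Main.v *)
(** In characteristic coordinates [alpha] depends on [u] and [beta] on [v] only,
    and equality of the mixed derivatives of [x] turns the remaining equations
    into [t_uv = P beta' t_u - Q alpha' t_v] with
    [P = (c_in)_beta / (c_out - c_in)] and [Q = (c_out)_alpha / (c_out - c_in)].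
    On [u = v] the boundary condition gives the ratio [t_u / t_v], and the jump
    condition gives [alpha = H1 (beta, ahead)]; on [u = a v] they give
    [t_v / t_u] and [beta = H2 (alpha, ahead)].

    The unknowns are the highest derivatives [alpha''], [beta''], [t_uu], [t_vv]
    on the shocks, and [t_uv], [t_uuv], [t_uvv]; everything else is recovered by
    integration from the origin.  Near the origin the leading order part of the
    resulting map is linear with nonnegative gains.  Its only cycles are
    [t_uu -> t_vv -> t_uu], of gain [a], and [alpha'' -> beta'' -> alpha''], of
    gain [a^2 |F0^(1) F0^(2)| = a^4], so it is a contraction for a weighted
    supremum norm.

    Extending the boundary equations by constants to [s < 0], the problem is
    solved on a full neighbourhood of the origin.  One solution, restricted to
    the triangles, thus serves all small [eps], and it is differentiated in open
    sets; only at the end are the derivatives read in the triangle. *)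

Require Import Defs.
From Stdlib Require Import Lra Lia.

Set Implicit Arguments.

(** For the first derivatives of [t] there is no contraction: at the origin the ratio [t_u / t_v]
    imposed on the left shock and the ratio [t_v / t_u] imposed on the right one have product one,
    which leaves the scaling that the normalisation [x_v = 1] fixes. Each differentiation along the
    right shock [(a s, s)] brings a factor [a], and only this makes the cycle contract. With the
    highest derivatives as unknowns no derivative is lost either: every lower quantity is an
    integral over an interval of length O(r), so it depends on the unknown only weakly, and the
    limit is C^2 at once. This has two consequences. The components [t_uv], [t_uuv], [t_uvv] are
    independent unknowns, and their compatibility has to be carried through the iteration to the
    limit. And the states ahead are known only on domains that have the origin on their boundary, so
    every iterate must yield shock curves inside them. Cones with apex at the origin ensure this,
    and boundary quantities are differentiated only at positive parameters. *)

Lemma within_lim {V : NormedModule R_AbsRing} (D : V -> Prop) (z : V) :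
  is_filter_lim (within D (locally z)) z.
Proof. intros P HP; unfold within; apply filter_imp with (2 := HP); auto. Qed.
Arguments within_lim {V} D z P HP.

(** * Differentials within a set *)

Section WithinDifferential.
Context {V : NormedModule R_AbsRing}.
Implicit Types (D : V -> Prop) (z : V).

Lemma filterlim_point {W : NormedModule R_AbsRing} D z (g : V -> W) x :
  D z -> is_filter_lim (filtermap g (within D (locally z))) x -> x = g z.
Proof.
intros Hz Hl; apply eq_close; intros eps.
assert (H := Hl (ball x eps) (locally_ball x eps)).
exact (locally_singleton _ _ H Hz).
Qed.

Lemma within_lim_unique D z x : D z -> is_filter_lim (within D (locally z)) x -> x = z.
Proof. intros Hz H; exact (filterlim_point (g := fun y => y) Hz H). Qed.

(** [filterdiff] quantifies over all limits of the filter. For [z] in [D] the only limit of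
    [within D (locally z)] is [z], so the definition collapses to one estimate at [z]. *)
Lemma wdiff_iff D (f : V -> R) z (l : V -> R) : D z ->
  (filterdiff f (within D (locally z)) l <->
   is_linear l /\ forall eps : posreal, locally z (fun y => D y ->
     Rabs (f y - f z - l (minus y z)) <= eps * norm (minus y z))).
Proof.
intros Hz; split; intros [H1 H2]; split; auto.
- intros eps; exact (H2 z (within_lim D z) eps).
- intros x Hx; rewrite (within_lim_unique Hz Hx); exact H2.
Qed.

Lemma wdiff_sub D D' (f : V -> R) z (l : V -> R) :
  (forall y, D' y -> D y) -> D' z ->
  filterdiff f (within D (locally z)) l -> filterdiff f (within D' (locally z)) l.
Proof.
intros H Hz Hf; apply wdiff_iff; auto.
apply wdiff_iff in Hf; auto; destruct Hf as [L Hf]; split; auto.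
intros eps; generalize (Hf eps); apply filter_imp; auto.
Qed.

Lemma wdiff_locally D (f : V -> R) z (l : V -> R) :
  D z -> filterdiff f (locally z) l -> filterdiff f (within D (locally z)) l.
Proof.
intros Hz Hf; apply wdiff_iff; auto; destruct Hf as [L Hf]; split; auto.
intros eps; assert (H := Hf z (fun P HP => HP) eps).
revert H; apply filter_imp; auto.
Qed.

Lemma locally_wdiff D (f : V -> R) z (l : V -> R) :
  locally z D -> filterdiff f (within D (locally z)) l -> filterdiff f (locally z) l.
Proof.
intros HD Hf; assert (Hz := locally_singleton _ _ HD).
apply wdiff_iff in Hf; auto; destruct Hf as [L Hf]; split; auto.
intros x Hx eps. rewrite <- (is_filter_lim_locally_unique z x Hx).
generalize (filter_and _ _ HD (Hf eps)); apply filter_imp; intros y [h1 h2]; apply h2; auto.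
Qed.

Lemma wdiff_ext D (f g : V -> R) z (l : V -> R) :
  D z -> (forall y, D y -> f y = g y) ->
  filterdiff f (within D (locally z)) l -> filterdiff g (within D (locally z)) l.
Proof.
intros Hz E Hf; apply wdiff_iff; auto.
apply wdiff_iff in Hf; auto; destruct Hf as [L Hf]; split; auto.
intros eps; generalize (Hf eps); apply filter_imp.
intros y H Hy; rewrite <- !E; auto.
Qed.

Lemma wdiff_continuous D (f : V -> R) z (l : V -> R) :
  filterdiff f (within D (locally z)) l -> filterlim f (within D (locally z)) (locally (f z)).
Proof.
intros Hf; apply (filterdiff_continuous_aux (V := R_NormedModule) f).
exists l; exact Hf. apply within_lim.
Qed.

End WithinDifferential.

Section WithinComposition.
Context {V : NormedModule R_AbsRing}.
Implicit Types (D : V -> Prop) (z : V).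

Lemma wdiff_comp {W : NormedModule R_AbsRing} D (E : W -> Prop) (g : V -> W) (f : W -> R) z lg lf :
  D z -> (forall y, D y -> E (g y)) ->
  filterdiff g (within D (locally z)) lg -> filterdiff f (within E (locally (g z))) lf ->
  filterdiff (fun y => f (g y)) (within D (locally z)) (fun h => lf (lg h)).
Proof.
intros Hz HE Hg Hf; apply filterdiff_comp; auto.
destruct Hf as [L Hf]; split; auto.
intros x Hx; apply filterlim_point in Hx; auto; subst x.
intros eps; assert (H := Hf (g z) (within_lim E (g z)) eps).
assert (C : filterlim g (within D (locally z)) (locally (g z))).
{ apply filterdiff_continuous_aux. exists lg; exact Hg. apply within_lim. }
generalize (C _ H); unfold filtermap, within; apply filter_imp; auto.
Qed.

Lemma wdiff_pair {W1 W2 : NormedModule R_AbsRing} D (g1 : V -> W1) (g2 : V -> W2) z l1 l2 :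
  filterdiff g1 (within D (locally z)) l1 -> filterdiff g2 (within D (locally z)) l2 ->
  filterdiff (fun y => (g1 y, g2 y)) (within D (locally z)) (fun h => (l1 h, l2 h)).
Proof.
intros H1 H2.
apply (filterdiff_comp_2 g1 g2 (fun a b => (a, b)) l1 l2 (fun a b => (a, b))); auto.
apply filterdiff_linear, is_linear_prod; [apply is_linear_fst | apply is_linear_snd].
Qed.

Lemma wdiff_mult D (f g : V -> R) z lf lg :
  D z -> filterdiff f (within D (locally z)) lf -> filterdiff g (within D (locally z)) lg ->
  filterdiff (fun y => f y * g y) (within D (locally z)) (fun h => lf h * g z + f z * lg h).
Proof.
intros Hz Hf Hg.
apply (@wdiff_comp (prod_NormedModule _ R_NormedModule R_NormedModule) D (fun _ => True)
   (fun y => (f y, g y)) (fun y => fst y * snd y) z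
   (fun h => (lf h, lg h)) (fun h => fst h * g z + f z * snd h)); auto.
- apply wdiff_pair; auto.
- apply wdiff_locally; auto.
  apply (filterdiff_mult (F := locally (f z, g z)) (f z, g z)).
  intros P HP; exact HP. exact Rmult_comm.
Qed.

End WithinComposition.

Fixpoint Cdiff {V : NormedModule R_AbsRing} (k : nat) (D : V -> Prop) (f : V -> R) : Prop :=
  match k with
  | O => continuous_on D f
  | S k' => exists l : V -> V -> R,
      (forall z, D z -> filterdiff f (within D (locally z)) (l z)) /\
      (forall h, Cdiff k' D (fun z => l z h))
  end.

(** [Cdiff] is [Ck] with the existence of differentials in place of the choice
    operator; both agree where differentials within the domain are unique. *)
Section CdiffTheory.
Context {V : NormedModule R_AbsRing}.
Implicit Types (D : V -> Prop) (f g : V -> R).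

Lemma Ck_Cdiff k D f : Ck k D f -> Cdiff k D f.
Proof.
revert f; induction k as [|k IH]; intros f; simpl; auto.
intros [H1 H2]; exists (dwithin D f); split; auto.
intros z Hz; unfold dwithin; apply epsilon_spec; apply (H1 z Hz).
Qed.

Lemma Cdiff_ext k D f g : (forall z, D z -> f z = g z) -> Cdiff k D f -> Cdiff k D g.
Proof.
destruct k; simpl; intros E.
- intros H z Hz. rewrite <- (E z Hz). apply filterlim_within_ext with f; auto.
- intros [l [H1 H2]]; exists l; split; auto.
  intros z Hz; apply (wdiff_ext (f := f)); auto.
Qed.

(** Testing the zero function is enough, because two differentials of one function differ by a
    differential of zero. *)
Definition has_unique_diff D z := forall l : V -> R,
  filterdiff (fun _ => 0) (within D (locally z)) l -> forall h, l h = 0.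

Lemma unique_diff D z f l1 l2 : has_unique_diff D z ->
  filterdiff f (within D (locally z)) l1 -> filterdiff f (within D (locally z)) l2 ->
  forall h, l1 h = l2 h.
Proof.
intros U H1 H2 h; apply Rminus_diag_uniq.
apply (U (fun h => l1 h - l2 h)).
apply (filterdiff_ext (fun y => f y - f y)); [intros; apply Rminus_diag_eq; reflexivity|].
apply (filterdiff_minus_fct f f l1 l2); auto.
Qed.

Lemma dwithin_eq D z f l : has_unique_diff D z ->
  filterdiff f (within D (locally z)) l -> forall h, dwithin D f z h = l h.
Proof.
intros U H; apply unique_diff with (f := f) (2 := epsilon_spec _ _ (ex_intro _ l H)); auto.
Qed.

Lemma Ck_ext k D f g : (forall z, D z -> has_unique_diff D z) ->
  (forall z, D z -> f z = g z) -> Ck k D f -> Ck k D g.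
Proof.
intros U; revert f g; induction k as [|k IH]; intros f g E; simpl.
- intros H z Hz. rewrite <- (E z Hz). apply filterlim_within_ext with f; auto.
- intros [H1 H2]; split.
  + intros z Hz; destruct (H1 z Hz) as [l Hl]; exists l; apply (wdiff_ext (f := f)); auto.
  + intros h; apply IH with (2 := H2 h). intros z Hz; symmetry.
    destruct (H1 z Hz) as [l Hl]. rewrite (dwithin_eq (U z Hz) Hl).
    apply dwithin_eq; auto. apply (wdiff_ext (f := f)); auto.
Qed.

Lemma Cdiff_Ck k D f : (forall z, D z -> has_unique_diff D z) -> Cdiff k D f -> Ck k D f.
Proof.
intros U; revert f; induction k as [|k IH]; intros f; simpl; auto.
intros [l [H1 H2]]; split.
- intros z Hz; exists (l z); auto.
- intros h; apply Ck_ext with (2 := fun z Hz => eq_sym (dwithin_eq (U z Hz) (H1 z Hz) h)); auto.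
Qed.

Lemma Cdiff_pred k D f : Cdiff (S k) D f -> Cdiff k D f.
Proof.
revert f; induction k as [|k IH]; intros f; simpl.
- intros [l [H1 H2]] z Hz; apply wdiff_continuous with (1 := H1 z Hz).
- intros [l [H1 H2]]; exists l; split; auto. intros h; apply IH, H2.
Qed.

Lemma Cdiff_le k k' D f : (k <= k')%nat -> Cdiff k' D f -> Cdiff k D f.
Proof. induction 1; auto using Cdiff_pred. Qed.

Lemma Cdiff_continuous k D f z : Cdiff k D f -> D z ->
  filterlim f (within D (locally z)) (locally (f z)).
Proof. intros H Hz; revert z Hz; apply (@Cdiff_le 0 k); auto; lia. Qed.

Lemma Cdiff_sub k D D' f : (forall y, D' y -> D y) -> Cdiff k D f -> Cdiff k D' f.
Proof.
intros HD; revert f; induction k as [|k IH]; intros f; simpl.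
- intros H z Hz; apply filterlim_filter_le_1 with (2 := H z (HD z Hz)).
  intros P; unfold within; apply filter_imp; auto.
- intros [l [H1 H2]]; exists l; split; auto.
  intros z Hz; apply wdiff_sub with (3 := H1 z (HD z Hz)); auto.
Qed.

Lemma Cdiff_const k D c : Cdiff k D (fun _ => c).
Proof.
revert c; induction k as [|k IH]; intros c; simpl.
- intros z Hz; apply filterlim_const.
- exists (fun _ _ => 0); split; auto. intros z Hz; apply (filterdiff_const c).
Qed.

Lemma Cdiff_linear k D (l : V -> R) : is_linear l -> Cdiff k D l.
Proof.
intros L; destruct k as [|k].
- intros z Hz; apply wdiff_continuous with (l := l); apply filterdiff_linear; auto.
- exists (fun _ => l); split; [intros; apply filterdiff_linear; auto | intros; apply Cdiff_const].
Qed.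

Lemma Cdiff_plus k D f g : Cdiff k D f -> Cdiff k D g -> Cdiff k D (fun z => f z + g z).
Proof.
revert f g; induction k as [|k IH]; intros f g; simpl.
- intros Hf Hg z Hz.
  apply (filterlim_comp_2 (G := locally (f z)) (H := locally (g z))); auto.
  apply (filterlim_plus (f z) (g z)).
- intros [l [H1 H2]] [m [H3 H4]]; exists (fun z h => l z h + m z h); split; auto.
  intros z Hz; apply (filterdiff_plus_fct f g (l z) (m z)); auto.
Qed.

Lemma Cdiff_mult k D f g : Cdiff k D f -> Cdiff k D g -> Cdiff k D (fun z => f z * g z).
Proof.
revert f g; induction k as [|k IH]; intros f g Hf Hg.
- intros z Hz.
  apply (filterlim_comp_2 (G := locally (f z)) (H := locally (g z))); [apply Hf|apply Hg|]; auto.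
  apply (filterlim_mult (f z) (g z)).
- assert (Hf' := Cdiff_pred Hf); assert (Hg' := Cdiff_pred Hg).
  destruct Hf as [l [H1 H2]], Hg as [m [H3 H4]].
  exists (fun z h => l z h * g z + f z * m z h); split.
  + intros z Hz; apply wdiff_mult; auto.
  + intros h; apply Cdiff_plus; apply IH; auto.
Qed.

Lemma Cdiff_opp k D f : Cdiff k D f -> Cdiff k D (fun z => - f z).
Proof.
intros H; apply Cdiff_ext with (fun z => (-1) * f z). intros; ring.
apply Cdiff_mult; auto using Cdiff_const.
Qed.

Lemma Cdiff_minus k D f g : Cdiff k D f -> Cdiff k D g -> Cdiff k D (fun z => f z - g z).
Proof. intros Hf Hg; apply Cdiff_plus; auto using Cdiff_opp. Qed.

Lemma Cdiff_comp_linear {W : NormedModule R_AbsRing} k D (E : W -> Prop) (L : V -> W) (f : W -> R) :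
  is_linear L -> (forall z, D z -> E (L z)) -> Cdiff k E f -> Cdiff k D (fun z => f (L z)).
Proof.
intros HL HE; revert f; induction k as [|k IH]; intros f; simpl.
- intros H z Hz; apply filterlim_comp with (2 := H (L z) (HE z Hz)).
  assert (C : filterlim L (within D (locally z)) (locally (L z))).
  { apply filterdiff_continuous_aux. exists L; apply filterdiff_linear; auto. apply within_lim. }
  intros P HP; generalize (C _ HP); unfold filtermap, within; apply filter_imp; auto.
- intros [l [H1 H2]]; exists (fun z h => l (L z) (L h)); split.
  + intros z Hz; apply (@wdiff_comp V W D E L f z L); auto. apply filterdiff_linear; auto.
  + intros h; apply (IH (fun y => l y (L h))); auto.
Qed.

Lemma Cdiff_comp3 k D (E : R * R * R -> Prop) (F : R * R * R -> R) g1 g2 g3 :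
  Cdiff k E F -> Cdiff k D g1 -> Cdiff k D g2 -> Cdiff k D g3 ->
  (forall z, D z -> E (g1 z, g2 z, g3 z)) -> Cdiff k D (fun z => F (g1 z, g2 z, g3 z)).
Proof.
revert F; induction k as [|k IH]; intros F HF H1 H2 H3 HE.
- intros z Hz; apply filterlim_comp with (2 := HF _ (HE z Hz)).
  assert (C : filterlim (fun z => (g1 z, g2 z, g3 z)) (within D (locally z))
                (locally (g1 z, g2 z, g3 z))).
  {
    intros P [eps HP].
    assert (K1 := H1 z Hz _ (locally_ball (g1 z) eps)).
    assert (K2 := H2 z Hz _ (locally_ball (g2 z) eps)).
    assert (K3 := H3 z Hz _ (locally_ball (g3 z) eps)).
    destruct K1 as [e1 K1], K2 as [e2 K2], K3 as [e3 K3].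
    assert (He : 0 < Rmin e1 (Rmin e2 e3)) by
      (repeat apply Rmin_glb_lt; apply cond_pos).
    exists (mkposreal _ He); intros y By Hy; apply HP; simpl in By.
    assert (h1 := Rmin_l e1 (Rmin e2 e3)). assert (h2 := Rmin_r e1 (Rmin e2 e3)).
    assert (h3 := Rmin_l e2 e3). assert (h4 := Rmin_r e2 e3).
    assert (B1 := K1 y (ball_le _ _ _ h1 _ By) Hy).
    assert (B2 := K2 y (ball_le _ _ _ (Rle_trans _ _ _ h2 h3) _ By) Hy).
    assert (B3 := K3 y (ball_le _ _ _ (Rle_trans _ _ _ h2 h4) _ By) Hy).
    split; [split|]; simpl; auto. }
  intros P HP; generalize (C _ HP); unfold filtermap, within; apply filter_imp; auto.
- assert (K1 := Cdiff_pred H1); assert (K2 := Cdiff_pred H2); assert (K3 := Cdiff_pred H3).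
  destruct HF as [l [L1 L2]], H1 as [m1 [M1 N1]], H2 as [m2 [M2 N2]], H3 as [m3 [M3 N3]].
  pose (q z := (g1 z, g2 z, g3 z)).
  exists (fun z h => m1 z h * l (q z) (1,0,0) + m2 z h * l (q z) (0,1,0) + m3 z h * l (q z) (0,0,1)).
  split.
  + intros z Hz.
    apply filterdiff_ext_lin with (fun h => l (q z) (m1 z h, m2 z h, m3 z h)).
    * apply (@wdiff_comp V (prod_NormedModule _ (prod_NormedModule _ R_NormedModule R_NormedModule) R_NormedModule) D E q F z (fun h => (m1 z h, m2 z h, m3 z h))); auto.
      apply wdiff_pair; auto. apply wdiff_pair; auto.
      apply L1, HE, Hz.
    * intros h. destruct (L1 _ (HE z Hz)) as [[P S _] _].
      assert (S' : forall k x, l (q z) (scal k x) = k * l (q z) x) by (intros; apply S).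
      assert (P' : forall x y, l (q z) (plus x y) = l (q z) x + l (q z) y) by (intros; apply P).
      rewrite <- !S', <- !P'. f_equal. unfold plus, scal, mult; simpl.
      unfold prod_plus, prod_scal, plus, scal, mult; simpl.
      unfold prod_plus, prod_scal, plus, scal, mult; simpl.
      apply (f_equal2 pair); [apply (f_equal2 pair)|]; unfold mult; simpl; ring.
  + intros k0; repeat apply Cdiff_plus; apply Cdiff_mult; auto;
      apply (IH (fun y => l y _)); auto.
Qed.

End CdiffTheory.

(** * Germs of smooth functions at a point of a set *)

Definition Germ {V : NormedModule R_AbsRing} (C : V -> Prop) (o : V) (k : nat) (f : V -> R) : Prop :=
  exists r : posreal, Cdiff k (fun z => C z /\ ball o r z) f.

Section GermTheory.
Context {V : NormedModule R_AbsRing}.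
Implicit Types (C : V -> Prop) (o : V) (f g : V -> R).

Lemma Germ_of_Cdiff C o k f : Cdiff k C f -> Germ C o k f.
Proof. intros H; exists (mkposreal 1 Rlt_0_1); apply Cdiff_sub with (2 := H); tauto. Qed.

Lemma Germ_shrink C o k f r : Cdiff k (fun z => C z /\ ball o r z) f ->
  forall r', r' <= r -> Cdiff k (fun z => C z /\ ball o r' z) f.
Proof.
intros H r' Hr; apply Cdiff_sub with (2 := H).
intros y [Hy By]; split; auto; apply ball_le with (2 := By); auto.
Qed.

Lemma Germ_le C o k k' f : (k <= k')%nat -> Germ C o k' f -> Germ C o k f.
Proof. intros H [r Hr]; exists r; apply Cdiff_le with (2 := Hr); auto. Qed.

Lemma Germ_const C o k c : Germ C o k (fun _ => c).
Proof. apply Germ_of_Cdiff, Cdiff_const. Qed.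

Lemma Germ_linear C o k (l : V -> R) : is_linear l -> Germ C o k l.
Proof. intros; apply Germ_of_Cdiff, Cdiff_linear; auto. Qed.

Lemma Germ_op2 C o k f g h :
  (forall D, Cdiff k D f -> Cdiff k D g -> Cdiff k D h) ->
  Germ C o k f -> Germ C o k g -> Germ C o k h.
Proof.
intros H [r1 H1] [r2 H2].
assert (Hr : 0 < Rmin r1 r2) by (apply Rmin_glb_lt; apply cond_pos).
exists (mkposreal _ Hr); apply H; simpl.
apply Germ_shrink with (1 := H1), Rmin_l. apply Germ_shrink with (1 := H2), Rmin_r.
Qed.

Lemma Germ_plus C o k f g : Germ C o k f -> Germ C o k g -> Germ C o k (fun z => f z + g z).
Proof. apply Germ_op2; intros; apply Cdiff_plus; auto. Qed.

Lemma Germ_minus C o k f g : Germ C o k f -> Germ C o k g -> Germ C o k (fun z => f z - g z).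
Proof. apply Germ_op2; intros; apply Cdiff_minus; auto. Qed.

Lemma Germ_mult C o k f g : Germ C o k f -> Germ C o k g -> Germ C o k (fun z => f z * g z).
Proof. apply Germ_op2; intros; apply Cdiff_mult; auto. Qed.

Lemma Germ_near C o k f (P : R -> Prop) : C o -> Germ C o k f -> locally (f o) P ->
  exists r : posreal, forall z, C z -> ball o r z -> P (f z).
Proof.
intros Co [r H] HP.
assert (K := @Cdiff_continuous V k _ f o H (conj Co (ball_center o r)) P HP).
destruct K as [e K]; assert (Hr : 0 < Rmin e r) by (apply Rmin_glb_lt; apply cond_pos).
exists (mkposreal _ Hr); simpl; intros z Cz Bz; apply K.
apply ball_le with (2 := Bz), Rmin_l.
split; auto; apply ball_le with (2 := Bz), Rmin_r.
Qed.

(** Continuity of the components gives values near [(g1 o, g2 o, g3 o)] but not in [E], whose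
    boundary may pass through that point; hence the last hypothesis. *)
Lemma Germ_comp3 C o k (E : R * R * R -> Prop) (F : R * R * R -> R) g1 g2 g3 :
  C o -> Germ E (g1 o, g2 o, g3 o) k F ->
  Germ C o k g1 -> Germ C o k g2 -> Germ C o k g3 ->
  (exists r : posreal, forall z, C z -> ball o r z -> E (g1 z, g2 z, g3 z)) ->
  Germ C o k (fun z => F (g1 z, g2 z, g3 z)).
Proof.
intros Co [rF HF] H1 H2 H3 [r0 HE].
assert (N1 := Germ_near Co H1 (locally_ball _ rF)).
assert (N2 := Germ_near Co H2 (locally_ball _ rF)).
assert (N3 := Germ_near Co H3 (locally_ball _ rF)).
destruct N1 as [e1 N1], N2 as [e2 N2], N3 as [e3 N3].
destruct H1 as [r1 H1], H2 as [r2 H2], H3 as [r3 H3].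
pose (l := (r0 :: e1 :: e2 :: e3 :: r1 :: r2 :: r3 :: nil)%list).
assert (Hl : exists r : posreal, forall s, List.In s l -> r <= s).
{ clear; induction l as [|s l [r IH]].
  exists (mkposreal 1 Rlt_0_1); intros s [].
  assert (Hr : 0 < Rmin s r) by (apply Rmin_glb_lt; apply cond_pos).
  exists (mkposreal _ Hr); simpl. intros t [<-|Ht]. apply Rmin_l.
  eapply Rle_trans. apply Rmin_r. auto. }
destruct Hl as [r Hl]; exists r.
apply Cdiff_comp3 with (fun w => E w /\ ball ((g1 o, g2 o, g3 o) : R * R * R) rF w); auto;
  try (eapply Germ_shrink; [eassumption | apply Hl; simpl; tauto]).
intros z [Cz Bz]; split.
- apply HE; auto; apply ball_le with (2 := Bz), Hl; simpl; tauto.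
- split; [split|]; simpl; [apply N1|apply N2|apply N3]; auto;
  apply ball_le with (2 := Bz), Hl; simpl; tauto.
Qed.

Lemma Germ_comp1 C o k (phi : R -> R) g (O : R -> Prop) :
  C o -> Cdiff k O phi -> locally (g o) O -> Germ C o k g -> Germ C o k (fun z => phi (g z)).
Proof.
intros Co Hphi HO Hg.
apply (@Germ_comp3 C o k (fun w => O (fst (fst w))) (fun w => phi (fst (fst w))) g g g); auto.
- exists (mkposreal 1 Rlt_0_1).
  apply (@Cdiff_comp_linear (prod_NormedModule _ (prod_NormedModule _ R_NormedModule R_NormedModule) R_NormedModule) R_NormedModule k _ O (fun w => fst (fst w)) phi); auto; [|tauto].
  apply (is_linear_comp fst fst); apply is_linear_fst.
- apply (Germ_near Co Hg HO).
Qed.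

Lemma Germ_ext C o k f g r : (forall z, C z -> ball o (pos r) z -> f z = g z) ->
  Germ C o k f -> Germ C o k g.
Proof.
intros H [r1 H1].
assert (Hr : 0 < Rmin r1 r) by (apply Rmin_glb_lt; apply cond_pos).
exists (mkposreal _ Hr); simpl. apply Cdiff_ext with f.
intros z [h1 h2]; apply H; auto; apply ball_le with (2 := h2), Rmin_r.
apply Germ_shrink with (1 := H1), Rmin_l.
Qed.

End GermTheory.

(** * Smooth functions of one real variable *)

Lemma Cdiff_derive k (O : R -> Prop) (f f' : R -> R) :
  (forall x, O x -> is_derive f x (f' x)) -> Cdiff k O f' -> Cdiff (S k) O f.
Proof.
intros H H'; exists (fun x h => h * f' x); split.
- intros x Hx; apply wdiff_locally; auto. apply H; auto.
- intros h; apply Cdiff_mult; auto. apply Cdiff_const.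
Qed.

Lemma Cdiff_0 (O : R -> Prop) (f f' : R -> R) :
  (forall x, O x -> is_derive f x (f' x)) -> Cdiff 0 O f.
Proof.
intros H x Hx. apply wdiff_continuous with (fun h => h * f' x).
apply wdiff_locally; auto. apply H; auto.
Qed.

Lemma Cdiff_comp1 {V : NormedModule R_AbsRing} (D : V -> Prop) k (phi : R -> R) g (O : R -> Prop) :
  Cdiff k O phi -> Cdiff k D g -> (forall z, D z -> O (g z)) -> Cdiff k D (fun z => phi (g z)).
Proof.
intros Hphi Hg HO.
apply (@Cdiff_comp3 V k D (fun w => O (fst (fst w))) (fun w => phi (fst (fst w))) g g g); auto.
apply (@Cdiff_comp_linear (prod_NormedModule _ (prod_NormedModule _ R_NormedModule R_NormedModule) R_NormedModule) R_NormedModule k _ O (fun w => fst (fst w)) phi); auto.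
apply (is_linear_comp fst fst); apply is_linear_fst.
Qed.

Lemma Cdiff_Rinv k : Cdiff k (fun x : R => x <> 0) Rinv.
Proof.
assert (H : forall x, x <> 0 -> is_derive Rinv x ((-1) * (/ x * / x))).
{ intros x Hx. auto_derive; auto. field; auto. }
induction k as [|k IH]. apply Cdiff_0 with (1 := H).
apply Cdiff_derive with (1 := H); auto using Cdiff_mult, Cdiff_const.
Qed.

Lemma Cdiff_sqrt k : Cdiff k (fun x : R => 0 < x) sqrt.
Proof.
assert (H : forall x, 0 < x -> is_derive sqrt x (/ 2 * / sqrt x)).
{ intros x Hx. auto_derive; auto. field. apply Rgt_not_eq, sqrt_lt_R0, Hx. }
induction k as [|k IH]. apply Cdiff_0 with (1 := H).
apply Cdiff_derive with (1 := H); apply Cdiff_mult. apply Cdiff_const.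
apply (@Cdiff_comp1 R_NormedModule _ k Rinv sqrt _ (Cdiff_Rinv k)); auto.
intros x Hx; apply Rgt_not_eq, sqrt_lt_R0, Hx.
Qed.

Lemma locally_neq0 (x : R) : x <> 0 -> locally x (fun y => y <> 0).
Proof.
intros H; assert (Hx : 0 < Rabs x) by (apply Rabs_pos_lt; auto).
exists (mkposreal _ Hx); intros y Hy E; subst y.
change (Rabs (0 - x) < Rabs x) in Hy. rewrite Rminus_0_l, Rabs_Ropp in Hy; lra.
Qed.

Lemma locally_pos (x : R) : 0 < x -> locally x (fun y => 0 < y).
Proof.
intros H; exists (mkposreal _ H); intros y Hy; change (Rabs (y - x) < x) in Hy.
apply Rabs_def2 in Hy; lra.
Qed.

Lemma Germ_Rinv {V : NormedModule R_AbsRing} (C : V -> Prop) o k f :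
  C o -> f o <> 0 -> Germ C o k f -> Germ C o k (fun z => / f z).
Proof.
intros Co Hf; apply Germ_comp1 with (1 := Co) (2 := Cdiff_Rinv k), locally_neq0, Hf.
Qed.

(** * The inverse of the pressure integral *)

Section Fluid.
Variables (p : R -> R) (rs : R).
Hypotheses (Hp : pressure_law p) (Hrs : 0 < rs).

Lemma Cdiff_Derive_n k n : Cdiff k (fun r : R => 0 < r) (Derive_n p n).
Proof.
assert (H : forall n x, 0 < x -> is_derive (Derive_n p n) x (Derive_n p (S n) x)).
{ intros m x Hx. apply Derive_correct, (proj1 Hp (S m) x Hx). }
revert n; induction k as [|k IH]; intros n.
apply Cdiff_0 with (1 := H n). apply Cdiff_derive with (1 := H n), IH.
Qed.

Lemma is_derive_pressure r : 0 < r -> is_derive p r (Derive p r).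
Proof. intros Hr; apply Derive_correct, (proj1 Hp 1%nat r Hr). Qed.

Lemma eta_pos r : 0 < r -> 0 < eta p r.
Proof. intros Hr; apply sqrt_lt_R0, Hp, Hr. Qed.

Lemma eta_sqr r : 0 < r -> eta p r * eta p r = Derive p r.
Proof. intros Hr; apply sqrt_sqrt, Rlt_le, Hp, Hr. Qed.

Lemma Cdiff_eta k : Cdiff k (fun r : R => 0 < r) (eta p).
Proof.
apply (@Cdiff_comp1 R_NormedModule _ k sqrt (Derive p) _ (Cdiff_sqrt k)).
apply (Cdiff_Derive_n k 1). apply Hp.
Qed.

Lemma Cdiff_eta_div k : Cdiff k (fun r : R => 0 < r) (fun s => eta p s / s).
Proof.
apply Cdiff_mult. apply Cdiff_eta.
apply Cdiff_sub with (fun r : R => r <> 0). intros r Hr; lra. apply Cdiff_Rinv.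
Qed.

Lemma continuous_Cdiff_pos (f : R -> R) r : Cdiff 0 (fun r : R => 0 < r) f -> 0 < r -> continuous f r.
Proof.
intros H Hr P HP. change (locally r (fun y => P (f y))).
assert (K : locally r (fun y => 0 < y -> P (f y))) by exact (H r Hr P HP).
generalize (filter_and _ _ (locally_pos Hr) K). apply filter_imp; intros y [h1 h2]; apply h2; auto.
Qed.

Lemma is_derive_Phi r : 0 < r -> is_derive (Phi p rs) r (eta p r / r).
Proof.
intros Hr; apply (is_derive_RInt (fun s => eta p s / s) (Phi p rs) rs r).
- generalize (locally_pos Hr); apply filter_imp; intros y Hy.
  apply (RInt_correct (fun s => eta p s / s)), ex_RInt_continuous; intros z [Hz _].
  apply (@continuous_Cdiff_pos (fun s => eta p s / s)). apply Cdiff_eta_div.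
  apply Rlt_le_trans with (2 := Hz). apply Rmin_glb_lt; auto.
- apply (@continuous_Cdiff_pos (fun s => eta p s / s)); auto. apply Cdiff_eta_div.
Qed.

Lemma Cdiff_Phi k : Cdiff k (fun r : R => 0 < r) (Phi p rs).
Proof.
apply Cdiff_pred, Cdiff_derive with (fun r => eta p r / r).
apply is_derive_Phi. apply Cdiff_eta_div.
Qed.

Lemma Phi_mvt r r' : 0 < r -> 0 < r' -> exists c, Rmin r r' <= c <= Rmax r r' /\
  Phi p rs r' - Phi p rs r = eta p c / c * (r' - r).
Proof.
intros Hr Hr'.
destruct (MVT_gen (Phi p rs) r r' (fun c => eta p c / c)) as [c [Hc E]].
- intros x [Hx _]; apply is_derive_Phi. apply Rlt_trans with (2 := Hx), Rmin_glb_lt; auto.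
- intros x [Hx _]; apply continuity_pt_filterlim.
  apply (ex_derive_continuous (Phi p rs) x); eexists; apply is_derive_Phi.
  apply Rlt_le_trans with (2 := Hx), Rmin_glb_lt; auto.
- exists c; auto.
Qed.

Lemma Phi_lt r r' : 0 < r -> r < r' -> Phi p rs r < Phi p rs r'.
Proof.
intros Hr Hr'. destruct (@Phi_mvt r r') as [c [[Hc _] E]]; try lra.
rewrite Rmin_left in Hc by lra.
assert (0 < eta p c / c * (r' - r)); [|lra].
apply Rmult_lt_0_compat; [|lra]. apply Rdiv_lt_0_compat; [apply eta_pos|]; lra.
Qed.

Lemma Phi_inj r r' : 0 < r -> 0 < r' -> Phi p rs r = Phi p rs r' -> r = r'.
Proof.
intros H H' E. destruct (Rtotal_order r r') as [L|[L|L]]; auto; exfalso.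
assert (K := Phi_lt H L); lra. assert (K := Phi_lt H' L); lra.
Qed.

(** The choice is the one made in [rho], so that [rho_Phi_inv] holds by conversion. *)
Definition Phi_inv (s : R) : R :=
  epsilon (inhabits rs) (fun r => 0 < r /\ Phi p rs r = s).
Definition Phi_range (s : R) : Prop := exists r, 0 < r /\ Phi p rs r = s.

Lemma Phi_inv_spec s : Phi_range s -> 0 < Phi_inv s /\ Phi p rs (Phi_inv s) = s.
Proof. intros H; exact (epsilon_spec _ _ H). Qed.

Lemma Phi_inv_Phi r : 0 < r -> Phi_inv (Phi p rs r) = r.
Proof.
intros Hr; destruct (@Phi_inv_spec (Phi p rs r)) as [h1 h2]. exists r; auto.
apply Phi_inj; auto.
Qed.

Lemma Phi_inv_near r d : 0 < r -> 0 < d -> locally (Phi p rs r) (fun s =>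
  Phi_range s /\ Rabs (Phi_inv s - r) <= d).
Proof.
intros Hr Hd.
(* At most [r / 2], which keeps [[r1, r2]] inside the positive axis, where [Phi] is increasing. *)
set (d' := Rmin d (r / 2)).
assert (Hd' : 0 < d') by (apply Rmin_glb_lt; lra).
assert (d' <= d) by apply Rmin_l. assert (d' <= r / 2) by apply Rmin_r.
set (r1 := r - d'). set (r2 := r + d').
assert (L1 : Phi p rs r1 < Phi p rs r) by (apply Phi_lt; unfold r1; lra).
assert (L2 : Phi p rs r < Phi p rs r2) by (apply Phi_lt; unfold r2; lra).
assert (He : 0 < Rmin (Phi p rs r - Phi p rs r1) (Phi p rs r2 - Phi p rs r))
  by (apply Rmin_glb_lt; lra).
exists (mkposreal _ He); intros s Hs; change (Rabs (s - Phi p rs r) <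
  Rmin (Phi p rs r - Phi p rs r1) (Phi p rs r2 - Phi p rs r)) in Hs.
assert (Hm := Rmin_l (Phi p rs r - Phi p rs r1) (Phi p rs r2 - Phi p rs r)).
assert (Hm' := Rmin_r (Phi p rs r - Phi p rs r1) (Phi p rs r2 - Phi p rs r)).
apply Rabs_def2 in Hs.
destruct (Ranalysis5.IVT_interv (fun x => Phi p rs x - s) r1 r2) as [x [Hx E]]; try lra.
- intros x Hx. apply continuity_pt_filterlim.
  apply (ex_derive_continuous (fun x => Phi p rs x - s) x).
  auto_derive. exists (eta p x / x); apply is_derive_Phi. unfold r1 in *; lra.
- unfold r1, r2; lra.
- assert (Ex : Phi p rs x = s) by lra. assert (Px : 0 < x) by (unfold r1 in *; lra).
  split. exists x; auto. rewrite <- Ex, Phi_inv_Phi; auto.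
  apply Rabs_le; unfold r1, r2 in *; lra.
Qed.

(** With [w = 1 / Phi'] the mean value theorem gives [r' - r = w c * (s - Phi r)] for some [c]
    between [r] and [r']. The error of the linear approximation is therefore
    [(w c - w r) * (s - Phi r)], and [c] tends to [r] with [s]. *)
Lemma is_derive_Phi_inv s : Phi_range s -> is_derive Phi_inv s (Phi_inv s / eta p (Phi_inv s)).
Proof.
intros [r [Hr <-]]; rewrite Phi_inv_Phi; auto.
split. apply (is_linear_scal_l (r / eta p r)).
intros x Hx eps; rewrite <- (is_filter_lim_locally_unique _ _ Hx); clear x Hx.
set (w := fun c => / (eta p c / c)).
assert (W : continuous w r).
{ apply continuous_Cdiff_pos; auto.
  apply (@Cdiff_comp1 R_NormedModule _ 0 Rinv _ _ (Cdiff_Rinv 0)). apply Cdiff_eta_div.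
  intros z Hz; apply Rgt_not_eq, Rdiv_lt_0_compat; auto. apply eta_pos; auto. }
destruct (W _ (locally_ball _ eps)) as [e We].
assert (Hd : 0 < Rmin (e / 2) (r / 2)).
{ apply Rmin_glb_lt; [assert (H := cond_pos e)|]; lra. }
generalize (@Phi_inv_near r _ Hr Hd); apply filter_imp; intros s [Rs N].
destruct (Phi_inv_spec Rs) as [P1 P2]; set (r' := Phi_inv s) in *.
rewrite Phi_inv_Phi; auto.
destruct (Phi_mvt Hr P1) as [c [Hc E]]. rewrite P2 in E.
assert (H1 := Rmin_l (e / 2) (r / 2)). assert (H2 := Rmin_r (e / 2) (r / 2)).
assert (Hcr : Rabs (c - r) <= Rabs (r' - r)).
{ unfold Rmin, Rmax in Hc; destruct (Rle_dec r r').
  rewrite !Rabs_pos_eq; lra. rewrite !Rabs_left1; lra. }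
assert (Hc0 : 0 < c).
{ assert (K : Rabs (c - r) <= r / 2) by lra. apply Rabs_le_between in K; lra. }
assert (Wc : Rabs (w c - w r) < eps).
{ apply (We c). change (Rabs (c - r) < e). assert (H := cond_pos e); lra. }
assert (Ec : 0 < eta p c) by (apply eta_pos; auto).
assert (Er : 0 < eta p r) by (apply eta_pos; auto).
change (Rabs (r' - r - (s - Phi p rs r) * (r / eta p r)) <= eps * Rabs (s - Phi p rs r)).
replace (r' - r - (s - Phi p rs r) * (r / eta p r)) with ((w c - w r) * (s - Phi p rs r)).
- rewrite Rabs_mult. apply Rmult_le_compat_r. apply Rabs_pos. lra.
- rewrite E. unfold w. field. repeat split; lra.
Qed.

(** The derivative of [Phi_inv] is a smooth function of [Phi_inv] itself, so each order of
    smoothness yields the next. *)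
Lemma Cdiff_Phi_inv k : Cdiff k Phi_range Phi_inv.
Proof.
assert (H := is_derive_Phi_inv).
induction k as [|k IH]. apply Cdiff_0 with (1 := H).
apply Cdiff_derive with (1 := H); apply Cdiff_mult; auto.
apply (@Cdiff_comp1 R_NormedModule _ k (fun x => / eta p x) Phi_inv (fun x => 0 < x)); auto.
- apply (@Cdiff_comp1 R_NormedModule _ k Rinv (eta p) _ (Cdiff_Rinv k)). apply Cdiff_eta.
  intros z Hz; apply Rgt_not_eq, eta_pos; auto.
- intros z Hz; apply Phi_inv_spec; auto.
Qed.

Lemma locally_Phi_range s : Phi_range s -> locally s Phi_range.
Proof.
intros [r [Hr <-]]. generalize (@Phi_inv_near r 1 Hr Rlt_0_1); apply filter_imp; tauto.
Qed.

Lemma rho_Phi_inv al be : rho p rs al be = Phi_inv ((al + be) / 2).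
Proof. reflexivity. Qed.

Lemma rho_state r w : 0 < r -> rho p rs (alpha_of p rs r w) (beta_of p rs r w) = r.
Proof.
intros Hr; rewrite rho_Phi_inv; unfold alpha_of, beta_of.
replace ((Phi p rs r + w + (Phi p rs r - w)) / 2) with (Phi p rs r) by field.
apply Phi_inv_Phi, Hr.
Qed.

Lemma vel_state r w : vel (alpha_of p rs r w) (beta_of p rs r w) = w.
Proof. unfold vel, alpha_of, beta_of; field. Qed.

End Fluid.

Unset Strict Implicit.

(** * Continuity in two variables and integrals with moving limits *)

Lemma continuity_2d_comp (f phi psi : R -> R -> R) x y :
  continuity_2d_pt f (phi x y) (psi x y) ->
  continuity_2d_pt phi x y -> continuity_2d_pt psi x y ->
  continuity_2d_pt (fun u v => f (phi u v) (psi u v)) x y.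
Proof.
intros Hf H1 H2 eps; destruct (Hf eps) as [d Hd].
generalize (locally_2d_and _ _ _ _ (H1 d) (H2 d)); apply locally_2d_impl, locally_2d_forall.
intros u v [h1 h2]; apply Hd; auto.
Qed.

Lemma continuity_2d_line (f : R -> R -> R) x y : continuity_2d_pt f x y -> continuous (fun s => f s y) x.
Proof.
intros H P [e HP]; destruct (H e) as [d Hd]; exists d; intros s Hs; apply HP.
apply (Hd s y Hs). rewrite Rminus_diag, Rabs_R0; apply cond_pos.
Qed.

Lemma continuity_2d_swap (f : R -> R -> R) x y :
  continuity_2d_pt f x y -> continuity_2d_pt (fun u v => f v u) y x.
Proof. intros H eps; destruct (H eps) as [d Hd]; exists d; intros u v h1 h2; auto. Qed.

Lemma continuity_2d_of_1d (h : R -> R) x y : continuity_pt h x -> continuity_2d_pt (fun u _ => h u) x y.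
Proof.
intros H; apply (continuity_1d_2d_pt_comp h (fun u _ => u)); auto. apply continuity_2d_pt_id1.
Qed.

Lemma abs_RInt_le (f : R -> R) a b M :
  (forall s, Rmin a b <= s <= Rmax a b -> continuous f s /\ Rabs (f s) <= M) ->
  Rabs (RInt f a b) <= Rabs (b - a) * M.
Proof.
intros H. assert (K : forall a b, a <= b ->
  (forall s, a <= s <= b -> continuous f s /\ Rabs (f s) <= M) -> Rabs (RInt f a b) <= (b - a) * M).
{ clear; intros a b L H. apply abs_RInt_le_const; auto. 2: apply H.
  apply (@ex_RInt_continuous R_CompleteNormedModule). intros z.
  rewrite Rmin_left, Rmax_right; auto. apply H. }
destruct (Rle_dec a b) as [L|L].
- rewrite (Rabs_pos_eq (b - a)) by lra. apply K; auto.
  rewrite Rmin_left, Rmax_right in H; auto.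
- assert (X : ex_RInt f a b) by
    (apply (@ex_RInt_continuous R_CompleteNormedModule); intros z Hz; apply H, Hz).
  rewrite Rmin_right, Rmax_left in H by lra.
  assert (E := opp_RInt_swap (V := R_CompleteNormedModule) f a b X).
  rewrite <- (Rabs_Ropp (RInt f a b)). change (- RInt f a b) with (opp (RInt f a b)). rewrite E.
  rewrite (Rabs_left1 (b - a)) by lra. replace (- (b - a)) with (a - b) by ring. apply K; auto; lra.
Qed.

Definition sq (r u v : R) : Prop := Rabs u <= r /\ Rabs v <= r.

Lemma between_abs r a b s : Rabs a <= r -> Rabs b <= r -> Rmin a b <= s <= Rmax a b -> Rabs s <= r.
Proof.
intros Ha Hb Hs; apply Rabs_le_between in Ha; apply Rabs_le_between in Hb; apply Rabs_le.
unfold Rmin, Rmax in Hs; destruct (Rle_dec a b); lra.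
Qed.

Lemma ex_RInt_line (f : R -> R -> R) r v a b : (forall s, Rabs s <= r -> continuity_2d_pt f s v) ->
  Rabs a <= r -> Rabs b <= r -> ex_RInt (fun s => f s v) a b.
Proof.
intros H Ha Hb; apply (@ex_RInt_continuous R_CompleteNormedModule); intros s Hs.
apply continuity_2d_line, H, (between_abs Ha Hb Hs).
Qed.

(** Integrand and limits both move. The change of the integrand is small by uniform continuity near
    the line [v = y]; with the integrand frozen at [y], the change of the limits is controlled by
    the continuity of the primitive [G]. *)
Lemma continuity_2d_RInt (f phi psi : R -> R -> R) r x y :
  (forall s v, sq r s v -> continuity_2d_pt f s v) -> Rabs x < r -> Rabs y < r ->
  (forall r' u v, sq r' u v -> Rabs (phi u v) <= r' /\ Rabs (psi u v) <= r') ->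
  continuity_2d_pt phi x y -> continuity_2d_pt psi x y ->
  continuity_2d_pt (fun u v => RInt (fun s => f s v) (phi u v) (psi u v)) x y.
Proof.
intros Hf Hx Hy Hb Hphi Hpsi.
assert (Hr : 0 < r) by (assert (H := Rabs_pos x); lra).
set (G b := RInt (fun s => f s y) 0 b).
assert (R0 : Rabs 0 <= r) by (rewrite Rabs_R0; lra).
assert (Hline : forall v, Rabs v <= r -> forall s, Rabs s <= r -> continuity_2d_pt f s v)
  by (intros; apply Hf; split; auto).
assert (HG : forall b, Rabs b < r -> continuity_pt G b).
{ intros b Hbr; apply continuity_pt_filterlim. apply (ex_derive_continuous G b); exists (f b y).
  apply (is_derive_RInt (fun s => f s y) G 0 b).
  - assert (He : 0 < r - Rabs b) by lra.
    exists (mkposreal _ He); intros c Hc; change (Rabs (c - b) < r - Rabs b) in Hc.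
    apply (RInt_correct (fun s => f s y)), ex_RInt_line with r; auto. apply Hline; lra.
    replace c with (c - b + b) by ring. eapply Rle_trans. apply Rabs_triang. lra.
  - apply continuity_2d_line, Hline; lra. }
set (m := Rmax (Rabs x) (Rabs y)).
assert (Hm : m < r) by (apply Rmax_lub_lt; auto).
assert (Hxy : sq m x y) by (split; [apply Rmax_l|apply Rmax_r]).
assert (K1 := Hb _ _ _ Hxy).
assert (C1 : continuity_2d_pt (fun u v => G (psi u v) - G (phi u v)) x y).
{ apply continuity_2d_pt_minus; apply continuity_1d_2d_pt_comp; auto; apply HG; lra. }
intros eps.
(* The interval of integration has length at most [2 * r], so this tolerance contributes at most
   [eps / 2]. *)
assert (He : 0 < eps / (4 * r)) by (apply Rdiv_lt_0_compat; [apply cond_pos|lra]).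
destruct (@uniform_continuity_2d_1d f (- r) r y) with (eps := mkposreal _ He) as [d Hd].
{ intros s Hs; apply Hline; [lra|apply Rabs_le; auto]. }
destruct (C1 (pos_div_2 eps)) as [d1 Hd1].
assert (Hdd : 0 < Rmin (Rmin d d1) (r - m)) by (repeat apply Rmin_glb_lt; try apply cond_pos; lra).
exists (mkposreal _ Hdd); simpl; intros u v Hu Hv.
assert (M1 := Rmin_l (Rmin d d1) (r - m)). assert (M2 := Rmin_r (Rmin d d1) (r - m)).
assert (M3 := Rmin_l d d1). assert (M4 := Rmin_r d d1).
assert (Hsq : sq r u v).
{ split; [replace u with (u - x + x) by ring | replace v with (v - y + y) by ring];
  eapply Rle_trans; try apply Rabs_triang; destruct Hxy; lra. }
destruct (Hb _ _ _ Hsq) as [Hphir Hpsir]. destruct Hsq as [Hur Hvr].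
assert (X1 : ex_RInt (fun s => f s v) (phi u v) (psi u v)) by (apply ex_RInt_line with r; auto).
assert (X2 : forall b, Rabs b <= r -> ex_RInt (fun s => f s y) 0 b)
  by (intros; apply ex_RInt_line with r; auto; apply Hline; lra).
assert (X3 : forall a b, Rabs a <= r -> Rabs b <= r -> RInt (fun s => f s y) a b = G b - G a).
{ intros a b Ha Hbr; unfold G.
  assert (E : RInt (fun s => f s y) 0 a + RInt (fun s => f s y) a b = RInt (fun s => f s y) 0 b).
  { apply (RInt_Chasles (V := R_CompleteNormedModule)); auto. apply ex_RInt_line with r; auto. apply Hline; lra. }
  lra. }
rewrite (X3 (phi x y)) by lra.
replace (RInt (fun s => f s v) (phi u v) (psi u v)) with
  (RInt (fun s => f s v - f s y) (phi u v) (psi u v) + (G (psi u v) - G (phi u v))).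
2:{ rewrite <- X3; auto.
    assert (X4 : ex_RInt (fun s => f s y) (phi u v) (psi u v)) by (apply ex_RInt_line with r; auto; apply Hline; lra).
    assert (E := RInt_minus (V := R_CompleteNormedModule) (fun s => f s v) (fun s => f s y) _ _ X1 X4).
    unfold minus, plus, opp in E; simpl in E. unfold Rminus. rewrite E. ring. }
assert (A1 : Rabs (RInt (fun s => f s v - f s y) (phi u v) (psi u v)) <=
   Rabs (psi u v - phi u v) * (eps / (4 * r))).
{ apply abs_RInt_le; intros s Hs. assert (Hsr := between_abs Hphir Hpsir Hs). split.
  - apply (continuous_minus (fun s => f s v) (fun s => f s y)); apply continuity_2d_line, Hline; lra.
  - assert (Hs' := Hsr). apply Rabs_le_between in Hs'. apply Rlt_le.
    assert (Hv' := Hv). apply Rabs_def2 in Hv'. assert (Pd := cond_pos d).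
    apply (Hd s y s v); try lra. rewrite Rminus_diag, Rabs_R0; apply cond_pos. }
assert (A2 : Rabs (psi u v - phi u v) <= 2 * r).
{ eapply Rle_trans. apply Rabs_triang. rewrite Rabs_Ropp; lra. }
assert (A3 : Rabs (psi u v - phi u v) * (eps / (4 * r)) <= 2 * r * (eps / (4 * r)))
  by (apply Rmult_le_compat_r; lra).
replace (2 * r * (eps / (4 * r))) with (eps / 2) in A3 by (field; lra).
assert (A4 : Rabs (G (psi u v) - G (phi u v) - (G (psi x y) - G (phi x y))) < eps / 2).
{ apply (Hd1 u v); lra. }
match goal with |- Rabs (?p + ?q - ?s) < _ => replace (p + q - s) with (p + (q - s)) by ring end.
eapply Rle_lt_trans. apply Rabs_triang. lra.
Qed.

(** * Quantities depending on the unknown *)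

(** The components stand for [alpha''(u)], [beta''(v)], [d/ds t_u] along
    [(s, s)], [d/ds t_v] along [(a s, s)], [t_uv], [t_uuv] and [t_uvv].  The
    first four are functions of the first variable only. *)
Inductive cmp := cA | cB | cp | cq | cR | cU | cV.
Definition unk := cmp -> R -> R -> R.

Definition dot (l m : cmp -> R) : R :=
  l cA * m cA + l cB * m cB + l cp * m cp + l cq * m cq + l cR * m cR + l cU * m cU + l cV * m cV.

Definition inX (m : cmp -> R) (Y : unk) : Prop :=
  forall c u v, Rabs (Y c u v) <= m c /\ continuity_2d_pt (Y c) u v.
Definition apart (d : cmp -> R) (Y Y' : unk) : Prop :=
  forall c u v, Rabs (Y c u v - Y' c u v) <= d c.

(** A quantity is a function of [(u, v)] depending on the unknown.  Near the
    origin and uniformly on bounded sets of unknowns, it is bounded by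
    [kap + l . m] and Lipschitz in the unknown with the vector [l] of constants,
    up to errors of the order of the distance to the origin. *)
Definition QE (kap : R) (l : cmp -> R) (Th : unk -> R -> R -> R) : Prop :=
  forall m, exists C r0, 0 <= C /\ 0 < r0 /\ forall r u v, 0 < r <= r0 -> sq r u v ->
  (forall Y, inX m Y -> continuity_2d_pt (Th Y) u v /\ Rabs (Th Y u v) <= kap + dot l m + C * r) /\
  (forall Y Y' d D, inX m Y -> inX m Y' -> apart d Y Y' -> (forall c, d c <= D) ->
     Rabs (Th Y u v - Th Y' u v) <= dot l d + C * r * D).

(** Quantities of lower order, for which the unknown counts only through errors of order [r]. The
    limit [th] at the origin is recorded, since it becomes a gain when the quantity multiplies a
    highest derivative. *)
Definition Low (th : R) (Th : unk -> R -> R -> R) : Prop :=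
  QE 0 (fun _ => 0) (fun Y u v => Th Y u v - th).
(** The constant [kap] only affects the radius of the invariant ball and is hidden; the gains [l]
    decide about contraction. *)
Definition Gr (l : cmp -> R) (Th : unk -> R -> R -> R) : Prop := exists kap, QE kap l Th.

Lemma apart_pos d Y Y' c : apart d Y Y' -> 0 <= d c.
Proof. intros H; eapply Rle_trans; [apply Rabs_pos|apply (H c 0 0)]. Qed.

Lemma dot_0 m : dot (fun _ => 0) m = 0.
Proof. unfold dot; ring. Qed.
Lemma dot_plus l l' m : dot (fun c => l c + l' c) m = dot l m + dot l' m.
Proof. unfold dot; ring. Qed.
Lemma dot_scal k l m : dot (fun c => k * l c) m = k * dot l m.
Proof. unfold dot; ring. Qed.

Lemma dot_le l d D : (forall c, 0 <= d c <= D) -> dot l d <= dot (fun c => Rabs (l c)) (fun _ => 1) * D.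
Proof.
intros H. assert (K : forall c, l c * d c <= Rabs (l c) * 1 * D).
{ intros c. rewrite Rmult_1_r. eapply Rle_trans. apply Rle_abs. rewrite Rabs_mult.
  apply Rmult_le_compat_l. apply Rabs_pos. rewrite Rabs_pos_eq; apply H. }
unfold dot. assert (h1 := K cA); assert (h2 := K cB); assert (h3 := K cp); assert (h4 := K cq);
assert (h5 := K cR); assert (h6 := K cU); assert (h7 := K cV). lra.
Qed.

Lemma sq_le r r' u v : sq r u v -> r <= r' -> sq r' u v.
Proof. intros [h1 h2]; split; lra. Qed.

Lemma QE_ext kap l Th Th' : (forall Y u v, Th Y u v = Th' Y u v) -> QE kap l Th -> QE kap l Th'.
Proof.
intros E H m; destruct (H m) as (C & r0 & HC & Hr & K); exists C, r0; split; auto; split; auto.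
intros r u v Hr' Hs; destruct (K r u v Hr' Hs) as [K1 K2]; split.
- intros Y HY; rewrite <- E; destruct (K1 Y HY); split; auto.
  apply continuity_2d_pt_ext with (Th Y); auto.
- intros Y Y' d D h1 h2 h3 h4; rewrite <- !E; auto.
Qed.

Lemma QE_eq kap kap' l l' Th : kap = kap' -> (forall c, l c = l' c) -> QE kap l Th -> QE kap' l' Th.
Proof.
intros <- E H m; destruct (H m) as (C & r0 & HC & Hr & K); exists C, r0.
assert (Ed : forall d, dot l' d = dot l d) by (intros d; unfold dot; rewrite !E; reflexivity).
split; auto; split; auto; intros r u v Hr' Hs; rewrite Ed; destruct (K r u v Hr' Hs) as [K1 K2].
split; auto. intros; rewrite Ed; eauto.
Qed.

Lemma QE_const c : QE (Rabs c) (fun _ => 0) (fun _ _ _ => c).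
Proof.
intros m; exists 0, 1; repeat split; try lra; intros; try apply continuity_2d_pt_const.
rewrite dot_0; lra. rewrite dot_0, Rminus_diag, Rabs_R0; lra.
Qed.

Lemma QE_cmp c0 : QE 0 (fun c => match c0, c with
   cA, cA | cB, cB | cp, cp | cq, cq | cR, cR | cU, cU | cV, cV => 1 | _, _ => 0 end)
   (fun Y => Y c0).
Proof.
intros m; exists 0, 1; split; [lra|]; split; [lra|]; intros r u v Hr Hs.
assert (E : forall m, dot (fun c => match c0, c with
   cA, cA | cB, cB | cp, cp | cq, cq | cR, cR | cU, cU | cV, cV => 1 | _, _ => 0 end) m = m c0)
 by (intros; destruct c0; unfold dot; ring).
split; intros; rewrite E.
destruct (H c0 u v); split; auto; lra. assert (K := H1 c0 u v); lra.
Qed.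

Lemma QE_plus k1 k2 l1 l2 T1 T2 : QE k1 l1 T1 -> QE k2 l2 T2 ->
  QE (k1 + k2) (fun c => l1 c + l2 c) (fun Y u v => T1 Y u v + T2 Y u v).
Proof.
intros H1 H2 m; destruct (H1 m) as (C1 & r1 & HC1 & Hr1 & K1), (H2 m) as (C2 & r2 & HC2 & Hr2 & K2).
assert (L1 := Rmin_l r1 r2). assert (L2 := Rmin_r r1 r2).
exists (C1 + C2), (Rmin r1 r2); split; [lra|]; split; [apply Rmin_glb_lt; auto|].
intros r u v Hr Hs. destruct (K1 r u v) as [P1 Q1]; [lra|auto|]. destruct (K2 r u v) as [P2 Q2]; [lra|auto|].
split.
- intros Y HY; destruct (P1 Y HY), (P2 Y HY); split. apply continuity_2d_pt_plus; auto.
  rewrite dot_plus. eapply Rle_trans. apply Rabs_triang. lra.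
- intros Y Y' d D h1 h2 h3 h4. assert (A1 := Q1 Y Y' d D h1 h2 h3 h4). assert (A2 := Q2 Y Y' d D h1 h2 h3 h4).
  rewrite dot_plus.
  replace (T1 Y u v + T2 Y u v - (T1 Y' u v + T2 Y' u v)) with
   ((T1 Y u v - T1 Y' u v) + (T2 Y u v - T2 Y' u v)) by ring.
  eapply Rle_trans. apply Rabs_triang. lra.
Qed.

(** Only the second factor may depend on the unknown at leading order. *)
Lemma QE_mult k1 k2 l T1 T2 : 0 <= k1 -> QE k1 (fun _ => 0) T1 -> QE k2 l T2 ->
  QE (k1 * k2) (fun c => k1 * l c) (fun Y u v => T1 Y u v * T2 Y u v).
Proof.
intros Hk H1 H2 m; destruct (H1 m) as (C1 & r1 & HC1 & Hr1 & K1), (H2 m) as (C2 & r2 & HC2 & Hr2 & K2).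
assert (L1 := Rmin_l r1 r2). assert (L2 := Rmin_r r1 r2). set (r0 := Rmin r1 r2) in *.
assert (Hr0 : 0 < r0) by (apply Rmin_glb_lt; auto).
(* [S] bounds the second factor and [B] its Lipschitz constant; they turn the products with the
   error [C1 * r] of the first factor into errors of order [r]. *)
set (S := Rabs k2 + Rabs (dot l m) + C2 * r0).
set (B := dot (fun c => Rabs (l c)) (fun _ => 1) + C2 * r0).
assert (HS : 0 <= S).
{ unfold S; assert (h1 := Rabs_pos k2); assert (h2 := Rabs_pos (dot l m)).
  assert (0 <= C2 * r0) by (apply Rmult_le_pos; lra). lra. }
assert (HB : 0 <= B).
{ unfold B, dot; assert (0 <= C2 * r0) by (apply Rmult_le_pos; lra).
  assert (h := fun c => Rabs_pos (l c)).
  assert (h1 := h cA); assert (h2 := h cB); assert (h3 := h cp); assert (h4 := h cq);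
  assert (h5 := h cR); assert (h6 := h cU); assert (h7 := h cV). lra. }
assert (P0 : 0 <= C1 * S + k1 * C2 + C1 * B).
{ assert (h1 := Rmult_le_pos _ _ HC1 HS). assert (h2 := Rmult_le_pos _ _ Hk HC2).
  assert (h3 := Rmult_le_pos _ _ HC1 HB). lra. }
exists (C1 * S + k1 * C2 + C1 * B), r0.
split; auto; split; auto. intros r u v Hr Hs.
destruct (K1 r u v) as [P1 Q1]; [lra|auto|]. destruct (K2 r u v) as [P2 Q2]; [lra|auto|].
assert (Hc2 : C2 * r <= C2 * r0) by (apply Rmult_le_compat_l; lra).
assert (Bd : forall Y, inX m Y -> Rabs (T2 Y u v) <= S).
{ intros Y HY; destruct (P2 Y HY) as [_ h]; unfold S.
  assert (h1 := Rle_abs k2); assert (h2 := Rle_abs (dot l m)); lra. }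
assert (Bd1 : forall Y, inX m Y -> Rabs (T1 Y u v) <= k1 + C1 * r).
{ intros Y HY; destruct (P1 Y HY) as [_ h]; rewrite dot_0 in h; lra. }
assert (HC1r : 0 <= C1 * r) by (apply Rmult_le_pos; lra).
split.
- intros Y HY. destruct (P1 Y HY), (P2 Y HY); split. apply continuity_2d_pt_mult; auto.
  rewrite Rabs_mult, dot_scal.
  assert (h1 := Bd Y HY); assert (h2 := Bd1 Y HY).
  assert (Rabs (T1 Y u v) * Rabs (T2 Y u v) <= (k1 + C1 * r) * Rabs (T2 Y u v))
    by (apply Rmult_le_compat_r; auto using Rabs_pos).
  assert (C1 * r * Rabs (T2 Y u v) <= C1 * r * S) by (apply Rmult_le_compat_l; auto).
  assert (k1 * Rabs (T2 Y u v) <= k1 * (k2 + dot l m + C2 * r)) by (apply Rmult_le_compat_l; auto).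
  assert (0 <= C1 * B * r) by (apply Rmult_le_pos; [apply Rmult_le_pos|]; lra).
  nra.
- intros Y Y' d D h1 h2 h3 h4. assert (A1 := Q1 Y Y' d D h1 h2 h3 h4). assert (A2 := Q2 Y Y' d D h1 h2 h3 h4).
  rewrite dot_0 in A1. rewrite dot_scal.
  assert (HD : 0 <= D) by (apply Rle_trans with (d cA); auto; apply apart_pos with (1 := h3)).
  assert (A3 : dot l d <= dot (fun c => Rabs (l c)) (fun _ => 1) * D).
  { apply dot_le; intros c; split; auto; apply apart_pos with (1 := h3). }
  assert (A4 : Rabs (T2 Y u v - T2 Y' u v) <= B * D).
  { assert (C2 * r * D <= C2 * r0 * D) by (apply Rmult_le_compat_r; auto). unfold B; lra. }
  replace (T1 Y u v * T2 Y u v - T1 Y' u v * T2 Y' u v) with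
   ((T1 Y u v - T1 Y' u v) * T2 Y' u v + T1 Y u v * (T2 Y u v - T2 Y' u v)) by ring.
  eapply Rle_trans. apply Rabs_triang. rewrite !Rabs_mult.
  assert (E1 : Rabs (T1 Y u v - T1 Y' u v) * Rabs (T2 Y' u v) <= (C1 * r * D) * S)
    by (apply Rmult_le_compat; auto using Rabs_pos; lra).
  assert (E2 : Rabs (T1 Y u v) * Rabs (T2 Y u v - T2 Y' u v) <= (k1 + C1 * r) * Rabs (T2 Y u v - T2 Y' u v))
    by (apply Rmult_le_compat_r; auto using Rabs_pos).
  assert (E3 : k1 * Rabs (T2 Y u v - T2 Y' u v) <= k1 * (dot l d + C2 * r * D))
    by (apply Rmult_le_compat_l; auto).
  assert (E4 : C1 * r * Rabs (T2 Y u v - T2 Y' u v) <= C1 * r * (B * D))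
    by (apply Rmult_le_compat_l; auto).
  lra.
Qed.

(** Reparametrisations that map every centred square into itself and hence preserve errors of order
    [r]. *)
Definition shift (phi psi : R -> R -> R) : Prop :=
  (forall u v, continuity_2d_pt phi u v /\ continuity_2d_pt psi u v) /\
  forall r u v, sq r u v -> sq r (phi u v) (psi u v).

Lemma QE_shift kap l Th phi psi : shift phi psi -> QE kap l Th ->
  QE kap l (fun Y u v => Th Y (phi u v) (psi u v)).
Proof.
intros [Hc Hs] H m; destruct (H m) as (C & r0 & HC & Hr & K); exists C, r0; split; auto; split; auto.
intros r u v Hr' Huv. destruct (K r _ _ Hr' (Hs _ _ _ Huv)) as [K1 K2]; split.
- intros Y HY; destruct (K1 Y HY); split; auto.
  apply continuity_2d_comp; auto; apply Hc.
- intros Y Y' d D h1 h2 h3 h4; eauto.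
Qed.

(** On the square of radius [r] the interval of integration has length at most [2 * r], so an
    integral has no gains, whatever the gains of its integrand. This is why only the highest
    derivatives enter the contraction estimate. *)
Lemma QE_RInt kap l Th phi psi : shift phi psi -> QE kap l Th ->
  QE 0 (fun _ => 0) (fun Y u v => RInt (fun s => Th Y s v) (phi u v) (psi u v)).
Proof.
intros [Hc Hs] H m; destruct (H m) as (C & r0 & HC & Hr & K).
set (S := Rabs kap + Rabs (dot l m) + C * r0).
set (B := dot (fun c => Rabs (l c)) (fun _ => 1) + C * r0).
assert (HCr : 0 <= C * r0) by (apply Rmult_le_pos; lra).
assert (HS : 0 <= S).
{ unfold S; assert (h1 := Rabs_pos kap); assert (h2 := Rabs_pos (dot l m)); lra. }
assert (HB : 0 <= B).
{ unfold B, dot; assert (h := fun c => Rabs_pos (l c)).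
  assert (h1 := h cA); assert (h2 := h cB); assert (h3 := h cp); assert (h4 := h cq);
  assert (h5 := h cR); assert (h6 := h cU); assert (h7 := h cV). lra. }
exists (2 * S + 2 * B), (r0 / 2); split; [lra|]; split; [lra|]. intros r u v Hr' Huv.
destruct (Hs _ _ _ Huv) as [Hp1 Hp2]. destruct (Huv) as [Hu Hv].
assert (Hin : forall s, Rmin (phi u v) (psi u v) <= s <= Rmax (phi u v) (psi u v) -> sq r s v).
{ intros s Hsb; split; auto. apply (between_abs Hp1 Hp2 Hsb). }
assert (Hlen : Rabs (psi u v - phi u v) <= 2 * r).
{ eapply Rle_trans. apply Rabs_triang. rewrite Rabs_Ropp; lra. }
assert (HCr' : C * r <= C * r0) by (apply Rmult_le_compat_l; lra).
split.
- intros Y HY; split.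
  + apply (@continuity_2d_RInt (Th Y) phi psi r0); try lra; try apply Hc.
    * intros s w Hsw. apply (K r0 s w); auto; lra.
    * intros r' a b Hab; apply Hs, Hab.
  + rewrite dot_0. eapply Rle_trans. apply abs_RInt_le with (M := S).
    * intros s Hsb. destruct (K r s v) as [K1 _]; [lra|auto|]. destruct (K1 Y HY) as [K2 K3].
      split. apply continuity_2d_line with (1 := K2).
      unfold S. assert (h1 := Rle_abs kap); assert (h2 := Rle_abs (dot l m)); lra.
    * assert (Rabs (psi u v - phi u v) * S <= 2 * r * S) by (apply Rmult_le_compat_r; auto).
      assert (0 <= B * r) by (apply Rmult_le_pos; lra). lra.
- intros Y Y' d D h1 h2 h3 h4. rewrite dot_0.
  assert (HD : 0 <= D) by (apply Rle_trans with (d cA); auto; apply apart_pos with (1 := h3)).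
  assert (X : forall Y, inX m Y -> ex_RInt (fun s => Th Y s v) (phi u v) (psi u v)).
  { intros Z HZ; apply (@ex_RInt_continuous R_CompleteNormedModule); intros s Hsb.
    apply continuity_2d_line. apply (K r s v); auto; lra. }
  assert (E := RInt_minus (V := R_CompleteNormedModule) (fun s => Th Y s v) (fun s => Th Y' s v) _ _ (X Y h1) (X Y' h2)).
  change (RInt (fun x => Th Y x v - Th Y' x v) (phi u v) (psi u v) =
    RInt (fun x => Th Y x v) (phi u v) (psi u v) - RInt (fun x => Th Y' x v) (phi u v) (psi u v)) in E.
  rewrite <- E.
  eapply Rle_trans. apply abs_RInt_le with (M := B * D).
  + intros s Hsb. destruct (K r s v) as [K1 K2]; [lra|auto|]. split.
    * apply (continuous_minus (fun s => Th Y s v) (fun s => Th Y' s v)); apply continuity_2d_line; apply K1; auto.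
    * eapply Rle_trans. apply (K2 Y Y' d D); auto.
      assert (A3 : dot l d <= dot (fun c => Rabs (l c)) (fun _ => 1) * D).
      { apply dot_le; intros c; split; auto; apply apart_pos with (1 := h3). }
      assert (C * r * D <= C * r0 * D) by (apply Rmult_le_compat_r; auto). unfold B; lra.
  + assert (0 <= B * D) by (apply Rmult_le_pos; auto).
    assert (Rabs (psi u v - phi u v) * (B * D) <= 2 * r * (B * D)) by (apply Rmult_le_compat_r; auto).
    assert (0 <= S * r * D) by (repeat apply Rmult_le_pos; lra). lra.
Qed.

Lemma Low_ext th Th Th' : (forall Y u v, Th Y u v = Th' Y u v) -> Low th Th -> Low th Th'.
Proof. intros E; apply QE_ext; intros; rewrite E; reflexivity. Qed.

Lemma Low_eq th th' Th : th = th' -> Low th Th -> Low th' Th.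
Proof. intros <-; auto. Qed.

Lemma QE_zero_scal k : QE 0 (fun _ => 0) (fun _ _ _ => k * 0).
Proof.
apply QE_ext with (fun _ _ _ => 0). intros; ring.
apply QE_eq with (3 := QE_const 0); auto using Rabs_R0.
Qed.

Lemma Low_QE th Th : Low th Th -> QE (Rabs th) (fun _ => 0) Th.
Proof.
intros H. apply QE_ext with (fun Y u v => Th Y u v - th + th). intros; ring.
apply QE_eq with (3 := QE_plus H (QE_const th)); intros; ring.
Qed.

Lemma QE_Low Th : QE 0 (fun _ => 0) Th -> Low 0 Th.
Proof. apply QE_ext; intros; ring. Qed.

Lemma Low_const c : Low c (fun _ _ _ => c).
Proof.
apply QE_ext with (fun _ _ _ => 0 * 0). intros; ring. apply QE_zero_scal.
Qed.

Lemma Low_plus t1 t2 T1 T2 : Low t1 T1 -> Low t2 T2 -> Low (t1 + t2) (fun Y u v => T1 Y u v + T2 Y u v).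
Proof.
intros H1 H2; apply QE_ext with (fun Y u v => (T1 Y u v - t1) + (T2 Y u v - t2)). intros; ring.
apply QE_eq with (3 := QE_plus H1 H2); intros; ring.
Qed.

Lemma Low_mult t1 t2 T1 T2 : Low t1 T1 -> Low t2 T2 -> Low (t1 * t2) (fun Y u v => T1 Y u v * T2 Y u v).
Proof.
intros H1 H2.
apply QE_ext with (fun Y u v => (T1 Y u v - t1) * T2 Y u v + t1 * (T2 Y u v - t2)). intros; ring.
apply QE_eq with (3 := QE_plus (QE_mult (Rle_refl 0) H1 (Low_QE H2))
  (QE_mult (Rabs_pos t1) (QE_const t1) H2)); intros; ring.
Qed.

Lemma Low_opp t T : Low t T -> Low (- t) (fun Y u v => - T Y u v).
Proof.
intros H. apply Low_eq with (-1 * t). ring.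
apply Low_ext with (fun Y u v => -1 * T Y u v). intros; ring.
apply Low_mult; auto using Low_const.
Qed.

Lemma Low_minus t1 t2 T1 T2 : Low t1 T1 -> Low t2 T2 -> Low (t1 - t2) (fun Y u v => T1 Y u v - T2 Y u v).
Proof. intros; apply (Low_plus (T2 := fun Y u v => - T2 Y u v)); auto using Low_opp. Qed.

Lemma Low_shift th Th phi psi : shift phi psi -> Low th Th -> Low th (fun Y u v => Th Y (phi u v) (psi u v)).
Proof. intros Hs H; apply (QE_shift Hs H). Qed.

Lemma Low_Gr th Th : Low th Th -> Gr (fun _ => 0) Th.
Proof. intros H; exists (Rabs th); apply Low_QE, H. Qed.

Lemma Gr_eq l l' Th : (forall c, l c = l' c) -> Gr l Th -> Gr l' Th.
Proof. intros E [k H]; exists k; apply QE_eq with (3 := H); auto. Qed.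

Lemma Gr_ext l Th Th' : (forall Y u v, Th Y u v = Th' Y u v) -> Gr l Th -> Gr l Th'.
Proof. intros E [k H]; exists k; apply QE_ext with (1 := E); auto. Qed.

Lemma Gr_plus l1 l2 T1 T2 : Gr l1 T1 -> Gr l2 T2 -> Gr (fun c => l1 c + l2 c) (fun Y u v => T1 Y u v + T2 Y u v).
Proof. intros [k1 H1] [k2 H2]; exists (k1 + k2); apply QE_plus; auto. Qed.

Lemma Gr_mult t l T1 T2 : Low t T1 -> Gr l T2 -> Gr (fun c => Rabs t * l c) (fun Y u v => T1 Y u v * T2 Y u v).
Proof.
intros H1 [k2 H2]; exists (Rabs t * k2); apply QE_mult; auto using Rabs_pos, Low_QE.
Qed.

Lemma Gr_opp l T : Gr l T -> Gr l (fun Y u v => - T Y u v).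
Proof.
intros H; apply Gr_ext with (fun Y u v => -1 * T Y u v). intros; ring.
apply Gr_eq with (2 := Gr_mult (Low_const (-1)) H). intros; rewrite Rabs_left; lra.
Qed.

Lemma Gr_minus l1 l2 T1 T2 : Gr l1 T1 -> Gr l2 T2 -> Gr (fun c => l1 c + l2 c) (fun Y u v => T1 Y u v - T2 Y u v).
Proof. intros; apply (Gr_plus (T2 := fun Y u v => - T2 Y u v)); auto using Gr_opp. Qed.

Lemma Gr_shift l Th phi psi : shift phi psi -> Gr l Th -> Gr l (fun Y u v => Th Y (phi u v) (psi u v)).
Proof. intros Hs [k H]; exists k; apply (QE_shift Hs H). Qed.

Lemma shift_swap : shift (fun _ v => v) (fun u _ => u).
Proof.
split. intros; split; [apply continuity_2d_pt_id2|apply continuity_2d_pt_id1].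
intros r u v [h1 h2]; split; auto.
Qed.

Lemma Low_RInt1 l Th phi psi : shift phi psi -> Gr l Th ->
  Low 0 (fun Y u v => RInt (fun s => Th Y s v) (phi u v) (psi u v)).
Proof. intros Hs [k H]; apply QE_Low, (QE_RInt Hs H). Qed.

Lemma Low_RInt2 l Th phi psi : shift phi psi -> Gr l Th ->
  Low 0 (fun Y u v => RInt (fun s => Th Y u s) (phi u v) (psi u v)).
Proof.
intros Hs H.
assert (Hs' : shift (fun u v => phi v u) (fun u v => psi v u)).
{ destruct Hs as [h1 h2]; split.
  - intros u v; destruct (h1 v u); split; apply continuity_2d_swap with (f := fun a b => _ a b); auto.
  - intros r u v [a b]; apply h2; split; auto. }
assert (H' := Gr_shift shift_swap H).
assert (K := Low_shift shift_swap (Low_RInt1 Hs' H')). exact K.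
Qed.

Lemma Low_near th Th (P : R -> Prop) m : Low th Th -> locally th P ->
  exists r0, 0 < r0 /\ forall Y u v, inX m Y -> sq r0 u v -> P (Th Y u v).
Proof.
intros H [e HP]; destruct (H m) as (C & r0 & HC & Hr & K).
assert (He := cond_pos e).
assert (Hr1 : 0 < Rmin r0 (e / (C + 1))) by (apply Rmin_glb_lt; auto; apply Rdiv_lt_0_compat; lra).
exists (Rmin r0 (e / (C + 1))); split; auto; intros Y u v HY Hs; apply HP.
destruct (K _ u v (conj Hr1 (Rmin_l _ _)) Hs) as [K1 _]; destruct (K1 Y HY) as [_ K2].
change (Rabs (Th Y u v - th) < e). rewrite dot_0 in K2.
eapply Rle_lt_trans. apply K2.
apply Rle_lt_trans with (C * (e / (C + 1))).
- assert (C * Rmin r0 (e / (C + 1)) <= C * (e / (C + 1))) by (apply Rmult_le_compat_l; auto; apply Rmin_r). lra.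
- apply Rmult_lt_reg_r with (C + 1). lra. field_simplify; [|lra]. nra.
Qed.

Lemma Low_cont th Th m : Low th Th ->
  exists r0, 0 < r0 /\ forall Y u v, inX m Y -> sq r0 u v -> continuity_2d_pt (Th Y) u v.
Proof.
intros H; destruct (H m) as (C & r0 & HC & Hr & K); exists r0; split; auto.
intros Y u v HY Hs; destruct (K r0 u v) as [K1 _]; auto; [lra|]; destruct (K1 Y HY) as [K2 _].
apply continuity_2d_pt_ext with (fun u v => Th Y u v - th + th). intros; ring.
apply continuity_2d_pt_plus; auto. apply continuity_2d_pt_const.
Qed.

(** * Composition with functions of four variables *)

Definition V4 : NormedModule R_AbsRing :=
  prod_NormedModule _ (prod_NormedModule _ R_NormedModule R_NormedModule)
    (prod_NormedModule _ R_NormedModule R_NormedModule).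
(** Grouped in pairs so that [snd] extracts the point [(t, x)] at which the states ahead are
    evaluated. *)
Definition mk (a b c d : R) : V4 := ((a, b), (c, d)).
Definition pr (i : nat) (z : V4) : R :=
  match i with 0%nat => fst (fst z) | 1%nat => snd (fst z) | 2%nat => fst (snd z) | _ => snd (snd z) end.
Definition sum4 (F : nat -> R) : R := F 0%nat + F 1%nat + F 2%nat + F 3%nat.

Definition LipAt (C : V4 -> Prop) (o : V4) (E : V4 -> R) : Prop :=
  exists L (r : posreal), 0 <= L /\ forall z z', C z -> C z' -> ball o r z -> ball o r z' ->
    Rabs (E z - E z') <= L * sum4 (fun i => Rabs (pr i z - pr i z')).

Lemma ball4 (o z : V4) r : ball o r z <-> forall i, Rabs (pr i z - pr i o) < r.
Proof.
split.
- intros [[h1 h2] [h3 h4]] i; destruct i as [|[|[|i]]]; auto.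
- intros H; split; split; [apply (H 0%nat)|apply (H 1%nat)|apply (H 2%nat)|apply (H 3%nat)].
Qed.

(** A Lipschitz function carries errors of order [r] over to errors of order [r]. Membership of the
    values in [C] is a separate requirement, because [o] may lie on the boundary of [C]; it is the
    apex of the cones on which the states ahead are used. *)
Lemma Low_comp C (o : V4) E (T : nat -> unk -> R -> R -> R) : LipAt C o E -> C o ->
  (forall i, (i < 4)%nat -> Low (pr i o) (T i)) ->
  (forall m, exists r0, 0 < r0 /\ forall Y u v, inX m Y -> sq r0 u v ->
     C (mk (T 0%nat Y u v) (T 1%nat Y u v) (T 2%nat Y u v) (T 3%nat Y u v))) ->
  Low (E o) (fun Y u v => E (mk (T 0%nat Y u v) (T 1%nat Y u v) (T 2%nat Y u v) (T 3%nat Y u v))).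
Proof.
intros (L & rL & HL & Lip) Co HT HC m.
set (Z := fun Y u v => mk (T 0%nat Y u v) (T 1%nat Y u v) (T 2%nat Y u v) (T 3%nat Y u v)) in *.
destruct (HC m) as (rC & HrC & HCin).
assert (HB : exists r0, 0 < r0 /\ forall Y u v, inX m Y -> sq r0 u v -> ball o rL (Z Y u v)).
{ assert (N : forall i, (i < 4)%nat -> exists r0, 0 < r0 /\ forall Y u v, inX m Y -> sq r0 u v -> ball (pr i o) rL (T i Y u v)).
  { intros i Hi; apply (@Low_near (pr i o) (T i) (ball (pr i o : R) rL) m); auto. apply locally_ball. }
  destruct (N 0%nat) as (a0 & A0 & N0); [lia|]. destruct (N 1%nat) as (a1 & A1 & N1); [lia|].
  destruct (N 2%nat) as (a2 & A2 & N2); [lia|]. destruct (N 3%nat) as (a3 & A3 & N3); [lia|].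
  exists (Rmin (Rmin a0 a1) (Rmin a2 a3)); split. repeat apply Rmin_glb_lt; auto.
  assert (h1 := Rmin_l (Rmin a0 a1) (Rmin a2 a3)). assert (h2 := Rmin_r (Rmin a0 a1) (Rmin a2 a3)).
  assert (h3 := Rmin_l a0 a1). assert (h4 := Rmin_r a0 a1). assert (h5 := Rmin_l a2 a3). assert (h6 := Rmin_r a2 a3).
  intros Y u v HY Hs; split; split; [apply N0|apply N1|apply N2|apply N3]; auto; apply sq_le with (1 := Hs); lra. }
destruct HB as (rB & HrB & HBin).
assert (HQ : exists C r0, 0 <= C /\ 0 < r0 /\ forall r u v i, (i < 4)%nat -> 0 < r <= r0 -> sq r u v ->
  (forall Y, inX m Y -> continuity_2d_pt (fun u v => T i Y u v - pr i o) u v /\ Rabs (T i Y u v - pr i o) <= C * r) /\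
  (forall Y Y' d D, inX m Y -> inX m Y' -> apart d Y Y' -> (forall c, d c <= D) ->
     Rabs (T i Y u v - T i Y' u v) <= C * r * D)).
{ destruct (HT 0%nat ltac:(lia) m) as (C0 & a0 & P0 & A0 & K0).
  destruct (HT 1%nat ltac:(lia) m) as (C1 & a1 & P1 & A1 & K1).
  destruct (HT 2%nat ltac:(lia) m) as (C2 & a2 & P2 & A2 & K2).
  destruct (HT 3%nat ltac:(lia) m) as (C3 & a3 & P3 & A3 & K3).
  assert (h1 := Rmin_l (Rmin a0 a1) (Rmin a2 a3)). assert (h2 := Rmin_r (Rmin a0 a1) (Rmin a2 a3)).
  assert (h3 := Rmin_l a0 a1). assert (h4 := Rmin_r a0 a1). assert (h5 := Rmin_l a2 a3). assert (h6 := Rmin_r a2 a3).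
  exists (C0 + C1 + C2 + C3), (Rmin (Rmin a0 a1) (Rmin a2 a3)).
  split; [lra|]. split. repeat apply Rmin_glb_lt; auto.
  assert (G : forall Ci ri i, 0 <= Ci <= C0 + C1 + C2 + C3 -> Rmin (Rmin a0 a1) (Rmin a2 a3) <= ri ->
    (forall r u v, 0 < r <= ri -> sq r u v ->
      (forall Y, inX m Y -> continuity_2d_pt (fun u v => T i Y u v - pr i o) u v /\
          Rabs (T i Y u v - pr i o) <= 0 + dot (fun _ => 0) m + Ci * r) /\
      (forall Y Y' d D, inX m Y -> inX m Y' -> apart d Y Y' -> (forall c, d c <= D) ->
        Rabs (T i Y u v - pr i o - (T i Y' u v - pr i o)) <= dot (fun _ => 0) d + Ci * r * D)) ->
    forall r u v, 0 < r <= Rmin (Rmin a0 a1) (Rmin a2 a3) -> sq r u v ->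
      (forall Y, inX m Y -> continuity_2d_pt (fun u v => T i Y u v - pr i o) u v /\
          Rabs (T i Y u v - pr i o) <= (C0 + C1 + C2 + C3) * r) /\
      (forall Y Y' d D, inX m Y -> inX m Y' -> apart d Y Y' -> (forall c, d c <= D) ->
        Rabs (T i Y u v - T i Y' u v) <= (C0 + C1 + C2 + C3) * r * D)).
  { intros Ci ri i HCi Hri K r u v Hr Hs; destruct (K r u v) as [Ka Kb]; [lra|auto|]. split.
    - intros Y HY; destruct (Ka Y HY) as [h h']; split; auto. rewrite dot_0 in h'.
      assert (Ci * r <= (C0 + C1 + C2 + C3) * r) by (apply Rmult_le_compat_r; lra). lra.
    - intros Y Y' d D g1 g2 g3 g4; assert (h := Kb Y Y' d D g1 g2 g3 g4). rewrite dot_0 in h.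
      replace (T i Y u v - pr i o - (T i Y' u v - pr i o)) with (T i Y u v - T i Y' u v) in h by ring.
      assert (HD : 0 <= D) by (apply Rle_trans with (d cA); auto; apply apart_pos with (1 := g3)).
      assert (Ci * r * D <= (C0 + C1 + C2 + C3) * r * D)
        by (apply Rmult_le_compat_r; auto; apply Rmult_le_compat_r; lra). lra. }
  intros r u v i Hi Hr Hs. destruct i as [|[|[|[|i]]]]; [| | | |lia].
  apply (G C0 a0 0%nat); auto; lra. apply (G C1 a1 1%nat); auto; lra.
  apply (G C2 a2 2%nat); auto; lra. apply (G C3 a3 3%nat); auto; lra. }
destruct HQ as (K & rK & HK & HrK & HQ).
set (r0 := Rmin rK (Rmin rB rC)).
assert (g1 : r0 <= rK) by apply Rmin_l.
assert (g2 : r0 <= rB) by (eapply Rle_trans; [apply Rmin_r|apply Rmin_l]).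
assert (g3 : r0 <= rC) by (eapply Rle_trans; [apply Rmin_r|apply Rmin_r]).
assert (Hr0 : 0 < r0) by (repeat apply Rmin_glb_lt; auto).
assert (LZ : forall Y Y' u v u' v', inX m Y -> inX m Y' -> sq r0 u v -> sq r0 u' v' ->
   Rabs (E (Z Y u v) - E (Z Y' u' v')) <= L * sum4 (fun i => Rabs (T i Y u v - T i Y' u' v'))).
{ intros Y Y' u v u' v' h1 h2 h3 h4.
  apply (Lip (Z Y u v) (Z Y' u' v')); try (apply HCin; auto; eapply sq_le; eauto); apply HBin; auto; eapply sq_le; eauto. }
exists (4 * (L * K)), (r0 / 2). split. assert (0 <= L * K) by (apply Rmult_le_pos; auto). lra.
split; [lra|]. intros r u v Hr Hs.
assert (Hs0 : sq r0 u v) by (apply sq_le with (1 := Hs); lra).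
split.
- intros Y HY; split.
  + intros eps. assert (He : 0 < eps / (4 * (L + 1))) by (apply Rdiv_lt_0_compat; [apply cond_pos|lra]).
    assert (CT : forall i, (i < 4)%nat -> locally_2d (fun u' v' => Rabs (T i Y u' v' - T i Y u v) < eps / (4 * (L + 1))) u v).
    { intros i Hi. destruct (HQ r u v i Hi) as [q _]; [lra|auto|]. destruct (q Y HY) as [q1 _].
      generalize (q1 (mkposreal _ He)); apply locally_2d_impl, locally_2d_forall; simpl.
      intros u' v' h. replace (T i Y u' v' - T i Y u v) with (T i Y u' v' - pr i o - (T i Y u v - pr i o)) by ring. exact h. }
    assert (Near : locally_2d (fun u' v' => sq r0 u' v') u v).
    { assert (Hd : 0 < r0 / 2) by lra. exists (mkposreal _ Hd); simpl; intros u' v' h1 h2.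
      destruct Hs as [s1 s2]. split; [replace u' with (u' - u + u) by ring|replace v' with (v' - v + v) by ring];
      (eapply Rle_trans; [apply Rabs_triang|lra]). }
    generalize (locally_2d_and _ _ _ _ Near (locally_2d_and _ _ _ _ (locally_2d_and _ _ _ _ (CT 0%nat ltac:(lia)) (CT 1%nat ltac:(lia)))
       (locally_2d_and _ _ _ _ (CT 2%nat ltac:(lia)) (CT 3%nat ltac:(lia))))).
    apply locally_2d_impl, locally_2d_forall; intros u' v' [h [[h0 h1] [h2 h3]]].
    change (Rabs (E (Z Y u' v') - E o - (E (Z Y u v) - E o)) < eps).
    replace (E (Z Y u' v') - E o - (E (Z Y u v) - E o)) with (E (Z Y u' v') - E (Z Y u v)) by ring.
    eapply Rle_lt_trans. apply LZ; auto. unfold sum4.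
    apply Rle_lt_trans with (L * (4 * (eps / (4 * (L + 1))))).
    * apply Rmult_le_compat_l; auto; lra.
    * replace (L * (4 * (eps / (4 * (L + 1))))) with (eps * (L / (L + 1))) by (field; lra).
      rewrite <- (Rmult_1_r eps) at 2. apply Rmult_lt_compat_l. apply cond_pos.
      apply Rmult_lt_reg_r with (L + 1). lra. field_simplify; lra.
  + rewrite dot_0. eapply Rle_trans. apply (Lip (Z Y u v) o);
      [apply HCin; auto; eapply sq_le; eauto|auto|apply HBin; auto; eapply sq_le; eauto|apply ball_center].
    assert (q : forall i, (i < 4)%nat -> Rabs (T i Y u v - pr i o) <= K * r).
    { intros i Hi; destruct (HQ r u v i Hi) as [q _]; [lra|auto|]. destruct (q Y HY); auto. }
    assert (q0 := q 0%nat ltac:(lia)). assert (q1 := q 1%nat ltac:(lia)).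
    assert (q2 := q 2%nat ltac:(lia)). assert (q3 := q 3%nat ltac:(lia)).
    unfold sum4; simpl in *. replace (0 + 0 + 4 * (L * K) * r) with (L * (4 * (K * r))) by ring.
    apply Rmult_le_compat_l; auto. lra.
- intros Y Y' d D h1 h2 h3 h4. rewrite dot_0.
  change (Rabs (E (Z Y u v) - E o - (E (Z Y' u v) - E o)) <= 0 + 4 * (L * K) * r * D).
  replace (E (Z Y u v) - E o - (E (Z Y' u v) - E o)) with (E (Z Y u v) - E (Z Y' u v)) by ring.
  eapply Rle_trans. apply LZ; auto.
  assert (q : forall i, (i < 4)%nat -> Rabs (T i Y u v - T i Y' u v) <= K * r * D).
  { intros i Hi; destruct (HQ r u v i Hi) as [_ q]; [lra|auto|]. eauto. }
  assert (q0 := q 0%nat ltac:(lia)). assert (q1 := q 1%nat ltac:(lia)).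
  assert (q2 := q 2%nat ltac:(lia)). assert (q3 := q 3%nat ltac:(lia)).
  unfold sum4. replace (0 + 4 * (L * K) * r * D) with (L * (4 * (K * r * D))) by ring.
  apply Rmult_le_compat_l; auto. lra.
Qed.

(** Freezing the arguments outside [[-d, d]] lets the iteration act on functions on the whole plane,
    while its estimates concern only the square of radius [d]. *)
Definition clamp (d u : R) : R := Rmax (- d) (Rmin d u).

Lemma clamp_abs d u : 0 <= d -> Rabs (clamp d u) <= d.
Proof.
intros Hd; apply Rabs_le; unfold clamp; split. apply Rmax_l.
apply Rmax_lub; [lra|apply Rmin_l].
Qed.

Lemma clamp_id d u : Rabs u <= d -> clamp d u = u.
Proof.
intros H; apply Rabs_le_between in H; unfold clamp.
rewrite Rmin_right by lra. apply Rmax_right; lra.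
Qed.

Lemma continuity_Rmax c x : continuity_pt (Rmax c) x.
Proof.
intros e He; exists e; split; auto. intros y [_ Hy]; simpl in *; unfold Rdist in *.
eapply Rle_lt_trans with (2 := Hy). unfold Rmax; destruct (Rle_dec c y), (Rle_dec c x);
unfold Rabs; repeat destruct Rcase_abs; lra.
Qed.

Lemma continuity_Rmin c x : continuity_pt (Rmin c) x.
Proof.
intros e He; exists e; split; auto. intros y [_ Hy]; simpl in *; unfold Rdist in *.
eapply Rle_lt_trans with (2 := Hy). unfold Rmin; destruct (Rle_dec c y), (Rle_dec c x);
unfold Rabs; repeat destruct Rcase_abs; lra.
Qed.

Lemma continuity_clamp d x : continuity_pt (clamp d) x.
Proof. apply (continuity_pt_comp (Rmin d) (Rmax (- d))); [apply continuity_Rmin|apply continuity_Rmax]. Qed.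

Lemma forall_cmp (P : cmp -> R -> Prop) :
  (forall c, exists r0, 0 < r0 /\ forall r, 0 < r <= r0 -> P c r) ->
  exists r0, 0 < r0 /\ forall r, 0 < r <= r0 -> forall c, P c r.
Proof.
intros H.
assert (K : forall l : list cmp, exists r0, 0 < r0 /\ forall r, 0 < r <= r0 -> forall c, List.In c l -> P c r).
{ induction l as [|c l [r1 [Hr1 IH]]].
  - exists 1; split; [lra|]; intros r _ c [].
  - destruct (H c) as [r2 [Hr2 H2]]; exists (Rmin r1 r2); split. apply Rmin_glb_lt; auto.
    assert (h1 := Rmin_l r1 r2). assert (h2 := Rmin_r r1 r2).
    intros r Hr c' [<-|Hc]; [apply H2|apply IH]; auto; lra. }
destruct (K (cA :: cB :: cp :: cq :: cR :: cU :: cV :: nil)%list) as [r0 [Hr0 K0]].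
exists r0; split; auto; intros r Hr c; apply K0; auto; destruct c; simpl; tauto.
Qed.

(** * The fixed point *)

Section FixedPoint.
Variables (N : unk -> unk) (kap : cmp -> R) (l : cmp -> cmp -> R) (w : cmp -> R) (th : R).
Hypotheses (HN : forall c, QE (kap c) (l c) (fun Y => N Y c))
  (Hw : forall c, 0 < w c) (Hth : 0 <= th < 1) (Hl : forall c, dot (l c) w <= th * w c).

Definition step (d : R) (Y : unk) : unk := fun c u v => N Y c (clamp d u) (clamp d v).

Let gap := (1 - th) / 2.
Let th' := (1 + th) / 2.
Let sum (f : cmp -> R) := f cA + f cB + f cp + f cq + f cR + f cU + f cV.
Let M := 1 + sum (fun c => Rabs (kap c) / (w c * gap)).
Let W := 1 + sum w.
Let m c := w c * M.

(** The slack [1 - th] is split into two halves [gap]. For invariance one half absorbs the constants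
    [kap], by the choice of [M], and the other the errors of order [r], by the choice of the radius.
    For differences only the errors remain, and the rate is [th' = th + gap]. *)
Lemma contraction : exists r0, 0 < r0 /\ forall d, 0 < d <= r0 ->
  (forall Y, inX m Y -> inX m (step d Y)) /\
  (forall Y Y' D, inX m Y -> inX m Y' -> apart (fun c => w c * D) Y Y' ->
     apart (fun c => w c * (th' * D)) (step d Y) (step d Y')).
Proof.
assert (Hgap : 0 < gap) by (unfold gap; lra).
assert (Hs : forall f c, (forall c, 0 <= f c) -> f c <= sum f).
{ intros f c Hf; assert (h1 := Hf cA); assert (h2 := Hf cB); assert (h3 := Hf cp); assert (h4 := Hf cq);
  assert (h5 := Hf cR); assert (h6 := Hf cU); assert (h7 := Hf cV); unfold sum; destruct c; lra. }
assert (Hk : forall c, 0 <= Rabs (kap c) / (w c * gap)).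
{ intros c; apply Rmult_le_pos. apply Rabs_pos. apply Rlt_le, Rinv_0_lt_compat, Rmult_lt_0_compat; auto. }
assert (HM : 1 <= M) by (unfold M; assert (h := Hs _ cA Hk); assert (h' := Hk cA); lra).
assert (HkM : forall c, kap c <= w c * M * gap).
{ intros c. apply Rle_trans with (1 := Rle_abs _).
  assert (h := Hs _ c Hk). assert (Hwg : 0 < w c * gap) by (apply Rmult_lt_0_compat; auto).
  replace (Rabs (kap c)) with (Rabs (kap c) / (w c * gap) * (w c * gap)) by (field; assert (h1 := Hw c); lra).
  replace (w c * M * gap) with (M * (w c * gap)) by ring. apply Rmult_le_compat_r. lra. unfold M; lra. }
assert (HW : forall c, w c <= W).
{ intros c; assert (h := Hs w c (fun c => Rlt_le _ _ (Hw c))); unfold W; lra. }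
assert (W0 : 0 < W) by (assert (h := HW cA); assert (h' := Hw cA); lra).
destruct (@forall_cmp (fun c d => forall u v, sq d u v ->
  (forall Y, inX m Y -> continuity_2d_pt (N Y c) u v /\ Rabs (N Y c u v) <= m c) /\
  (forall Y Y' D, inX m Y -> inX m Y' -> apart (fun c => w c * D) Y Y' ->
     Rabs (N Y c u v - N Y' c u v) <= w c * (th' * D)))) as (r0 & Hr0 & H).
- intros c; destruct (@HN c m) as (C & r1 & HC & Hr1 & K).
  assert (Hwg : 0 < w c * gap) by (apply Rmult_lt_0_compat; auto).
  set (r2 := w c * gap / ((C + 1) * (W + 1))).
  assert (Hr2 : 0 < r2) by (apply Rdiv_lt_0_compat; auto; apply Rmult_lt_0_compat; lra).
  assert (C2 : forall r, 0 < r <= r2 -> C * r * (W + 1) <= w c * gap).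
  { intros r Hr. apply Rle_trans with ((C + 1) * r2 * (W + 1)).
    apply Rmult_le_compat_r. lra. apply Rmult_le_compat; lra.
    unfold r2. right; field; lra. }
  exists (Rmin r1 r2); split. apply Rmin_glb_lt; auto.
  assert (h1 := Rmin_l r1 r2). assert (h2 := Rmin_r r1 r2).
  intros r Hr u v Hsq. destruct (K r u v) as [K1 K2]; [lra|auto|].
  assert (C3 := C2 r ltac:(lra)). assert (Cr : 0 <= C * r) by (apply Rmult_le_pos; lra).
  assert (CW : C * r <= w c * gap /\ C * r * W <= w c * gap).
  { assert (0 <= C * r * W) by (apply Rmult_le_pos; lra). lra. }
  split.
  + intros Y HY; destruct (K1 Y HY) as [K3 K4]; split; auto.
    apply Rle_trans with (1 := K4).
    assert (E : dot (l c) m = dot (l c) w * M) by (unfold dot, m; ring). rewrite E.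
    assert (dot (l c) w * M <= th * w c * M) by (apply Rmult_le_compat_r; auto; lra).
    assert (w c * gap <= w c * gap * M) by (rewrite <- (Rmult_1_r (w c * gap)) at 1; apply Rmult_le_compat_l; lra).
    assert (h := HkM c). unfold m. replace (w c * M) with (th * w c * M + w c * M * gap + w c * gap * M) by (unfold gap; field). lra.
  + intros Y Y' D a1 a2 a3.
    assert (HD : 0 <= D).
    { assert (h := apart_pos cA a3). assert (h' := Hw cA). apply Rmult_le_reg_l with (w cA); lra. }
    apply Rle_trans with (1 := K2 Y Y' _ (W * D) a1 a2 a3 (fun c => Rmult_le_compat_r _ _ _ HD (HW c))).
    assert (E : dot (l c) (fun c => w c * D) = dot (l c) w * D) by (unfold dot; ring). rewrite E.
    assert (dot (l c) w * D <= th * w c * D) by (apply Rmult_le_compat_r; auto; lra).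
    replace (w c * (th' * D)) with (th * w c * D + w c * gap * D) by (unfold th', gap; field).
    assert (C * r * W * D <= w c * gap * D) by (apply Rmult_le_compat_r; lra). lra.
- exists r0; split; auto; intros d Hd; specialize (H d Hd).
  assert (Hc : forall u v, sq d (clamp d u) (clamp d v)) by (intros; split; apply clamp_abs; lra).
  split.
  + intros Y HY c u v; destruct (H c _ _ (Hc u v)) as [h _]; destruct (h Y HY) as [h1 h2]; split; auto.
    unfold step. apply (continuity_2d_comp (f := N Y c) (phi := fun u _ => clamp d u) (psi := fun _ v => clamp d v)); auto.
    apply continuity_2d_of_1d, continuity_clamp.
    apply (continuity_2d_swap (f := fun u _ => clamp d u)), continuity_2d_of_1d, continuity_clamp.
  + intros Y Y' D a1 a2 a3 c u v; destruct (H c _ _ (Hc u v)) as [_ h]; apply h; auto.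
Qed.

Variable Pr : R -> unk -> Prop.
Hypotheses (Pr0 : forall d, Pr d (fun _ _ _ => 0))
  (PrN : forall m, exists r0, 0 < r0 /\ forall d Y, 0 < d <= r0 -> inX m Y -> Pr d Y -> Pr d (step d Y))
  (Prlim : forall d (Yn : nat -> unk) (Y : unk), 0 < d -> (forall n c u v, continuity_2d_pt (Yn n c) u v) ->
     (forall c u v, continuity_2d_pt (Y c) u v) -> (forall n, Pr d (Yn n)) ->
     (forall e, 0 < e -> exists n, forall c u v, Rabs (Yn n c u v - Y c u v) <= e) -> Pr d Y).

(** The bound [m] is fixed before [r1], so that smallness conditions depending on [m] can still be
    imposed on [d]. The iteration starts from zero; [Pr] is preserved by each step and closed under
    uniform limits, so the fixed point inherits it. *)
Lemma fixed_point : exists m, forall r1, 0 < r1 -> exists d Y, 0 < d <= r1 /\ inX m Y /\ Pr d Y /\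
  forall c u v, Y c u v = step d Y c u v.
Proof.
exists m; intros r1 Hr1.
destruct contraction as (r0 & Hr0 & HC). destruct (PrN m) as (r2 & Hr2 & HP).
set (d := Rmin r1 (Rmin r0 r2)).
assert (d1 : d <= r1) by apply Rmin_l.
assert (d2 : d <= r0) by (eapply Rle_trans; [apply Rmin_r|apply Rmin_l]).
assert (d3 : d <= r2) by (eapply Rle_trans; [apply Rmin_r|apply Rmin_r]).
assert (Hd : 0 < d) by (repeat apply Rmin_glb_lt; auto).
destruct (HC d) as [C1 C2]; [lra|].
set (Yn := fix Yn (n : nat) : unk := match n with O => (fun _ _ _ => 0) | S n => step d (Yn n) end).
assert (HM : 0 <= M).
{ unfold M, sum. assert (H : forall c, 0 <= Rabs (kap c) / (w c * gap)).
  { intros c; apply Rmult_le_pos. apply Rabs_pos.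
    apply Rlt_le, Rinv_0_lt_compat, Rmult_lt_0_compat; auto. unfold gap; lra. }
  assert (h1 := H cA); assert (h2 := H cB); assert (h3 := H cp); assert (h4 := H cq);
  assert (h5 := H cR); assert (h6 := H cU); assert (h7 := H cV). lra. }
assert (Hm : forall c, 0 <= m c) by (intros; apply Rmult_le_pos; auto; apply Rlt_le, Hw).
assert (Xn : forall n, inX m (Yn n)).
{ induction n as [|n IH]; simpl; auto. intros c u v; split; [rewrite Rabs_R0; auto | apply continuity_2d_pt_const]. }
assert (Pn : forall n, Pr d (Yn n)).
{ induction n as [|n IH]; simpl; [apply Pr0|apply HP; auto; lra]. }
assert (Hth' : 0 <= th' < 1) by (unfold th'; lra).
assert (St : forall n, apart (fun c => w c * (th' ^ n * M)) (Yn n) (Yn (S n))).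
{ induction n as [|n IH].
  - intros c u v. simpl. rewrite Rminus_0_l, Rabs_Ropp. destruct (Xn 1%nat c u v) as [h _].
    unfold m in h. simpl in h. lra.
  - replace (fun c => w c * (th' ^ S n * M)) with (fun c => w c * (th' * (th' ^ n * M))).
    apply C2; auto. apply FunctionalExtensionality.functional_extensionality; intros c; simpl; ring. }
(* Tail of the geometric series that bounds all later steps. *)
set (e n := th' ^ n * (M / (1 - th'))).
assert (Far : forall n k c u v, Rabs (Yn n c u v - Yn (n + k)%nat c u v) <= w c * (e n - e (n + k)%nat)).
{ intros n; induction k as [|k IH]; intros c u v.
  - rewrite Nat.add_0_r, !Rminus_diag, Rabs_R0; lra.
  - replace (Yn n c u v - Yn (n + S k)%nat c u v) with
      ((Yn n c u v - Yn (n + k)%nat c u v) + (Yn (n + k)%nat c u v - Yn (S (n + k)) c u v))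
      by (rewrite Nat.add_succ_r; ring).
    eapply Rle_trans. apply Rabs_triang.
    assert (h1 := IH c u v). assert (h2 := St (n + k)%nat c u v).
    replace (e (n + S k)%nat) with (e (n + k)%nat - th' ^ (n + k) * M).
    lra. rewrite Nat.add_succ_r; unfold e; simpl; field; lra. }
assert (e_pos : forall n, 0 <= e n).
{ intros n; apply Rmult_le_pos. apply pow_le; lra. apply Rmult_le_pos; auto. apply Rlt_le, Rinv_0_lt_compat; lra. }
assert (e_lim : forall x, 0 < x -> exists n, forall k, (n <= k)%nat -> e k <= x).
{ intros x Hx. set (B := M / (1 - th')).
  assert (HB : 0 <= B) by (apply Rmult_le_pos; auto; apply Rlt_le, Rinv_0_lt_compat; lra).
  destruct (pow_lt_1_zero th') with (y := x / (B + 1)) as [n Hn].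
  rewrite Rabs_pos_eq; lra. apply Rdiv_lt_0_compat; lra.
  exists n; intros k Hk. assert (h := Hn k Hk). rewrite Rabs_pos_eq in h by (apply pow_le; lra).
  unfold e; fold B. apply Rle_trans with (x / (B + 1) * B). apply Rmult_le_compat_r; lra.
  apply Rmult_le_reg_r with (B + 1). lra. field_simplify; nra. }
assert (Cau : forall c u v, ex_finite_lim_seq (fun n => Yn n c u v)).
{ intros c u v; apply ex_lim_seq_cauchy_corr; intros x.
  assert (Hx : 0 < x / (2 * w c)) by (apply Rdiv_lt_0_compat; [apply cond_pos|assert (h := Hw c); lra]).
  destruct (e_lim _ Hx) as [n Hn]; exists n.
  assert (K : forall i k, (n <= i)%nat -> (i <= k)%nat -> Rabs (Yn i c u v - Yn k c u v) < x).
  { intros i k Hi Hk. replace k with (i + (k - i))%nat by lia.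
    eapply Rle_lt_trans. apply Far. assert (h := Hn i Hi). assert (h' := e_pos (i + (k - i))%nat).
    assert (Hwc := Hw c). assert (Px := cond_pos x).
    apply Rle_lt_trans with (w c * (x / (2 * w c))). apply Rmult_le_compat_l; lra.
    replace (w c * (x / (2 * w c))) with (x / 2) by (field; lra). lra. }
  intros i k Hi Hk. destruct (Nat.le_ge_cases i k). apply K; auto.
  rewrite Rabs_minus_sym; apply K; auto. }
set (Y := (fun c u v => real (Lim_seq (fun n => Yn n c u v))) : unk).
assert (Lim : forall n c u v, Rabs (Yn n c u v - Y c u v) <= w c * e n).
{ intros n c u v. destruct (Cau c u v) as [y Hy].
  assert (Ey : Y c u v = y) by (unfold Y; rewrite (is_lim_seq_unique _ _ Hy); reflexivity). rewrite Ey.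
  assert (L : is_lim_seq (fun k => Rabs (Yn n c u v - Yn (n + k)%nat c u v)) (Rabs (Yn n c u v - y))).
  { apply (is_lim_seq_abs _ (Finite (Yn n c u v - y))). apply is_lim_seq_minus'. apply is_lim_seq_const.
    apply is_lim_seq_ext with (fun k => Yn (k + n)%nat c u v). intros; f_equal; lia.
    apply (is_lim_seq_incr_n (fun k => Yn k c u v) n); auto. }
  apply (is_lim_seq_le _ (fun _ => w c * e n) (Finite _) (Finite _)) with (2 := L) (3 := is_lim_seq_const _).
  intros k. eapply Rle_trans. apply Far. apply Rmult_le_compat_l. apply Rlt_le, Hw.
  assert (h := e_pos (n + k)%nat); lra. }
assert (UC : forall x, 0 < x -> exists n, forall c u v, Rabs (Yn n c u v - Y c u v) <= x).
{ intros x Hx. set (S := 1 + sum w).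
  assert (Hws : forall c, w c <= S).
  { intros c. assert (h1 := Hw cA); assert (h2 := Hw cB); assert (h3 := Hw cp); assert (h4 := Hw cq);
    assert (h5 := Hw cR); assert (h6 := Hw cU); assert (h7 := Hw cV). unfold S, sum; destruct c; lra. }
  assert (HS : 0 < S) by (apply Rlt_le_trans with (w cA); auto).
  destruct (e_lim (x / S)) as [n Hn]. apply Rdiv_lt_0_compat; auto.
  exists n; intros c u v. eapply Rle_trans. apply Lim. assert (h := Hn n (Nat.le_refl n)).
  apply Rle_trans with (S * (x / S)). apply Rmult_le_compat; auto. apply Rlt_le, Hw.
  right; field; lra. }
assert (CY : forall c u v, continuity_2d_pt (Y c) u v).
{ intros c u v x. assert (Hx : 0 < x / 4) by (assert (h := cond_pos x); lra).
  destruct (UC _ Hx) as [n Hn]. destruct (Xn n c u v) as [_ h].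
  generalize (h (mkposreal _ Hx)); apply locally_2d_impl, locally_2d_forall; simpl.
  intros u' v' h'. assert (h1 := Hn c u' v'). assert (h2 := Hn c u v).
  replace (Y c u' v' - Y c u v) with ((Yn n c u' v' - Yn n c u v) + ((Yn n c u v - Y c u v) - (Yn n c u' v' - Y c u' v'))) by ring.
  eapply Rle_lt_trans. apply Rabs_triang. eapply Rle_lt_trans. apply Rplus_le_compat_l, Rabs_triang.
  rewrite Rabs_Ropp. assert (h3 := cond_pos x). lra. }
assert (XY : inX m Y).
{ intros c u v; split; auto. apply le_epsilon; intros x Hx. destruct (UC _ Hx) as [n Hn].
  destruct (Xn n c u v) as [h _]. assert (h' := Hn c u v).
  replace (Y c u v) with (Yn n c u v - (Yn n c u v - Y c u v)) by ring.
  eapply Rle_trans. apply Rabs_triang. rewrite Rabs_Ropp. lra. }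
exists d, Y; split; [lra|]; split; auto; split.
- apply (Prlim (Yn := Yn)); auto. intros n c u v; apply (Xn n c u v).
- intros c u v. apply cond_eq; intros x Hx.
  assert (Hx2 : 0 < x / 3 / w c) by (apply Rdiv_lt_0_compat; auto; lra).
  destruct (e_lim _ Hx2) as [n Hn].
  assert (h1 := Lim (S n) c u v). assert (A : apart (fun c => w c * e n) (Yn n) Y) by (intros c' u' v'; apply Lim).
  assert (h2 := C2 _ _ _ (Xn n) XY A c u v).
  change (step d (Yn n) c u v) with (Yn (S n) c u v) in h2.
  assert (Q1 := Hn n (Nat.le_refl n)). assert (Q2 := Hn (S n) (Nat.le_succ_diag_r n)).
  assert (Hwc := Hw c).
  assert (B : w c * (x / 3 / w c) = x / 3) by (field; lra).
  assert (w c * e (S n) <= x / 3) by (rewrite <- B; apply Rmult_le_compat_l; lra).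
  assert (w c * e n <= x / 3) by (rewrite <- B; apply Rmult_le_compat_l; lra).
  assert (w c * (th' * e n) <= w c * e n).
  { apply Rmult_le_compat_l. lra. assert (h := e_pos n). nra. }
  replace (Y c u v - step d Y c u v) with ((Yn (S n) c u v - step d Y c u v) - (Yn (S n) c u v - Y c u v)) by ring.
  eapply Rle_lt_trans. apply Rabs_triang. rewrite Rabs_Ropp. lra.
Qed.

End FixedPoint.

(** * Differentiation along curves and under the integral sign *)

Lemma derive_eq (f : R -> R) (x l l' : R) : is_derive f x l -> l = l' -> is_derive f x l'.
Proof. intros H <-; auto. Qed.

Lemma derive_plus (f g : R -> R) (x lf lg : R) :
  is_derive f x lf -> is_derive g x lg -> is_derive (fun x => f x + g x) x (lf + lg).
Proof. apply (is_derive_plus f g). Qed.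

Lemma derive_minus (f g : R -> R) (x lf lg : R) :
  is_derive f x lf -> is_derive g x lg -> is_derive (fun x => f x - g x) x (lf - lg).
Proof. apply (is_derive_minus f g). Qed.

Lemma derive_const (c x : R) : is_derive (fun _ => c) x 0.
Proof. apply (@is_derive_const R_AbsRing R_NormedModule c x). Qed.

Lemma derive_mult (f g : R -> R) (x lf lg : R) :
  is_derive f x lf -> is_derive g x lg -> is_derive (fun x => f x * g x) x (lf * g x + f x * lg).
Proof. intros; apply (is_derive_mult f g); auto. exact Rmult_comm. Qed.

Lemma derive_scal_id (c x : R) : is_derive (fun s => c * s) x c.
Proof. auto_derive; auto; ring. Qed.

Lemma derive_comp_scal (f : R -> R) (c x l : R) : is_derive f (c * x) l -> is_derive (fun s => f (c * s)) x (c * l).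
Proof. intros H; apply (is_derive_comp f (fun s => c * s)); auto. apply derive_scal_id. Qed.

Lemma derive_const_plus (f : R -> R) (c x l : R) : is_derive f x l -> is_derive (fun s => c + f s) x l.
Proof. intros H; apply derive_eq with (0 + l). apply derive_plus; auto using derive_const. ring. Qed.

Lemma derive_RInt (f : R -> R) a x d : Rabs a < d -> Rabs x < d ->
  (forall y, Rabs y < d -> continuous f y) -> is_derive (fun b => RInt f a b) x (f x).
Proof.
intros Ha Hx H; apply (is_derive_RInt f (fun b => RInt f a b) a x); auto.
assert (He : 0 < d - Rabs x) by lra.
exists (mkposreal _ He); intros y Hy; change (Rabs (y - x) < d - Rabs x) in Hy.
apply (RInt_correct f), (@ex_RInt_continuous R_CompleteNormedModule); intros z Hz.
assert (Hyd : Rabs y < d).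
{ replace y with (y - x + x) by ring; eapply Rle_lt_trans; [apply Rabs_triang|lra]. }
apply H. apply Rle_lt_trans with (Rmax (Rabs a) (Rabs y)); [|apply Rmax_lub_lt; auto].
apply (between_abs (Rmax_l _ _) (Rmax_r _ _) Hz).
Qed.

Lemma locally_abs_lt (f : R -> R) x c r : continuous f x -> Rabs (f x - c) < r ->
  locally x (fun y => Rabs (f y - c) < r).
Proof.
intros H Hr. assert (He : 0 < r - Rabs (f x - c)) by lra.
apply (filter_imp (F := locally x) (fun y => ball (f x) (mkposreal _ He) (f y))); [intros y Hy|
  exact (H _ (locally_ball (f x) (mkposreal _ He)))].
change (Rabs (f y - f x) < r - Rabs (f x - c)) in Hy.
replace (f y - c) with (f y - f x + (f x - c)) by ring. eapply Rle_lt_trans. apply Rabs_triang. lra.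
Qed.

Lemma locally_abs (x d : R) : Rabs x < d -> locally x (fun y => Rabs y < d).
Proof.
intros H. generalize (@locally_abs_lt (fun y => y) x 0 d (continuous_id x)).
rewrite Rminus_0_r; intros K; generalize (K H); apply filter_imp; intros y; rewrite Rminus_0_r; auto.
Qed.

Lemma derive_continuous (f : R -> R) x l : is_derive f x l -> continuous f x.
Proof. intros H; apply (ex_derive_continuous f x); exists l; auto. Qed.

(** Boundary quantities are differentiable only at positive parameters, since for negative ones the
    curve may leave the cone. Composition with [Rmax 0] supplies the two-sided continuity at zero
    that the mean value theorem asks for. *)
Lemma zero_of_derive (h : R -> R) d :
  (forall u, Rabs u < d -> continuity_2d_pt (fun u _ => h (Rmax 0 u)) u 0) ->
  (forall s, 0 < s < d -> is_derive h s 0) -> forall s, 0 <= s < d -> h s = h 0.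
Proof.
intros Hc Hd s Hs.
destruct (MVT_gen (fun u => h (Rmax 0 u)) 0 s (fun _ => 0)) as [c [_ E]].
- rewrite Rmin_left, Rmax_right by lra; intros x Hx.
  apply is_derive_ext_loc with h; [|apply Hd; lra].
  generalize (locally_pos (proj1 Hx)); apply filter_imp; intros y Hy. rewrite Rmax_right; auto; lra.
- rewrite Rmin_left, Rmax_right by lra; intros x Hx. apply continuity_pt_filterlim.
  apply (continuity_2d_line (f := fun u _ => h (Rmax 0 u)) (y := 0)), Hc. rewrite Rabs_pos_eq; lra.
- rewrite (Rmax_right 0 s), (Rmax_right 0 0) in E by lra. lra.
Qed.

(** One partial derivative is continuous, the other exists at the point. This asymmetric chain rule
    fits [t_u] and [t_v], whose mixed derivative is a continuous component of the unknown. *)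
Lemma total_derive (F F1 : R -> R -> R) (g h : R -> R) (s g' h' l d : R) :
  Rabs (g s) < d -> Rabs (h s) < d ->
  (forall u v, Rabs u < d -> Rabs v < d -> is_derive (fun u => F u v) u (F1 u v)) ->
  continuity_2d_pt F1 (g s) (h s) -> is_derive (fun v => F (g s) v) (h s) l ->
  is_derive g s g' -> is_derive h s h' -> is_derive (fun s => F (g s) (h s)) s (g' * F1 (g s) (h s) + h' * l).
Proof.
intros Hg Hh H1 Hc H2 Dg Dh.
assert (K : filterdiff (fun u : R * R => F (fst u) (snd u)) (locally (g s, h s))
   (fun u => plus (scal (fst u) (F1 (g s) (h s))) (scal (snd u) l))).
{ apply is_derive_filterdiff; auto.
  - assert (Hl : locally (g s, h s) (fun u : R * R => Rabs (fst u) < d /\ Rabs (snd u) < d)).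
    { destruct (locally_abs Hg) as [e1 E1], (locally_abs Hh) as [e2 E2].
      assert (He : 0 < Rmin e1 e2) by (apply Rmin_glb_lt; apply cond_pos).
      exists (mkposreal _ He); intros [x y] [B1 B2]; simpl in *; split; [apply E1|apply E2];
      eapply Rlt_le_trans; try apply B1; try apply B2; [apply Rmin_l|apply Rmin_r]. }
    revert Hl; apply filter_imp; intros [x y] [h1 h2]; apply H1; auto.
  - apply (proj1 (continuity_2d_pt_filterlim F1 (g s) (h s))), Hc. }
assert (K2 := filterdiff_comp'_2 (K := R_AbsRing) (T := R_NormedModule) (U := R_NormedModule) (V := R_NormedModule)
   (W := R_NormedModule) g h F s _ _ (fun x y => x * F1 (g s) (h s) + y * l) Dg Dh K).
apply (filterdiff_ext_lin _ _ _ K2); intros y.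
unfold scal; simpl; unfold mult; simpl; ring.
Qed.

Definition cont_on (d : R) (F : R -> R -> R) : Prop :=
  forall u v, Rabs u < d -> Rabs v < d -> continuity_2d_pt F u v.

Lemma locally_2d_abs x y d : Rabs x < d -> Rabs y < d -> locally_2d (fun u v => Rabs u < d /\ Rabs v < d) x y.
Proof.
intros Hg Hh; destruct (locally_abs Hg) as [e1 E1], (locally_abs Hh) as [e2 E2].
assert (He : 0 < Rmin e1 e2) by (apply Rmin_glb_lt; apply cond_pos).
exists (mkposreal _ He); intros u v B1 B2; simpl in *; split; [apply E1|apply E2];
eapply Rlt_le_trans; try apply B1; try apply B2; [apply Rmin_l|apply Rmin_r].
Qed.

(** Leibniz rule with a moving lower limit: [k = 1] serves integrals that start on the left shock,
    [k = a] those that start on the right one. *)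
Lemma derive_RInt_param (F F1 : R -> R -> R) k x b d : Rabs k <= 1 -> Rabs x < d -> Rabs b < d ->
  cont_on d F -> cont_on d F1 ->
  (forall u v, Rabs u < d -> Rabs v < d -> is_derive (fun u => F u v) u (F1 u v)) ->
  is_derive (fun u => RInt (fun s => F u s) (k * u) b) x (RInt (fun s => F1 x s) (k * x) b - k * F x (k * x)).
Proof.
intros Hk Hx Hb CF CF1 HF.
assert (Hkx : Rabs (k * x) < d).
{ rewrite Rabs_mult. assert (P := Rabs_pos x). nra. }
set (e := (d - Rmax (Rabs (k * x)) (Rabs b)) / 2).
assert (M1 := Rmax_l (Rabs (k * x)) (Rabs b)). assert (M2 := Rmax_r (Rabs (k * x)) (Rabs b)).
assert (M3 : Rmax (Rabs (k * x)) (Rabs b) < d) by (apply Rmax_lub_lt; auto).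
assert (He : 0 < e) by (unfold e; lra).
assert (Hin : forall t, Rmin (k * x - e) b <= t <= Rmax (k * x + e) b -> Rabs t < d).
{ intros t Ht. apply Rle_lt_trans with (d - e); [|lra].
  assert (B1 : Rabs (k * x) <= d - 2 * e) by (unfold e; lra).
  assert (B2 : Rabs b <= d - 2 * e) by (unfold e; lra).
  apply Rabs_le_between in B1; apply Rabs_le_between in B2. apply Rabs_le.
  unfold Rmin, Rmax in Ht; destruct Rle_dec, Rle_dec; lra. }
assert (Lx := locally_abs Hx).
assert (CD : forall t, Rabs t < d -> forall x, Rabs x < d -> continuity_2d_pt (fun u v => Derive (fun z => F z v) u) x t).
{ intros t Ht y Hy; apply continuity_2d_pt_ext_loc with F1; auto.
  generalize (locally_2d_abs Hy Ht); apply locally_2d_impl, locally_2d_forall; intros u v [h1 h2].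
  symmetry; apply is_derive_unique; auto. }
assert (X : forall y p q, Rabs y < d -> (forall t, Rmin p q <= t <= Rmax p q -> Rabs t < d) -> ex_RInt (fun t => F y t) p q).
{ intros y p q Hy H; apply (@ex_RInt_continuous R_CompleteNormedModule); intros t Ht.
  apply (continuity_2d_line (f := fun t y => F y t) (y := y)), continuity_2d_swap, CF; auto. }
apply derive_eq with (RInt (fun t => Derive (fun u => F u t) x) (k * x) b + - F x (k * x) * k).
- apply (is_derive_RInt_param_bound_comp_aux2 F (fun u => k * u)).
  + revert Lx; apply filter_imp; intros y Hy; apply X; auto.
    intros t Ht; apply Hin. unfold Rmin, Rmax in *; repeat destruct Rle_dec; lra.
  + exists (mkposreal _ He). revert Lx; apply filter_imp; intros y Hy; apply X; auto; simpl.
    intros t Ht; apply Hin. unfold Rmin, Rmax in *; repeat destruct Rle_dec; lra.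
  + apply derive_scal_id.
  + exists (mkposreal _ He). revert Lx; apply filter_imp; intros y Hy t Ht; simpl in Ht.
    exists (F1 y t); apply HF; auto.
  + intros t Ht; apply CD; auto. apply Hin. unfold Rmin, Rmax in *; repeat destruct Rle_dec; lra.
  + generalize (locally_2d_abs Hx Hkx); apply locally_2d_impl, locally_2d_forall; intros u v [h1 h2]; auto.
  + apply continuity_pt_filterlim.
    apply (continuity_2d_line (f := fun t y => F y t) (y := x)), continuity_2d_swap, CF; auto.
- replace (RInt (fun t => Derive (fun u => F u t) x) (k * x) b) with (RInt (fun s => F1 x s) (k * x) b). ring.
  apply RInt_ext; intros t Ht; symmetry; apply is_derive_unique, HF; auto.
  apply Hin. unfold Rmin, Rmax in *; repeat destruct Rle_dec; lra.
Qed.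

(** The function with partial derivatives [phi] and [psi], integrated along the
    diagonal and then along the second coordinate. *)
Definition potential (phi psi : R -> R -> R) u v : R :=
  RInt (fun s => phi s s + psi s s) 0 u + RInt (fun s => psi u s) u v.

Lemma RInt_derive_open (F F' : R -> R) d x y : Rabs x < d -> Rabs y < d ->
  (forall u, Rabs u < d -> is_derive F u (F' u)) -> (forall u, Rabs u < d -> continuous F' u) ->
  RInt F' x y = F y - F x.
Proof.
intros Hx Hy H1 H2. apply is_RInt_unique.
assert (K : forall t, Rmin x y <= t <= Rmax x y -> Rabs t < d).
{ intros t Ht; apply Rle_lt_trans with (Rmax (Rabs x) (Rabs y)); [|apply Rmax_lub_lt; auto].
  apply (between_abs (Rmax_l _ _) (Rmax_r _ _) Ht). }
apply (is_RInt_derive F F'); intros t Ht; [apply H1|apply H2]; auto.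
Qed.

(** The common function [rho] expresses that the form [phi du + psi dv] is closed. In the
    [u]-derivative the terms [psi u u] cancel, and the integral of [rho] yields
    [phi u v - phi u u]. *)
Lemma potential_derive phi psi rho d u v : Rabs u < d -> Rabs v < d ->
  cont_on d phi -> cont_on d psi -> cont_on d rho ->
  (forall u v, Rabs u < d -> Rabs v < d -> is_derive (fun v => phi u v) v (rho u v)) ->
  (forall u v, Rabs u < d -> Rabs v < d -> is_derive (fun u => psi u v) u (rho u v)) ->
  is_derive (fun u => potential phi psi u v) u (phi u v) /\
  is_derive (fun v => potential phi psi u v) v (psi u v).
Proof.
intros Hu Hv C1 C2 C3 D1 D2.
assert (H0 : Rabs 0 < d) by (rewrite Rabs_R0; assert (P := Rabs_pos u); lra).
assert (Cl : forall F, cont_on d F -> forall y s, Rabs y < d -> Rabs s < d -> continuous (fun s => F y s) s).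
{ intros F CF y s Hy Hs; apply (continuity_2d_line (f := fun t y => F y t) (y := y)), continuity_2d_swap, CF; auto. }
assert (Cd : forall F, cont_on d F -> forall y, Rabs y < d -> continuous (fun s => F s s) y).
{ intros F CF y Hy; apply (continuity_2d_line (f := fun s _ => F s s) (y := 0)).
  apply (continuity_2d_comp (f := F) (phi := fun s _ => s) (psi := fun s _ => s)).
  apply CF; auto. apply continuity_2d_pt_id1. apply continuity_2d_pt_id1. }
split.
- apply derive_eq with ((phi u u + psi u u) + (RInt (fun s => rho u s) (1 * u) v - 1 * psi u (1 * u))).
  + apply derive_plus.
    * apply (@derive_RInt (fun s => phi s s + psi s s) 0 u d); auto. intros y Hy.
      apply (continuous_plus (fun s => phi s s) (fun s => psi s s)); auto.
    * apply is_derive_ext with (fun u => RInt (fun s => psi u s) (1 * u) v).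
      intros; rewrite Rmult_1_l; reflexivity.
      apply derive_RInt_param with d; auto. rewrite Rabs_R1; lra.
  + rewrite !Rmult_1_l. rewrite (@RInt_derive_open (fun s => phi u s) (fun s => rho u s) d); auto. ring.
- apply derive_const_plus. apply (@derive_RInt (fun s => psi u s) u v d); auto.
Qed.

(** There is no entry for [cU] and [cV]: they enter other quantities only under an integral sign,
    hence without gain. *)
Definition lin xA xB xp xq xR (c : cmp) : R :=
  match c with cA => xA | cB => xB | cp => xp | cq => xq | cR => xR | _ => 0 end.

(** The two-cycles [cp <-> cq] and [cA <-> cB] have gains [a] and [a ^ 4]; the
    other dependencies at leading order go from [cR] to [cp, cq] to [cA, cB] to
    [cU, cV], so that they can be made small by the choice of the weights. *)
Lemma weights a kp kq F1 F2 (eA eB eU : R * R * R) eV ep eq :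
  0 < a < 1 -> 0 < kp -> kp * kq = 1 -> F1 * F2 = a * a ->
  exists (w : cmp -> R) th, (forall c, 0 < w c) /\ 0 <= th < 1 /\
    dot (lin 0 (Rabs F1) (fst (fst eA)) (snd (fst eA)) (snd eA)) w <= th * w cA /\
    dot (lin (a * a * Rabs F2) 0 (fst (fst eB)) (snd (fst eB)) (snd eB)) w <= th * w cB /\
    dot (lin 0 0 0 kp ep) w <= th * w cp /\
    dot (lin 0 0 (kq * a) 0 eq) w <= th * w cq /\
    dot (fun _ => 0) w <= th * w cR /\
    dot (lin (fst (fst eU)) 0 (snd (fst eU)) 0 (snd eU)) w <= th * w cU /\
    dot (lin 0 (fst (fst eV)) 0 (snd (fst eV)) (snd eV)) w <= th * w cV.
Proof.
intros Ha Hkp Hk HF.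
destruct eA as [[a1 a2] a3], eB as [[b1 b2] b3], eU as [[u1 u2] u3], eV as [[v1 v2] v3]; simpl.
set (E := 1 + Rabs a1 + Rabs a2 + Rabs a3 + Rabs b1 + Rabs b2 + Rabs b3 + Rabs u1 + Rabs u2 + Rabs u3
  + Rabs v1 + Rabs v2 + Rabs v3 + Rabs ep + Rabs eq).
assert (HE : forall x, List.In x (a1 :: a2 :: a3 :: b1 :: b2 :: b3 :: u1 :: u2 :: u3 :: v1 :: v2 :: v3 :: ep :: eq :: nil)%list ->
  x <= E).
{ intros x Hx; apply Rle_trans with (1 := Rle_abs x); unfold E.
  assert (h := Rabs_pos a1); assert (h1 := Rabs_pos a2); assert (h2 := Rabs_pos a3); assert (h3 := Rabs_pos b1);
  assert (h4 := Rabs_pos b2); assert (h5 := Rabs_pos b3); assert (h6 := Rabs_pos u1); assert (h7 := Rabs_pos u2);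
  assert (h8 := Rabs_pos u3); assert (h9 := Rabs_pos v1); assert (h10 := Rabs_pos v2); assert (h11 := Rabs_pos v3);
  assert (h12 := Rabs_pos ep); assert (h13 := Rabs_pos eq).
  simpl in Hx. repeat (destruct Hx as [<-|Hx]; [lra|]). contradiction. }
simpl in HE.
assert (HE1 : 1 <= E).
{ unfold E. assert (h := Rabs_pos a1); assert (h1 := Rabs_pos a2); assert (h2 := Rabs_pos a3); assert (h3 := Rabs_pos b1);
  assert (h4 := Rabs_pos b2); assert (h5 := Rabs_pos b3); assert (h6 := Rabs_pos u1); assert (h7 := Rabs_pos u2);
  assert (h8 := Rabs_pos u3); assert (h9 := Rabs_pos v1); assert (h10 := Rabs_pos v2); assert (h11 := Rabs_pos v3);
  assert (h12 := Rabs_pos ep); assert (h13 := Rabs_pos eq). lra. }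
clearbody E.
assert (HF1 : 0 < Rabs F1) by (apply Rabs_pos_lt; intros h; rewrite h in HF; nra).
assert (HFF : Rabs F1 * Rabs F2 = a * a) by (rewrite <- Rabs_mult, HF; apply Rabs_pos_eq; nra).
set (f1 := Rabs F1) in *. set (f2 := Rabs F2) in *. clearbody f1 f2.
(* Since [a <= b * b], each of the two arrows of a cycle can be given the ratio [b < 1]. The slack
   [g] absorbs the arrows from outside the cycle, and [b + g] is still less than one. *)
set (b := (1 + a) / 2). assert (Hb : 0 < b < 1) by (unfold b; lra).
assert (Hab : a <= b * b) by (unfold b; nra).
set (g := (1 - b) / 2). assert (Hg : 0 < g) by (unfold g; lra).
set (th := b + g). assert (Hth : th < 1) by (unfold th, g; lra).
assert (Ekq : kq = / kp) by (field_simplify_eq; lra).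
(* The weight of [cR] is one, and that of [cp] is large in comparison: the first term suffices on
   [cp], the second on [cq], whose weight is [b / kp * s1]. *)
set (s1 := E / g + E * kp / (b * g)).
assert (Q1 : 0 < E / g) by (apply Rdiv_lt_0_compat; lra).
assert (Q2 : 0 < E * kp / (b * g)) by (apply Rdiv_lt_0_compat; apply Rmult_lt_0_compat; lra).
assert (Hs1 : E <= g * s1).
{ replace E with (g * (E / g)) at 1 by (field; lra). apply Rmult_le_compat_l; unfold s1; lra. }
assert (Hs2 : E <= g * (b / kp * s1)).
{ replace E with (g * (b / kp * (E * kp / (b * g)))) at 1 by (field; lra).
  repeat apply Rmult_le_compat_l; try (unfold s1; lra). apply Rlt_le, Rdiv_lt_0_compat; lra. }
assert (Hs10 : 0 < s1) by (unfold s1; lra).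
set (wq := b / kp * s1).
assert (Hwq : 0 < wq) by (apply Rmult_lt_0_compat; auto; apply Rdiv_lt_0_compat; lra).
set (S1 := E * (s1 + wq + 1)).
assert (HS1 : 0 < S1) by (apply Rmult_lt_0_compat; lra).
(* The same choice one level up: [S1] bounds the contributions of [cp], [cq] and [cR] to [cA] and
   [cB]. *)
set (s2 := S1 / g + S1 * f1 / (b * g)).
assert (Q3 : 0 < S1 / g) by (apply Rdiv_lt_0_compat; lra).
assert (Q4 : 0 < S1 * f1 / (b * g)) by (apply Rdiv_lt_0_compat; apply Rmult_lt_0_compat; lra).
assert (Hs3 : S1 <= g * s2).
{ replace S1 with (g * (S1 / g)) at 1 by (field; lra). apply Rmult_le_compat_l; unfold s2; lra. }
assert (Hs4 : S1 <= g * (b / f1 * s2)).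
{ replace S1 with (g * (b / f1 * (S1 * f1 / (b * g)))) at 1 by (field; lra).
  repeat apply Rmult_le_compat_l; try (unfold s2; lra). apply Rlt_le, Rdiv_lt_0_compat; lra. }
assert (Hs20 : 0 < s2) by (unfold s2; lra).
set (wB := b / f1 * s2).
assert (HwB : 0 < wB) by (apply Rmult_lt_0_compat; auto; apply Rdiv_lt_0_compat; lra).
set (S2 := E * (s2 + wB + s1 + wq + 1)).
assert (HS2 : 0 < S2) by (apply Rmult_lt_0_compat; lra).
exists (fun c => match c with cA => s2 | cB => wB | cp => s1 | cq => wq | cR => 1 | _ => S2 / th end), th.
assert (Hth0 : 0 < th) by (unfold th; lra).
assert (M : forall x y, x <= E -> 0 < y -> x * y <= E * y) by (intros; apply Rmult_le_compat_r; lra).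
assert (Pa1 := M a1 s1 (HE a1 ltac:(tauto)) Hs10). assert (Pa2 := M a2 wq (HE a2 ltac:(tauto)) Hwq).
assert (Pa3 := HE a3 ltac:(tauto)).
assert (Pb1 := M b1 s1 (HE b1 ltac:(tauto)) Hs10). assert (Pb2 := M b2 wq (HE b2 ltac:(tauto)) Hwq).
assert (Pb3 := HE b3 ltac:(tauto)).
assert (Pu1 := M u1 s2 (HE u1 ltac:(tauto)) Hs20). assert (Pu2 := M u2 s1 (HE u2 ltac:(tauto)) Hs10).
assert (Pu3 := HE u3 ltac:(tauto)).
assert (Pv1 := M v1 wB (HE v1 ltac:(tauto)) HwB). assert (Pv2 := M v2 wq (HE v2 ltac:(tauto)) Hwq).
assert (Pv3 := HE v3 ltac:(tauto)).
assert (Pp := HE ep ltac:(tauto)). assert (Pq := HE eq ltac:(tauto)).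
assert (N : forall y, 0 < y -> 0 < E * y) by (intros; apply Rmult_lt_0_compat; lra).
assert (N1 := N s1 Hs10); assert (N2 := N wq Hwq); assert (N3 := N s2 Hs20); assert (N4 := N wB HwB).
split; [intros []; try lra; apply Rdiv_lt_0_compat; lra|].
split; [lra|].
unfold dot; simpl.
assert (T : th * (S2 / th) = S2) by (field; lra). rewrite T.
repeat split.
- assert (X : f1 * wB = b * s2) by (unfold wB; field; lra). unfold th, S1 in *; lra.
- assert (X : a * a * f2 * s2 <= b * wB).
  { replace f2 with (a * a / f1) by (rewrite <- HFF; field; lra).
    replace (a * a * (a * a / f1) * s2) with (a * a * (a * a) * (s2 / f1)) by (field; lra).
    replace (b * wB) with (b * b * (s2 / f1)) by (unfold wB; field; lra).
    apply Rmult_le_compat_r. apply Rlt_le, Rdiv_lt_0_compat; lra. assert (a * a <= a) by nra. nra. }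
  change (b / f1 * s2) with wB in Hs4. unfold th, S1 in *; lra.
- assert (X : kp * wq = b * s1) by (unfold wq; field; lra). unfold th in *; lra.
- assert (X : kq * a * s1 <= b * wq).
  { rewrite Ekq. replace (/ kp * a * s1) with (a * (s1 / kp)) by (field; lra).
    replace (b * wq) with (b * b * (s1 / kp)) by (unfold wq; field; lra).
    apply Rmult_le_compat_r; auto. apply Rlt_le, Rdiv_lt_0_compat; lra. }
  change (b / kp * s1) with wq in Hs2. unfold th in *; lra.
- lra.
- unfold S2; lra.
- unfold S2; lra.
Qed.

(** * Admissible arguments, gradients and cones *)

Definition adm (phi : R -> R -> R) : Prop :=
  (forall u v, continuity_2d_pt phi u v) /\ forall r u v, sq r u v -> Rabs (phi u v) <= r.

Lemma adm_shift phi psi : adm phi -> adm psi -> shift phi psi.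
Proof. intros [h1 h2] [h3 h4]; split; [split|split]; eauto. Qed.

Lemma adm_fst : adm (fun u _ => u).
Proof. split; [intros; apply continuity_2d_pt_id1|intros r u v []; auto]. Qed.
Lemma adm_snd : adm (fun _ v => v).
Proof. split; [intros; apply continuity_2d_pt_id2|intros r u v []; auto]. Qed.
Lemma adm_0 : adm (fun _ _ => 0).
Proof.
split; [intros; apply continuity_2d_pt_const|intros r u v []; rewrite Rabs_R0].
assert (H1 := Rabs_pos u); lra.
Qed.
Lemma adm_scal c phi : Rabs c <= 1 -> adm phi -> adm (fun u v => c * phi u v).
Proof.
intros Hc [h1 h2]; split.
intros; apply continuity_2d_pt_mult; auto; apply continuity_2d_pt_const.
intros r u v H; rewrite Rabs_mult. assert (h := h2 _ _ _ H). assert (P := Rabs_pos (phi u v)). nra.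
Qed.
Lemma adm_max0 phi : adm phi -> adm (fun u v => Rmax 0 (phi u v)).
Proof.
intros [h1 h2]; split.
intros u v; apply (continuity_1d_2d_pt_comp (Rmax 0)); auto. apply continuity_Rmax.
intros r u v H. assert (h := h2 _ _ _ H). assert (P := Rabs_pos (phi u v)).
apply Rabs_le; apply Rabs_le_between in h. unfold Rmax; destruct Rle_dec; lra.
Qed.

Definition Grad (D : V4 -> Prop) (E : V4 -> R) (dE : nat -> V4 -> R) : Prop :=
  forall z, D z -> filterdiff E (within D (locally z)) (fun h => sum4 (fun i => pr i h * dE i z)).

(** The Lipschitz bounds feed the contraction estimates, the gradient feeds the differentiations. *)
Definition C1r (C : V4 -> Prop) (o : V4) (r : posreal) (E : V4 -> R) (dE : nat -> V4 -> R) : Prop :=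
  LipAt C o E /\ (forall i, LipAt C o (dE i)) /\ Grad (fun z => C z /\ ball o r z) E dE.

(** For [sg = 1] the points with [x <= k t], for [sg = -1] those with
    [x >= k t], where [t >= 0]. *)
Definition cone (sg k : R) (z : V4) : Prop := 0 <= pr 2 z /\ 0 <= sg * (k * pr 2 z - pr 3 z).

Lemma is_derive_wdiff (f : R -> R) s l (D : R -> Prop) :
  D s -> is_derive f s l -> filterdiff f (within D (locally s)) (fun h => h * l).
Proof. intros h1 h2; apply (@wdiff_locally R_NormedModule D f s (fun h => h * l) h1 h2). Qed.

(** A differential within [D] suffices for an ordinary derivative, because the curve stays in [D] on
    both sides of [s]. *)
Lemma Grad_chain D E dE (g0 g1 g2 g3 : R -> R) s d0 d1 d2 d3 : Grad D E dE ->
  locally s (fun s => D (mk (g0 s) (g1 s) (g2 s) (g3 s))) ->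
  is_derive g0 s d0 -> is_derive g1 s d1 -> is_derive g2 s d2 -> is_derive g3 s d3 ->
  let z := mk (g0 s) (g1 s) (g2 s) (g3 s) in
  is_derive (fun s => E (mk (g0 s) (g1 s) (g2 s) (g3 s))) s
    (dE 0%nat z * d0 + dE 1%nat z * d1 + dE 2%nat z * d2 + dE 3%nat z * d3).
Proof.
intros HG HD H0 H1 H2 H3 z.
set (D' := fun s => D (mk (g0 s) (g1 s) (g2 s) (g3 s))).
assert (Ds : D' s) by exact (locally_singleton _ _ HD).
apply (locally_wdiff (D := D') (V := R_NormedModule)); auto.
apply filterdiff_ext_lin with (fun h => sum4 (fun i => pr i (mk (h * d0) (h * d1) (h * d2) (h * d3)) * dE i z)).
- apply (@wdiff_comp R_NormedModule V4 D' D (fun s => mk (g0 s) (g1 s) (g2 s) (g3 s)) E s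
    (fun h => mk (h * d0) (h * d1) (h * d2) (h * d3)) (fun h => sum4 (fun i => pr i h * dE i z))); auto.
  + set (W := prod_NormedModule _ R_NormedModule R_NormedModule).
    apply (@wdiff_pair R_NormedModule W W D' (fun s => (g0 s, g1 s)) (fun s => (g2 s, g3 s)) s
      (fun h => (h * d0, h * d1)) (fun h => (h * d2, h * d3)));
    apply (@wdiff_pair R_NormedModule R_NormedModule R_NormedModule D' _ _ s (fun h => h * _) (fun h => h * _));
    apply is_derive_wdiff; auto.
- intros h; unfold sum4; simpl. unfold scal; simpl; unfold mult; simpl. ring.
Qed.

(** * The boundary value problem for the highest derivatives *)

(** Points of [V4] are [(alpha, beta, t, x)].  [f00] and [g00] are the values of
    [t_u] and [t_v] at the origin, [lam] and [mu] the characteristic speeds. *)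
Section Quantities.

Variables (a b0 da db f00 g00 : R) (lam mu P Q : V4 -> R) (dlam dmu dP dQ : nat -> V4 -> R).

Definition al1 (Y : unk) u := da + RInt (fun s => Y cA s 0) 0 u.
Definition al (Y : unk) u := b0 + RInt (al1 Y) 0 u.
Definition be1 (Y : unk) v := db + RInt (fun s => Y cB s 0) 0 v.
Definition be (Y : unk) v := b0 + RInt (be1 Y) 0 v.
(** Each first derivative of [t] is integrated from the shock along which its derivative is an
    unknown: [t_u] from [u = v], [t_v] from [u = a v]. *)
Definition ff (Y : unk) u v := f00 + RInt (fun s => Y cp s 0) 0 u + RInt (fun s => Y cR u s) u v.
Definition gg (Y : unk) u v := g00 + RInt (fun s => Y cq s 0) 0 v + RInt (fun s => Y cR s v) (a * v) u.
(** The second derivatives [t_uu] and [t_vv] by the Leibniz rule; the subtracted terms come from the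
    moving lower limits. *)
Definition fu (Y : unk) u v := Y cp u 0 - Y cR u u + RInt (fun s => Y cU u s) u v.
Definition gv (Y : unk) u v := Y cq v 0 - a * Y cR (a * v) v + RInt (fun s => Y cV s v) (a * v) u.
Definition ev (E : V4 -> R) (Y : unk) u v := E (mk (al Y u) (be Y v) 0 0).

(** The right-hand side of the equation for [t_uv], then its two derivatives. *)
Definition NR (Y : unk) u v :=
  ev P Y u v * be1 Y v * ff Y u v - ev Q Y u v * al1 Y u * gg Y u v.
Definition NU (Y : unk) u v :=
  ev (dP 0%nat) Y u v * al1 Y u * be1 Y v * ff Y u v + ev P Y u v * be1 Y v * fu Y u v
  - ((ev (dQ 0%nat) Y u v * al1 Y u * al1 Y u * gg Y u v
      + ev Q Y u v * gg Y u v * Y cA u 0) + ev Q Y u v * al1 Y u * Y cR u v).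
Definition NV (Y : unk) u v :=
  ev (dP 1%nat) Y u v * be1 Y v * be1 Y v * ff Y u v + ev P Y u v * ff Y u v * Y cB v 0
  + ev P Y u v * be1 Y v * Y cR u v
  - (ev (dQ 1%nat) Y u v * be1 Y v * al1 Y u * gg Y u v + ev Q Y u v * al1 Y u * gv Y u v).

(** Along the curve [s |-> (c s, s)]. *)
Definition t1 c (Y : unk) s := c * ff Y (c * s) s + gg Y (c * s) s.
Definition x1 c (Y : unk) s :=
  c * (ev lam Y (c * s) s * ff Y (c * s) s) + ev mu Y (c * s) s * gg Y (c * s) s.
Definition t2 c (Y : unk) s :=
  c * (c * fu Y (c * s) s + Y cR (c * s) s) + (c * Y cR (c * s) s + gv Y (c * s) s).
Definition x2 c (Y : unk) s :=
  c * ((ev (dlam 0%nat) Y (c * s) s * (c * al1 Y (c * s)) + ev (dlam 1%nat) Y (c * s) s * be1 Y s) * ff Y (c * s) s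
       + ev lam Y (c * s) s * (c * fu Y (c * s) s + Y cR (c * s) s))
  + ((ev (dmu 0%nat) Y (c * s) s * (c * al1 Y (c * s)) + ev (dmu 1%nat) Y (c * s) s * be1 Y s) * gg Y (c * s) s
     + ev mu Y (c * s) s * (c * Y cR (c * s) s + gv Y (c * s) s)).
Definition cv c (E : V4 -> R) (Y : unk) s :=
  E (mk (al Y (c * s)) (be Y s) (RInt (t1 c Y) 0 s) (RInt (x1 c Y) 0 s)).
Definition cv1 c (dE : nat -> V4 -> R) (Y : unk) s :=
  cv c (dE 0%nat) Y s * (c * al1 Y (c * s)) + cv c (dE 1%nat) Y s * be1 Y s
  + cv c (dE 2%nat) Y s * t1 c Y s + cv c (dE 3%nat) Y s * x1 c Y s.
Definition cv2 c (dE : nat -> V4 -> R) (ddE : nat -> nat -> V4 -> R) (Y : unk) s :=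
  (cv1 c (ddE 0%nat) Y s * (c * al1 Y (c * s)) + cv c (dE 0%nat) Y s * (c * (c * Y cA (c * s) 0)))
  + (cv1 c (ddE 1%nat) Y s * be1 Y s + cv c (dE 1%nat) Y s * Y cB s 0)
  + (cv1 c (ddE 2%nat) Y s * t1 c Y s + cv c (dE 2%nat) Y s * t2 c Y s)
  + (cv1 c (ddE 3%nat) Y s * x1 c Y s + cv c (dE 3%nat) Y s * x2 c Y s).

Definition o4 : V4 := mk b0 b0 0 0.
Definition C0 : V4 -> Prop := fun _ => True.

Hypotheses (Ha : 0 < a < 1).

Lemma Rabs_a : Rabs a <= 1.
Proof. apply Rabs_le; lra. Qed.

Lemma Gr_at c0 phi psi : adm phi -> adm psi ->
  Gr (fun c => match c0, c with
   cA, cA | cB, cB | cp, cp | cq, cq | cR, cR | cU, cU | cV, cV => 1 | _, _ => 0 end)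
   (fun Y u v => Y c0 (phi u v) (psi u v)).
Proof.
intros H1 H2; apply (Gr_shift (Th := fun Y => Y c0)). apply adm_shift; auto.
exists 0; apply QE_cmp.
Qed.

Lemma Low_int t T phi : adm phi -> Low t T -> Low 0 (fun Y u v => RInt (fun s => T Y s 0) 0 (phi u v)).
Proof.
intros H HT. apply (Low_RInt1 (Th := fun Y s v => T Y s 0) (phi := fun _ _ => 0) (l := fun _ => 0)).
apply adm_shift; auto using adm_0.
apply (Gr_shift (Th := T) (phi := fun s _ => s) (psi := fun _ _ => 0)).
apply adm_shift; auto using adm_0, adm_fst. apply Low_Gr with t; auto.
Qed.

Lemma Low_int_cmp c0 phi : adm phi -> Low 0 (fun Y u v => RInt (fun s => Y c0 s 0) 0 (phi u v)).
Proof.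
intros H. eapply (Low_RInt1 (Th := fun Y s v => Y c0 s 0) (phi := fun _ _ => 0)).
apply adm_shift; auto using adm_0.
apply (Gr_at c0 (phi := fun s _ => s) (psi := fun _ _ => 0)); auto using adm_0, adm_fst.
Qed.

Lemma Low_al1 phi : adm phi -> Low da (fun Y u v => al1 Y (phi u v)).
Proof.
intros H; apply Low_eq with (da + 0). ring. apply Low_plus. apply Low_const. apply Low_int_cmp, H.
Qed.
Lemma Low_be1 phi : adm phi -> Low db (fun Y u v => be1 Y (phi u v)).
Proof.
intros H; apply Low_eq with (db + 0). ring. apply Low_plus. apply Low_const. apply Low_int_cmp, H.
Qed.
Lemma Low_al phi : adm phi -> Low b0 (fun Y u v => al Y (phi u v)).
Proof.
intros H; apply Low_eq with (b0 + 0). ring. apply Low_plus. apply Low_const.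
apply (Low_int (t := da) (T := fun Y u _ => al1 Y u)); auto. apply (Low_al1 adm_fst).
Qed.
Lemma Low_be phi : adm phi -> Low b0 (fun Y u v => be Y (phi u v)).
Proof.
intros H; apply Low_eq with (b0 + 0). ring. apply Low_plus. apply Low_const.
apply (Low_int (t := db) (T := fun Y u _ => be1 Y u)); auto. apply (Low_be1 adm_fst).
Qed.

Lemma Low_ff phi psi : adm phi -> adm psi -> Low f00 (fun Y u v => ff Y (phi u v) (psi u v)).
Proof.
intros H1 H2; apply (Low_shift (Th := fun Y u v => ff Y u v)). apply adm_shift; auto.
apply Low_eq with (f00 + 0 + 0). ring. apply Low_plus. apply Low_plus. apply Low_const.
apply Low_int_cmp, adm_fst.
eapply (Low_RInt2 (Th := fun Y u s => Y cR u s) (phi := fun u v => u) (psi := fun u v => v)).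
apply adm_shift; auto using adm_fst, adm_snd.
apply (Gr_at cR adm_fst adm_snd).
Qed.

Lemma Low_gg phi psi : adm phi -> adm psi -> Low g00 (fun Y u v => gg Y (phi u v) (psi u v)).
Proof.
intros H1 H2; apply (Low_shift (Th := fun Y u v => gg Y u v)). apply adm_shift; auto.
apply Low_eq with (g00 + 0 + 0). ring. apply Low_plus. apply Low_plus. apply Low_const.
apply Low_int_cmp, adm_snd.
eapply (Low_RInt1 (Th := fun Y s v => Y cR s v) (phi := fun u v => a * v) (psi := fun u v => u)).
apply adm_shift; auto using adm_fst, adm_snd, adm_scal, Rabs_a.
apply (Gr_at cR adm_fst adm_snd).
Qed.

Lemma Gr_cA phi psi : adm phi -> adm psi -> Gr (lin 1 0 0 0 0) (fun Y u v => Y cA (phi u v) (psi u v)).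
Proof. intros; eapply Gr_eq; [|apply (Gr_at cA); auto]; intros []; reflexivity. Qed.
Lemma Gr_cB phi psi : adm phi -> adm psi -> Gr (lin 0 1 0 0 0) (fun Y u v => Y cB (phi u v) (psi u v)).
Proof. intros; eapply Gr_eq; [|apply (Gr_at cB); auto]; intros []; reflexivity. Qed.
Lemma Gr_cR phi psi : adm phi -> adm psi -> Gr (lin 0 0 0 0 1) (fun Y u v => Y cR (phi u v) (psi u v)).
Proof. intros; eapply Gr_eq; [|apply (Gr_at cR); auto]; intros []; reflexivity. Qed.

Lemma Gr_fu phi psi : adm phi -> adm psi -> Gr (lin 0 0 1 0 1) (fun Y u v => fu Y (phi u v) (psi u v)).
Proof.
intros H1 H2; apply (Gr_shift (Th := fun Y u v => fu Y u v)). apply adm_shift; auto.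
eapply Gr_eq; [|apply Gr_plus; [apply Gr_minus|]].
2: apply (Gr_at cp adm_fst adm_0). 2: apply (Gr_cR adm_fst adm_fst).
2: eapply Low_Gr, (Low_RInt2 (Th := fun Y u s => Y cU u s) (phi := fun u v => u) (psi := fun u v => v)).
2: apply adm_shift; auto using adm_fst, adm_snd.
2: apply (Gr_at cU adm_fst adm_snd).
intros []; simpl; ring.
Qed.

Lemma Gr_gv phi psi : adm phi -> adm psi -> Gr (lin 0 0 0 1 a) (fun Y u v => gv Y (phi u v) (psi u v)).
Proof.
intros H1 H2; apply (Gr_shift (Th := fun Y u v => gv Y u v)). apply adm_shift; auto.
eapply Gr_eq; [|apply Gr_plus; [apply Gr_minus|]].
2: apply (Gr_at cq adm_snd adm_0).
2: apply Gr_mult; [apply Low_const|apply (Gr_cR (adm_scal Rabs_a adm_snd) adm_snd)].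
2: eapply Low_Gr, (Low_RInt1 (Th := fun Y s v => Y cV s v) (phi := fun u v => a * v) (psi := fun u v => u)).
2: apply adm_shift; auto using adm_fst, adm_snd, adm_scal, Rabs_a.
2: apply (Gr_at cV adm_fst adm_snd).
intros []; simpl; rewrite Rabs_pos_eq by lra; ring.
Qed.

Lemma Low_ev E phi psi : LipAt C0 o4 E -> adm phi -> adm psi ->
  Low (E o4) (fun Y u v => ev E Y (phi u v) (psi u v)).
Proof.
intros HE H1 H2.
apply (Low_comp (C := C0) (T := fun i Y u v => match i with 0%nat => al Y (phi u v) | 1%nat => be Y (psi u v) | _ => 0 end)); auto.
exact I.
- intros [|[|[|[|i]]]] Hi; simpl; try lia; auto using Low_al, Low_be, Low_const.
- intros m; exists 1; split; [lra|]; intros; exact I.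
Qed.

Section WaveTerm.
Hypotheses (HP : LipAt C0 o4 P) (HQ : LipAt C0 o4 Q)
  (HdP : forall i, LipAt C0 o4 (dP i)) (HdQ : forall i, LipAt C0 o4 (dQ i)).

(** The equation for [t_uv] contains first derivatives only, so the row of [cR] in the matrix of
    gains vanishes. *)
Lemma Low_NR : Low (P o4 * db * f00 - Q o4 * da * g00) (fun Y => NR Y).
Proof.
apply Low_minus; repeat apply Low_mult.
- apply Low_ev; auto using adm_fst, adm_snd.
- apply (Low_be1 adm_snd).
- apply (Low_ff adm_fst adm_snd).
- apply Low_ev; auto using adm_fst, adm_snd.
- apply (Low_al1 adm_fst).
- apply (Low_gg adm_fst adm_snd).
Qed.

Lemma Gr_NU : exists eA ep eR, Gr (lin eA 0 ep 0 eR) (fun Y => NU Y).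
Proof.
eexists _, _, _; eapply Gr_eq; [|apply Gr_minus; [apply Gr_plus|apply Gr_plus; [apply Gr_plus|]]].
2: eapply Low_Gr; repeat apply Low_mult;
  [apply (Low_ev (HdP 0) adm_fst adm_snd)|apply (Low_al1 adm_fst)|apply (Low_be1 adm_snd)|apply (Low_ff adm_fst adm_snd)].
2: apply Gr_mult; [apply Low_mult; [apply (Low_ev HP adm_fst adm_snd)|apply (Low_be1 adm_snd)]|apply (Gr_fu adm_fst adm_snd)].
2: eapply Low_Gr; repeat apply Low_mult;
  [apply (Low_ev (HdQ 0) adm_fst adm_snd)|apply (Low_al1 adm_fst)|apply (Low_al1 adm_fst)|apply (Low_gg adm_fst adm_snd)].
2: apply Gr_mult; [apply Low_mult; [apply (Low_ev HQ adm_fst adm_snd)|apply (Low_gg adm_fst adm_snd)]|apply (Gr_cA adm_fst adm_0)].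
2: apply Gr_mult; [apply Low_mult; [apply (Low_ev HQ adm_fst adm_snd)|apply (Low_al1 adm_fst)]|apply (Gr_cR adm_fst adm_snd)].
intros []; simpl; try reflexivity; ring.
Qed.

Lemma Gr_NV : exists eB eq eR, Gr (lin 0 eB 0 eq eR) (fun Y => NV Y).
Proof.
eexists _, _, _; eapply Gr_eq; [|apply Gr_minus; [apply Gr_plus; [apply Gr_plus|]|apply Gr_plus]].
2: eapply Low_Gr; repeat apply Low_mult;
  [apply (Low_ev (HdP 1) adm_fst adm_snd)|apply (Low_be1 adm_snd)|apply (Low_be1 adm_snd)|apply (Low_ff adm_fst adm_snd)].
2: apply Gr_mult; [apply Low_mult; [apply (Low_ev HP adm_fst adm_snd)|apply (Low_ff adm_fst adm_snd)]|apply (Gr_cB adm_snd adm_0)].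
2: apply Gr_mult; [apply Low_mult; [apply (Low_ev HP adm_fst adm_snd)|apply (Low_be1 adm_snd)]|apply (Gr_cR adm_fst adm_snd)].
2: eapply Low_Gr; repeat apply Low_mult;
  [apply (Low_ev (HdQ 1) adm_fst adm_snd)|apply (Low_be1 adm_snd)|apply (Low_al1 adm_fst)|apply (Low_gg adm_fst adm_snd)].
2: apply Gr_mult; [apply Low_mult; [apply (Low_ev HQ adm_fst adm_snd)|apply (Low_al1 adm_fst)]|apply (Gr_gv adm_fst adm_snd)].
intros []; simpl; try reflexivity; ring.
Qed.
End WaveTerm.

(** * Quantities along a shock *)

Section Curve.
Variables (c : R) (C : V4 -> Prop) (sg k : R).
Hypotheses (Hc : 0 < c <= 1)
  (Hlam : LipAt C0 o4 lam) (Hmu : LipAt C0 o4 mu)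
  (Hdlam : forall i, LipAt C0 o4 (dlam i)) (Hdmu : forall i, LipAt C0 o4 (dmu i))
  (HC : forall z, C z <-> 0 <= pr 2 z /\ 0 <= sg * (k * pr 2 z - pr 3 z))
  (Ht : 0 < c * f00 + g00)
  (Hx : 0 < sg * (k * (c * f00 + g00) - (c * (lam o4 * f00) + mu o4 * g00))).

Lemma adm_curve phi : adm phi -> adm (fun u v => c * phi u v).
Proof. apply adm_scal, Rabs_le; lra. Qed.

Lemma Low_t1 phi : adm phi -> Low (c * f00 + g00) (fun Y u v => t1 c Y (phi u v)).
Proof.
intros H; apply Low_plus; [apply Low_mult; [apply Low_const|]|].
apply Low_ff; auto using adm_curve. apply Low_gg; auto using adm_curve.
Qed.

Lemma Low_x1 phi : adm phi -> Low (c * (lam o4 * f00) + mu o4 * g00) (fun Y u v => x1 c Y (phi u v)).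
Proof.
intros H; apply Low_plus; [apply Low_mult; [apply Low_const|apply Low_mult]|apply Low_mult].
apply Low_ev; auto using adm_curve. apply Low_ff; auto using adm_curve.
apply Low_ev; auto using adm_curve. apply Low_gg; auto using adm_curve.
Qed.

Lemma Low_tc phi : adm phi -> Low 0 (fun Y u v => RInt (t1 c Y) 0 (phi u v)).
Proof. intros H; apply (Low_int (T := fun Y u _ => t1 c Y u) H (Low_t1 adm_fst)). Qed.
Lemma Low_xc phi : adm phi -> Low 0 (fun Y u v => RInt (x1 c Y) 0 (phi u v)).
Proof. intros H; apply (Low_int (T := fun Y u _ => x1 c Y u) H (Low_x1 adm_fst)). Qed.

(** By [Ht] and [Hx] the velocity of the curve at the origin points into the interior of the cone.
    Near the origin it does so for all unknowns bounded by [m], and integration keeps the curve in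
    the cone. *)
Lemma RInt_pos_cone m : exists r0, 0 < r0 /\ forall Y s, inX m Y -> 0 <= s <= r0 ->
  0 <= RInt (t1 c Y) 0 s /\ 0 <= sg * (k * RInt (t1 c Y) 0 s - RInt (x1 c Y) 0 s).
Proof.
destruct (Low_near m (Low_t1 adm_fst) (locally_pos Ht)) as (r1 & Hr1 & K1).
assert (L : Low (sg * (k * (c * f00 + g00) - (c * (lam o4 * f00) + mu o4 * g00)))
   (fun Y u v => sg * (k * t1 c Y u - x1 c Y u))).
{ apply Low_mult. apply Low_const. apply Low_minus. apply Low_mult. apply Low_const.
  apply (Low_t1 adm_fst). apply (Low_x1 adm_fst). }
destruct (Low_near m L (locally_pos Hx)) as (r2 & Hr2 & K2).
destruct (Low_cont m (Low_t1 adm_fst)) as (r3 & Hr3 & K3).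
destruct (Low_cont m (Low_x1 adm_fst)) as (r4 & Hr4 & K4).
exists (Rmin (Rmin r1 r2) (Rmin r3 r4)); split. repeat apply Rmin_glb_lt; auto.
assert (h1 := Rmin_l (Rmin r1 r2) (Rmin r3 r4)). assert (h2 := Rmin_r (Rmin r1 r2) (Rmin r3 r4)).
assert (h3 := Rmin_l r1 r2). assert (h4 := Rmin_r r1 r2). assert (h5 := Rmin_l r3 r4). assert (h6 := Rmin_r r3 r4).
intros Y s HY Hs.
assert (Hsq : forall r x, Rmin (Rmin r1 r2) (Rmin r3 r4) <= r -> 0 <= x <= s -> sq r x 0).
{ intros r x Hr Hx'; split. rewrite Rabs_pos_eq; lra. rewrite Rabs_R0; lra. }
assert (X1 : forall x, 0 <= x <= s -> continuous (t1 c Y) x).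
{ intros x Hx'; apply (continuity_2d_line (f := fun u v => t1 c Y u) (y := 0)), K3; auto. apply Hsq; auto; lra. }
assert (X2 : forall x, 0 <= x <= s -> continuous (x1 c Y) x).
{ intros x Hx'; apply (continuity_2d_line (f := fun u v => x1 c Y u) (y := 0)), K4; auto. apply Hsq; auto; lra. }
assert (I1 : ex_RInt (t1 c Y) 0 s).
{ apply (@ex_RInt_continuous R_CompleteNormedModule). rewrite Rmin_left, Rmax_right by lra; auto. }
assert (I2 : ex_RInt (x1 c Y) 0 s).
{ apply (@ex_RInt_continuous R_CompleteNormedModule). rewrite Rmin_left, Rmax_right by lra; auto. }
split.
- apply RInt_ge_0; [lra|auto|]. intros x Hx'. apply Rlt_le, (K1 Y x 0); auto. apply Hsq; lra.
- assert (I3 : ex_RInt (fun x => k * t1 c Y x) 0 s) by (apply (ex_RInt_scal (V := R_NormedModule)); auto).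
  assert (I4 : ex_RInt (fun x => k * t1 c Y x - x1 c Y x) 0 s) by (apply (ex_RInt_minus (V := R_NormedModule)); auto).
  assert (E : RInt (fun x => sg * (k * t1 c Y x - x1 c Y x)) 0 s
     = sg * (k * RInt (t1 c Y) 0 s - RInt (x1 c Y) 0 s)).
  { assert (E1 := RInt_scal (V := R_CompleteNormedModule) _ 0 s sg I4).
    assert (E2 := RInt_minus (V := R_CompleteNormedModule) _ _ 0 s I3 I2).
    assert (E3 := RInt_scal (V := R_CompleteNormedModule) _ 0 s k I1).
    change (RInt (fun x => sg * (k * t1 c Y x - x1 c Y x)) 0 s = sg * RInt (fun x => k * t1 c Y x - x1 c Y x) 0 s) in E1.
    change (RInt (fun x => k * t1 c Y x - x1 c Y x) 0 s = RInt (fun x => k * t1 c Y x) 0 s - RInt (x1 c Y) 0 s) in E2.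
    change (RInt (fun x => k * t1 c Y x) 0 s = k * RInt (t1 c Y) 0 s) in E3.
    rewrite E1, E2, E3; reflexivity. }
  rewrite <- E. apply RInt_ge_0; [lra| |].
  apply (ex_RInt_scal (V := R_NormedModule)); auto.
  intros x Hx'. apply Rlt_le, (K2 Y x 0); auto. apply Hsq; lra.
Qed.

Let pos (u v : R) := Rmax 0 u.
Let adm_pos : adm pos.
Proof. apply (adm_max0 adm_fst). Qed.

Lemma Low_cv E : LipAt C o4 E -> Low (E o4) (fun Y u v => cv c E Y (Rmax 0 u)).
Proof.
intros HE.
apply (Low_comp (C := C) (T := fun i Y u v => match i with 0%nat => al Y (c * Rmax 0 u) | 1%nat => be Y (Rmax 0 u)
  | 2%nat => RInt (t1 c Y) 0 (Rmax 0 u) | _ => RInt (x1 c Y) 0 (Rmax 0 u) end)); auto.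
- apply HC; simpl; lra.
- assert (A := adm_pos). intros [|[|[|[|i]]]] Hi; simpl; try lia.
  + apply (Low_al (adm_curve A)).
  + apply (Low_be A).
  + apply (Low_tc A).
  + apply (Low_xc A).
- intros m; destruct (RInt_pos_cone m) as (r0 & Hr0 & K); exists r0; split; auto.
  intros Y u v HY [Hu _]; apply HC; simpl; apply K; auto.
  apply Rabs_le_between in Hu; split; [apply Rmax_l|apply Rmax_lub; lra].
Qed.

(** The derivative at the origin of a function of the state along the shock. For [G1] and [G2], its
    equality with [da] and [db] is the linear system that defines the initial slopes. *)
Definition slope (dE : nat -> V4 -> R) : R :=
  dE 0%nat o4 * (c * da) + dE 1%nat o4 * db + dE 2%nat o4 * (c * f00 + g00)
  + dE 3%nat o4 * (c * (lam o4 * f00) + mu o4 * g00).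

Lemma Low_cv1 dE : (forall i, LipAt C o4 (dE i)) -> Low (slope dE) (fun Y u v => cv1 c dE Y (Rmax 0 u)).
Proof.
intros HE; assert (A := adm_pos). repeat apply Low_plus; apply Low_mult; try (apply Low_cv; auto).
- apply Low_mult. apply Low_const. apply (Low_al1 (adm_curve A)).
- apply (Low_be1 A).
- apply (Low_t1 A).
- apply (Low_x1 A).
Qed.

Lemma Gr_t2 : exists ep eq eR, Gr (lin 0 0 ep eq eR) (fun Y u v => t2 c Y (Rmax 0 u)).
Proof.
assert (A := adm_pos). assert (A' := adm_curve A).
eexists _, _, _; eapply Gr_eq; [|apply Gr_plus; [apply Gr_mult; [apply Low_const|apply Gr_plus; [apply Gr_mult; [apply Low_const|]|]]|
   apply Gr_plus; [apply Gr_mult; [apply Low_const|]|]]].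
2: apply (Gr_fu A' A). 2: apply (Gr_cR A' A). 2: apply (Gr_cR A' A). 2: apply (Gr_gv A' A).
intros []; simpl; try reflexivity; ring.
Qed.

Lemma Gr_x2 : exists ep eq eR, Gr (lin 0 0 ep eq eR) (fun Y u v => x2 c Y (Rmax 0 u)).
Proof.
assert (A := adm_pos). assert (A' := adm_curve A).
eexists _, _, _; eapply Gr_eq; [|apply Gr_plus; [apply Gr_mult; [apply Low_const|apply Gr_plus]|apply Gr_plus]].
2: eapply Low_Gr, Low_mult; [apply Low_plus; apply Low_mult|].
2: apply (Low_ev (Hdlam 0) A' A). 2: apply Low_mult; [apply Low_const|apply (Low_al1 A')].
2: apply (Low_ev (Hdlam 1) A' A). 2: apply (Low_be1 A). 2: apply (Low_ff A' A).
2: apply Gr_mult; [apply (Low_ev Hlam A' A)|apply Gr_plus; [apply Gr_mult; [apply Low_const|apply (Gr_fu A' A)]|apply (Gr_cR A' A)]].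
2: eapply Low_Gr, Low_mult; [apply Low_plus; apply Low_mult|].
2: apply (Low_ev (Hdmu 0) A' A). 2: apply Low_mult; [apply Low_const|apply (Low_al1 A')].
2: apply (Low_ev (Hdmu 1) A' A). 2: apply (Low_be1 A). 2: apply (Low_gg A' A).
2: apply Gr_mult; [apply (Low_ev Hmu A' A)|apply Gr_plus; [apply Gr_mult; [apply Low_const|apply (Gr_cR A' A)]|apply (Gr_gv A' A)]].
intros []; simpl; try reflexivity; ring.
Qed.

(** The first gain carries [c * c] because [alpha] is taken at [c * s] and differentiated twice. On
    the right shock this is the factor [a ^ 2] in the cycle of [alpha''] and [beta'']. *)
Lemma Gr_cv2 dE ddE : (forall i, LipAt C o4 (dE i)) -> (forall i j, LipAt C o4 (ddE i j)) ->
  exists ep eq eR, Gr (lin (c * c * Rabs (dE 0%nat o4)) (Rabs (dE 1%nat o4)) ep eq eR)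
    (fun Y u v => cv2 c dE ddE Y (Rmax 0 u)).
Proof.
intros HE HEE; assert (A := adm_pos). assert (A' := adm_curve A).
destruct Gr_t2 as (tp & tq & tR & Gt). destruct Gr_x2 as (xp & xq & xR & Gx).
eexists _, _, _; eapply Gr_eq; [|apply Gr_plus; [apply Gr_plus; [apply Gr_plus; apply Gr_plus|apply Gr_plus]|apply Gr_plus]].
2,4,6,8: eapply Low_Gr, Low_mult; [apply Low_cv1; auto|].
2: apply Low_mult; [apply Low_const|apply (Low_al1 A')].
2: apply (Low_be1 A). 2: apply (Low_t1 A). 2: apply (Low_x1 A).
2: apply Gr_mult; [apply Low_cv; auto|apply Gr_mult; [apply Low_const|apply Gr_mult; [apply Low_const|apply (Gr_cA A' adm_0)]]].
2: apply Gr_mult; [apply Low_cv; auto|apply (Gr_cB A adm_0)].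
2: apply Gr_mult; [apply Low_cv; auto|exact Gt].
2: apply Gr_mult; [apply Low_cv; auto|exact Gx].
intros []; simpl; try reflexivity; try ring. rewrite (Rabs_pos_eq c) by lra; ring.
Qed.

End Curve.

Lemma Gr_cont l T m : Gr l T -> exists r0, 0 < r0 /\
  forall Y u v, inX m Y -> sq r0 u v -> continuity_2d_pt (T Y) u v.
Proof.
intros [k H]; destruct (H m) as (C & r0 & HC & Hr & K); exists r0; split; auto.
intros Y u v HY Hs; destruct (K r0 u v) as [K1 _]; auto; [lra|]; destruct (K1 Y HY); auto.
Qed.

(** In integral form, which passes to uniform limits: [cU] and [cV] are the
    partial derivatives of [cR] on the open square. *)
Definition Pr (d : R) (Y : unk) : Prop :=
  (forall u1 u2 v, Rabs u1 < d -> Rabs u2 < d -> Rabs v < d ->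
     Y cR u2 v - Y cR u1 v = RInt (fun s => Y cU s v) u1 u2) /\
  (forall u v1 v2, Rabs u < d -> Rabs v1 < d -> Rabs v2 < d ->
     Y cR u v2 - Y cR u v1 = RInt (fun s => Y cV u s) v1 v2).

Lemma Pr_zero d : Pr d (fun _ _ _ => 0).
Proof.
split; intros; rewrite RInt_const; unfold scal; simpl; unfold mult; simpl; ring.
Qed.

Lemma cont_line1 (F : R -> R -> R) : (forall u v, continuity_2d_pt F u v) -> forall u v, continuous (fun s => F s v) u.
Proof. intros H u v; apply (continuity_2d_line (H u v)). Qed.
Lemma cont_line2 (F : R -> R -> R) : (forall u v, continuity_2d_pt F u v) -> forall u v, continuous (fun s => F u s) v.
Proof. intros H u v; apply (continuity_2d_line (f := fun t y => F y t) (y := u)), continuity_2d_swap, H. Qed.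

Lemma ex_RInt_cont (f : R -> R) x y : (forall s, continuous f s) -> ex_RInt f x y.
Proof. intros H; apply (@ex_RInt_continuous R_CompleteNormedModule); intros; apply H. Qed.

Lemma lim_RInt (f1 g1 h : R -> R) x y x' y' e d : (forall s, continuous g1 s) -> (forall s, continuous h s) ->
  Rabs x < d -> Rabs y < d ->
  f1 y - f1 x = RInt g1 x y -> Rabs (f1 y - y') <= e -> Rabs (f1 x - x') <= e ->
  (forall s, Rabs (g1 s - h s) <= e) -> Rabs (y' - x' - RInt h x y) <= (2 + 2 * d) * e.
Proof.
intros Cg Ch Hx Hy E E1 E2 E3.
assert (He : 0 <= e) by (eapply Rle_trans; [apply Rabs_pos|apply E1]).
assert (K := RInt_minus (V := R_CompleteNormedModule) g1 h x y (ex_RInt_cont x y Cg) (ex_RInt_cont x y Ch)).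
change (RInt (fun x => g1 x - h x) x y = RInt g1 x y - RInt h x y) in K.
assert (B : Rabs (RInt (fun x => g1 x - h x) x y) <= Rabs (y - x) * e).
{ apply abs_RInt_le; intros s _; split; auto. apply (continuous_minus g1 h); auto. }
assert (Rabs (y - x) <= 2 * d).
{ eapply Rle_trans. apply Rabs_triang. rewrite Rabs_Ropp; lra. }
assert (Rabs (y - x) * e <= 2 * d * e) by (apply Rmult_le_compat_r; auto).
replace (y' - x' - RInt h x y) with
  (RInt (fun x => g1 x - h x) x y - (f1 y - y') + (f1 x - x')) by lra.
eapply Rle_trans. apply Rabs_triang. eapply Rle_trans. apply Rplus_le_compat_r, Rabs_triang.
rewrite Rabs_Ropp. lra.
Qed.

Lemma Pr_lim d (Yn : nat -> unk) (Y : unk) : 0 < d ->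
  (forall n c u v, continuity_2d_pt (Yn n c) u v) -> (forall c u v, continuity_2d_pt (Y c) u v) ->
  (forall n, Pr d (Yn n)) ->
  (forall e, 0 < e -> exists n, forall c u v, Rabs (Yn n c u v - Y c u v) <= e) -> Pr d Y.
Proof.
intros Hd Cn CY Pn Hlim.
assert (S : forall x, (forall e, 0 < e -> Rabs x <= (2 + 2 * d) * e) -> x = 0).
{ intros x H; apply cond_eq; intros e He. rewrite Rminus_0_r.
  apply Rle_lt_trans with ((2 + 2 * d) * (e / (2 * (2 + 2 * d)))).
  apply H, Rdiv_lt_0_compat; lra. field_simplify; lra. }
split; intros; apply Rminus_diag_uniq, S; intros e He; destruct (Hlim e He) as [n Hn]; destruct (Pn n) as [P1 P2].
- apply (@lim_RInt (fun s => Yn n cR s v) (fun s => Yn n cU s v)); auto; intros; apply cont_line1; auto.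
- apply (@lim_RInt (fun s => Yn n cR u s) (fun s => Yn n cV u s)); auto; intros; apply cont_line2; auto.
Qed.

(** * Differentiability of the recovered functions *)

Section Regular.
Variables (Y : unk) (d : R).
Hypotheses (CY : forall c u v, continuity_2d_pt (Y c) u v) (HPr : Pr d Y).

Lemma derive_RInt_cont (f : R -> R) x0 x : (forall s, continuous f s) -> is_derive (fun b => RInt f x0 b) x (f x).
Proof.
intros H; assert (M1 := Rmax_l (Rabs x0) (Rabs x)); assert (M2 := Rmax_r (Rabs x0) (Rabs x)).
apply (@derive_RInt f x0 x (Rmax (Rabs x0) (Rabs x) + 1)); auto; lra.
Qed.

Lemma derive_al1 u : is_derive (al1 Y) u (Y cA u 0).
Proof.
apply derive_const_plus. apply (@derive_RInt_cont (fun s => Y cA s 0)). intros; apply cont_line1; auto.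
Qed.
Lemma derive_be1 u : is_derive (be1 Y) u (Y cB u 0).
Proof.
apply derive_const_plus. apply (@derive_RInt_cont (fun s => Y cB s 0)). intros; apply cont_line1; auto.
Qed.
Lemma derive_al u : is_derive (al Y) u (al1 Y u).
Proof.
apply derive_const_plus, derive_RInt_cont. intros s; apply derive_continuous with (1 := derive_al1 s).
Qed.
Lemma derive_be u : is_derive (be Y) u (be1 Y u).
Proof.
apply derive_const_plus, derive_RInt_cont. intros s; apply derive_continuous with (1 := derive_be1 s).
Qed.

Lemma derive_R_u u v : Rabs u < d -> Rabs v < d -> is_derive (fun u => Y cR u v) u (Y cU u v).
Proof.
intros Hu Hv. apply is_derive_ext_loc with (fun x => Y cR u v + RInt (fun s => Y cU s v) u x).
- generalize (locally_abs Hu); apply filter_imp; intros y Hy. rewrite <- (proj1 HPr u y v); auto; apply Rplus_minus.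
- apply derive_const_plus. apply (@derive_RInt_cont (fun s => Y cU s v)). intros; apply cont_line1; auto.
Qed.
Lemma derive_R_v u v : Rabs u < d -> Rabs v < d -> is_derive (fun v => Y cR u v) v (Y cV u v).
Proof.
intros Hu Hv. apply is_derive_ext_loc with (fun x => Y cR u v + RInt (fun s => Y cV u s) v x).
- generalize (locally_abs Hv); apply filter_imp; intros y Hy. rewrite <- (proj2 HPr u v y); auto; apply Rplus_minus.
- apply derive_const_plus. apply (@derive_RInt_cont (fun s => Y cV u s)). intros; apply cont_line2; auto.
Qed.

Lemma derive_ff_v u v : is_derive (fun v => ff Y u v) v (Y cR u v).
Proof.
apply derive_const_plus. apply (@derive_RInt_cont (fun s => Y cR u s)). intros; apply cont_line2; auto.
Qed.
Lemma derive_gg_u u v : is_derive (fun u => gg Y u v) u (Y cR u v).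
Proof.
apply derive_const_plus. apply (@derive_RInt_cont (fun s => Y cR s v)). intros; apply cont_line1; auto.
Qed.
Lemma derive_ff_u u v : Rabs u < d -> Rabs v < d -> is_derive (fun u => ff Y u v) u (fu Y u v).
Proof.
intros Hu Hv. apply derive_eq with (Y cp u 0 + (RInt (fun s => Y cU u s) (1 * u) v - 1 * Y cR u (1 * u))).
- apply derive_plus.
  + apply derive_const_plus. apply (@derive_RInt_cont (fun s => Y cp s 0)). intros; apply cont_line1; auto.
  + apply is_derive_ext with (fun u => RInt (fun s => Y cR u s) (1 * u) v).
    intros; rewrite Rmult_1_l; reflexivity.
    apply derive_RInt_param with d; auto; try (intros x y _ _; apply CY). rewrite Rabs_R1; lra.
    intros; apply derive_R_u; auto.
- unfold fu; rewrite !Rmult_1_l; ring.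
Qed.
Lemma derive_gg_v u v : Rabs u < d -> Rabs v < d -> is_derive (fun v => gg Y u v) v (gv Y u v).
Proof.
intros Hu Hv. apply derive_eq with (Y cq v 0 + (RInt (fun s => Y cV s v) (a * v) u - a * Y cR (a * v) v)).
- apply derive_plus.
  + apply derive_const_plus. apply (@derive_RInt_cont (fun s => Y cq s 0)). intros; apply cont_line1; auto.
  + apply (@derive_RInt_param (fun v s => Y cR s v) (fun v s => Y cV s v) a v u d); auto using Rabs_a;
    try (intros x y _ _; apply continuity_2d_swap, CY).
    intros x y hx hy; apply (derive_R_v hy hx).
- unfold gv; ring.
Qed.

Definition inball (r : R) u v := Rabs (al Y u - b0) < r /\ Rabs (be Y v - b0) < r.

Lemma inball_ball (r : posreal) u v : inball r u v -> ball o4 r (mk (al Y u) (be Y v) 0 0).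
Proof.
intros [h1 h2]; apply ball4; intros [|[|[|i]]]; simpl; auto;
rewrite Rminus_diag, Rabs_R0; apply cond_pos.
Qed.

Lemma derive_ev_curve E dE (r : posreal) (g h : R -> R) s g' h' :
  Grad (fun z => C0 z /\ ball o4 r z) E dE -> inball r (g s) (h s) ->
  is_derive g s g' -> is_derive h s h' ->
  is_derive (fun s => ev E Y (g s) (h s)) s
    (ev (dE 0%nat) Y (g s) (h s) * (g' * al1 Y (g s)) + ev (dE 1%nat) Y (g s) (h s) * (h' * be1 Y (h s))).
Proof.
intros HG HB Hg Hh.
assert (Dg : is_derive (fun s => al Y (g s)) s (g' * al1 Y (g s)))
  by (apply (is_derive_comp (al Y) g); auto; apply derive_al).
assert (Dh : is_derive (fun s => be Y (h s)) s (h' * be1 Y (h s)))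
  by (apply (is_derive_comp (be Y) h); auto; apply derive_be).
eapply derive_eq. apply (Grad_chain HG) with (2 := Dg) (3 := Dh) (4 := @derive_const 0 s) (5 := @derive_const 0 s).
- destruct HB as [h1 h2].
  generalize (filter_and _ _ (locally_abs_lt (derive_continuous Dg) h1) (locally_abs_lt (derive_continuous Dh) h2)).
  apply filter_imp; intros y [k1 k2]; split. exact I. apply inball_ball; split; auto.
- unfold ev; ring.
Qed.

Lemma derive_ev_u E dE (r : posreal) u v : Grad (fun z => C0 z /\ ball o4 r z) E dE -> inball r u v ->
  is_derive (fun u => ev E Y u v) u (ev (dE 0%nat) Y u v * al1 Y u).
Proof.
intros HG HB. eapply derive_eq.
apply (@derive_ev_curve E dE r (fun u => u) (fun _ => v) u 1 0 HG HB). apply (@is_derive_id R_AbsRing). apply derive_const.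
simpl; ring.
Qed.
Lemma derive_ev_v E dE (r : posreal) u v : Grad (fun z => C0 z /\ ball o4 r z) E dE -> inball r u v ->
  is_derive (fun v => ev E Y u v) v (ev (dE 1%nat) Y u v * be1 Y v).
Proof.
intros HG HB. eapply derive_eq.
apply (@derive_ev_curve E dE r (fun _ => u) (fun v => v) v 0 1 HG HB). apply derive_const. apply (@is_derive_id R_AbsRing).
simpl; ring.
Qed.

Lemma derive_NR_u (r : posreal) u v : Grad (fun z => C0 z /\ ball o4 r z) P dP -> Grad (fun z => C0 z /\ ball o4 r z) Q dQ ->
  inball r u v -> Rabs u < d -> Rabs v < d -> is_derive (fun u => NR Y u v) u (NU Y u v).
Proof.
intros GP GQ HB Hu Hv. eapply derive_eq.
- apply derive_minus; apply derive_mult; [apply derive_mult| |apply derive_mult|].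
  apply (derive_ev_u GP HB). apply derive_const. apply derive_ff_u; auto.
  apply (derive_ev_u GQ HB). apply derive_al1. apply derive_gg_u.
- unfold NU; ring.
Qed.
Lemma derive_NR_v (r : posreal) u v : Grad (fun z => C0 z /\ ball o4 r z) P dP -> Grad (fun z => C0 z /\ ball o4 r z) Q dQ ->
  inball r u v -> Rabs u < d -> Rabs v < d -> is_derive (fun v => NR Y u v) v (NV Y u v).
Proof.
intros GP GQ HB Hu Hv. eapply derive_eq.
- apply derive_minus; apply derive_mult; [apply derive_mult| |apply derive_mult|].
  apply (derive_ev_v GP HB). apply derive_be1. apply derive_ff_v.
  apply (derive_ev_v GQ HB). apply derive_const. apply derive_gg_v; auto.
- unfold NV; ring.
Qed.

Section AlongCurve.
Variables (c : R) (Hc : 0 < c <= 1) (rl : posreal).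
Hypotheses (Glam : Grad (fun z => C0 z /\ ball o4 rl z) lam dlam)
  (Gmu : Grad (fun z => C0 z /\ ball o4 rl z) mu dmu).

Lemma abs_curve s : Rabs s < d -> Rabs (c * s) < d.
Proof. intros H; rewrite Rabs_mult, (Rabs_pos_eq c) by lra. assert (h := Rabs_pos s). nra. Qed.

Lemma derive_ff_curve s : Rabs s < d -> is_derive (fun s => ff Y (c * s) s) s (c * fu Y (c * s) s + Y cR (c * s) s).
Proof.
intros Hs; eapply derive_eq.
apply (@total_derive (fun v u => ff Y u v) (fun v u => Y cR u v) (fun s => s) (fun s => c * s) s 1 c (fu Y (c * s) s) d); auto.
- apply abs_curve, Hs.
- intros v u _ _; apply derive_ff_v.
- apply continuity_2d_swap, CY.
- apply derive_ff_u; auto. apply abs_curve, Hs.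
- apply (@is_derive_id R_AbsRing).
- apply derive_scal_id.
- simpl; ring.
Qed.
Lemma derive_gg_curve s : Rabs s < d -> is_derive (fun s => gg Y (c * s) s) s (c * Y cR (c * s) s + gv Y (c * s) s).
Proof.
intros Hs; eapply derive_eq.
apply (@total_derive (fun u v => gg Y u v) (fun u v => Y cR u v) (fun s => c * s) (fun s => s) s c 1 (gv Y (c * s) s) d); auto.
- apply abs_curve, Hs.
- intros u v _ _; apply derive_gg_u.
- apply derive_gg_v; auto. apply abs_curve, Hs.
- apply derive_scal_id.
- apply (@is_derive_id R_AbsRing).
- simpl; ring.
Qed.

Lemma derive_t1 s : Rabs s < d -> is_derive (t1 c Y) s (t2 c Y s).
Proof.
intros Hs; eapply derive_eq.
apply derive_plus. apply derive_mult. apply derive_const. apply derive_ff_curve, Hs. apply derive_gg_curve, Hs.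
unfold t2; ring.
Qed.
Lemma derive_x1 s : Rabs s < d -> inball rl (c * s) s -> is_derive (x1 c Y) s (x2 c Y s).
Proof.
intros Hs HB; eapply derive_eq.
apply derive_plus.
- apply derive_mult. apply derive_const. apply derive_mult; [|apply derive_ff_curve, Hs].
  apply (@derive_ev_curve lam dlam rl (fun s => c * s) (fun s => s) s c 1); auto. apply derive_scal_id. apply (@is_derive_id R_AbsRing).
- apply derive_mult; [|apply derive_gg_curve, Hs].
  apply (@derive_ev_curve mu dmu rl (fun s => c * s) (fun s => s) s c 1); auto. apply derive_scal_id. apply (@is_derive_id R_AbsRing).
- unfold x2; ring.
Qed.

Hypotheses (HB : forall u v, Rabs u < d -> Rabs v < d -> inball rl u v).

Lemma derive_tc s : Rabs s < d -> is_derive (RInt (t1 c Y) 0) s (t1 c Y s).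
Proof.
intros Hs; apply (@derive_RInt (t1 c Y) 0 s d); auto.
rewrite Rabs_R0; assert (h := Rabs_pos s); lra.
intros y Hy; apply derive_continuous with (1 := derive_t1 Hy).
Qed.
Lemma derive_xc s : Rabs s < d -> is_derive (RInt (x1 c Y) 0) s (x1 c Y s).
Proof.
intros Hs; apply (@derive_RInt (x1 c Y) 0 s d); auto.
rewrite Rabs_R0; assert (h := Rabs_pos s); lra.
intros y Hy; apply derive_continuous with (l := x2 c Y y). apply derive_x1; auto. apply HB; auto. apply abs_curve, Hy.
Qed.

(** Only positive [s]: around such a parameter the curve stays in [D] on both sides, whereas the
    origin is the apex of the cone. *)
Definition inC (D : V4 -> Prop) := forall s, 0 < s < d ->
  D (mk (al Y (c * s)) (be Y s) (RInt (t1 c Y) 0 s) (RInt (x1 c Y) 0 s)).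

Lemma derive_cv D E dE s : Grad D E dE -> inC D -> 0 < s < d -> is_derive (cv c E Y) s (cv1 c dE Y s).
Proof.
intros HG HD Hs. assert (Hsd : Rabs s < d) by (rewrite Rabs_pos_eq; lra).
assert (Dal : is_derive (fun s => al Y (c * s)) s (c * al1 Y (c * s))).
{ apply (@derive_comp_scal (al Y)), derive_al. }
apply (Grad_chain HG) with (2 := Dal) (3 := derive_be s) (4 := derive_tc Hsd) (5 := derive_xc Hsd).
generalize (filter_and _ _ (locally_pos (proj1 Hs)) (locally_abs Hsd)); apply filter_imp.
intros y [h1 h2]; apply HD. rewrite Rabs_pos_eq in h2; lra.
Qed.

Lemma derive_cv1 D dE ddE s : (forall i, (i < 4)%nat -> Grad D (dE i) (ddE i)) -> inC D -> 0 < s < d ->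
  is_derive (cv1 c dE Y) s (cv2 c dE ddE Y s).
Proof.
intros HG HD Hs. assert (Hsd : Rabs s < d) by (rewrite Rabs_pos_eq; lra).
assert (K : forall i, (i < 4)%nat -> is_derive (cv c (dE i) Y) s (cv1 c (ddE i) Y s)) by (intros; apply derive_cv with D; auto).
eapply derive_eq.
- apply (derive_plus (f := fun s => _ + _ + _)); [apply (derive_plus (f := fun s => _ + _)); [apply derive_plus|]|];
    (apply derive_mult; [apply K; lia|]).
  + apply derive_mult. apply derive_const. apply (@derive_comp_scal (al1 Y)), derive_al1.
  + apply derive_be1.
  + apply (derive_t1 Hsd).
  + apply derive_x1; auto. apply HB; auto; apply abs_curve, Hsd.
- unfold cv2; ring.
Qed.

End AlongCurve.
End Regular.

(** [kap] is the ratio [t_u / t_v] on the left shock, [KK] the ratio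
    [t_v / t_u] on the right one. *)
Section Solve.
Variables (k1 k2 : R) (rg : posreal) (kap KK G1 G2 : V4 -> R) (dkap dKK dG1 dG2 : nat -> V4 -> R)
  (ddG1 ddG2 : nat -> nat -> V4 -> R).
Hypotheses (Hlam : C1r C0 o4 rg lam dlam) (Hmu : C1r C0 o4 rg mu dmu)
  (HP : C1r C0 o4 rg P dP) (HQ : C1r C0 o4 rg Q dQ)
  (Hkap : C1r (cone 1 k1) o4 rg kap dkap) (HKK : C1r (cone (-1) k2) o4 rg KK dKK)
  (HG1 : C1r (cone 1 k1) o4 rg G1 dG1) (HdG1 : forall i, C1r (cone 1 k1) o4 rg (dG1 i) (ddG1 i))
  (HG2 : C1r (cone (-1) k2) o4 rg G2 dG2) (HdG2 : forall i, C1r (cone (-1) k2) o4 rg (dG2 i) (ddG2 i))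
  (Hf : 0 < f00) (Hg : 0 < g00)
  (Hx1 : 0 < 1 * (k1 * (1 * f00 + g00) - (1 * (lam o4 * f00) + mu o4 * g00)))
  (Hx2 : 0 < -1 * (k2 * (a * f00 + g00) - (a * (lam o4 * f00) + mu o4 * g00)))
  (Hkap0 : 0 < kap o4) (HkK : kap o4 * KK o4 = 1) (Hfg : f00 = kap o4 * g00)
  (HGa : dG1 0%nat o4 = 0) (HGb : dG2 1%nat o4 = 0) (HGG : dG1 1%nat o4 * dG2 0%nat o4 = a * a)
  (HG10 : G1 o4 = b0) (HG20 : G2 o4 = b0) (Hsl1 : slope 1 dG1 = da) (Hsl2 : slope a dG2 = db).

(** The first four rows are the boundary equations differentiated along their shocks up to the order
    of the unknown: [alpha = G1] and [beta = G2] twice, [t_u = kap t_v] and [t_v = KK t_u] once. *)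
Definition N (Y : unk) : unk := fun c u v =>
  match c with
  | cA => cv2 1 dG1 ddG1 Y (Rmax 0 u)
  | cB => cv2 a dG2 ddG2 Y (Rmax 0 u)
  | cp => cv 1 kap Y (Rmax 0 u) * (1 * Y cR (1 * Rmax 0 u) (Rmax 0 u) + gv Y (1 * Rmax 0 u) (Rmax 0 u))
          + cv1 1 dkap Y (Rmax 0 u) * gg Y (1 * Rmax 0 u) (Rmax 0 u)
  | cq => cv a KK Y (Rmax 0 u) * (a * fu Y (a * Rmax 0 u) (Rmax 0 u) + Y cR (a * Rmax 0 u) (Rmax 0 u))
          + cv1 a dKK Y (Rmax 0 u) * ff Y (a * Rmax 0 u) (Rmax 0 u)
  | cR => NR Y u v
  | cU => NU Y u v
  | cV => NV Y u v
  end.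

Let H1 : 0 < 1 <= 1. Proof. lra. Qed.
Let Ha' : 0 < a <= 1. Proof. lra. Qed.
Let Ht1 : 0 < 1 * f00 + g00. Proof. lra. Qed.
Let Ht2 : 0 < a * f00 + g00. Proof. assert (0 < a * f00) by (apply Rmult_lt_0_compat; lra). lra. Qed.
Let Hcone1 z : cone 1 k1 z <-> 0 <= pr 2 z /\ 0 <= 1 * (k1 * pr 2 z - pr 3 z). Proof. reflexivity. Qed.
Let Hcone2 z : cone (-1) k2 z <-> 0 <= pr 2 z /\ 0 <= -1 * (k2 * pr 2 z - pr 3 z). Proof. reflexivity. Qed.
Let adm_s : adm (fun u v => Rmax 0 u). Proof. apply (adm_max0 adm_fst). Qed.
Let adm_1s : adm (fun u v => 1 * Rmax 0 u). Proof. apply (adm_curve H1 adm_s). Qed.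
Let adm_as : adm (fun u v => a * Rmax 0 u). Proof. apply (adm_curve Ha' adm_s). Qed.

Lemma Low_cv_l E : LipAt (cone 1 k1) o4 E -> Low (E o4) (fun Y u v => cv 1 E Y (Rmax 0 u)).
Proof. apply (Low_cv H1 (proj1 Hlam) (proj1 Hmu) Hcone1 Ht1 Hx1). Qed.
Lemma Low_cv_r E : LipAt (cone (-1) k2) o4 E -> Low (E o4) (fun Y u v => cv a E Y (Rmax 0 u)).
Proof. apply (Low_cv Ha' (proj1 Hlam) (proj1 Hmu) Hcone2 Ht2 Hx2). Qed.
Lemma Low_cv1_l dE : (forall i, LipAt (cone 1 k1) o4 (dE i)) -> Low (slope 1 dE) (fun Y u v => cv1 1 dE Y (Rmax 0 u)).
Proof. apply (Low_cv1 H1 (proj1 Hlam) (proj1 Hmu) Hcone1 Ht1 Hx1). Qed.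
Lemma Low_cv1_r dE : (forall i, LipAt (cone (-1) k2) o4 (dE i)) -> Low (slope a dE) (fun Y u v => cv1 a dE Y (Rmax 0 u)).
Proof. apply (Low_cv1 Ha' (proj1 Hlam) (proj1 Hmu) Hcone2 Ht2 Hx2). Qed.

Lemma Gr_Np : exists e, Gr (lin 0 0 0 (kap o4) e) (fun Y => N Y cp).
Proof.
eexists; eapply Gr_eq; [|apply Gr_plus].
2: apply Gr_mult; [apply Low_cv_l, Hkap|apply Gr_plus; [apply Gr_mult; [apply Low_const|]|]].
2: apply (Gr_cR adm_1s adm_s). 2: apply (Gr_gv adm_1s adm_s).
2: eapply Low_Gr, Low_mult; [apply Low_cv1_l, Hkap|apply (Low_gg adm_1s adm_s)].
intros []; simpl; try reflexivity; try ring. rewrite (Rabs_pos_eq (kap o4)) by lra; ring.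
Qed.

(** The factor [a] comes from differentiating [t_u (a s, s)] in its first argument. It alone brings
    the gain of the cycle of [cp] and [cq] below one, because [kap] and [KK] are inverse to each
    other at the origin. *)
Lemma Gr_Nq : exists e, Gr (lin 0 0 (KK o4 * a) 0 e) (fun Y => N Y cq).
Proof.
assert (K0 : 0 < KK o4).
{ apply Rmult_lt_reg_l with (kap o4); auto. rewrite HkK; lra. }
eexists; eapply Gr_eq; [|apply Gr_plus].
2: apply Gr_mult; [apply Low_cv_r, HKK|apply Gr_plus; [apply Gr_mult; [apply Low_const|]|]].
2: apply (Gr_fu adm_as adm_s). 2: apply (Gr_cR adm_as adm_s).
2: eapply Low_Gr, Low_mult; [apply Low_cv1_r, HKK|apply (Low_ff adm_as adm_s)].
intros []; simpl; try reflexivity; try ring.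
rewrite (Rabs_pos_eq (KK o4)), (Rabs_pos_eq a) by lra; ring.
Qed.

Lemma Gr_NA : exists ep eq eR, Gr (lin 0 (Rabs (dG1 1%nat o4)) ep eq eR) (fun Y => N Y cA).
Proof.
destruct (Gr_cv2 H1 (proj1 Hlam) (proj1 Hmu) (proj1 (proj2 Hlam)) (proj1 (proj2 Hmu)) Hcone1 Ht1 Hx1
  (dE := dG1) (ddE := ddG1)) as (e1 & e2 & e3 & H).
intros i; apply HdG1. intros i j; apply HdG1.
exists e1, e2, e3; revert H; apply Gr_eq; intros []; simpl; auto. rewrite HGa, Rabs_R0; ring.
Qed.

Lemma Gr_NB : exists ep eq eR, Gr (lin (a * a * Rabs (dG2 0%nat o4)) 0 ep eq eR) (fun Y => N Y cB).
Proof.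
destruct (Gr_cv2 Ha' (proj1 Hlam) (proj1 Hmu) (proj1 (proj2 Hlam)) (proj1 (proj2 Hmu)) Hcone2 Ht2 Hx2
  (dE := dG2) (ddE := ddG2)) as (e1 & e2 & e3 & H).
intros i; apply HdG2. intros i j; apply HdG2.
exists e1, e2, e3; revert H; apply Gr_eq; intros []; simpl; auto. rewrite HGb, Rabs_R0; ring.
Qed.

Lemma al_be_near m r : 0 < r -> exists r0, 0 < r0 /\ forall Y u v, inX m Y -> sq r0 u v -> inball Y r u v.
Proof.
intros Hr.
destruct (Low_near m (Low_al adm_fst) (locally_ball b0 (mkposreal r Hr))) as (r1 & Hr1 & K1).
destruct (Low_near m (Low_be adm_snd) (locally_ball b0 (mkposreal r Hr))) as (r2 & Hr2 & K2).
exists (Rmin r1 r2); split. apply Rmin_glb_lt; auto.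
intros Y u v HY Hs; split; [apply (K1 Y u v)|apply (K2 Y u v)]; auto;
apply sq_le with (1 := Hs); [apply Rmin_l|apply Rmin_r].
Qed.

Lemma curve_near c sg k m : 0 < c <= 1 -> 0 < c * f00 + g00 ->
  0 < sg * (k * (c * f00 + g00) - (c * (lam o4 * f00) + mu o4 * g00)) ->
  exists r0, 0 < r0 /\ forall Y s, inX m Y -> 0 <= s <= r0 ->
   let z := mk (al Y (c * s)) (be Y s) (RInt (t1 c Y) 0 s) (RInt (x1 c Y) 0 s) in
   cone sg k z /\ ball o4 rg z.
Proof.
intros Hc Ht Hx.
destruct (RInt_pos_cone Hc (proj1 Hlam) (proj1 Hmu) Ht Hx m) as (r1 & Hr1 & K1).
destruct (al_be_near m (cond_pos rg)) as (r2 & Hr2 & K2).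
destruct (Low_near m (Low_tc Hc adm_fst) (locally_ball 0 rg)) as (r3 & Hr3 & K3).
destruct (Low_near m (Low_xc Hc (proj1 Hlam) (proj1 Hmu) adm_fst) (locally_ball 0 rg)) as (r4 & Hr4 & K4).
exists (Rmin (Rmin r1 r2) (Rmin r3 r4)); split. repeat apply Rmin_glb_lt; auto.
assert (h1 := Rmin_l (Rmin r1 r2) (Rmin r3 r4)). assert (h2 := Rmin_r (Rmin r1 r2) (Rmin r3 r4)).
assert (h3 := Rmin_l r1 r2). assert (h4 := Rmin_r r1 r2). assert (h5 := Rmin_l r3 r4). assert (h6 := Rmin_r r3 r4).
intros Y s HY Hs z; split. apply K1; auto; lra.
assert (Hsq : forall r, Rmin (Rmin r1 r2) (Rmin r3 r4) <= r -> sq r s 0).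
{ intros r Hr; split; [rewrite Rabs_pos_eq; lra|rewrite Rabs_R0; lra]. }
assert (Hsq2 : sq r2 (c * s) s).
{ split; [rewrite Rabs_mult, (Rabs_pos_eq c), (Rabs_pos_eq s) by lra; nra | rewrite Rabs_pos_eq; lra]. }
destruct (K2 Y _ _ HY Hsq2) as [A1 A2].
apply ball4; intros [|[|[|i]]]; simpl; auto.
apply (K3 Y s 0); auto; apply Hsq; lra. apply (K4 Y s 0); auto; apply Hsq; lra.
Qed.

(** The rows [cU] and [cV] are the formal partial derivatives of the row [cR]. They are its true
    partial derivatives once the components of [Y] are compatible, since [fu] and [gv] come from
    differentiating [cR] under the integral sign. *)
Lemma Pr_step m : exists r0, 0 < r0 /\ forall d Y, 0 < d <= r0 -> inX m Y -> Pr d Y -> Pr d (step N d Y).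
Proof.
destruct (al_be_near m (cond_pos rg)) as (r1 & Hr1 & K1).
destruct (Gr_NU (proj1 HP) (proj1 HQ) (proj1 (proj2 HP)) (proj1 (proj2 HQ))) as (x1 & x2 & x3 & GU).
destruct (Gr_NV (proj1 HP) (proj1 HQ) (proj1 (proj2 HP)) (proj1 (proj2 HQ))) as (y1 & y2 & y3 & GV).
destruct (Gr_cont m GU) as (r2 & Hr2 & K2). destruct (Gr_cont m GV) as (r3 & Hr3 & K3).
exists (Rmin r1 (Rmin r2 r3)); split. repeat apply Rmin_glb_lt; auto.
assert (h1 := Rmin_l r1 (Rmin r2 r3)). assert (h2 := Rmin_r r1 (Rmin r2 r3)).
assert (h3 := Rmin_l r2 r3). assert (h4 := Rmin_r r2 r3).
intros d Y Hd HY HPr.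
assert (Hsq : forall r u v, Rmin r1 (Rmin r2 r3) <= r -> Rabs u < d -> Rabs v < d -> sq r u v)
  by (intros; split; lra).
assert (CY : forall c u v, continuity_2d_pt (Y c) u v) by (intros c u v; exact (proj2 (HY c u v))).
assert (Btw : forall x y s, Rabs x < d -> Rabs y < d -> Rmin x y < s < Rmax x y -> Rabs s < d).
{ intros x y s hx hy hs; apply Rle_lt_trans with (Rmax (Rabs x) (Rabs y)); [|apply Rmax_lub_lt; auto].
  apply (between_abs (Rmax_l _ _) (Rmax_r _ _)) with (1 := conj (Rlt_le _ _ (proj1 hs)) (Rlt_le _ _ (proj2 hs))). }
split; [intros u1 u2 v hu1 hu2 hv|intros v u1 u2 hv hu1 hu2]; unfold step; rewrite !clamp_id by lra; simpl.
- rewrite (RInt_ext _ (fun s => NU Y s v)).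
  2:{ intros s Hs; rewrite clamp_id; auto. apply Rlt_le, (Btw u1 u2); auto. }
  symmetry; apply (@RInt_derive_open (fun s => NR Y s v) (fun s => NU Y s v) d); auto.
  + intros u Hu; exact (derive_NR_u CY HPr (proj2 (proj2 HP)) (proj2 (proj2 HQ)) (K1 Y u v HY (Hsq _ _ _ h1 Hu hv)) Hu hv).
  + intros u Hu; apply continuity_2d_line, K2; auto; apply Hsq; auto; lra.
- rewrite (RInt_ext _ (fun s => NV Y v s)).
  2:{ intros s Hs; rewrite clamp_id; auto. apply Rlt_le, (Btw u1 u2); auto. }
  symmetry; apply (@RInt_derive_open (fun s => NR Y v s) (fun s => NV Y v s) d); auto.
  + intros u Hu; exact (derive_NR_v CY HPr (proj2 (proj2 HP)) (proj2 (proj2 HQ)) (K1 Y v u HY (Hsq _ _ _ h1 hv Hu)) hv Hu).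
  + intros u Hu; apply (continuity_2d_line (f := fun t y => NV Y y t) (y := v)), continuity_2d_swap, K3; auto; apply Hsq; auto; lra.
Qed.

Lemma solution : exists m, forall r1, 0 < r1 -> exists d Y, 0 < d <= r1 /\ inX m Y /\ Pr d Y /\
  forall c u v, Y c u v = step N d Y c u v.
Proof.
destruct Gr_NA as (xA1 & xA2 & xA3 & [kA GA]). destruct Gr_NB as (xB1 & xB2 & xB3 & [kB GB]).
destruct Gr_Np as (xp & [kp Gp]). destruct Gr_Nq as (xq & [kq Gq]).
destruct (Gr_NU (proj1 HP) (proj1 HQ) (proj1 (proj2 HP)) (proj1 (proj2 HQ))) as (xU1 & xU2 & xU3 & [kU GU]).
destruct (Gr_NV (proj1 HP) (proj1 HQ) (proj1 (proj2 HP)) (proj1 (proj2 HQ))) as (xV1 & xV2 & xV3 & [kV GV]).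
destruct (Low_Gr (Low_NR (proj1 HP) (proj1 HQ))) as [kR GR].
destruct (@weights a (kap o4) (KK o4) (dG1 1%nat o4) (dG2 0%nat o4) (xA1, xA2, xA3) (xB1, xB2, xB3)
  (xU1, xU2, xU3) (xV1, xV2, xV3) xp xq Ha Hkap0 HkK HGG) as (w & th & Hw & Hth & WA & WB & Wp & Wq & WR & WU & WV).
simpl in *.
apply (@fixed_point N
  (fun c => match c with cA => kA | cB => kB | cp => kp | cq => kq | cR => kR | cU => kU | cV => kV end)
  (fun c => match c with cA => lin 0 (Rabs (dG1 1%nat o4)) xA1 xA2 xA3 | cB => lin (a * a * Rabs (dG2 0%nat o4)) 0 xB1 xB2 xB3
     | cp => lin 0 0 0 (kap o4) xp | cq => lin 0 0 (KK o4 * a) 0 xq | cR => fun _ => 0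
     | cU => lin xU1 0 xU2 0 xU3 | cV => lin 0 xV1 0 xV2 xV3 end) w th); auto.
- intros []; assumption.
- intros []; assumption.
- apply Pr_zero.
- apply Pr_step.
- intros d Yn Y; apply Pr_lim.
Qed.

Definition nearX m (Phi : unk -> R -> R -> Prop) : Prop :=
  exists r0, 0 < r0 /\ forall Y u v, inX m Y -> sq r0 u v -> Phi Y u v.

Lemma nearX_and m Phi Psi : nearX m Phi -> nearX m Psi -> nearX m (fun Y u v => Phi Y u v /\ Psi Y u v).
Proof.
intros (r1 & Hr1 & K1) (r2 & Hr2 & K2); exists (Rmin r1 r2); split. apply Rmin_glb_lt; auto.
intros Y u v HY Hs; split; [apply K1|apply K2]; auto; apply sq_le with (1 := Hs); [apply Rmin_l|apply Rmin_r].
Qed.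

Lemma curve_nearX c sg k m : 0 < c <= 1 -> 0 < c * f00 + g00 ->
  0 < sg * (k * (c * f00 + g00) - (c * (lam o4 * f00) + mu o4 * g00)) ->
  nearX m (fun Y s _ => 0 <= s -> let z := mk (al Y (c * s)) (be Y s) (RInt (t1 c Y) 0 s) (RInt (x1 c Y) 0 s) in
   cone sg k z /\ ball o4 rg z).
Proof.
intros h1 h2 h3; destruct (curve_near m h1 h2 h3) as (r & Hr & K); exists r; split; auto.
intros Y s v HY [Hs _] Hs0; apply K; auto. rewrite Rabs_pos_eq in Hs; auto.
Qed.

Hypothesis HPQ : forall z, ball o4 rg z ->
  P z * (mu z - lam z) = dlam 1%nat z /\ Q z * (mu z - lam z) = dmu 0%nat z.

(** What the fixed point provides, freed from the unknown [Y]: equations on an open square, where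
    ordinary derivatives exist, and shock conditions at nonnegative parameters, where the curves lie
    in the cones. *)
Record core_solution (d : R) (al al1 al2 be be1 be2 : R -> R) (t x f g fu r gv : R -> R -> R) : Prop := {
  cs_al : forall u, Rabs u < d -> is_derive al u (al1 u) /\ is_derive al1 u (al2 u) /\ continuous al2 u;
  cs_be : forall v, Rabs v < d -> is_derive be v (be1 v) /\ is_derive be1 v (be2 v) /\ continuous be2 v;
  cs_t : forall u v, Rabs u < d -> Rabs v < d ->
    is_derive (fun u => t u v) u (f u v) /\ is_derive (fun v => t u v) v (g u v);
  cs_x : forall u v, Rabs u < d -> Rabs v < d ->
    is_derive (fun u => x u v) u (lam (mk (al u) (be v) 0 0) * f u v) /\
    is_derive (fun v => x u v) v (mu (mk (al u) (be v) 0 0) * g u v);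
  cs_f : forall u v, Rabs u < d -> Rabs v < d ->
    is_derive (fun u => f u v) u (fu u v) /\ is_derive (fun v => f u v) v (r u v);
  cs_g : forall u v, Rabs u < d -> Rabs v < d ->
    is_derive (fun u => g u v) u (r u v) /\ is_derive (fun v => g u v) v (gv u v);
  cs_cont : cont_on d fu /\ cont_on d r /\ cont_on d gv;
  cs_left : forall s, 0 <= s < d -> let z := mk (al s) (be s) (t s s) (x s s) in
    cone 1 k1 z /\ f s s = kap z * g s s /\ al s = G1 z;
  cs_right : forall s, 0 <= s < d -> let z := mk (al (a * s)) (be s) (t (a * s) s) (x (a * s) s) in
    cone (-1) k2 z /\ g (a * s) s = KK z * f (a * s) s /\ be s = G2 z;
  cs_0 : al 0 = b0 /\ be 0 = b0 /\ al1 0 = da /\ be1 0 = db /\ t 0 0 = 0 /\ x 0 0 = 0 /\ f 0 0 = f00 /\ g 0 0 = g00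
}.

Lemma al_0 Y : al Y 0 = b0.
Proof. unfold al; rewrite RInt_point; unfold zero; simpl; ring. Qed.
Lemma be_0 Y : be Y 0 = b0.
Proof. unfold be; rewrite RInt_point; unfold zero; simpl; ring. Qed.
Lemma al1_0 Y : al1 Y 0 = da.
Proof. unfold al1; rewrite RInt_point; unfold zero; simpl; ring. Qed.
Lemma be1_0 Y : be1 Y 0 = db.
Proof. unfold be1; rewrite RInt_point; unfold zero; simpl; ring. Qed.
Lemma ff_0 Y : ff Y 0 0 = f00.
Proof. unfold ff; rewrite !RInt_point; unfold zero; simpl; ring. Qed.
Lemma gg_0 Y : gg Y 0 0 = g00.
Proof. unfold gg; rewrite Rmult_0_r, !RInt_point; unfold zero; simpl; ring. Qed.
Lemma cv_0 c E Y : cv c E Y 0 = E o4.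
Proof. unfold cv; rewrite !RInt_point, Rmult_0_r, al_0, be_0; reflexivity. Qed.
Lemma cv1_0 c dE Y : cv1 c dE Y 0 = slope c dE.
Proof.
unfold cv1, slope, t1, x1, ev; rewrite !cv_0, Rmult_0_r, al1_0, be1_0, ff_0, gg_0, al_0, be_0; reflexivity.
Qed.

Lemma core : exists d al al1 al2 be be1 be2 t x f g fu r gv,
  0 < d /\ core_solution d al al1 al2 be be1 be2 t x f g fu r gv.
Proof.
destruct solution as [m Hsol].
destruct Hlam as (LL & LdL & GL), Hmu as (LM & LdM & GM), HP as (LP & _ & GP), HQ as (LQ & _ & GQ).
destruct Hkap as (Lk & Ldk & Gk), HKK as (LK & LdK & GK), HG1 as (LG1 & LdG1 & GG1), HG2 as (LG2 & LdG2 & GG2).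
(* All properties that hold near the origin for unknowns bounded by [m] are collected in one radius,
   before [d] and [Y] are chosen. *)
assert (NX : nearX m (fun Y u v => inball Y rg u v /\
  (continuity_2d_pt (ff Y) u v /\ continuity_2d_pt (gg Y) u v /\ continuity_2d_pt (ev lam Y) u v /\
    continuity_2d_pt (ev mu Y) u v /\ continuity_2d_pt (ev (dlam 1%nat) Y) u v /\
    continuity_2d_pt (fun _ v => be1 Y v) u v) /\
   (continuity_2d_pt (fun u v => ff Y (1 * Rmax 0 u) (Rmax 0 u)) u v /\
    continuity_2d_pt (fun u v => gg Y (1 * Rmax 0 u) (Rmax 0 u)) u v /\
    continuity_2d_pt (fun u v => ff Y (a * Rmax 0 u) (Rmax 0 u)) u v /\
    continuity_2d_pt (fun u v => gg Y (a * Rmax 0 u) (Rmax 0 u)) u v) /\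
   (continuity_2d_pt (fun u v => al Y (Rmax 0 u)) u v /\ continuity_2d_pt (fun u v => al1 Y (Rmax 0 u)) u v /\
    continuity_2d_pt (fun u v => be Y (Rmax 0 u)) u v /\ continuity_2d_pt (fun u v => be1 Y (Rmax 0 u)) u v) /\
   (continuity_2d_pt (fun u v => cv 1 kap Y (Rmax 0 u)) u v /\ continuity_2d_pt (fun u v => cv a KK Y (Rmax 0 u)) u v /\
    continuity_2d_pt (fun u v => cv 1 G1 Y (Rmax 0 u)) u v /\ continuity_2d_pt (fun u v => cv a G2 Y (Rmax 0 u)) u v /\
    continuity_2d_pt (fun u v => cv1 1 dG1 Y (Rmax 0 u)) u v /\ continuity_2d_pt (fun u v => cv1 a dG2 Y (Rmax 0 u)) u v) /\
  (continuity_2d_pt (fu Y) u v /\ continuity_2d_pt (gv Y) u v) /\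
  ((0 <= u -> let z := mk (al Y (1 * u)) (be Y u) (RInt (t1 1 Y) 0 u) (RInt (x1 1 Y) 0 u) in
     cone 1 k1 z /\ ball o4 rg z) /\
   (0 <= u -> let z := mk (al Y (a * u)) (be Y u) (RInt (t1 a Y) 0 u) (RInt (x1 a Y) 0 u) in
     cone (-1) k2 z /\ ball o4 rg z)))).
{ repeat match goal with |- nearX _ (fun _ _ _ => _ /\ _) => apply nearX_and end.
  - exact (al_be_near m (cond_pos rg)).
  - exact (Low_cont m (Low_ff adm_fst adm_snd)).
  - exact (Low_cont m (Low_gg adm_fst adm_snd)).
  - exact (Low_cont m (Low_ev LL adm_fst adm_snd)).
  - exact (Low_cont m (Low_ev LM adm_fst adm_snd)).
  - exact (Low_cont m (Low_ev (LdL 1%nat) adm_fst adm_snd)).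
  - exact (Low_cont m (Low_be1 adm_snd)).
  - exact (Low_cont m (Low_ff adm_1s adm_s)).
  - exact (Low_cont m (Low_gg adm_1s adm_s)).
  - exact (Low_cont m (Low_ff adm_as adm_s)).
  - exact (Low_cont m (Low_gg adm_as adm_s)).
  - exact (Low_cont m (Low_al adm_s)).
  - exact (Low_cont m (Low_al1 adm_s)).
  - exact (Low_cont m (Low_be adm_s)).
  - exact (Low_cont m (Low_be1 adm_s)).
  - exact (Low_cont m (Low_cv_l Lk)).
  - exact (Low_cont m (Low_cv_r LK)).
  - exact (Low_cont m (Low_cv_l LG1)).
  - exact (Low_cont m (Low_cv_r LG2)).
  - exact (Low_cont m (Low_cv1_l LdG1)).
  - exact (Low_cont m (Low_cv1_r LdG2)).
  - exact (Gr_cont m (Gr_fu adm_fst adm_snd)).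
  - exact (Gr_cont m (Gr_gv adm_fst adm_snd)).
  - exact (curve_nearX m H1 Ht1 Hx1).
  - exact (curve_nearX m Ha' Ht2 Hx2). }
destruct NX as (r1 & Hr1 & NX). destruct (Hsol r1 Hr1) as (d & Y & Hd & XY & HPr & Fix).
exists d, (al Y), (al1 Y), (fun u => Y cA u 0), (be Y), (be1 Y), (fun u => Y cB u 0).
exists (potential (ff Y) (gg Y)), (potential (fun u v => ev lam Y u v * ff Y u v) (fun u v => ev mu Y u v * gg Y u v)).
exists (ff Y), (gg Y), (fu Y), (Y cR), (gv Y).
split; [lra|].
assert (CY : forall c u v, continuity_2d_pt (Y c) u v) by (intros c u v; exact (proj2 (XY c u v))).
assert (K : forall u v, Rabs u < d -> Rabs v < d -> sq r1 u v) by (intros; split; lra).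
assert (HB : forall u v, Rabs u < d -> Rabs v < d -> inball Y rg u v) by (intros; apply (NX Y u v XY), K; auto).
assert (R0 : Rabs 0 < d) by (rewrite Rabs_R0; lra).
assert (FX : forall c u v, Rabs u < d -> Rabs v < d -> Y c u v = N Y c u v).
{ intros c u v hu hv; rewrite Fix; unfold step; rewrite !clamp_id by lra; auto. }
assert (FX0 : forall c s, 0 <= s < d -> Y c s 0 = N Y c s 0).
{ intros c s Hs; apply FX; auto. rewrite Rabs_pos_eq; lra. }
assert (Cff : cont_on d (ff Y)) by (intros u v hu hv; apply (NX Y u v XY), K; auto).
assert (Cgg : cont_on d (gg Y)) by (intros u v hu hv; apply (NX Y u v XY), K; auto).
assert (CR : cont_on d (Y cR)) by (intros u v hu hv; apply CY).
assert (Cphi : cont_on d (fun u v => ev lam Y u v * ff Y u v)).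
{ intros u v hu hv; apply continuity_2d_pt_mult; auto; apply (NX Y u v XY), K; auto. }
assert (Cpsi : cont_on d (fun u v => ev mu Y u v * gg Y u v)).
{ intros u v hu hv; apply continuity_2d_pt_mult; auto; apply (NX Y u v XY), K; auto. }
assert (Pt : forall u v, Rabs u < d -> Rabs v < d ->
  is_derive (fun u => potential (ff Y) (gg Y) u v) u (ff Y u v) /\
  is_derive (fun v => potential (ff Y) (gg Y) u v) v (gg Y u v)).
{ intros u v hu hv; apply potential_derive with (Y cR) d; auto; intros u' v' _ _;
  [apply derive_ff_v|apply derive_gg_u]; auto. }
assert (Px : forall u v, Rabs u < d -> Rabs v < d ->
  is_derive (fun u => potential (fun u v => ev lam Y u v * ff Y u v) (fun u v => ev mu Y u v * gg Y u v) u v) u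
    (ev lam Y u v * ff Y u v) /\
  is_derive (fun v => potential (fun u v => ev lam Y u v * ff Y u v) (fun u v => ev mu Y u v * gg Y u v) u v) v
    (ev mu Y u v * gg Y u v)).
{ intros u v hu hv.
  apply (@potential_derive (fun u v => ev lam Y u v * ff Y u v) (fun u v => ev mu Y u v * gg Y u v)
    (fun u v => ev (dlam 1%nat) Y u v * be1 Y v * ff Y u v + ev lam Y u v * Y cR u v) d u v); auto.
  - intros u' v' hu' hv'. destruct (NX Y u' v' XY (K _ _ hu' hv')) as (_ & (q1 & _ & q2 & _ & q3 & q4) & _).
    apply continuity_2d_pt_plus; repeat apply continuity_2d_pt_mult;
      first [exact q1|exact q2|exact q3|exact q4|apply CY].
  - intros u' v' hu' hv'. eapply derive_eq.
    apply derive_mult. apply (derive_ev_v CY GL (HB _ _ hu' hv')). apply derive_ff_v; auto. reflexivity.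
  - intros u' v' hu' hv'. eapply derive_eq.
    apply derive_mult. apply (derive_ev_u CY GM (HB _ _ hu' hv')). apply derive_gg_u; auto.
    (* The fixed point equation for [cR] is the closedness of [lam t_u du + mu t_v dv], which makes
       [x] well defined. *)
    destruct (HPQ (inball_ball (HB _ _ hu' hv'))) as [E1 E2].
    assert (E3 := FX cR u' v' hu' hv'). simpl in E3. unfold NR, ev in E3.
    unfold ev. rewrite <- E1, <- E2, E3. ring. }
(* The states ahead were evaluated at the integrals of [t1] and [x1]; along the shocks these are the
   values of the potentials [t] and [x]. *)
assert (Tc : forall c s, 0 < c <= 1 -> 0 <= s < d -> potential (ff Y) (gg Y) (c * s) s = RInt (t1 c Y) 0 s).
{ intros c s Hc Hs. assert (Hsd : Rabs s < d) by (rewrite Rabs_pos_eq; lra).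
  rewrite (@RInt_derive_open (fun s => potential (ff Y) (gg Y) (c * s) s) (t1 c Y) d 0 s); auto.
  - unfold potential at 3. rewrite Rmult_0_r, !RInt_point. unfold zero; simpl; ring.
  - intros y Hy. eapply derive_eq.
    apply (@total_derive (potential (ff Y) (gg Y)) (ff Y) (fun s => c * s) (fun s => s) y c 1 (gg Y (c * y) y) d); auto.
    + apply abs_curve; auto.
    + intros; apply Pt; auto.
    + apply Cff; auto. apply abs_curve; auto.
    + apply Pt; auto. apply abs_curve; auto.
    + apply derive_scal_id.
    + apply (@is_derive_id R_AbsRing).
    + unfold t1; simpl; ring.
  - intros y Hy; apply derive_continuous with (t2 c Y y). apply derive_t1 with d; auto. }
assert (Xc : forall c s, 0 < c <= 1 -> 0 <= s < d ->
  potential (fun u v => ev lam Y u v * ff Y u v) (fun u v => ev mu Y u v * gg Y u v) (c * s) s = RInt (x1 c Y) 0 s).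
{ intros c s Hc Hs. assert (Hsd : Rabs s < d) by (rewrite Rabs_pos_eq; lra).
  set (F := potential (fun u v => ev lam Y u v * ff Y u v) (fun u v => ev mu Y u v * gg Y u v)) in *.
  rewrite (@RInt_derive_open (fun s => F (c * s) s) (x1 c Y) d 0 s); auto.
  - unfold F at 3, potential. rewrite Rmult_0_r, !RInt_point. unfold zero; simpl; ring.
  - intros y Hy. eapply derive_eq.
    apply (@total_derive F (fun u v => ev lam Y u v * ff Y u v) (fun s => c * s) (fun s => s) y c 1 (ev mu Y (c * y) y * gg Y (c * y) y) d); auto.
    + apply abs_curve; auto.
    + intros; apply Px; auto.
    + apply Cphi; auto. apply abs_curve; auto.
    + apply Px; auto. apply abs_curve; auto.
    + apply derive_scal_id.
    + apply (@is_derive_id R_AbsRing).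
    + unfold x1; simpl; ring.
  - intros y Hy; apply derive_continuous with (x2 c Y y). apply (derive_x1 CY HPr Hc GL GM); auto. apply HB; auto. apply abs_curve; auto. }
assert (CV : forall c E s, 0 < c <= 1 -> 0 <= s < d ->
  cv c E Y s = E (mk (al Y (c * s)) (be Y s) (potential (ff Y) (gg Y) (c * s) s)
     (potential (fun u v => ev lam Y u v * ff Y u v) (fun u v => ev mu Y u v * gg Y u v) (c * s) s))).
{ intros c E s Hc Hs; rewrite Tc, Xc; auto. }
assert (IC1 : inC Y d 1 (fun z => cone 1 k1 z /\ ball o4 rg z)).
{ intros s Hs; apply (NX Y s 0 XY); [|lra]. apply K; auto. rewrite Rabs_pos_eq; lra. }
assert (IC2 : inC Y d a (fun z => cone (-1) k2 z /\ ball o4 rg z)).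
{ intros s Hs; apply (NX Y s 0 XY); [|lra]. apply K; auto. rewrite Rabs_pos_eq; lra. }
assert (HCv : forall c C E dE s, 0 < c <= 1 -> Grad (fun z => C z /\ ball o4 rg z) E dE ->
  inC Y d c (fun z => C z /\ ball o4 rg z) -> 0 < s < d -> is_derive (cv c E Y) s (cv1 c dE Y s)).
{ intros c C E dE s Hc HG HI Hs. apply (derive_cv CY HPr Hc GL GM HB HG HI Hs). }
assert (HCv1 : forall c C dE ddE s, 0 < c <= 1 -> (forall i, Grad (fun z => C z /\ ball o4 rg z) (dE i) (ddE i)) ->
  inC Y d c (fun z => C z /\ ball o4 rg z) -> 0 < s < d -> is_derive (cv1 c dE Y) s (cv2 c dE ddE Y s)).
{ intros c C dE ddE s Hc HG HI Hs. apply (derive_cv1 CY HPr Hc GL GM HB (fun i _ => HG i) HI Hs). }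
(* The undifferentiated boundary equations are recovered by integration: the difference of the two
   sides vanishes at the origin, and its derivative is zero by the fixed point equation. *)
assert (BL : forall s, 0 <= s < d -> ff Y (1 * s) s - cv 1 kap Y s * gg Y (1 * s) s = 0).
{ intros s Hs. rewrite (@zero_of_derive (fun s => ff Y (1 * s) s - cv 1 kap Y s * gg Y (1 * s) s) d); auto.
  - rewrite Rmult_0_r, cv_0, ff_0, gg_0, Hfg; ring.
  - intros u Hu. destruct (NX Y u 0 XY (K _ _ Hu R0)) as (_ & _ & (q1 & q2 & _) & _ & (q3 & _) & _).
    apply continuity_2d_pt_minus; [|apply continuity_2d_pt_mult]; auto.
  - intros y Hy. assert (Hyd : Rabs y < d) by (rewrite Rabs_pos_eq; lra). eapply derive_eq.
    apply derive_minus. apply (derive_ff_curve CY HPr H1 Hyd).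
    apply derive_mult. apply (HCv _ _ _ _ _ H1 Gk IC1 Hy). apply (derive_gg_curve CY HPr H1 Hyd).
    simpl. assert (E := FX0 cp y ltac:(lra)). simpl in E. rewrite Rmax_right in E by lra.
    unfold fu. rewrite (Rmult_1_l y) in *. rewrite RInt_point, E. unfold zero; simpl; ring. }
assert (BR : forall s, 0 <= s < d -> gg Y (a * s) s - cv a KK Y s * ff Y (a * s) s = 0).
{ intros s Hs. rewrite (@zero_of_derive (fun s => gg Y (a * s) s - cv a KK Y s * ff Y (a * s) s) d); auto.
  - rewrite Rmult_0_r, cv_0, ff_0, gg_0, Hfg. transitivity (g00 * (1 - kap o4 * KK o4)). ring. rewrite HkK; ring.
  - intros u Hu. destruct (NX Y u 0 XY (K _ _ Hu R0)) as (_ & _ & (_ & _ & q1 & q2) & _ & (_ & q3 & _) & _).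
    apply continuity_2d_pt_minus; [|apply continuity_2d_pt_mult]; auto.
  - intros y Hy. assert (Hyd : Rabs y < d) by (rewrite Rabs_pos_eq; lra). eapply derive_eq.
    apply derive_minus. apply (derive_gg_curve CY HPr Ha' Hyd).
    apply derive_mult. apply (HCv _ _ _ _ _ Ha' GK IC2 Hy). apply (derive_ff_curve CY HPr Ha' Hyd).
    simpl. assert (E := FX0 cq y ltac:(lra)). simpl in E. rewrite Rmax_right in E by lra.
    unfold gv. rewrite RInt_point, E. unfold zero; simpl; ring. }
(* The equations for [alpha] and [beta] were differentiated twice, so they are integrated twice; the
   initial slopes are the constants of the first integration. *)
assert (AL1 : forall s, 0 <= s < d -> al1 Y s - cv1 1 dG1 Y s = 0).
{ intros s Hs. rewrite (@zero_of_derive (fun s => al1 Y s - cv1 1 dG1 Y s) d); auto.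
  - rewrite cv1_0, al1_0, Hsl1; ring.
  - intros u Hu. destruct (NX Y u 0 XY (K _ _ Hu R0)) as (_ & _ & _ & (_ & q1 & _) & (_ & _ & _ & _ & q2 & _) & _).
    apply continuity_2d_pt_minus; auto.
  - intros y Hy. eapply derive_eq.
    apply derive_minus. apply derive_al1; auto.
    apply (HCv1 _ _ _ _ _ H1 (fun i => proj2 (proj2 (HdG1 i))) IC1 Hy).
    simpl. assert (E := FX0 cA y ltac:(lra)). simpl in E. rewrite Rmax_right in E by lra. rewrite E; ring. }
assert (BE1 : forall s, 0 <= s < d -> be1 Y s - cv1 a dG2 Y s = 0).
{ intros s Hs. rewrite (@zero_of_derive (fun s => be1 Y s - cv1 a dG2 Y s) d); auto.
  - rewrite cv1_0, be1_0, Hsl2; ring.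
  - intros u Hu. destruct (NX Y u 0 XY (K _ _ Hu R0)) as (_ & _ & _ & (_ & _ & _ & q1) & (_ & _ & _ & _ & _ & q2) & _).
    apply continuity_2d_pt_minus; auto.
  - intros y Hy. eapply derive_eq.
    apply derive_minus. apply derive_be1; auto.
    apply (HCv1 _ _ _ _ _ Ha' (fun i => proj2 (proj2 (HdG2 i))) IC2 Hy).
    simpl. assert (E := FX0 cB y ltac:(lra)). simpl in E. rewrite Rmax_right in E by lra. rewrite E; ring. }
assert (AL : forall s, 0 <= s < d -> al Y s - cv 1 G1 Y s = 0).
{ intros s Hs. rewrite (@zero_of_derive (fun s => al Y s - cv 1 G1 Y s) d); auto.
  - rewrite cv_0, al_0, HG10; ring.
  - intros u Hu. destruct (NX Y u 0 XY (K _ _ Hu R0)) as (_ & _ & _ & (q1 & _) & (_ & _ & q2 & _) & _).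
    apply continuity_2d_pt_minus; auto.
  - intros y Hy. eapply derive_eq.
    apply derive_minus. apply derive_al; auto. apply (HCv _ _ _ _ _ H1 GG1 IC1 Hy). apply AL1; lra. }
assert (BE : forall s, 0 <= s < d -> be Y s - cv a G2 Y s = 0).
{ intros s Hs. rewrite (@zero_of_derive (fun s => be Y s - cv a G2 Y s) d); auto.
  - rewrite cv_0, be_0, HG20; ring.
  - intros u Hu. destruct (NX Y u 0 XY (K _ _ Hu R0)) as (_ & _ & _ & (_ & _ & q1 & _) & (_ & _ & _ & q2 & _) & _).
    apply continuity_2d_pt_minus; auto.
  - intros y Hy. eapply derive_eq.
    apply derive_minus. apply derive_be; auto. apply (HCv _ _ _ _ _ Ha' GG2 IC2 Hy). apply BE1; lra. }
constructor.
- intros u Hu; split; [|split]. apply derive_al; auto. apply derive_al1; auto. apply (cont_line1 (CY cA)).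
- intros u Hu; split; [|split]. apply derive_be; auto. apply derive_be1; auto. apply (cont_line1 (CY cB)).
- exact Pt.
- exact Px.
- intros u v hu hv; split. apply derive_ff_u with d; auto. apply derive_ff_v; auto.
- intros u v hu hv; split. apply derive_gg_u; auto. apply derive_gg_v with d; auto.
- split; [|split]; auto; intros u v hu hv; apply (NX Y u v XY), K; auto.
- intros s Hs z.
  assert (Ez : z = mk (al Y (1 * s)) (be Y s) (potential (ff Y) (gg Y) (1 * s) s)
    (potential (fun u v => ev lam Y u v * ff Y u v) (fun u v => ev mu Y u v * gg Y u v) (1 * s) s))
    by (unfold z; rewrite Rmult_1_l; reflexivity).
  assert (h1 := BL s Hs). assert (h2 := AL s Hs). rewrite CV in h1, h2 by auto. rewrite <- Ez in h1, h2.
  rewrite Rmult_1_l in h1. repeat split; try lra.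
  + rewrite Ez, Tc, Xc by auto. apply (NX Y s 0 XY); [|lra]. apply K; auto. rewrite Rabs_pos_eq; lra.
  + rewrite Ez, Tc, Xc by auto. apply (NX Y s 0 XY); [|lra]. apply K; auto. rewrite Rabs_pos_eq; lra.
- intros s Hs z.
  assert (h1 := BR s Hs). assert (h2 := BE s Hs). rewrite CV in h1, h2 by auto. fold z in h1, h2.
  repeat split; try lra.
  + unfold z; rewrite Tc, Xc by auto. apply (NX Y s 0 XY); [|lra]. apply K; auto. rewrite Rabs_pos_eq; lra.
  + unfold z; rewrite Tc, Xc by auto. apply (NX Y s 0 XY); [|lra]. apply K; auto. rewrite Rabs_pos_eq; lra.
- rewrite al_0, be_0, al1_0, be1_0, ff_0, gg_0. unfold potential; rewrite !RInt_point.
  unfold zero; simpl; repeat split; ring.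
Qed.

End Solve.
End Quantities.

(** * The fluid near the interaction point *)

Definition basis (i : nat) : V4 :=
  match i with 0%nat => mk 1 0 0 0 | 1%nat => mk 0 1 0 0 | 2%nat => mk 0 0 1 0 | _ => mk 0 0 0 1 end.

Lemma mk_eta (z : V4) : mk (pr 0 z) (pr 1 z) (pr 2 z) (pr 3 z) = z.
Proof. destruct z as [[? ?] [? ?]]; reflexivity. Qed.

Lemma mk_eq (a b c d a' b' c' d' : R) : a = a' -> b = b' -> c = c' -> d = d' -> mk a b c d = mk a' b' c' d'.
Proof. intros -> -> -> ->; reflexivity. Qed.

Lemma linear_basis (l : V4 -> R) : is_linear l -> forall h, l h = sum4 (fun i => pr i h * l (basis i)).
Proof.
intros [P S _] h; unfold sum4.
assert (S' : forall (k : R) x, k * l x = l (scal k x)) by (intros; symmetry; apply S).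
assert (P' : forall x y, l x + l y = l (plus x y)) by (intros; symmetry; apply P).
rewrite !S', !P'. f_equal. rewrite <- (mk_eta h) at 1.
generalize (pr 0 h) (pr 1 h) (pr 2 h) (pr 3 h); intros a b c d.
change (mk a b c d = mk (a * 1 + b * 0 + c * 0 + d * 0) (a * 0 + b * 1 + c * 0 + d * 0)
  (a * 0 + b * 0 + c * 1 + d * 0) (a * 0 + b * 0 + c * 0 + d * 1)).
apply mk_eq; ring.
Qed.

Definition convex (C : V4 -> Prop) : Prop := forall z z' s, C z -> C z' -> 0 <= s <= 1 ->
  C (mk (pr 0 z + s * (pr 0 z' - pr 0 z)) (pr 1 z + s * (pr 1 z' - pr 1 z))
        (pr 2 z + s * (pr 2 z' - pr 2 z)) (pr 3 z + s * (pr 3 z' - pr 3 z))).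

Lemma convex_cone sg k : convex (cone sg k).
Proof.
intros z z' s [h1 h2] [h3 h4] Hs; split; simpl in *.
- replace (fst (snd z) + s * (fst (snd z') - fst (snd z))) with ((1 - s) * fst (snd z) + s * fst (snd z')) by ring.
  apply Rplus_le_le_0_compat; apply Rmult_le_pos; lra.
- match goal with |- 0 <= ?x => replace x with ((1 - s) * (sg * (k * fst (snd z) - snd (snd z)))
    + s * (sg * (k * fst (snd z') - snd (snd z')))) by ring end.
  apply Rplus_le_le_0_compat; apply Rmult_le_pos; lra.
Qed.

Lemma Grad_of_diff (D : V4 -> Prop) (E : V4 -> R) (l : V4 -> V4 -> R) :
  (forall z, D z -> filterdiff E (within D (locally z)) (l z)) -> Grad D E (fun i z => l z (basis i)).
Proof.
intros H z Hz. apply filterdiff_ext_lin with (l z); auto.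
apply linear_basis. apply (H z Hz).
Qed.

(** Mean value theorem on the segment from [z] to [z'], which stays in the convex set [C] and in the
    ball. Near [o] each partial derivative exceeds its value at [o] by at most one in modulus,
    whence the constant [L]. *)
Lemma Germ_LipAt C o E : convex C -> C o -> Germ C o 1 E -> LipAt C o E.
Proof.
intros HC Co HE; assert (HE' := HE); destruct HE as [r [l [H1 H2]]]; simpl in H2.
set (D := fun z => C z /\ ball o r z) in *.
assert (HG := Grad_of_diff H1).
assert (HB : forall i, exists e : posreal, forall z, C z -> ball o e z -> Rabs (l z (basis i)) <= Rabs (l o (basis i)) + 1).
{ intros i. destruct (@Germ_near V4 C o 0 (fun z => l z (basis i)) (ball (l o (basis i)) 1) Co) as [e He].
  exists r; apply H2. apply (locally_ball _ (mkposreal 1 Rlt_0_1)).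
  exists e; intros z Cz Bz. assert (K := He z Cz Bz). change (Rabs (l z (basis i) - l o (basis i)) < 1) in K.
  replace (l z (basis i)) with ((l z (basis i) - l o (basis i)) + l o (basis i)) by ring.
  eapply Rle_trans. apply Rabs_triang. lra. }
destruct (HB 0%nat) as [e0 B0], (HB 1%nat) as [e1 B1], (HB 2%nat) as [e2 B2], (HB 3%nat) as [e3 B3].
set (e := Rmin r (Rmin (Rmin e0 e1) (Rmin e2 e3))).
assert (He : 0 < e) by (repeat apply Rmin_glb_lt; apply cond_pos).
assert (g1 : e <= r) by apply Rmin_l.
assert (g2 : e <= Rmin (Rmin e0 e1) (Rmin e2 e3)) by apply Rmin_r.
assert (g3 := Rmin_l (Rmin e0 e1) (Rmin e2 e3)). assert (g4 := Rmin_r (Rmin e0 e1) (Rmin e2 e3)).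
assert (g5 := Rmin_l e0 e1). assert (g6 := Rmin_r e0 e1). assert (g7 := Rmin_l e2 e3). assert (g8 := Rmin_r e2 e3).
set (L := sum4 (fun i => Rabs (l o (basis i)) + 1)).
assert (HL : forall i, (i < 4)%nat -> Rabs (l o (basis i)) + 1 <= L).
{ assert (p0 := Rabs_pos (l o (basis 0))). assert (p1 := Rabs_pos (l o (basis 1))).
  assert (p2 := Rabs_pos (l o (basis 2))). assert (p3 := Rabs_pos (l o (basis 3))).
  intros [|[|[|[|i]]]] Hi; unfold L, sum4; try lra; lia. }
exists L, (mkposreal e He); split.
{ apply Rle_trans with (2 := HL 0%nat ltac:(lia)). assert (p0 := Rabs_pos (l o (basis 0))). lra. }
intros z' z Cz' Cz Bz' Bz; simpl in Bz, Bz'.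
set (ga := fun s => mk (pr 0 z + s * (pr 0 z' - pr 0 z)) (pr 1 z + s * (pr 1 z' - pr 1 z))
        (pr 2 z + s * (pr 2 z' - pr 2 z)) (pr 3 z + s * (pr 3 z' - pr 3 z))).
assert (Hga : forall s, 0 <= s <= 1 -> C (ga s) /\ ball o e (ga s)).
{ intros s Hs; split. apply HC; auto.
  apply ball4. rewrite ball4 in Bz, Bz'.
  assert (K : forall i, Rabs (pr i z + s * (pr i z' - pr i z) - pr i o) < e).
  { intros i. assert (k1 := Bz i). assert (k2 := Bz' i). apply Rabs_def2 in k1; apply Rabs_def2 in k2.
    replace (pr i z + s * (pr i z' - pr i z) - pr i o) with ((1 - s) * (pr i z - pr i o) + s * (pr i z' - pr i o)) by ring.
    set (x := pr i z - pr i o) in *. set (y := pr i z' - pr i o) in *.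
    apply Rabs_def1; [apply Rle_lt_trans with (Rmax x y)|apply Rlt_le_trans with (Rmin x y)];
    unfold Rmax, Rmin; destruct Rle_dec; try lra; nra. }
  intros [|[|[|i]]]; [apply (K 0%nat)|apply (K 1%nat)|apply (K 2%nat)|apply (K 3%nat)]. }
assert (HgaD : forall s, 0 <= s <= 1 -> D (ga s)).
{ intros s Hs; destruct (Hga s Hs); split; auto. apply ball_le with e; auto. }
(* The parameter is clamped to [[0, 1]], because the segment may leave [C] beyond its end points
   while the mean value theorem asks for two-sided continuity there. *)
set (cl := fun s => Rmax 0 (Rmin 1 s)).
assert (Hcl : forall s, 0 <= cl s <= 1).
{ intros s; unfold cl; split. apply Rmax_l. apply Rmax_lub; [lra|apply Rmin_l]. }
assert (Hcl_id : forall s, 0 <= s <= 1 -> cl s = s).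
{ intros s Hs; unfold cl. rewrite Rmin_right, Rmax_right; lra. }
assert (Ccl : forall s, continuous cl s).
{ intros s; apply continuity_pt_filterlim, (continuity_pt_comp (Rmin 1) (Rmax 0)); [apply continuity_Rmin|apply continuity_Rmax]. }
assert (Lin : forall p q s, is_derive (fun s => p + s * (q - p)) s (q - p)).
{ intros p q s; auto_derive; auto; ring. }
destruct (MVT_gen (fun s => E (ga (cl s))) 0 1 (fun s => sum4 (fun i => l (ga s) (basis i) * (pr i z' - pr i z)))) as [s [Hs Es]].
- rewrite Rmin_left, Rmax_right by lra; intros s Hs.
  apply is_derive_ext_loc with (fun s => E (ga s)).
  + assert (H01 : locally s (fun y => 0 <= y <= 1)).
    { assert (He' : 0 < Rmin s (1 - s)) by (apply Rmin_glb_lt; lra).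
      exists (mkposreal _ He'); intros y Hy; change (Rabs (y - s) < Rmin s (1 - s)) in Hy.
      assert (m1 := Rmin_l s (1 - s)). assert (m2 := Rmin_r s (1 - s)). apply Rabs_def2 in Hy; lra. }
    revert H01; apply filter_imp; intros y Hy; rewrite Hcl_id; auto.
  + apply (Grad_chain HG) with (2 := Lin (pr 0 z) (pr 0 z') s) (3 := Lin (pr 1 z) (pr 1 z') s)
      (4 := Lin (pr 2 z) (pr 2 z') s) (5 := Lin (pr 3 z) (pr 3 z') s).
    assert (He' : 0 < Rmin s (1 - s)) by (apply Rmin_glb_lt; lra).
    exists (mkposreal _ He'); intros y Hy; change (Rabs (y - s) < Rmin s (1 - s)) in Hy.
    assert (m1 := Rmin_l s (1 - s)). assert (m2 := Rmin_r s (1 - s)). apply HgaD; apply Rabs_def2 in Hy; lra.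
- intros s _. apply continuity_pt_filterlim.
  assert (CE := wdiff_continuous (H1 _ (HgaD _ (Hcl s)))).
  intros P HP. assert (K := CE P HP). destruct K as [e' K].
  assert (Cg : locally s (fun y => ball (ga (cl s)) e' (ga (cl y)))).
  { assert (Ci : forall p q, locally s (fun y => Rabs (p + cl y * (q - p) - (p + cl s * (q - p))) < e')).
    { intros p q. apply (locally_abs_lt (f := fun y => p + cl y * (q - p)) (c := p + cl s * (q - p))).
      apply (continuous_comp cl (fun s => p + s * (q - p))); auto.
      apply derive_continuous with (1 := Lin p q (cl s)). rewrite Rminus_diag, Rabs_R0; apply cond_pos. }
    generalize (filter_and _ _ (filter_and _ _ (Ci (pr 0 z) (pr 0 z')) (Ci (pr 1 z) (pr 1 z')))
      (filter_and _ _ (Ci (pr 2 z) (pr 2 z')) (Ci (pr 3 z) (pr 3 z')))).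
    apply filter_imp; intros y [[c0 c1] [c2 c3]]; apply ball4; intros [|[|[|i]]]; auto. }
  unfold filtermap. revert Cg; apply filter_imp; intros y Hy; apply K; auto.
- rewrite Rmin_left, Rmax_right in Hs by lra.
  rewrite !Hcl_id in Es by lra.
  assert (G0 : ga 0 = z) by (unfold ga; rewrite !Rmult_0_l, !Rplus_0_r; apply mk_eta).
  assert (G1 : ga 1 = z').
  { rewrite <- (mk_eta z'). unfold ga. apply mk_eq; ring. }
  rewrite G0, G1, Rminus_0_r, Rmult_1_r in Es. rewrite Es.
  destruct (Hga s Hs) as [Cg Bg].
  assert (Bd : forall i, (i < 4)%nat -> Rabs (l (ga s) (basis i)) <= L).
  { intros [|[|[|[|i]]]] Hi; try lia; eapply Rle_trans; [apply B0; auto| |apply B1; auto| |apply B2; auto| |apply B3; auto| ];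
    try (apply HL; lia); apply ball_le with (2 := Bg); lra. }
  assert (T : forall i, (i < 4)%nat -> Rabs (l (ga s) (basis i) * (pr i z' - pr i z)) <= L * Rabs (pr i z' - pr i z)).
  { intros i Hi; rewrite Rabs_mult; apply Rmult_le_compat_r; auto using Rabs_pos. }
  assert (T0 := T 0%nat ltac:(lia)). assert (T1 := T 1%nat ltac:(lia)).
  assert (T2 := T 2%nat ltac:(lia)). assert (T3 := T 3%nat ltac:(lia)).
  unfold sum4. eapply Rle_trans. apply Rabs_triang. eapply Rle_trans. apply Rplus_le_compat_r, Rabs_triang.
  eapply Rle_trans. apply Rplus_le_compat_r, Rplus_le_compat_r, Rabs_triang. lra.
Qed.

Lemma C1r_shrink C o (r r' : posreal) E dE : r' <= r -> C1r C o r E dE -> C1r C o r' E dE.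
Proof.
intros Hr (h1 & h2 & h3); split; [|split]; auto.
intros z Hz. apply (@wdiff_sub V4 (fun z => C z /\ ball o r z)); auto.
intros y [k1 k2]; split; auto; apply ball_le with (2 := k2); auto.
apply h3. destruct Hz as [k1 k2]; split; auto; apply ball_le with (2 := k2); auto.
Qed.

(** One order of smoothness is spent on the gradient, and at least one remains for its Lipschitz
    bound. *)
Lemma Germ_C1r C o k E : convex C -> C o -> Germ C o (S (S k)) E ->
  exists dE, (exists r, C1r C o r E dE) /\ forall i, Germ C o (S k) (dE i).
Proof.
intros HC Co HE. assert (HE' := HE). destruct HE as [r [l [H1 H2]]].
exists (fun i z => l z (basis i)).
assert (HdE : forall i, Germ C o (S k) (fun z => l z (basis i))) by (intros i; exists r; apply H2).
split; auto. exists r; split; [|split].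
- apply Germ_LipAt; auto. apply Germ_le with (2 := HE'); lia.
- intros i; apply Germ_LipAt; auto. apply Germ_le with (2 := HdE i); lia.
- apply Grad_of_diff, H1.
Qed.

(** Second derivatives along the shocks must still be Lipschitz, hence the order three. *)
Lemma Germ_C1r2 C o E : convex C -> C o -> Germ C o 3 E ->
  exists dE ddE (r : posreal), C1r C o r E dE /\ forall i, C1r C o r (dE i) (ddE i).
Proof.
intros HC Co HE. destruct (Germ_C1r HC Co HE) as (dE & [r Hr] & HdE).
destruct (Germ_C1r HC Co (HdE 0%nat)) as (d0 & [r0 H0] & _).
destruct (Germ_C1r HC Co (HdE 1%nat)) as (d1 & [r1 H1] & _).
destruct (Germ_C1r HC Co (HdE 2%nat)) as (d2 & [r2 H2] & _).
destruct (Germ_C1r HC Co (HdE 3%nat)) as (d3 & [r3 H3] & _).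
set (e := Rmin r (Rmin (Rmin r0 r1) (Rmin r2 r3))).
assert (He : 0 < e) by (repeat apply Rmin_glb_lt; apply cond_pos).
assert (g1 : e <= r) by apply Rmin_l.
assert (g2 : e <= Rmin (Rmin r0 r1) (Rmin r2 r3)) by apply Rmin_r.
assert (g3 := Rmin_l (Rmin r0 r1) (Rmin r2 r3)). assert (g4 := Rmin_r (Rmin r0 r1) (Rmin r2 r3)).
assert (g5 := Rmin_l r0 r1). assert (g6 := Rmin_r r0 r1). assert (g7 := Rmin_l r2 r3). assert (g8 := Rmin_r r2 r3).
(* The index is truncated since [C1r] quantifies over all natural numbers, whereas only four second
   gradients are at hand. *)
exists (fun i => dE (Nat.min i 3)), (fun i => match i with 0%nat => d0 | 1%nat => d1 | 2%nat => d2 | _ => d3 end), (mkposreal e He).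
split.
- destruct (C1r_shrink (r := r) (r' := mkposreal e He) g1 Hr) as (h1 & h2 & h3); split; [|split]; auto.
- intros [|[|[|i]]]; simpl Nat.min; [apply C1r_shrink with r0|apply C1r_shrink with r1|apply C1r_shrink with r2|
   replace (Nat.min i 0) with 0%nat by lia; apply C1r_shrink with r3]; auto; simpl; lra.
Qed.

Definition Plane : NormedModule R_AbsRing := prod_NormedModule _ R_NormedModule R_NormedModule.
Definition V3 : NormedModule R_AbsRing := prod_NormedModule _ Plane R_NormedModule.

Lemma linear_pr i : is_linear (pr i : V4 -> R).
Proof.
destruct i as [|[|[|i]]].
- apply (is_linear_comp (U := V4) (V := Plane) (W := R_NormedModule) fst fst); apply is_linear_fst.
- apply (is_linear_comp (U := V4) (V := Plane) (W := R_NormedModule) fst snd); [apply is_linear_fst|apply is_linear_snd].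
- apply (is_linear_comp (U := V4) (V := Plane) (W := R_NormedModule) snd fst); [apply is_linear_snd|apply is_linear_fst].
- apply (is_linear_comp (U := V4) (V := Plane) (W := R_NormedModule) snd snd); apply is_linear_snd.
Qed.

Lemma Germ_div {V : NormedModule R_AbsRing} (C : V -> Prop) o k f g :
  C o -> g o <> 0 -> Germ C o k f -> Germ C o k g -> Germ C o k (fun z => f z / g z).
Proof. intros; apply Germ_mult; auto. apply Germ_Rinv; auto. Qed.

(** * Characteristic speeds, shock speed and jump condition near the origin *)

Section Data.
Variables (p : R -> R) (rs r0 : R).
Hypotheses (Hp : pressure_law p) (Hrs : 0 < rs) (Hr0 : 0 < r0).

Definition b_0 : R := beta_of p rs r0 0.
Definition base : V4 := o4 b_0.
Definition eta_0 : R := eta p r0.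

Lemma eta_0_pos : 0 < eta_0.
Proof. apply eta_pos; auto. Qed.

Lemma half_b_0 : (b_0 + b_0) / 2 = Phi p rs r0.
Proof. unfold b_0, beta_of; field. Qed.

Lemma rho_base : rho p rs b_0 b_0 = r0.
Proof. rewrite rho_Phi_inv, half_b_0; apply Phi_inv_Phi; auto. Qed.

Definition lam4 (z : V4) : R := c_in p rs (pr 0 z) (pr 1 z).
Definition mu4 (z : V4) : R := c_out p rs (pr 0 z) (pr 1 z).

Lemma lam4_base : lam4 base = - eta_0.
Proof. unfold lam4, c_in, vel; simpl; rewrite rho_base; unfold eta_0; field. Qed.
Lemma mu4_base : mu4 base = eta_0.
Proof. unfold mu4, c_out, vel; simpl; rewrite rho_base; unfold eta_0; field. Qed.

Section Germs.
Variable (C : V4 -> Prop).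
Hypothesis (Co : C base).

Lemma Germ_rho k : Germ C base k (fun z => rho p rs (pr 0 z) (pr 1 z)).
Proof.
apply Germ_comp1 with (1 := Co) (2 := Cdiff_Phi_inv Hp Hrs k).
- apply locally_Phi_range; auto. exists r0; split; auto. simpl. symmetry; apply half_b_0.
- apply Germ_mult; [|apply Germ_const]. apply Germ_plus; apply Germ_linear, linear_pr.
Qed.

Lemma Germ_vel k : Germ C base k (fun z => vel (pr 0 z) (pr 1 z)).
Proof. apply Germ_mult; [|apply Germ_const]. apply Germ_minus; apply Germ_linear, linear_pr. Qed.

Lemma Germ_eta_rho k : Germ C base k (fun z => eta p (rho p rs (pr 0 z) (pr 1 z))).
Proof.
apply Germ_comp1 with (1 := Co) (2 := Cdiff_eta Hp k) (4 := Germ_rho k).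
apply locally_pos. simpl; rewrite rho_base; auto.
Qed.

Lemma Germ_lam k : Germ C base k lam4.
Proof. apply Germ_minus; [apply Germ_vel|apply Germ_eta_rho]. Qed.
Lemma Germ_mu k : Germ C base k mu4.
Proof. apply Germ_plus; [apply Germ_vel|apply Germ_eta_rho]. Qed.
End Germs.

Lemma cone_base sg k : cone sg k base.
Proof. split; simpl; lra. Qed.

Section Side.
Variables (S : ahead) (sg k V : R).
Hypotheses (HS : smooth_flow p S)
  (Hdom : exists r : posreal, forall z, cone sg k z -> ball base r z -> dom S (snd z))
  (Hjump : jump_conditions p r0 0 (dens S (0, 0)) (veloc S (0, 0)) V)
  (Hdens : r0 <> dens S (0, 0)).

Let C := cone sg k.

Lemma dom_0 : dom S (0, 0).
Proof.
destruct Hdom as [r H]; apply (H base); [apply cone_base|apply ball_center].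
Qed.

Lemma dens_pos z : dom S z -> 0 < dens S z.
Proof. intros Hz; apply HS, Hz. Qed.

Lemma Germ_ahead n (f : R * R -> R) : Cdiff n (dom S : Plane -> Prop) f -> Germ C base n (fun z => f (snd z)).
Proof.
intros Hf; destruct Hdom as [r H]; exists r.
apply (@Cdiff_comp_linear V4 Plane n _ (dom S) (fun z => snd z) f); auto. apply is_linear_snd.
intros z [h1 h2]; apply H; auto.
Qed.

Lemma Cdiff_dens n : Cdiff n (dom S : Plane -> Prop) (dens S).
Proof. apply (Ck_Cdiff (V := Plane)), HS. Qed.
Lemma Cdiff_veloc n : Cdiff n (dom S : Plane -> Prop) (veloc S).
Proof. apply (Ck_Cdiff (V := Plane)), HS. Qed.
Lemma Cdiff_Phi_dens n : Cdiff n (dom S : Plane -> Prop) (fun z => Phi p rs (dens S z)).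
Proof.
apply (@Cdiff_comp1 Plane (dom S) n (Phi p rs) (dens S) (fun r => 0 < r)).
apply Cdiff_Phi; auto. apply Cdiff_dens. apply dens_pos.
Qed.
Lemma Cdiff_astar n : Cdiff n (dom S : Plane -> Prop) (astar p rs S).
Proof. apply (Cdiff_plus (V := Plane)); [apply Cdiff_Phi_dens|apply Cdiff_veloc]. Qed.
Lemma Cdiff_bstar n : Cdiff n (dom S : Plane -> Prop) (bstar p rs S).
Proof. apply (Cdiff_minus (V := Plane)); [apply Cdiff_Phi_dens|apply Cdiff_veloc]. Qed.

Definition speed4 (z : V4) : R :=
  shock_speed p rs (pr 0 z) (pr 1 z) (astar p rs S (snd z)) (bstar p rs S (snd z)).

Lemma shock_speed_ahead al be z : dom S z ->
  shock_speed p rs al be (astar p rs S z) (bstar p rs S z) =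
  (rho p rs al be * vel al be - dens S z * veloc S z) / (rho p rs al be - dens S z).
Proof.
intros Hz; unfold shock_speed. unfold astar, bstar. rewrite rho_state, vel_state; auto. apply dens_pos, Hz.
Qed.

Lemma speed4_base : speed4 base = V.
Proof.
unfold speed4; simpl. rewrite shock_speed_ahead by apply dom_0. rewrite rho_base.
unfold vel. destruct Hjump as [h1 _]. apply Rmult_eq_reg_l with (r0 - dens S (0, 0)); [|lra].
rewrite h1. field. lra.
Qed.

Lemma Germ_speed n : Germ C base n speed4.
Proof.
destruct Hdom as [r H].
apply (@Germ_ext V4 C base n (fun z => (rho p rs (pr 0 z) (pr 1 z) * vel (pr 0 z) (pr 1 z) - dens S (snd z) * veloc S (snd z))
   / (rho p rs (pr 0 z) (pr 1 z) - dens S (snd z))) speed4 r).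
- intros z Cz Bz; symmetry; apply shock_speed_ahead; auto.
- assert (Co : C base) by apply cone_base. apply Germ_div; auto.
  + simpl; rewrite rho_base; lra.
  + apply Germ_minus; apply Germ_mult; auto using Germ_rho, Germ_vel; apply Germ_ahead; auto using Cdiff_dens, Cdiff_veloc.
  + apply Germ_minus; auto using Germ_rho; apply Germ_ahead, Cdiff_dens.
Qed.

(** Implicit differentiation of [J] at the interaction point with the state ahead fixed. The jump
    conditions express the flux differences through [V], and the result has the nonzero factor
    [(r0 - rm) * r0 / (2 * eta_0)]. The two squares are the source of the product [a ^ 2] of the
    derivatives [F0] of [H1] and [H2]. *)
Lemma jump_slope (A B : R -> R) y A' B' : A y = b_0 -> B y = b_0 ->
  is_derive A y A' -> is_derive B y B' ->
  locally y (fun s => J p rs (A s) (B s) (astar p rs S (0, 0)) (bstar p rs S (0, 0)) = 0) ->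
  (eta_0 - V) ^ 2 * A' + (eta_0 + V) ^ 2 * B' = 0.
Proof.
intros EA EB DA DB HJ.
set (rm := dens S (0, 0)) in *. set (wm := veloc S (0, 0)) in *.
assert (Hrm : rho p rs (astar p rs S (0, 0)) (bstar p rs S (0, 0)) = rm).
{ apply rho_state; auto. apply dens_pos, dom_0. }
assert (Hwm : vel (astar p rs S (0, 0)) (bstar p rs S (0, 0)) = wm) by apply vel_state.
assert (Dh : is_derive (fun s => (A s + B s) / 2) y ((A' + B') / 2)).
{ apply derive_eq with ((A' + B') * / 2 + (A y + B y) * 0); [|field].
  apply (derive_mult (f := fun s => A s + B s) (g := fun _ => / 2)). apply derive_plus; auto. apply derive_const. }
assert (Eh : (A y + B y) / 2 = Phi p rs r0) by (rewrite EA, EB; apply half_b_0).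
set (r1 := (A' + B') / 2 * (r0 / eta_0)).
assert (Dr : is_derive (fun s => Phi_inv p rs ((A s + B s) / 2)) y r1).
{ apply (is_derive_comp (Phi_inv p rs) (fun s => (A s + B s) / 2)); auto.
  rewrite Eh. eapply derive_eq. apply is_derive_Phi_inv; auto. exists r0; auto.
  rewrite Phi_inv_Phi; auto. }
assert (Er : Phi_inv p rs ((A y + B y) / 2) = r0) by (rewrite Eh; apply Phi_inv_Phi; auto).
set (rr := fun s => Phi_inv p rs ((A s + B s) / 2)) in *. change (rr y = r0) in Er.
assert (Dw : is_derive (fun s => (A s - B s) / 2) y ((A' - B') / 2)).
{ apply derive_eq with ((A' - B') * / 2 + (A y - B y) * 0); [|field].
  apply (derive_mult (f := fun s => A s - B s) (g := fun _ => / 2)). apply derive_minus; auto. apply derive_const. }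
set (ww := fun s => (A s - B s) / 2) in *.
assert (Ew : ww y = 0) by (unfold ww; rewrite EA, EB; field).
assert (Dp : is_derive (fun s => p (rr s)) y (r1 * eta_0 ^ 2)).
{ apply (is_derive_comp p rr); auto. rewrite Er. eapply derive_eq. apply is_derive_pressure; auto.
  unfold eta_0; rewrite <- eta_sqr; auto. simpl; ring. }
assert (DJ : is_derive (fun s => (rr s * ww s - rm * wm) * (rr s * ww s - rm * wm)
   - (rr s * (ww s * ww s) + p (rr s) - (rm * wm ^ 2 + p rm)) * (rr s - rm)) y 0).
{ apply is_derive_ext_loc with (fun _ => 0); [|apply derive_const].
  revert HJ; apply filter_imp; intros s E. rewrite <- E. unfold J. rewrite Hrm, Hwm.
  rewrite rho_Phi_inv. fold (rr s). unfold vel; fold (ww s). simpl; ring. }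
assert (DJ' : is_derive (fun s => (rr s * ww s - rm * wm) * (rr s * ww s - rm * wm)
   - (rr s * (ww s * ww s) + p (rr s) - (rm * wm ^ 2 + p rm)) * (rr s - rm)) y
   (2 * (- (rm * wm)) * (r0 * ((A' - B') / 2)) - r1 * eta_0 ^ 2 * (r0 - rm) - (p r0 - (rm * wm ^ 2 + p rm)) * r1)).
{ eapply derive_eq.
  - apply derive_minus; apply derive_mult.
    + apply derive_minus; [apply derive_mult; [exact Dr|exact Dw]|apply derive_const].
    + apply derive_minus; [apply derive_mult; [exact Dr|exact Dw]|apply derive_const].
    + apply derive_minus; [|apply derive_const]. apply derive_plus; [|exact Dp].
      apply derive_mult; [exact Dr|apply derive_mult; exact Dw].
    + apply derive_minus; [exact Dr|apply derive_const].
  - cbv beta. fold (rr y). rewrite !Er, !Ew. field. }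
assert (E := is_derive_unique _ _ _ DJ). rewrite (is_derive_unique _ _ _ DJ') in E.
destruct Hjump as [J1 J2]. fold rm wm in J1, J2.
assert (E1 : rm * wm = - ((r0 - rm) * V)) by lra.
assert (E2 : p r0 - (rm * wm ^ 2 + p rm) = (r0 - rm) * V * V).
{ replace ((r0 - rm) * V) with (r0 * 0 - rm * wm) by lra. lra. }
rewrite E2 in E. rewrite E1 in E. unfold r1 in E.
assert (He := eta_0_pos).
assert (F : (r0 - rm) * r0 / (2 * eta_0) * ((eta_0 - V) ^ 2 * A' + (eta_0 + V) ^ 2 * B') = 0).
{ rewrite <- (Ropp_involutive 0), Ropp_0, <- E. field. lra. }
apply Rmult_integral in F; destruct F as [F|F]; auto. exfalso.
revert F. apply Rmult_integral_contrapositive_currified.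
apply Rmult_integral_contrapositive_currified; lra. apply Rinv_neq_0_compat; lra.
Qed.

End Side.
End Data.

(** * Differentials in directions that point into a set *)

Lemma minus_plus_l {G : AbelianGroup} (x y : G) : minus (plus x y) x = y.
Proof.
unfold minus; rewrite (plus_comm x y). transitivity (plus y (plus x (opp x))).
symmetry; apply plus_assoc. transitivity (plus y zero); [apply f_equal, plus_opp_r|apply plus_zero_r].
Qed.

(** On the segment [z + s h] the remainder of a differential [l] of zero is [s * l h] up to sign,
    and it must be [o(s)]. *)
Lemma wdiff_dir {V : NormedModule R_AbsRing} (D : V -> Prop) z (l : V -> R) h : D z ->
  filterdiff (fun _ => 0) (within D (locally z)) l ->
  (exists s0, 0 < s0 /\ forall s, 0 <= s <= s0 -> D (plus z (scal s h))) -> l h = 0.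
Proof.
intros Hz Hl (s0 & Hs0 & HD). apply wdiff_iff in Hl; auto. destruct Hl as [L Hl].
apply cond_eq; intros e He; rewrite Rminus_0_r.
assert (Hn := norm_ge_0 h).
assert (He' : 0 < e / (norm h + 1)) by (apply Rdiv_lt_0_compat; lra).
destruct (Hl (mkposreal _ He')) as [d Hd].
set (s := Rmin s0 (d / (norm h + 1))).
assert (Hdn : 0 < d / (norm h + 1)) by (apply Rdiv_lt_0_compat; [apply cond_pos|lra]).
assert (Hs : 0 < s) by (apply Rmin_glb_lt; auto).
assert (Hs1 : s <= s0) by apply Rmin_l. assert (Hs2 : s <= d / (norm h + 1)) by apply Rmin_r.
assert (Em : minus (plus z (scal s h)) z = scal s h).
{ apply (minus_plus_l z (scal s h)). }
assert (Ns : norm (scal s h) <= s * norm h).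
{ eapply Rle_trans. apply (norm_scal s h). unfold abs; simpl. rewrite Rabs_pos_eq; lra. }
assert (B : ball z d (plus z (scal s h))).
{ apply (norm_compat1 z (plus z (scal s h)) d). rewrite Em.
  apply Rle_lt_trans with (1 := Ns). apply Rle_lt_trans with (d / (norm h + 1) * norm h).
  apply Rmult_le_compat_r; auto. apply Rmult_lt_reg_r with (norm h + 1). lra. field_simplify; [|lra].
  assert (K := cond_pos d). nra. }
assert (K := Hd _ B (HD s ltac:(lra))). rewrite Em in K. simpl in K.
assert (Els : l (scal s h) = s * l h) by apply L. rewrite Els in K.
rewrite Rminus_0_r, Rminus_0_l, Rabs_Ropp, Rabs_mult, (Rabs_pos_eq s) in K by lra.
apply Rmult_lt_reg_l with s; auto. apply Rle_lt_trans with (1 := K).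
apply Rle_lt_trans with (e / (norm h + 1) * (s * norm h)). apply Rmult_le_compat_l; lra.
replace (e / (norm h + 1) * (s * norm h)) with (s * (e * (norm h / (norm h + 1)))) by (field; lra).
apply Rmult_lt_compat_l; auto. rewrite <- (Rmult_1_r e) at 2. apply Rmult_lt_compat_l; auto.
apply Rmult_lt_reg_r with (norm h + 1). lra. field_simplify; lra.
Qed.

Lemma wdiff_dir_eq {V : NormedModule R_AbsRing} (D : V -> Prop) z f (l1 l2 : V -> R) h : D z ->
  filterdiff f (within D (locally z)) l1 -> filterdiff f (within D (locally z)) l2 ->
  (exists s0, 0 < s0 /\ forall s, 0 <= s <= s0 -> D (plus z (scal s h))) -> l1 h = l2 h.
Proof.
intros Hz H1 H2 HD. apply Rminus_diag_uniq.
apply (@wdiff_dir V D z (fun h => l1 h - l2 h) h Hz); auto.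
apply (filterdiff_ext (fun y => f y - f y)); [intros; apply Rminus_diag_eq; reflexivity|].
apply (filterdiff_minus_fct f f l1 l2); auto.
Qed.

Lemma posreal_min (l : list posreal) : exists r : posreal, forall s, List.In s l -> r <= s.
Proof.
induction l as [|s l [r IH]].
- exists (mkposreal 1 Rlt_0_1); intros s [].
- assert (Hr : 0 < Rmin s r) by (apply Rmin_glb_lt; apply cond_pos).
  exists (mkposreal _ Hr); simpl. intros t [<-|Ht]. apply Rmin_l.
  eapply Rle_trans. apply Rmin_r. auto.
Qed.

Lemma linear_pair (l : Plane -> R) : is_linear l -> forall x y : R, l (x, y) = x * l (1, 0) + y * l (0, 1).
Proof.
intros [P S _] x y.
assert (S' : forall (k : R) h, k * l h = l (scal k h)) by (intros; symmetry; apply S).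
assert (P' : forall h h', l h + l h' = l (plus h h')) by (intros; symmetry; apply P).
rewrite !S', P'. f_equal.
change ((x, y) = (x * 1 + y * 0, x * 0 + y * 1)). apply (@f_equal2 R R _ pair); ring.
Qed.

Lemma linear_triple (l : V3 -> R) : is_linear l ->
  forall x y w : R, l (x, y, w) = x * l (1, 0, 0) + y * l (0, 1, 0) + w * l (0, 0, 1).
Proof.
intros [P S _] x y w.
assert (S' : forall (k : R) h, k * l h = l (scal k h)) by (intros; symmetry; apply S).
assert (P' : forall h h', l h + l h' = l (plus h h')) by (intros; symmetry; apply P).
rewrite !S', !P'. f_equal.
change ((x, y, w) = (x * 1 + y * 0 + w * 0, x * 0 + y * 1 + w * 0, x * 0 + y * 0 + w * 1)).
apply (@f_equal2 (R * R) R _ pair); [apply (@f_equal2 R R _ pair)|]; ring.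
Qed.

Lemma derive_triple (H : V3 -> R) (g g' : R -> V3) l y : filterdiff H (locally (g y)) l ->
  (forall s, g s = plus (g y) (g' (s - y))) -> is_linear (g' : R_NormedModule -> V3) ->
  is_derive (fun y => H (g y)) y (l (g' 1)).
Proof.
intros HH Eg Lg.
assert (Hg : filterdiff (g : R_NormedModule -> V3) (locally (y : R)) g').
{ split; auto. intros x Hx eps.
  rewrite <- (is_filter_lim_locally_unique (y : R_NormedModule) x Hx). apply filter_forall; intros s.
  assert (Z : minus (minus (g s) (g y)) (g' (s - y)) = (zero : V3)).
  { transitivity (minus (g' (s - y)) (g' (s - y))); [|apply (minus_eq_zero (g' (s - y)))].
    apply (f_equal (fun w => minus w (g' (s - y)))). rewrite (Eg s). exact (minus_plus_l (g y) (g' (s - y))). }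
  eapply Rle_trans; [right; apply (f_equal norm Z)|].
  eapply Rle_trans; [right; apply (@norm_zero R_AbsRing V3)|]. apply Rmult_le_pos; [apply Rlt_le, cond_pos|apply norm_ge_0]. }
assert (K := filterdiff_comp' g H y _ _ Hg HH).
apply (filterdiff_ext_lin _ _ _ K). intros h.
assert (Eh : g' h = scal h (g' 1)).
{ transitivity (g' (h * 1)). rewrite Rmult_1_r; reflexivity. exact (linear_scal g' Lg h 1). }
rewrite Eh. apply (linear_scal l (proj1 HH)).
Qed.

Lemma characteristic_bound c T X e : characteristic c T X -> 0 < T -> 0 < e ->
  exists r : posreal, forall s, 0 <= s <= T -> s < r -> Rabs (X s - c (0, 0) * s) <= e * s.
Proof.
intros [X0 HX] HT He.
assert (H0 : Icc 0 T 0) by (split; lra).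
assert (K := HX 0 H0). rewrite X0 in K.
apply (@wdiff_iff R_NormedModule (Icc 0 T) X 0) in K; auto. destruct K as [_ K].
destruct (K (mkposreal e He)) as [r Hr]; exists r; intros s Hs Hsr.
assert (B : ball (0 : R) r s).
{ change (Rabs (s - 0) < r). rewrite Rminus_0_r, Rabs_pos_eq; lra. }
assert (E := Hr s B Hs).
change (Rabs (X s - X 0 - (s - 0) * c (0, 0)) <= e * Rabs (s - 0)) in E.
rewrite X0, !Rminus_0_r, (Rabs_pos_eq s) in E by lra. rewrite (Rmult_comm (c (0, 0))); auto.
Qed.

(** * Domains of the states ahead and implicit functions near the origin *)

Section Solution.
Variables (p : R -> R) (rs r0 : R).
Hypotheses (Hp : pressure_law p) (Hrs : 0 < rs) (Hr0 : 0 < r0).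
Notation b0 := (b_0 p rs r0).
Notation base := (base p rs r0).
Notation eta0 := (eta_0 p r0).

(** The line of slope [k] leaves the characteristic at a positive angle, measured by [e], which
    absorbs the deviation of the characteristic from its tangent. So near the origin the cone lies
    on the correct side. *)
Lemma ahead_left_cone S k : ahead_left p S -> k < veloc S (0, 0) - eta p (dens S (0, 0)) ->
  smooth_flow p S /\ exists r : posreal, forall z, cone 1 k z -> ball base r z -> dom S (snd z).
Proof.
intros (T & X & HT & Hdom & HX & HS) Hk; split; auto.
set (e := veloc S (0, 0) - eta p (dens S (0, 0)) - k).
destruct (@characteristic_bound _ T X e HX HT) as [r1 H1]. unfold e; lra.
destruct (posreal_min (r1 :: mkposreal T HT :: nil)) as [r Hr].
assert (g1 := Hr r1 (or_introl eq_refl)). assert (g2 := Hr (mkposreal T HT) (or_intror (or_introl eq_refl))). simpl in g2.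
exists r; intros z [Z1 Z2] Bz. rewrite ball4 in Bz. assert (B2 := Bz 2%nat). simpl in *.
apply Hdom. apply Rabs_def2 in B2. split; [lra|].
assert (K := H1 (fst (snd z)) ltac:(lra) ltac:(lra)). apply Rabs_le_between in K. simpl in K. unfold e in K. lra.
Qed.

Lemma ahead_right_cone S k : ahead_right p S -> veloc S (0, 0) + eta p (dens S (0, 0)) < k ->
  smooth_flow p S /\ exists r : posreal, forall z, cone (-1) k z -> ball base r z -> dom S (snd z).
Proof.
intros (T & X & HT & Hdom & HX & HS) Hk; split; auto.
set (e := k - (veloc S (0, 0) + eta p (dens S (0, 0)))).
destruct (@characteristic_bound _ T X e HX HT) as [r1 H1]. unfold e; lra.
destruct (posreal_min (r1 :: mkposreal T HT :: nil)) as [r Hr].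
assert (g1 := Hr r1 (or_introl eq_refl)). assert (g2 := Hr (mkposreal T HT) (or_intror (or_introl eq_refl))). simpl in g2.
exists r; intros z [Z1 Z2] Bz. rewrite ball4 in Bz. assert (B2 := Bz 2%nat). simpl in *.
apply Hdom. apply Rabs_def2 in B2. split; [lra|].
assert (K := H1 (fst (snd z)) ltac:(lra) ltac:(lra)). apply Rabs_le_between in K. simpl in K. unfold e in K. lra.
Qed.

Section Side.
Variables (S : ahead) (sg k : R) (j : nat) (H : R * R * R -> R) (r : R).
Hypotheses (HS : smooth_flow p S)
  (Hdom : exists r : posreal, forall z, cone sg k z -> ball base r z -> dom S (snd z))
  (Hj : pr j base = b0) (Hr : 0 < r).
Notation am := (astar p rs S (0, 0)).
Notation bm := (bstar p rs S (0, 0)).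
Hypothesis (HH : smooth_on (ball ((b0, am, bm) : R * R * R) r) H).

(** [j] selects the Riemann invariant on which the other depends behind the shock: [beta] on the
    left, [alpha] on the right. *)
Definition Gside (z : V4) : R := H (pr j z, astar p rs S (snd z), bstar p rs S (snd z)).

Lemma Germ_Gside n : Germ (cone sg k) base n Gside.
Proof.
apply (@Germ_comp3 V4 (cone sg k) base n (fun _ => True) H (pr j) (fun z => astar p rs S (snd z)) (fun z => bstar p rs S (snd z))).
- apply cone_base.
- rewrite Hj. exists (mkposreal r Hr).
  apply (@Cdiff_sub V3 n (ball ((b0, am, bm) : V3) r)). intros y []; auto.
  apply (Ck_Cdiff (V := V3)), HH.
- apply Germ_linear, linear_pr.
- exact (Germ_ahead Hdom (Cdiff_astar Hp Hrs HS n)).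
- exact (Germ_ahead Hdom (Cdiff_bstar Hp Hrs HS n)).
- exists (mkposreal r Hr); auto.
Qed.

(** The gradient [dG] and the chain rule for [H] both give differentials of [Gside] within the cone.
    They are compared only in directions [h] that point into the cone, where any two differentials
    agree. *)
Lemma Gside_slope (rr : posreal) dG h : Grad (fun z => cone sg k z /\ ball base rr z) Gside dG ->
  (exists s0, 0 < s0 /\ forall s, 0 <= s <= s0 -> cone sg k (plus base (scal s h))) ->
  sum4 (fun i => pr i h * dG i base) = pr j h * F0 H b0 am bm
   + (pr 2 h * d1 (dom S) (astar p rs S) (0, 0) + pr 3 h * d2 (dom S) (astar p rs S) (0, 0)) * M10 H b0 am bm
   + (pr 2 h * d1 (dom S) (bstar p rs S) (0, 0) + pr 3 h * d2 (dom S) (bstar p rs S) (0, 0)) * M20 H b0 am bm.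
Proof.
intros HG Hh.
destruct Hdom as [rd Hd]. destruct (posreal_min (rr :: rd :: nil)) as [r1 Hr1].
assert (g1 := Hr1 rr (or_introl eq_refl)). assert (g2 := Hr1 rd (or_intror (or_introl eq_refl))).
set (D := fun z => cone sg k z /\ ball base r1 z).
assert (Db : D base) by (split; [apply cone_base|apply ball_center]).
assert (HD : exists s0, 0 < s0 /\ forall s, 0 <= s <= s0 -> D (plus base (scal s h))).
{ destruct Hh as (s0 & Hs0 & Hc).
  assert (N := norm_ge_0 h).
  assert (Hq : 0 < r1 / (norm h + 1)) by (apply Rdiv_lt_0_compat; [apply cond_pos|lra]).
  exists (Rmin s0 (r1 / (norm h + 1))); split. apply Rmin_glb_lt; auto.
  assert (m1 := Rmin_l s0 (r1 / (norm h + 1))). assert (m2 := Rmin_r s0 (r1 / (norm h + 1))).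
  intros s Hs; split. apply Hc; lra.
  apply (norm_compat1 base (plus base (scal s h)) r1).
  replace (minus (plus base (scal s h)) base) with (scal s h).
  2:{ symmetry; apply (minus_plus_l base (scal s h)). }
  eapply Rle_lt_trans. apply (norm_scal s h). unfold abs; simpl. rewrite Rabs_pos_eq by lra.
  apply Rle_lt_trans with (r1 / (norm h + 1) * norm h). apply Rmult_le_compat_r; lra.
  apply Rmult_lt_reg_r with (norm h + 1). lra. field_simplify; [|lra]. assert (K := cond_pos r1). nra. }
assert (Hball : locally ((b0, am, bm) : V3) (ball ((b0, am, bm) : V3) r)) by (exists (mkposreal r Hr); auto).
assert (DH : ex_filterdiff H (within (ball ((b0, am, bm) : V3) r) (locally ((b0, am, bm) : V3)))).
{ apply (proj1 (HH 1%nat)). apply (ball_center ((b0, am, bm) : V3) (mkposreal r Hr)). }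
destruct DH as [lH DH]. apply (locally_wdiff Hball) in DH.
assert (D0 : dom S (0, 0)).
{ apply (Hd base); [apply cone_base|apply ball_center]. }
assert (K1 : filterdiff (astar p rs S) (within (dom S : Plane -> Prop) (locally ((0, 0) : Plane))) (dwithin (dom S) (astar p rs S) (0, 0))).
{ destruct (Cdiff_astar Hp Hrs HS 1) as [l [Hl _]]. exact (epsilon_spec _ _ (ex_intro _ (l (0, 0)) (Hl (0, 0) D0))). }
assert (K2 : filterdiff (bstar p rs S) (within (dom S : Plane -> Prop) (locally ((0, 0) : Plane))) (dwithin (dom S) (bstar p rs S) (0, 0))).
{ destruct (Cdiff_bstar Hp Hrs HS 1) as [l [Hl _]]. exact (epsilon_spec _ _ (ex_intro _ (l (0, 0)) (Hl (0, 0) D0))). }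
set (la := dwithin (dom S) (astar p rs S) (0, 0)) in *. set (lb := dwithin (dom S) (bstar p rs S) (0, 0)) in *.
assert (Hsnd : filterdiff (fun z : V4 => snd z) (within D (locally base)) (fun z => snd z)).
{ apply filterdiff_linear, is_linear_snd. }
assert (HDd : forall z, D z -> dom S (snd z)).
{ intros z [z1 z2]; apply Hd; auto. apply ball_le with (2 := z2); auto. }
assert (E2 : filterdiff Gside (within D (locally base)) (fun h => lH (pr j h, la (snd h), lb (snd h)))).
{ apply (@wdiff_comp V4 V3 D (fun _ => True) (fun z => (pr j z, astar p rs S (snd z), bstar p rs S (snd z))) H base
    (fun h => (pr j h, la (snd h), lb (snd h))) lH); auto.
  - apply (@wdiff_pair V4 Plane R_NormedModule D (fun z => (pr j z, astar p rs S (snd z))) (fun z => bstar p rs S (snd z)) base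
      (fun h => (pr j h, la (snd h))) (fun h => lb (snd h))).
    + apply (@wdiff_pair V4 R_NormedModule R_NormedModule D (pr j) (fun z => astar p rs S (snd z)) base
       (pr j) (fun h => la (snd h))).
      apply filterdiff_linear, linear_pr.
      apply (@wdiff_comp V4 Plane D (dom S) (fun z => snd z) (astar p rs S) base (fun h => snd h) la); auto.
    + apply (@wdiff_comp V4 Plane D (dom S) (fun z => snd z) (bstar p rs S) base (fun h => snd h) lb); auto.
  - apply wdiff_locally; auto. rewrite Hj. exact DH. }
assert (E1 : filterdiff Gside (within D (locally base)) (fun h => sum4 (fun i => pr i h * dG i base))).
{ apply (@wdiff_sub V4 (fun z => cone sg k z /\ ball base rr z)); auto.
  intros y [y1 y2]; split; auto. apply ball_le with (2 := y2); auto.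
  apply HG. split. apply cone_base. apply ball_center. }
rewrite (wdiff_dir_eq Db E1 E2 HD).
rewrite (linear_triple (proj1 DH)).
assert (Ela : la (snd h) = pr 2 h * la (1, 0) + pr 3 h * la (0, 1)).
{ destruct h as [h1 [h2 h3]]. apply (linear_pair (proj1 K1)). }
assert (Elb : lb (snd h) = pr 2 h * lb (1, 0) + pr 3 h * lb (0, 1)).
{ destruct h as [h1 [h2 h3]]. apply (linear_pair (proj1 K2)). }
assert (LS : forall g' : V3, is_linear (fun h : R_NormedModule => scal h g'))
  by (intros g'; exact (@is_linear_scal_l R_AbsRing V3 g')).
assert (E1s : forall g' : V3, lH (scal 1 g') = lH g') by (intros; apply f_equal, (scal_one (V := V3))).
assert (EF : F0 H b0 am bm = lH (1, 0, 0)).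
{ rewrite <- E1s. apply is_derive_unique, (@derive_triple H (fun y => (y, am, bm)) (fun h => scal h ((1, 0, 0) : V3)) lH b0); auto.
  intros s. change ((s, am, bm) = (b0 + (s - b0) * 1, am + (s - b0) * 0, bm + (s - b0) * 0)).
  apply (@f_equal2 (R * R) R _ pair); [apply (@f_equal2 R R _ pair)|]; ring. }
assert (EM1 : M10 H b0 am bm = lH (0, 1, 0)).
{ rewrite <- E1s. apply is_derive_unique, (@derive_triple H (fun y => (b0, y, bm)) (fun h => scal h ((0, 1, 0) : V3)) lH am); auto.
  intros s. change ((b0, s, bm) = (b0 + (s - am) * 0, am + (s - am) * 1, bm + (s - am) * 0)).
  apply (@f_equal2 (R * R) R _ pair); [apply (@f_equal2 R R _ pair)|]; ring. }
assert (EM2 : M20 H b0 am bm = lH (0, 0, 1)).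
{ rewrite <- E1s. apply is_derive_unique, (@derive_triple H (fun y => (b0, am, y)) (fun h => scal h ((0, 0, 1) : V3)) lH bm); auto.
  intros s. change ((b0, am, s) = (b0 + (s - bm) * 0, am + (s - bm) * 0, bm + (s - bm) * 1)).
  apply (@f_equal2 (R * R) R _ pair); [apply (@f_equal2 R R _ pair)|]; ring. }
rewrite EF, EM1, EM2, Ela, Elb. reflexivity.
Qed.

Lemma derive_F0 : is_derive (fun y => H (y, am, bm)) b0 (F0 H b0 am bm).
Proof.
apply Derive_correct.
assert (Hball : locally ((b0, am, bm) : V3) (ball ((b0, am, bm) : V3) r)) by (exists (mkposreal r Hr); auto).
assert (DH : ex_filterdiff H (within (ball ((b0, am, bm) : V3) r) (locally ((b0, am, bm) : V3)))).
{ apply (proj1 (HH 1%nat)). apply (ball_center ((b0, am, bm) : V3) (mkposreal r Hr)). }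
destruct DH as [lH DH]. apply (locally_wdiff Hball) in DH.
exists (lH (scal 1 ((1, 0, 0) : V3))).
apply (@derive_triple H (fun y => (y, am, bm)) (fun h => scal h ((1, 0, 0) : V3)) lH b0); auto.
intros s. change ((s, am, bm) = (b0 + (s - b0) * 1, am + (s - b0) * 0, bm + (s - b0) * 0)).
apply (@f_equal2 (R * R) R _ pair); [apply (@f_equal2 R R _ pair)|]; ring.
exact (@is_linear_scal_l R_AbsRing V3 _).
Qed.
End Side.
End Solution.

(** The cones of slopes [k1], [k2] contain the shocks and lie in the domains of
    the states ahead. *)
Section Existence.
Variables (p : R -> R) (rs : R) (S1 S2 : ahead) (r0 V1 V2 : R) (H1 H2 : R * R * R -> R) (da db : R).
Hypotheses (Hp : pressure_law p) (Hrs : 0 < rs) (HS1 : ahead_left p S1) (HS2 : ahead_right p S2)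
  (HI : interaction_point p S1 S2 r0 V1 V2).
Notation b0 := (b_0 p rs r0).
Notation base := (base p rs r0).
Notation eta0 := (eta p r0).
Notation a := (a_const eta0 V1 V2).
Notation am1 := (astar p rs S1 (0, 0)).
Notation bm1 := (bstar p rs S1 (0, 0)).
Notation am2 := (astar p rs S2 (0, 0)).
Notation bm2 := (bstar p rs S2 (0, 0)).
Hypotheses (HH1 : implicit_left p rs b0 am1 bm1 H1) (HH2 : implicit_right p rs b0 am2 bm2 H2)
  (Hsl : initial_slopes p rs S1 S2 r0 V1 V2 H1 H2 da db).

(** Solves the shock condition [lam t_u + mu t_v = V (t_u + t_v)] for [t_u / t_v]. On the right
    shock, [a lam t_u + mu t_v = V (a t_u + t_v)] gives [KK4]. *)
Definition kap4 (z : V4) : R := (mu4 p rs z - speed4 p rs S1 z) / (speed4 p rs S1 z - lam4 p rs z).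
Definition KK4 (z : V4) : R := a * ((speed4 p rs S2 z - lam4 p rs z) / (mu4 p rs z - speed4 p rs S2 z)).
Definition G1 : V4 -> R := Gside p rs S1 1 H1.
Definition G2 : V4 -> R := Gside p rs S2 0 H2.
(** The value of [kap4] at the interaction point, equal to [- 1 / Gamma0]. *)
Definition kap0 : R := (eta0 - V1) / (V1 + eta0).
Definition k1 : R := (V1 + (veloc S1 (0, 0) - eta p (dens S1 (0, 0)))) / 2.
Definition k2 : R := (V2 + (veloc S2 (0, 0) + eta p (dens S2 (0, 0)))) / 2.

Lemma r0_pos : 0 < r0.
Proof. apply HI. Qed.
Lemma bounds : - eta0 < V1 /\ V1 < 0 /\ 0 < V2 /\ V2 < eta0 /\
  V1 < k1 < veloc S1 (0, 0) - eta p (dens S1 (0, 0)) /\ veloc S2 (0, 0) + eta p (dens S2 (0, 0)) < k2 < V2.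
Proof. destruct HI as (h1 & h2 & h3 & h4 & h5 & h6). simpl in *. unfold k1, k2. lra. Qed.

Lemma a_bounds : 0 < a < 1.
Proof.
destruct bounds as (h1 & h2 & h3 & h4 & _). unfold a_const.
assert (A : 0 < (eta0 + V1) / (eta0 - V1) < 1).
{ split. apply Rdiv_lt_0_compat; lra. apply Rmult_lt_reg_r with (eta0 - V1). lra. field_simplify; lra. }
assert (B : 0 < (eta0 - V2) / (eta0 + V2) < 1).
{ split. apply Rdiv_lt_0_compat; lra. apply Rmult_lt_reg_r with (eta0 + V2). lra. field_simplify; lra. }
destruct A, B; split. apply Rmult_lt_0_compat; auto.
apply Rlt_trans with (1 * ((eta0 - V2) / (eta0 + V2))); [apply Rmult_lt_compat_r|]; lra.
Qed.

Lemma side1 : smooth_flow p S1 /\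
  exists r : posreal, forall z, cone 1 k1 z -> ball base r z -> dom S1 (snd z).
Proof. apply (@ahead_left_cone p rs r0 S1 k1 HS1). apply bounds. Qed.
Lemma side2 : smooth_flow p S2 /\
  exists r : posreal, forall z, cone (-1) k2 z -> ball base r z -> dom S2 (snd z).
Proof. apply (@ahead_right_cone p rs r0 S2 k2 HS2). apply bounds. Qed.

Lemma jump1 : jump_conditions p r0 0 (dens S1 (0, 0)) (veloc S1 (0, 0)) V1.
Proof. apply HI. Qed.
Lemma jump2 : jump_conditions p r0 0 (dens S2 (0, 0)) (veloc S2 (0, 0)) V2.
Proof. apply HI. Qed.

(** Without a jump of the density the velocity would not jump either, and the
    determinism condition would fail. *)
Lemma dens_jump1 : r0 <> dens S1 (0, 0).
Proof.
intros E. destruct jump1 as [J1 _]. rewrite <- E in J1.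
assert (W : veloc S1 (0, 0) = 0).
{ apply Rmult_eq_reg_l with r0; [|apply Rgt_not_eq, r0_pos]. lra. }
destruct bounds as (h1 & _ & _ & _ & h5 & _). rewrite W, <- E in h5. lra.
Qed.
Lemma dens_jump2 : r0 <> dens S2 (0, 0).
Proof.
intros E. destruct jump2 as [J1 _]. rewrite <- E in J1.
assert (W : veloc S2 (0, 0) = 0).
{ apply Rmult_eq_reg_l with r0; [|apply Rgt_not_eq, r0_pos]. lra. }
destruct bounds as (_ & _ & _ & h4 & _ & h5). rewrite W, <- E in h5. lra.
Qed.

Lemma speed1_base : speed4 p rs S1 base = V1.
Proof. destruct side1. apply (@speed4_base p rs r0 Hp Hrs r0_pos S1 1 k1); auto using jump1, dens_jump1. Qed.
Lemma speed2_base : speed4 p rs S2 base = V2.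
Proof. destruct side2. apply (@speed4_base p rs r0 Hp Hrs r0_pos S2 (-1) k2); auto using jump2, dens_jump2. Qed.
Lemma lam_base : lam4 p rs base = - eta0.
Proof. apply lam4_base; auto using r0_pos. Qed.
Lemma mu_base : mu4 p rs base = eta0.
Proof. apply mu4_base; auto using r0_pos. Qed.

Lemma Germ_kap n : Germ (cone 1 k1) base n kap4.
Proof.
destruct side1 as [s1 s2]. assert (R0 := r0_pos). destruct bounds as (h1 & h2 & _).
assert (Cb : cone 1 k1 base) by apply cone_base.
assert (GS := Germ_speed Hp Hrs R0 s1 s2 dens_jump1 n).
apply Germ_div; auto.
- rewrite speed1_base, lam_base; lra.
- apply Germ_minus; auto. apply Germ_mu; auto.
- apply Germ_minus; auto. apply Germ_lam; auto.
Qed.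
Lemma Germ_KK n : Germ (cone (-1) k2) base n KK4.
Proof.
destruct side2 as [s1 s2]. assert (R0 := r0_pos). destruct bounds as (_ & _ & h1 & h2 & _).
assert (Cb : cone (-1) k2 base) by apply cone_base.
assert (GS := Germ_speed Hp Hrs R0 s1 s2 dens_jump2 n).
apply Germ_mult; [apply Germ_const|]. apply Germ_div; auto.
- rewrite speed2_base, mu_base; lra.
- apply Germ_minus; auto. apply Germ_lam; auto.
- apply Germ_minus; auto. apply Germ_mu; auto.
Qed.

Lemma Germ_G1 n : Germ (cone 1 k1) base n G1.
Proof.
destruct side1 as [s1 s2]; destruct HH1 as [_ (r & Hr & Hs & _)].
apply (@Germ_Gside p rs r0 Hp Hrs S1 1 k1 1 H1 r); auto.
Qed.
Lemma Germ_G2 n : Germ (cone (-1) k2) base n G2.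
Proof.
destruct side2 as [s1 s2]; destruct HH2 as [_ (r & Hr & Hs & _)].
apply (@Germ_Gside p rs r0 Hp Hrs S2 (-1) k2 0 H2 r); auto.
Qed.

Lemma F0_left : F0 H1 b0 am1 bm1 * (eta0 - V1) ^ 2 = - (eta0 + V1) ^ 2.
Proof.
destruct side1 as [s1 s2]; destruct HH1 as [E (r & Hr & Hs & HJ)].
assert (D := @derive_F0 p rs r0 S1 H1 r Hr Hs).
assert (K := @jump_slope p rs r0 Hp Hrs r0_pos S1 1 k1 V1 s1 s2 jump1 dens_jump1
  (fun y => H1 (y, am1, bm1)) (fun y => y) b0 _ 1 E eq_refl D (@is_derive_id R_AbsRing b0)).
enough (X : locally b0 (fun s => J p rs (H1 (s, am1, bm1)) s am1 bm1 = 0)).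
{ specialize (K X). unfold eta_0 in K. lra. }
exists (mkposreal r Hr); intros y Hy; apply HJ. split; [split|]; simpl; auto; apply (ball_center _ (mkposreal r Hr)).
Qed.
Lemma F0_right : (eta0 - V2) ^ 2 + (eta0 + V2) ^ 2 * F0 H2 b0 am2 bm2 = 0.
Proof.
destruct side2 as [s1 s2]; destruct HH2 as [E (r & Hr & Hs & HJ)].
assert (D := @derive_F0 p rs r0 S2 H2 r Hr Hs).
assert (K := @jump_slope p rs r0 Hp Hrs r0_pos S2 (-1) k2 V2 s1 s2 jump2 dens_jump2
  (fun y => y) (fun y => H2 (y, am2, bm2)) b0 1 _ eq_refl E (@is_derive_id R_AbsRing b0) D).
enough (X : locally b0 (fun s => J p rs s (H2 (s, am2, bm2)) am2 bm2 = 0)).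
{ specialize (K X). unfold eta_0 in K. lra. }
exists (mkposreal r Hr); intros y Hy; apply HJ. split; [split|]; simpl; auto; apply (ball_center _ (mkposreal r Hr)).
Qed.

Lemma cone_dir sg k h : 0 <= pr 2 h -> 0 <= sg * (k * pr 2 h - pr 3 h) ->
  exists s0, 0 < s0 /\ forall s, 0 <= s <= s0 -> cone sg k (plus base (scal s h)).
Proof.
intros h1 h2; exists 1; split; [lra|]; intros s Hs.
assert (E2 : pr 2 (plus base (scal s h)) = s * pr 2 h) by apply Rplus_0_l.
assert (E3 : pr 3 (plus base (scal s h)) = s * pr 3 h) by apply Rplus_0_l.
split; rewrite E2, ?E3. apply Rmult_le_pos; lra.
replace (sg * (k * (s * pr 2 h) - s * pr 3 h)) with (s * (sg * (k * pr 2 h - pr 3 h))) by ring.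
apply Rmult_le_pos; lra.
Qed.

(** At the origin [x_v = mu t_v] with [mu = eta0], so the normalisation [x_v = 1] means
    [t_v = / eta0]; the left shock then forces [t_u = kap0 / eta0]. *)
Lemma existence : exists d al al1 al2 be be1 be2 t x f g fu r gv, 0 < d /\
  core_solution a b0 da db (kap0 / eta0) (/ eta0) (lam4 p rs) (mu4 p rs) k1 k2 kap4 KK4 G1 G2
    d al al1 al2 be be1 be2 t x f g fu r gv.
Proof.
assert (R0 := r0_pos). assert (He := eta_pos Hp R0). assert (Ha := a_bounds).
destruct bounds as (v1 & v2 & v3 & v4 & v5 & v6).
destruct side1 as [s1 s2], side2 as [s3 s4].
assert (Cv0 : convex C0) by (intros z z' s _ _ _; exact I).
assert (C00 : C0 base) by exact I.
assert (Cb1 : cone 1 k1 base) by apply cone_base.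
assert (Cb2 : cone (-1) k2 base) by apply cone_base.
(* Order four leaves the derivatives of the speeds smooth enough for the coefficients [P] and [Q],
   whose gradients must be Lipschitz. *)
destruct (Germ_C1r Cv0 C00 (Germ_lam Hp Hrs R0 C00 4)) as (dlam & [rl Hlam] & Gdl).
destruct (Germ_C1r Cv0 C00 (Germ_mu Hp Hrs R0 C00 4)) as (dmu & [rm Hmu] & Gdm).
set (gap := fun z => mu4 p rs z - lam4 p rs z).
assert (Ggap : forall n, Germ C0 base n gap) by (intros n; apply Germ_minus; [apply Germ_mu|apply Germ_lam]; auto).
assert (gap0 : gap base <> 0) by (unfold gap; rewrite lam_base, mu_base; lra).
destruct (Germ_near C00 (Ggap 0%nat) (locally_neq0 gap0)) as [rgap Hgap].
destruct (@Germ_C1r C0 base 0 (fun z => dlam 1%nat z / gap z) Cv0 C00) as (dP & [rP HP] & _).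
{ apply Germ_div; auto. apply Germ_le with (2 := Gdl 1%nat); lia. }
destruct (@Germ_C1r C0 base 0 (fun z => dmu 0%nat z / gap z) Cv0 C00) as (dQ & [rQ HQ] & _).
{ apply Germ_div; auto. apply Germ_le with (2 := Gdm 0%nat); lia. }
destruct (Germ_C1r (convex_cone (sg := 1) (k := k1)) Cb1 (Germ_kap 2)) as (dkap & [rk Hkap] & _).
destruct (Germ_C1r (convex_cone (sg := -1) (k := k2)) Cb2 (Germ_KK 2)) as (dKK & [rK HKK] & _).
destruct (Germ_C1r2 (convex_cone (sg := 1) (k := k1)) Cb1 (Germ_G1 3)) as (dG1 & ddG1 & rG1 & HG1 & HdG1).
destruct (Germ_C1r2 (convex_cone (sg := -1) (k := k2)) Cb2 (Germ_G2 3)) as (dG2 & ddG2 & rG2 & HG2 & HdG2).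
destruct (posreal_min (rl :: rm :: rgap :: rP :: rQ :: rk :: rK :: rG1 :: rG2 :: nil)) as [rg Hrg].
assert (Gk := proj2 (proj2 HG1)). assert (Gk2 := proj2 (proj2 HG2)).
destruct HH1 as [E1 (r1 & Hr1 & Hs1 & _)], HH2 as [E2 (r2 & Hr2 & Hs2 & _)].
assert (Sl1 := @Gside_slope p rs r0 Hp Hrs S1 1 k1 1 H1 r1 s1 s2 eq_refl Hr1 Hs1 rG1 dG1).
assert (Sl2 := @Gside_slope p rs r0 Hp Hrs S2 (-1) k2 0 H2 r2 s3 s4 eq_refl Hr2 Hs2 rG2 dG2).
(* Directions with vanishing [t] and [x] components lie in the cone, so the derivatives in [alpha]
   and [beta] are determined. *)
assert (A1 : dG1 0%nat base = 0).
{ assert (K := Sl1 (basis 0) Gk (@cone_dir _ _ (basis 0) (Rle_refl 0) ltac:(simpl; lra))).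
  unfold sum4 in K; simpl in K. lra. }
assert (A2 : dG1 1%nat base = F0 H1 b0 am1 bm1).
{ assert (K := Sl1 (basis 1) Gk (@cone_dir _ _ (basis 1) (Rle_refl 0) ltac:(simpl; lra))).
  unfold sum4 in K; simpl in K. lra. }
assert (A3 : dG2 1%nat base = 0).
{ assert (K := Sl2 (basis 1) Gk2 (@cone_dir _ _ (basis 1) (Rle_refl 0) ltac:(simpl; lra))).
  unfold sum4 in K; simpl in K. lra. }
assert (A4 : dG2 0%nat base = F0 H2 b0 am2 bm2).
{ assert (K := Sl2 (basis 0) Gk2 (@cone_dir _ _ (basis 0) (Rle_refl 0) ltac:(simpl; lra))).
  unfold sum4 in K; simpl in K. lra. }
assert (k0 : 0 < kap0) by (apply Rdiv_lt_0_compat; lra).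
assert (Hf : 0 < kap0 / eta0) by (apply Rdiv_lt_0_compat; auto).
assert (Hg : 0 < / eta0) by (apply Rinv_0_lt_compat; auto).
(* The shocks leave the origin with speeds [V1] and [V2], so the cone conditions reduce to [V1 < k1]
   and [k2 < V2]. *)
assert (X1 : 1 * (k1 * (1 * (kap0 / eta0) + / eta0) - (1 * (lam4 p rs base * (kap0 / eta0)) + mu4 p rs base * / eta0))
  = (k1 - V1) * (kap0 / eta0 + / eta0)).
{ rewrite lam_base, mu_base; unfold kap0; field; lra. }
assert (X2 : -1 * (k2 * (a * (kap0 / eta0) + / eta0) - (a * (lam4 p rs base * (kap0 / eta0)) + mu4 p rs base * / eta0))
  = (V2 - k2) * (a * (kap0 / eta0) + / eta0)).
{ rewrite lam_base, mu_base; unfold kap0, a_const; field; repeat split; lra. }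
assert (Y1 : 0 < (k1 - V1) * (kap0 / eta0 + / eta0)) by (apply Rmult_lt_0_compat; lra).
assert (Y2 : 0 < (V2 - k2) * (a * (kap0 / eta0) + / eta0)).
{ apply Rmult_lt_0_compat; [lra|]. assert (0 < a * (kap0 / eta0)) by (apply Rmult_lt_0_compat; lra). lra. }
rewrite <- X1 in Y1. rewrite <- X2 in Y2.
assert (Kb : kap4 base = kap0).
{ unfold kap4; rewrite speed1_base, lam_base, mu_base. unfold kap0; field; lra. }
assert (KKb : KK4 base = a * ((V2 + eta0) / (eta0 - V2))).
{ unfold KK4; rewrite speed2_base, lam_base, mu_base. field; lra. }
destruct Hsl as [L1 L2]. unfold along_shock in L1, L2.
apply (@core a b0 da db (kap0 / eta0) (/ eta0) (lam4 p rs) (mu4 p rs)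
  (fun z => dlam 1%nat z / gap z) (fun z => dmu 0%nat z / gap z) dlam dmu dP dQ Ha k1 k2 rg kap4 KK4 G1 G2
  dkap dKK dG1 dG2 ddG1 ddG2); auto.
- apply C1r_shrink with (2 := Hlam); apply Hrg; simpl; tauto.
- apply C1r_shrink with (2 := Hmu); apply Hrg; simpl; tauto.
- apply C1r_shrink with (2 := HP); apply Hrg; simpl; tauto.
- apply C1r_shrink with (2 := HQ); apply Hrg; simpl; tauto.
- apply C1r_shrink with (2 := Hkap); apply Hrg; simpl; tauto.
- apply C1r_shrink with (2 := HKK); apply Hrg; simpl; tauto.
- apply C1r_shrink with (2 := HG1); apply Hrg; simpl; tauto.
- intros i; apply C1r_shrink with (2 := HdG1 i); apply Hrg; simpl; tauto.
- apply C1r_shrink with (2 := HG2); apply Hrg; simpl; tauto.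
- intros i; apply C1r_shrink with (2 := HdG2 i); apply Hrg; simpl; tauto.
- fold base; rewrite Kb; auto.
(* [kap * KK = 1] at the origin: this relation is what determines the constant [a]. *)
- fold base; rewrite Kb, KKb; unfold kap0, a_const; field; repeat split; lra.
- fold base; rewrite Kb; reflexivity.
- fold base; rewrite A2, A4.
  assert (FL := F0_left). assert (FR := F0_right).
  assert (FL' : F0 H1 b0 am1 bm1 = - (eta0 + V1) ^ 2 / (eta0 - V1) ^ 2).
  { rewrite <- FL. field. lra. }
  assert (FR' : F0 H2 b0 am2 bm2 = - (eta0 - V2) ^ 2 / (eta0 + V2) ^ 2).
  { apply Rmult_eq_reg_l with ((eta0 + V2) ^ 2); [|apply pow_nonzero; lra]. field_simplify; lra. }
  rewrite FL', FR'. unfold a_const. field. lra.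
(* [h] is the velocity at the origin of the left shock in the space of [(alpha, beta, t, x)]; the
   claim becomes the first equation of the linear system for [da] and [db]. *)
- set (h := mk (1 * da) db (1 * (kap0 / eta0) + / eta0) (1 * (lam4 p rs base * (kap0 / eta0)) + mu4 p rs base * / eta0)).
  transitivity (sum4 (fun i => pr i h * dG1 i base)).
  + unfold slope, sum4; simpl; fold base; ring.
  + rewrite (Sl1 h Gk).
    2:{ apply cone_dir; simpl; lra. }
    simpl. rewrite lam_base, mu_base.
    transitivity (F0 H1 b0 am1 bm1 * db + (da - F0 H1 b0 am1 bm1 * db)); [|ring].
    fold (b_0 p rs r0) in L1. rewrite L1. unfold Gamma0, kap0. field. repeat split; lra.
- set (h := mk (a * da) db (a * (kap0 / eta0) + / eta0) (a * (lam4 p rs base * (kap0 / eta0)) + mu4 p rs base * / eta0)).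
  transitivity (sum4 (fun i => pr i h * dG2 i base)).
  + unfold slope, sum4; simpl; fold base; ring.
  + rewrite (Sl2 h Gk2).
    2:{ apply cone_dir; simpl; try lra. assert (0 < a * (kap0 / eta0)) by (apply Rmult_lt_0_compat; lra). lra. }
    simpl. rewrite lam_base, mu_base.
    transitivity (a * F0 H2 b0 am2 bm2 * da + (- a * F0 H2 b0 am2 bm2 * da + db)); [|ring].
    fold (b_0 p rs r0) in L2. rewrite L2. unfold Gamma0, kap0.
    generalize a; intros a'. field. repeat split; lra.
- intros z Bz. assert (N : gap z <> 0).
  { apply Hgap. exact I. apply ball_le with (2 := Bz), Hrg; simpl; tauto. }
  unfold gap in *. split; field; exact N.
Qed.

End Existence.

(** * Back to the triangle *)

Definition Sq (d : R) : Plane -> Prop := fun z => Rabs (fst z) < d /\ Rabs (snd z) < d.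

Lemma Sq_ball d z : ball ((0, 0) : Plane) d z <-> Sq d z.
Proof.
unfold Sq. rewrite <- (Rminus_0_r (fst z)), <- (Rminus_0_r (snd z)). reflexivity.
Qed.

Lemma Sq_locally d z : Sq d z -> locally z (Sq d).
Proof.
intros [h1 h2]. destruct (locally_2d_abs h1 h2) as [e He]; exists e.
intros [u v] [b1 b2]; apply He; auto.
Qed.

Lemma Cdiff_partials k d (F Fu Fv : R -> R -> R) :
  (forall u v, Rabs u < d -> Rabs v < d ->
     is_derive (fun u => F u v) u (Fu u v) /\ is_derive (fun v => F u v) v (Fv u v)) ->
  Cdiff k (Sq d) (fun z => Fu (fst z) (snd z)) -> Cdiff k (Sq d) (fun z => Fv (fst z) (snd z)) ->
  (forall z, Sq d z -> filterdiff (fun z : Plane => F (fst z) (snd z)) (locally z)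
     (fun h => fst h * Fu (fst z) (snd z) + snd h * Fv (fst z) (snd z))) /\
  Cdiff (S k) (Sq d) (fun z => F (fst z) (snd z)).
Proof.
intros HD Hu Hv.
assert (K : forall z, Sq d z -> filterdiff (fun z : Plane => F (fst z) (snd z)) (locally z)
     (fun h => fst h * Fu (fst z) (snd z) + snd h * Fv (fst z) (snd z))).
{ intros [u v] Hz. apply (is_derive_filterdiff F u v Fu (Fv u v)).
  - generalize (Sq_locally Hz); apply filter_imp; intros [u' v'] [h1 h2]; apply HD; auto.
  - apply HD; apply Hz.
  - assert (C := Cdiff_continuous _ _ _ _ Hu Hz). intros P HP. assert (C' := C P HP).
    generalize (filter_and _ _ (Sq_locally Hz) (C' : locally ((u, v) : Plane) (fun y => Sq d y -> P (Fu (fst y) (snd y))))).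
    unfold filtermap; apply filter_imp; intros y [y1 y2]; auto. }
split; auto.
exists (fun z h => fst h * Fu (fst z) (snd z) + snd h * Fv (fst z) (snd z)); split.
- intros z Hz; apply wdiff_locally; auto.
- intros h; apply Cdiff_plus; apply Cdiff_mult; auto using Cdiff_const.
Qed.

Lemma cont_on_Cdiff d F : cont_on d F -> Cdiff 0 (Sq d) (fun z => F (fst z) (snd z)).
Proof.
intros H [u v] [h1 h2] P HP.
assert (K := proj1 (continuity_2d_pt_filterlim F u v) (H u v h1 h2) P HP).
revert K; unfold filtermap, within; apply filter_imp; auto.
Qed.

(** A differential of zero annihilates [w - z] for every [w] in [D], as [D] contains the segment
    from [z] to [w]. Three points that are not collinear give two independent differences. *)
Lemma unique_dirs (D : Plane -> Prop) z : D z ->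
  (forall w s, D w -> 0 <= s <= 1 -> D (fst z + s * (fst w - fst z), snd z + s * (snd w - snd z))) ->
  forall w1 w2 w3, D w1 -> D w2 -> D w3 ->
  (fst w2 - fst w1) * (snd w3 - snd w1) - (fst w3 - fst w1) * (snd w2 - snd w1) <> 0 ->
  has_unique_diff D z.
Proof.
intros Hz HC w1 w2 w3 H1 H2 H3 Hdet l Hl h.
assert (L : forall x y : R, l (x, y) = x * l (1, 0) + y * l (0, 1)) by apply (linear_pair (proj1 Hl)).
assert (K : forall w, D w -> (fst w - fst z) * l (1, 0) + (snd w - snd z) * l (0, 1) = 0).
{ intros w Hw. rewrite <- L. apply (wdiff_dir Hz Hl). exists 1; split; [lra|].
  intros s Hs. assert (K := HC w s Hw Hs). destruct z; exact K. }
assert (K1 := K w1 H1). assert (K2 := K w2 H2). assert (K3 := K w3 H3).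
set (A := l (1, 0)) in *. set (B := l (0, 1)) in *.
assert (E1 : (fst w2 - fst w1) * A + (snd w2 - snd w1) * B = 0) by lra.
assert (E2 : (fst w3 - fst w1) * A + (snd w3 - snd w1) * B = 0) by lra.
assert (A0 : A = 0).
{ apply Rmult_eq_reg_l with (2 := Hdet).
  transitivity ((snd w3 - snd w1) * ((fst w2 - fst w1) * A + (snd w2 - snd w1) * B)
    - (snd w2 - snd w1) * ((fst w3 - fst w1) * A + (snd w3 - snd w1) * B)). ring. rewrite E1, E2; ring. }
assert (B0 : B = 0).
{ apply Rmult_eq_reg_l with (2 := Hdet).
  transitivity ((fst w2 - fst w1) * ((fst w3 - fst w1) * A + (snd w3 - snd w1) * B)
    - (fst w3 - fst w1) * ((fst w2 - fst w1) * A + (snd w2 - snd w1) * B)). ring. rewrite E1, E2; ring. }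
destruct h as [x y]. rewrite L. fold A B. rewrite A0, B0. simpl; ring.
Qed.

(** The three corners serve as test points at every [z], corners included; they are not collinear
    because [0 < a < 1]. *)
Lemma Tri_unique a eps z : 0 < a < 1 -> 0 < eps -> Tri a eps z -> has_unique_diff (V := Plane) (Tri a eps) z.
Proof.
intros Ha He Hz.
assert (Ia : a * / a = 1) by (field; lra). assert (Pa : 0 < / a) by (apply Rinv_0_lt_compat; lra).
assert (Pae : 0 < a * eps) by (apply Rmult_lt_0_compat; lra).
assert (Q : a * eps / a = eps) by (field; lra).
assert (L : a * eps <= eps) by nra.
apply unique_dirs with ((0, 0) : Plane) ((a * eps, a * eps) : Plane) ((a * eps, eps) : Plane); auto; unfold Tri in *; simpl.
- intros [w1 w2] s (q1 & q2 & q3 & q4) Hs; destruct z as [z1 z2], Hz as (p1 & p2 & p3 & p4); simpl in *.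
  unfold Rdiv in *. set (ia := / a) in *.
  replace (z1 + s * (w1 - z1)) with ((1 - s) * z1 + s * w1) by ring.
  replace (z2 + s * (w2 - z2)) with ((1 - s) * z2 + s * w2) by ring.
  assert (M1 : forall x y, x <= y -> (1 - s) * x <= (1 - s) * y) by (intros; apply Rmult_le_compat_l; lra).
  assert (M2 : forall x y, x <= y -> s * x <= s * y) by (intros; apply Rmult_le_compat_l; lra).
  assert (a1 := M1 _ _ p1); assert (a2 := M1 _ _ p2); assert (a3 := M1 _ _ p3); assert (a4 := M1 _ _ p4).
  assert (c1 := M2 _ _ q1); assert (c2 := M2 _ _ q2); assert (c3 := M2 _ _ q3); assert (c4 := M2 _ _ q4).
  rewrite Rmult_plus_distr_r. lra.
- unfold Rdiv; rewrite Rmult_0_l; lra.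
- rewrite Q; lra.
- rewrite Q; lra.
- intros E. assert (a * eps * (eps * (1 - a)) = 0) by lra.
  assert (0 < a * eps * (eps * (1 - a))) by (repeat apply Rmult_lt_0_compat; lra). lra.
Qed.

Lemma Icc_unique b s : 0 < b -> Icc 0 b s -> has_unique_diff (V := R_NormedModule) (Icc 0 b) s.
Proof.
intros Hb Hs l Hl h.
assert (L : forall x : R, l x = x * l 1).
{ intros x. transitivity (l (scal x (1 : R))). f_equal. symmetry; apply Rmult_1_r. apply Hl. }
rewrite L. enough (l 1 = 0) as -> by apply Rmult_0_r.
unfold Icc in Hs. destruct (Rlt_dec s b) as [q|q].
- apply (wdiff_dir Hs Hl). exists (b - s); split; [lra|]. intros r Hr.
  change (0 <= s + r * 1 <= b). lra.
(* At the right end point only the direction [-1] points into the interval. *)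
- assert (K : l (-1) = 0).
  { apply (wdiff_dir Hs Hl). exists b; split; [lra|]. intros r Hr. change (0 <= s + r * -1 <= b). lra. }
  rewrite L in K. lra.
Qed.

Lemma deriv_on_eq b (f : R -> R) s l : 0 < b -> Icc 0 b s -> is_derive f s l -> deriv_on (Icc 0 b) f s = l.
Proof.
intros Hb Hs Hf. unfold deriv_on.
rewrite (@dwithin_eq R_NormedModule (Icc 0 b) s f (fun h => h * l) (Icc_unique Hb Hs)).
apply Rmult_1_l. apply is_derive_wdiff; auto.
Qed.

(** * The inverse of the map from (u, v) to (t, x) *)

Section Inverse.
Variables (D : Plane -> Prop) (E1 E2 : Plane -> R) (L : R)
  (a11 a12 a21 a22 c11 c12 c21 c22 : Plane -> R).
Hypotheses (HL : 0 <= L)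
  (Hinj : forall z z', D z -> D z' ->
     Rabs (fst z' - fst z) + Rabs (snd z' - snd z) <= L * (Rabs (E1 z' - E1 z) + Rabs (E2 z' - E2 z)))
  (HE1 : forall z, D z -> filterdiff E1 (within D (locally z)) (fun h => fst h * a11 z + snd h * a12 z))
  (HE2 : forall z, D z -> filterdiff E2 (within D (locally z)) (fun h => fst h * a21 z + snd h * a22 z))
  (I11 : forall z, D z -> c11 z * a11 z + c12 z * a21 z = 1) (I12 : forall z, D z -> c11 z * a12 z + c12 z * a22 z = 0)
  (I21 : forall z, D z -> c21 z * a11 z + c22 z * a21 z = 0) (I22 : forall z, D z -> c21 z * a12 z + c22 z * a22 z = 1).

Definition image : Plane -> Prop := image2 D E1 E2.
Definition inverse (y : Plane) : Plane := epsilon (inhabits ((0, 0) : Plane)) (fun z => D z /\ y = (E1 z, E2 z)).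

Lemma inverse_spec y : image y -> D (inverse y) /\ y = (E1 (inverse y), E2 (inverse y)).
Proof. intros Hy; exact (epsilon_spec _ _ Hy). Qed.

Lemma inverse_E z : D z -> inverse (E1 z, E2 z) = z.
Proof.
intros Hz. destruct (@inverse_spec (E1 z, E2 z)) as [h1 h2]. exists z; auto.
assert (K := Hinj Hz h1). assert (F1 := f_equal fst h2). assert (F2 := f_equal snd h2). simpl in F1, F2.
rewrite <- F1, <- F2, !Rminus_diag, Rabs_R0 in K.
assert (p1 := Rabs_pos (fst (inverse (E1 z, E2 z)) - fst z)). assert (p2 := Rabs_pos (snd (inverse (E1 z, E2 z)) - snd z)).
assert (q1 : Rabs (fst (inverse (E1 z, E2 z)) - fst z) = 0) by lra.
assert (q2 : Rabs (snd (inverse (E1 z, E2 z)) - snd z) = 0) by lra.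
apply Rabs_eq_0 in q1; apply Rabs_eq_0 in q2.
destruct z as [z1 z2], (inverse (E1 (z1, z2), E2 (z1, z2))) as [w1 w2]; simpl in *.
apply (@f_equal2 R R _ pair); lra.
Qed.

Lemma norm_ge (h : Plane) : Rabs (fst h) <= norm h /\ Rabs (snd h) <= norm h.
Proof. split; [apply (norm_le_prod_norm_1 h)|apply (norm_le_prod_norm_2 h)]. Qed.

Lemma norm_le (h : Plane) : norm h <= 2 * (Rabs (fst h) + Rabs (snd h)).
Proof.
destruct h as [x y]. eapply Rle_trans. apply (norm_prod (U := R_NormedModule) (V := R_NormedModule) x y).
change (sqrt 2 * Rmax (Rabs x) (Rabs y) <= 2 * (Rabs x + Rabs y)).
assert (p1 := Rabs_pos x). assert (p2 := Rabs_pos y).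
assert (Hm : 0 <= Rmax (Rabs x) (Rabs y) <= Rabs x + Rabs y).
{ split. apply Rle_trans with (Rabs x); auto; apply Rmax_l. apply Rmax_lub; lra. }
assert (S2 : 0 <= sqrt 2 <= 2).
{ split. apply sqrt_pos. replace 2 with (sqrt (2 * 2)) at 2 by (apply sqrt_square; lra). apply sqrt_le_1_alt; lra. }
apply Rmult_le_compat; lra.
Qed.

Lemma inverse_Lipschitz z y : D z -> image y ->
  Rabs (fst (inverse y) - fst z) + Rabs (snd (inverse y) - snd z) <= 2 * L * norm (minus y ((E1 z, E2 z) : Plane)).
Proof.
intros Hz Hy; destruct (inverse_spec Hy) as [h1 h2].
assert (K := Hinj Hz h1). assert (F1 := f_equal fst h2). assert (F2 := f_equal snd h2). simpl in F1, F2.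
rewrite <- F1, <- F2 in K.
assert (n1 : Rabs (fst y - E1 z) <= norm (minus y ((E1 z, E2 z) : Plane))) by apply (norm_ge (minus y ((E1 z, E2 z) : Plane))).
assert (n2 : Rabs (snd y - E2 z) <= norm (minus y ((E1 z, E2 z) : Plane))) by apply (norm_ge (minus y ((E1 z, E2 z) : Plane))).
set (N := norm (minus y ((E1 z, E2 z) : Plane))) in *. clearbody N.
eapply Rle_trans. apply K. replace (2 * L * N) with (L * (2 * N)) by ring.
apply Rmult_le_compat_l; auto.
rewrite double; apply Rplus_le_compat; assumption.
Qed.

Lemma inverse_near z (P : Plane -> Prop) : D z -> locally z P ->
  locally ((E1 z, E2 z) : Plane) (fun y => image y -> P (inverse y)).
Proof.
intros Hz [e He].
assert (Hd : 0 < e / (2 * (2 * L + 1))) by (apply Rdiv_lt_0_compat; [apply cond_pos|lra]).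
assert (Pe := cond_pos e).
assert (B : locally ((E1 z, E2 z) : Plane) (fun y => norm (minus y ((E1 z, E2 z) : Plane)) < e / (2 * L + 1))).
{ apply (locally_le_locally_norm (V := Plane)).
  assert (Hd' : 0 < e / (2 * L + 1)) by (apply Rdiv_lt_0_compat; lra).
  exists (mkposreal _ Hd'); intros y Hy; exact Hy. }
revert B; apply filter_imp; intros y By Hy; apply He.
assert (K := inverse_Lipschitz Hz Hy).
assert (K2 : 2 * L * norm (minus y ((E1 z, E2 z) : Plane)) < e).
{ apply Rle_lt_trans with (2 * L * (e / (2 * L + 1))). apply Rmult_le_compat_l; lra.
  apply Rmult_lt_reg_r with (2 * L + 1). lra. field_simplify; nra. }
assert (p1 := Rabs_pos (fst (inverse y) - fst z)). assert (p2 := Rabs_pos (snd (inverse y) - snd z)).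
split.
- change (Rabs (fst (inverse y) - fst z) < e). lra.
- change (Rabs (snd (inverse y) - snd z) < e). lra.
Qed.

(** The Lipschitz bound for the inverse turns an error [o(|w - z|)] in the source into an error of
    the same kind in the image. The factor [4 * L] combines this bound with the comparison of
    norms. *)
Lemma remainder z (E : Plane -> R) b1 b2 e : D z -> 0 < e ->
  filterdiff E (within D (locally z)) (fun h => fst h * b1 + snd h * b2) ->
  locally ((E1 z, E2 z) : Plane) (fun y => image y -> let w := inverse y in
    Rabs (E w - E z - ((fst w - fst z) * b1 + (snd w - snd z) * b2)) <= e * norm (minus y ((E1 z, E2 z) : Plane))).
Proof.
intros Hz He HE. apply wdiff_iff in HE; auto. destruct HE as [_ HE].
assert (He' : 0 < e / (4 * L + 1)) by (apply Rdiv_lt_0_compat; lra).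
generalize (inverse_near Hz (HE (mkposreal _ He'))). apply filter_imp.
intros y Hy Iy; destruct (inverse_spec Iy) as [Dw _]. assert (K := Hy Iy Dw). simpl in K.
intros w. change (inverse y) with w in K.
change (Rabs (E w - E z - ((fst w - fst z) * b1 + (snd w - snd z) * b2)) <= e / (4 * L + 1) * norm (minus w z)) in K.
apply Rle_trans with (1 := K). set (N := norm (minus y ((E1 z, E2 z) : Plane))).
assert (HN : 0 <= N) by apply norm_ge_0.
assert (K1 := inverse_Lipschitz Hz Iy). fold w N in K1.
assert (K2 := norm_le (minus w z)).
change (norm (minus w z) <= 2 * (Rabs (fst w - fst z) + Rabs (snd w - snd z))) in K2.
apply Rle_trans with (e / (4 * L + 1) * (4 * L * N)).
- apply Rmult_le_compat_l; [apply Rlt_le, He'|]. lra.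
- replace (e / (4 * L + 1) * (4 * L * N)) with (e * N * (4 * L / (4 * L + 1))) by (field; lra).
  rewrite <- (Rmult_1_r (e * N)) at 2. apply Rmult_le_compat_l. apply Rmult_le_pos; lra.
  apply Rmult_le_reg_r with (4 * L + 1). lra. field_simplify; lra.
Qed.

Lemma linear_form (x y : R) : is_linear (fun k : Plane => x * fst k + y * snd k).
Proof.
apply (is_linear_comp (U := Plane) (V := Plane) (W := R_NormedModule) (fun k : Plane => (x * fst k, y * snd k)) (fun k => plus (fst k) (snd k))).
- apply (is_linear_prod (T := Plane) (U := R_NormedModule) (V := R_NormedModule)).
  + apply (is_linear_comp (U := Plane) (V := R_NormedModule) (W := R_NormedModule) fst (fun k => x * k)); [apply is_linear_fst|apply (is_linear_scal_r (K := R_AbsRing) (V := R_NormedModule) x Rmult_comm)].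
  + apply (is_linear_comp (U := Plane) (V := R_NormedModule) (W := R_NormedModule) snd (fun k => y * k)); [apply is_linear_snd|apply (is_linear_scal_r (K := R_AbsRing) (V := R_NormedModule) y Rmult_comm)].
- apply (is_linear_plus (V := R_NormedModule)).
Qed.

(** The row [(x, y)] times the Jacobian matrix is the linear form [G]. In this combination of the
    expansions of [E1] and [E2] only their remainders [r1] and [r2] survive. *)
Lemma inverse_component z (G : Plane -> R) (g1 g2 x y : R) : D z ->
  (forall w, G w = fst w * g1 + snd w * g2) ->
  x * a11 z + y * a21 z = g1 -> x * a12 z + y * a22 z = g2 ->
  filterdiff (fun y => G (inverse y)) (within image (locally ((E1 z, E2 z) : Plane))) (fun k => x * fst k + y * snd k).
Proof.
intros Hz HG Hx Hy.
apply wdiff_iff. exists z; auto. split. apply linear_form.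
intros e. set (A := Rabs x + Rabs y + 1).
assert (HA : 0 < A) by (assert (p1 := Rabs_pos x); assert (p2 := Rabs_pos y); unfold A; lra).
assert (He : 0 < e / A) by (apply Rdiv_lt_0_compat; auto; apply cond_pos).
generalize (filter_and _ _ (remainder Hz He (HE1 Hz)) (remainder Hz He (HE2 Hz))).
apply filter_imp; intros k [K1 K2] Ik. specialize (K1 Ik). specialize (K2 Ik). simpl in K1, K2.
destruct (inverse_spec Ik) as [Dw Ek]. assert (F1 := f_equal fst Ek). assert (F2 := f_equal snd Ek). simpl in F1, F2.
set (w := inverse k) in *. rewrite <- F1 in K1. rewrite <- F2 in K2.
set (N := norm (minus k ((E1 z, E2 z) : Plane))) in *.
rewrite (inverse_E Hz), (HG w), (HG z).
change (Rabs (fst w * g1 + snd w * g2 - (fst z * g1 + snd z * g2) - (x * (fst k - E1 z) + y * (snd k - E2 z))) <= e * N).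
set (r1 := fst k - E1 z - ((fst w - fst z) * a11 z + (snd w - snd z) * a12 z)) in *.
set (r2 := snd k - E2 z - ((fst w - fst z) * a21 z + (snd w - snd z) * a22 z)) in *.
replace (fst w * g1 + snd w * g2 - (fst z * g1 + snd z * g2) - (x * (fst k - E1 z) + y * (snd k - E2 z)))
  with (- (x * r1 + y * r2)) by (rewrite <- Hx, <- Hy; unfold r1, r2; ring).
rewrite Rabs_Ropp. eapply Rle_trans. apply Rabs_triang. rewrite !Rabs_mult.
assert (HN : 0 <= N) by apply norm_ge_0.
assert (T1 : Rabs x * Rabs r1 <= Rabs x * (e / A * N)) by (apply Rmult_le_compat_l; auto; apply Rabs_pos).
assert (T2 : Rabs y * Rabs r2 <= Rabs y * (e / A * N)) by (apply Rmult_le_compat_l; auto; apply Rabs_pos).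
replace (e * N) with (A * (e / A * N)) by (field; lra).
assert (0 <= e / A * N) by (apply Rmult_le_pos; lra). unfold A at 1. lra.
Qed.

Lemma image_E z : D z -> image (E1 z, E2 z).
Proof. intros Hz; exists z; auto. Qed.

(** The differential of [F] composed with the inverse is again a function on [D] composed with the
    inverse, built from the differential of [F] and the entries of the inverse matrix. So the order
    rises by induction, and the entries need one order less than [F]. *)
Lemma Cdiff_inverse k F : Cdiff k D F -> (k = 0%nat \/
  (Cdiff (pred k) D c11 /\ Cdiff (pred k) D c12 /\ Cdiff (pred k) D c21 /\ Cdiff (pred k) D c22)) ->
  Cdiff k image (fun y => F (inverse y)).
Proof.
revert F; induction k as [|k IH]; intros F HF Hc.
- intros y Hy. destruct (inverse_spec Hy) as [Dz Ey]. set (z := inverse y) in *.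
  intros P HP. assert (K := HF z Dz P HP).
  generalize (inverse_near Dz K). rewrite <- Ey. unfold filtermap, within. apply filter_imp.
  intros y' h1 h2. apply h1; auto. apply inverse_spec; auto.
- destruct Hc as [Hc|(h11 & h12 & h21 & h22)]; [discriminate|]. simpl in h11, h12, h21, h22.
  destruct HF as [l [Hl1 Hl2]].
  exists (fun y k => (fun z => l z (1, 0) * (c11 z * fst k + c12 z * snd k) + l z (0, 1) * (c21 z * fst k + c22 z * snd k)) (inverse y)).
  split.
  + intros y Hy. destruct (inverse_spec Hy) as [Dz Ey]. set (z := inverse y) in *.
    apply filterdiff_ext_lin with (fun k => l z (c11 z * fst k + c12 z * snd k, c21 z * fst k + c22 z * snd k)).
    * apply (@wdiff_comp Plane Plane image D inverse F y (fun k => (c11 z * fst k + c12 z * snd k, c21 z * fst k + c22 z * snd k)) (l z)); auto.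
      -- intros y' Hy'; apply inverse_spec; auto.
      -- rewrite Ey.
         assert (L1 : forall w : Plane, (fst w : R) = fst w * 1 + snd w * 0) by (intros [w1 w2]; simpl; rewrite Rmult_1_r, Rmult_0_r, Rplus_0_r; auto).
         assert (L2 : forall w : Plane, (snd w : R) = fst w * 0 + snd w * 1) by (intros [w1 w2]; simpl; rewrite Rmult_1_r, Rmult_0_r, Rplus_0_l; auto).
         assert (Q1 := @inverse_component z fst 1 0 (c11 z) (c12 z) Dz L1 (I11 Dz) (I12 Dz)).
         assert (Q2 := @inverse_component z snd 0 1 (c21 z) (c22 z) Dz L2 (I21 Dz) (I22 Dz)).
         assert (Q := @wdiff_pair Plane R_NormedModule R_NormedModule _ _ _ _ _ _ Q1 Q2).
         revert Q. apply filterdiff_ext. intros y'; destruct (inverse y'); reflexivity.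
    * intros k0. rewrite (linear_pair (proj1 (Hl1 z Dz))). fold z.
      match goal with |- ?A = ?B => change (@eq R A B) end; ring.
  + intros k0. apply (IH (fun z => l z (1, 0) * (c11 z * fst k0 + c12 z * snd k0) + l z (0, 1) * (c21 z * fst k0 + c22 z * snd k0))).
    * apply Cdiff_plus; apply Cdiff_mult; auto; apply Cdiff_plus; apply Cdiff_mult; auto using Cdiff_const.
    * destruct k as [|k]; [left; auto|right]. simpl; repeat split; apply Cdiff_pred; auto.
Qed.

Hypotheses (U : forall z, D z -> has_unique_diff D z)
  (J11 : forall z, D z -> a11 z * c11 z + a12 z * c21 z = 1) (J12 : forall z, D z -> a11 z * c12 z + a12 z * c22 z = 0)
  (J21 : forall z, D z -> a21 z * c11 z + a22 z * c21 z = 0) (J22 : forall z, D z -> a21 z * c12 z + a22 z * c22 z = 1).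

(** The image has no explicit shape, so uniqueness is pulled back: a differential of zero within the
    image, composed with the Jacobian matrix, is one within [D] and vanishes, and the matrix is
    invertible. *)
Lemma image_unique y : image y -> has_unique_diff image y.
Proof.
intros [z [Dz ->]] l Hl k.
assert (K : filterdiff (fun _ : Plane => 0) (within D (locally z))
  (fun h => l (fst h * a11 z + snd h * a12 z, fst h * a21 z + snd h * a22 z))).
{ apply (@wdiff_comp Plane Plane D image (fun z => (E1 z, E2 z)) (fun _ => 0) z
    (fun h => (fst h * a11 z + snd h * a12 z, fst h * a21 z + snd h * a22 z)) l); auto.
  - intros w Hw; apply image_E; auto.
  - apply (@wdiff_pair Plane R_NormedModule R_NormedModule); auto. }
assert (K2 := U Dz K (c11 z * fst k + c12 z * snd k, c21 z * fst k + c22 z * snd k)). simpl in K2.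
rewrite <- K2. f_equal. destruct k as [y1 y2]; simpl.
assert (R0 : forall a b p q r s e1 e2 y1 y2 : R, a * p + b * r = e1 -> a * q + b * s = e2 ->
  (p * y1 + q * y2) * a + (r * y1 + s * y2) * b = e1 * y1 + e2 * y2) by (intros; subst; ring).
apply (@f_equal2 R R _ pair).
- rewrite (R0 _ _ _ _ _ _ _ _ _ _ (J11 Dz) (J12 Dz)). rewrite Rmult_1_l, Rmult_0_l; symmetry; apply Rplus_0_r.
- rewrite (R0 _ _ _ _ _ _ _ _ _ _ (J21 Dz) (J22 Dz)). rewrite Rmult_1_l, Rmult_0_l; symmetry; apply Rplus_0_l.
Qed.

Lemma C2_inverse F : Cdiff 2 D F -> Cdiff 1 D c11 -> Cdiff 1 D c12 -> Cdiff 1 D c21 -> Cdiff 1 D c22 ->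
  C2_function_of D E1 E2 F.
Proof.
intros HF h11 h12 h21 h22. exists (fun y => F (inverse y)); split.
- apply (@Cdiff_Ck Plane 2 image). apply image_unique. apply Cdiff_inverse; auto.
- intros z Hz. rewrite inverse_E; auto.
Qed.

End Inverse.

Lemma Germ_near_pos {V : NormedModule R_AbsRing} (C : V -> Prop) o k f g :
  C o -> Germ C o k f -> Germ C o k g -> f o < g o ->
  exists r : posreal, forall z, C z -> ball o r z -> f z < g z.
Proof.
intros Co Hf Hg H. destruct (@Germ_near V C o k (fun z => g z - f z) (fun y => 0 < y) Co) as [r Hr].
- apply Germ_minus; auto.
- apply locally_pos; lra.
- exists r; intros z Cz Bz. specialize (Hr z Cz Bz). simpl in Hr. lra.
Qed.

(** * Domain, jump and determinism conditions near the interaction point *)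

Section Side.
Variables (p : R -> R) (rs r0 : R) (S : ahead) (sg k : R) (H : R * R * R -> R) (j : nat) (rH : R).
Hypotheses (Hp : pressure_law p) (Hrs : 0 < rs) (HS : smooth_flow p S) (Hr : 0 < rH)
  (Hj : pr j (base p rs r0) = b_0 p rs r0)
  (Hdom : exists r : posreal, forall z, cone sg k z -> ball (base p rs r0) r z -> dom S (snd z)).

Lemma Germ_eta_dens n : Germ (cone sg k) (base p rs r0) n (fun z => eta p (dens S (snd z))).
Proof.
apply (@Germ_ahead p rs r0 S sg k Hdom n (fun z => eta p (dens S z))).
apply (@Cdiff_comp1 Plane (dom S) n (eta p) (dens S) (fun r => 0 < r)); [apply Cdiff_eta; auto|eapply Cdiff_dens; eauto|].
intros; eapply dens_pos; eauto.
Qed.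

Lemma Germ_veloc n : Germ (cone sg k) (base p rs r0) n (fun z => veloc S (snd z)).
Proof. apply (@Germ_ahead p rs r0 S sg k Hdom n (veloc S)). eapply Cdiff_veloc; eauto. Qed.

Lemma argument_near : exists r : posreal, forall z, cone sg k z -> ball (base p rs r0) r z ->
  dom S (snd z) /\
  ball ((b_0 p rs r0, astar p rs S (0, 0), bstar p rs S (0, 0)) : R * R * R) rH (pr j z, astar p rs S (snd z), bstar p rs S (snd z)).
Proof.
destruct Hdom as [r1 Hr1]. assert (Cb := cone_base p rs r0 sg k).
assert (A1 : Germ (cone sg k) (base p rs r0) 0 (pr j)) by (apply Germ_linear, linear_pr).
assert (A2 := Germ_ahead Hdom (Cdiff_astar Hp Hrs HS 0)).
assert (A3 := Germ_ahead Hdom (Cdiff_bstar Hp Hrs HS 0)).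
destruct (Germ_near Cb A1 (locally_ball _ (mkposreal _ Hr))) as [r2 Hr2].
destruct (Germ_near Cb A2 (locally_ball _ (mkposreal _ Hr))) as [r3 Hr3].
destruct (Germ_near Cb A3 (locally_ball _ (mkposreal _ Hr))) as [r4 Hr4].
destruct (posreal_min (r1 :: r2 :: r3 :: r4 :: nil)) as [r Hm].
exists r; intros z Cz Bz.
assert (Q : forall s, List.In s (r1 :: r2 :: r3 :: r4 :: nil) -> ball (base p rs r0) s z) by (intros; eapply ball_le; [apply Hm|]; eauto).
split; [apply Hr1; auto; apply Q; simpl; auto|].
repeat split.
- rewrite <- Hj. apply Hr2; auto; apply Q; simpl; auto.
- apply Hr3; auto; apply Q; simpl; auto.
- apply Hr4; auto; apply Q; simpl; auto.
Qed.

Lemma characteristic_ahead z : dom S z ->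
  c_in p rs (astar p rs S z) (bstar p rs S z) = veloc S z - eta p (dens S z) /\
  c_out p rs (astar p rs S z) (bstar p rs S z) = veloc S z + eta p (dens S z).
Proof.
intros Hz. unfold c_in, c_out, astar, bstar. rewrite rho_state, vel_state; auto. apply HS, Hz.
Qed.

End Side.

Section Existence.
Variables (p : R -> R) (rs : R) (S1 S2 : ahead) (r0 V1 V2 : R) (H1 H2 : R * R * R -> R).
Hypotheses (Hp : pressure_law p) (Hrs : 0 < rs) (HS1 : ahead_left p S1) (HS2 : ahead_right p S2)
  (HI : interaction_point p S1 S2 r0 V1 V2)
  (HH1 : implicit_left p rs (b_0 p rs r0) (astar p rs S1 (0, 0)) (bstar p rs S1 (0, 0)) H1)
  (HH2 : implicit_right p rs (b_0 p rs r0) (astar p rs S2 (0, 0)) (bstar p rs S2 (0, 0)) H2).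

(** The determinism inequalities are strict at the interaction point and persist by continuity. The
    jump condition holds because the arguments of [H1] stay in the ball on which [H1] solves
    [J = 0]. *)
Lemma left_shock_near : exists r : posreal, forall z, cone 1 (k1 p S1 V1) z -> ball (base p rs r0) r z ->
  dom S1 (snd z) /\
  lam4 p rs z < speed4 p rs S1 z < c_in p rs (astar p rs S1 (snd z)) (bstar p rs S1 (snd z)) /\
  J p rs (G1 p rs S1 H1 z) (pr 1 z) (astar p rs S1 (snd z)) (bstar p rs S1 (snd z)) = 0.
Proof.
destruct (side1 rs HS1 HI) as [s1 s2]. assert (R0 := r0_pos HI).
destruct (bounds HI) as (h1 & h2 & h3 & h4 & h5 & _).
destruct HH1 as (_ & rH & HrH & _ & HJ).
assert (Cb := cone_base p rs r0 1 (k1 p S1 V1)).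
destruct (@argument_near p rs r0 S1 1 (k1 p S1 V1) 1 rH Hp Hrs s1 HrH eq_refl s2) as [r1 Hr1].
assert (GS := Germ_speed Hp Hrs R0 s1 s2 (dens_jump1 HI) 0).
destruct (Germ_near_pos Cb (Germ_lam Hp Hrs R0 Cb 0) GS) as [r2 Hr2].
{ rewrite (speed1_base Hp Hrs HS1 HI), (lam_base Hp Hrs HI). lra. }
destruct (Germ_near_pos Cb GS (Germ_minus (Germ_veloc s1 s2 0) (Germ_eta_dens Hp s1 s2 0))) as [r3 Hr3].
{ rewrite (speed1_base Hp Hrs HS1 HI). simpl. lra. }
destruct (posreal_min (r1 :: r2 :: r3 :: nil)) as [r Hm].
exists r; intros z Cz Bz.
assert (Q : forall s, List.In s (r1 :: r2 :: r3 :: nil) -> ball (base p rs r0) s z) by (intros; eapply ball_le; [apply Hm|]; eauto).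
destruct (Hr1 z Cz) as [Dz Bz']. apply Q; simpl; auto.
rewrite (proj1 (characteristic_ahead Hp Hrs s1 Dz)).
repeat split; auto.
- apply Hr2; auto; apply Q; simpl; auto.
- apply Hr3; auto; apply Q; simpl; auto.
- apply HJ; auto.
Qed.

Lemma right_shock_near : exists r : posreal, forall z, cone (-1) (k2 p S2 V2) z -> ball (base p rs r0) r z ->
  dom S2 (snd z) /\
  c_out p rs (astar p rs S2 (snd z)) (bstar p rs S2 (snd z)) < speed4 p rs S2 z < mu4 p rs z /\
  J p rs (pr 0 z) (G2 p rs S2 H2 z) (astar p rs S2 (snd z)) (bstar p rs S2 (snd z)) = 0.
Proof.
destruct (side2 rs HS2 HI) as [s1 s2]. assert (R0 := r0_pos HI).
destruct (bounds HI) as (h1 & h2 & h3 & h4 & _ & h5).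
destruct HH2 as (_ & rH & HrH & _ & HJ).
assert (Cb := cone_base p rs r0 (-1) (k2 p S2 V2)).
destruct (@argument_near p rs r0 S2 (-1) (k2 p S2 V2) 0 rH Hp Hrs s1 HrH eq_refl s2) as [r1 Hr1].
assert (GS := Germ_speed Hp Hrs R0 s1 s2 (dens_jump2 HI) 0).
destruct (Germ_near_pos Cb GS (Germ_mu Hp Hrs R0 Cb 0)) as [r2 Hr2].
{ rewrite (speed2_base Hp Hrs HS2 HI), (mu_base Hp Hrs HI). lra. }
destruct (Germ_near_pos Cb (Germ_plus (Germ_veloc s1 s2 0) (Germ_eta_dens Hp s1 s2 0)) GS) as [r3 Hr3].
{ rewrite (speed2_base Hp Hrs HS2 HI). simpl. lra. }
destruct (posreal_min (r1 :: r2 :: r3 :: nil)) as [r Hm].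
exists r; intros z Cz Bz.
assert (Q : forall s, List.In s (r1 :: r2 :: r3 :: nil) -> ball (base p rs r0) s z) by (intros; eapply ball_le; [apply Hm|]; eauto).
destruct (Hr1 z Cz) as [Dz Bz']. apply Q; simpl; auto.
rewrite (proj2 (characteristic_ahead Hp Hrs s1 Dz)).
repeat split; auto.
- apply Hr3; auto; apply Q; simpl; auto.
- apply Hr2; auto; apply Q; simpl; auto.
- apply HJ; auto.
Qed.

End Existence.

Lemma near_origin d k F (P : R -> Prop) : 0 < d -> Cdiff k (Sq d) F -> locally (F (0, 0)) P ->
  locally ((0, 0) : Plane) (fun z => P (F z)).
Proof.
intros Hd HF HP.
assert (H0 : Sq d (0, 0)) by (split; simpl; rewrite Rabs_R0; auto).
assert (C := Cdiff_continuous _ _ _ _ HF H0). assert (C' := C P HP).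
generalize (filter_and _ _ (Sq_locally H0) (C' : locally ((0, 0) : Plane) (fun y => Sq d y -> P (F y)))).
apply filter_imp; intros y [y1 y2]; auto.
Qed.

Lemma Sq_of_locally d (P : Plane -> Prop) : 0 < d -> locally ((0, 0) : Plane) P ->
  exists e, 0 < e <= d /\ forall z, Sq e z -> P z.
Proof.
intros Hd [e He]. exists (Rmin d e); split.
- split; [apply Rmin_glb_lt; auto; apply cond_pos|apply Rmin_l].
- intros z [h1 h2]. apply He, Sq_ball. split; eapply Rlt_le_trans; eauto; apply Rmin_r.
Qed.

Lemma Cdiff_2 d (f f1 f2 : R -> R) :
  (forall u, Rabs u < d -> is_derive f u (f1 u) /\ is_derive f1 u (f2 u) /\ continuous f2 u) ->
  Cdiff 2 (fun u => Rabs u < d) f.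
Proof.
intros H. apply Cdiff_derive with f1; [intros; apply H; auto|].
apply Cdiff_derive with f2; [intros; apply H; auto|].
intros u Hu P HP. generalize (proj2 (proj2 (H u Hu)) P HP). unfold filtermap, within; apply filter_imp; auto.
Qed.

Lemma curve_derive (F Fu Fv : R -> R -> R) (g : R -> R) s c : is_derive g s c ->
  filterdiff (fun z : Plane => F (fst z) (snd z)) (locally ((g s, s) : Plane))
    (fun h => fst h * Fu (g s) s + snd h * Fv (g s) s) ->
  is_derive (fun s => F (g s) s) s (c * Fu (g s) s + Fv (g s) s).
Proof.
intros Hg HF. unfold is_derive.
assert (K := @filterdiff_comp'_2 R_AbsRing R_NormedModule R_NormedModule R_NormedModule R_NormedModule g (fun s => s) F s _ _
  (fun a b => a * Fu (g s) s + b * Fv (g s) s) Hg (filterdiff_id _) HF).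
eapply filterdiff_ext_lin. apply K. intros y. simpl.
change (y * c * Fu (g s) s + y * Fv (g s) s = y * (c * Fu (g s) s + Fv (g s) s)). ring.
Qed.

Lemma increment_u d (F Fu : R -> R -> R) u u' v :
  (forall u v, Rabs u < d -> Rabs v < d -> is_derive (fun u => F u v) u (Fu u v)) ->
  Rabs u < d -> Rabs u' < d -> Rabs v < d ->
  exists c, Rabs c < d /\ F u' v - F u v = Fu c v * (u' - u).
Proof.
intros HD h1 h2 h3.
assert (B : forall c, Rmin u u' <= c <= Rmax u u' -> Rabs c < d).
{ intros c Hc. apply Rabs_def2 in h1; apply Rabs_def2 in h2. apply Rabs_def1.
  - apply Rle_lt_trans with (1 := proj2 Hc). apply Rmax_lub_lt; lra.
  - apply Rlt_le_trans with (2 := proj1 Hc). apply Rmin_glb_lt; lra. }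
destruct (MVT_gen (fun u => F u v) u u' (fun u => Fu u v)) as [c [Hc Ec]].
- intros c Hc; apply HD; auto; apply B; lra.
- intros c Hc. apply derivable_continuous_pt. eexists. apply is_derive_Reals, HD; auto.
- exists c; split; auto.
Qed.

Lemma abs_ge_minus (x y A B : R) : Rabs x <= A -> B <= Rabs y -> B - A <= Rabs (x + y).
Proof.
intros h1 h2. replace y with ((x + y) + - x) in h2 by ring.
assert (K := Rabs_triang (x + y) (- x)). rewrite Rabs_Ropp in K. lra.
Qed.

(** The combinations [x + c t] and [x - c t] have a diagonally dominant
    Jacobian matrix. *)
Lemma dominant_injective d m c (t x tu tv xu xv : R -> R -> R) : 0 < m -> 0 < c ->
  (forall u v, Rabs u < d -> Rabs v < d ->
     is_derive (fun u => t u v) u (tu u v) /\ is_derive (fun v => t u v) v (tv u v)) ->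
  (forall u v, Rabs u < d -> Rabs v < d ->
     is_derive (fun u => x u v) u (xu u v) /\ is_derive (fun v => x u v) v (xv u v)) ->
  (forall u v, Rabs u < d -> Rabs v < d ->
     Rabs (xu u v + c * tu u v) <= m / 2 /\ m <= Rabs (xv u v + c * tv u v) /\
     Rabs (xv u v - c * tv u v) <= m / 2 /\ m <= Rabs (xu u v - c * tu u v)) ->
  forall u v u' v', Rabs u < d -> Rabs v < d -> Rabs u' < d -> Rabs v' < d ->
  Rabs (u' - u) + Rabs (v' - v) <= 4 * (1 + c) / m * (Rabs (t u' v' - t u v) + Rabs (x u' v' - x u v)).
Proof.
intros Hm Hc Ht Hx HB u v u' v' h1 h2 h3 h4.
assert (I : forall e, exists a b, Rabs a < d /\ Rabs b < d /\
  (x u' v' + e * t u' v') - (x u v + e * t u v) =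
  (xu a v' + e * tu a v') * (u' - u) + (xv u b + e * tv u b) * (v' - v) ).
{ intros e.
  destruct (@increment_u d (fun u v => x u v + e * t u v) (fun u v => xu u v + e * tu u v) u u' v') as [a [Ha Ea]]; auto.
  { intros y z q1 q2; apply derive_plus; [exact (proj1 (Hx _ _ q1 q2))|].
    eapply derive_eq; [exact (derive_mult (derive_const e y) (proj1 (Ht _ _ q1 q2)))|simpl; ring]. }
  destruct (@increment_u d (fun v u => x u v + e * t u v) (fun v u => xv u v + e * tv u v) v v' u) as [b [Hb Eb]]; auto.
  { intros y z q1 q2; apply derive_plus; [exact (proj2 (Hx _ _ q2 q1))|].
    eapply derive_eq; [exact (derive_mult (derive_const e y) (proj2 (Ht _ _ q2 q1)))|simpl; ring]. }
  simpl in Ea, Eb. exists a, b; repeat split; auto. rewrite <- Ea, <- Eb; ring. }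
destruct (I c) as (a & b & Ha & Hb & E). destruct (I (- c)) as (a' & b' & Ha' & Hb' & E').
set (A := Rabs (u' - u)). set (B := Rabs (v' - v)).
assert (A0 : 0 <= A) by apply Rabs_pos. assert (B0 : 0 <= B) by apply Rabs_pos.
destruct (HB a v' Ha h4) as (k1 & _ & _ & _). destruct (HB u b h1 Hb) as (_ & k2 & _ & _).
destruct (HB a' v' Ha' h4) as (_ & _ & _ & k4). destruct (HB u b' h1 Hb') as (_ & _ & k3 & _).
assert (P : m * B - m / 2 * A <= Rabs ((x u' v' + c * t u' v') - (x u v + c * t u v))).
{ rewrite E. apply abs_ge_minus; rewrite Rabs_mult; apply Rmult_le_compat_r; auto. }
assert (Q : m * A - m / 2 * B <= Rabs ((x u' v' + - c * t u' v') - (x u v + - c * t u v))).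
{ rewrite E', Rplus_comm. apply abs_ge_minus; rewrite Rabs_mult; apply Rmult_le_compat_r; auto.
  replace (xv u b' + - c * tv u b') with (xv u b' - c * tv u b') by ring; auto.
  replace (xu a' v' + - c * tu a' v') with (xu a' v' - c * tu a' v') by ring; auto. }
set (X := Rabs (x u' v' - x u v)). set (T := Rabs (t u' v' - t u v)).
assert (X0 : 0 <= X) by apply Rabs_pos. assert (T0 : 0 <= T) by apply Rabs_pos.
assert (PU : Rabs ((x u' v' + c * t u' v') - (x u v + c * t u v)) <= X + c * T).
{ replace ((x u' v' + c * t u' v') - (x u v + c * t u v)) with ((x u' v' - x u v) + c * (t u' v' - t u v)) by ring.
  eapply Rle_trans. apply Rabs_triang. rewrite Rabs_mult, (Rabs_pos_eq c) by lra. apply Rle_refl. }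
assert (QU : Rabs ((x u' v' + - c * t u' v') - (x u v + - c * t u v)) <= X + c * T).
{ replace ((x u' v' + - c * t u' v') - (x u v + - c * t u v)) with ((x u' v' - x u v) + - c * (t u' v' - t u v)) by ring.
  eapply Rle_trans. apply Rabs_triang. rewrite Rabs_mult, Rabs_Ropp, (Rabs_pos_eq c) by lra. apply Rle_refl. }
assert (S : m / 2 * (A + B) <= 2 * (X + c * T)) by lra.
assert (S' : 2 * (X + c * T) <= 2 * (1 + c) * (T + X)) by nra.
apply Rmult_le_reg_l with (m / 2). lra.
eapply Rle_trans. apply S. eapply Rle_trans. apply S'. right; field; lra.
Qed.

(** * From the core solution to the shock interaction problem *)

Section Solution.
Variables (p : R -> R) (rs : R) (S1 S2 : ahead) (r0 V1 V2 : R) (H1 H2 : R * R * R -> R) (da db : R).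
Hypotheses (Hp : pressure_law p) (Hrs : 0 < rs) (HS1 : ahead_left p S1) (HS2 : ahead_right p S2)
  (HI : interaction_point p S1 S2 r0 V1 V2)
  (HH1 : implicit_left p rs (b_0 p rs r0) (astar p rs S1 (0, 0)) (bstar p rs S1 (0, 0)) H1)
  (HH2 : implicit_right p rs (b_0 p rs r0) (astar p rs S2 (0, 0)) (bstar p rs S2 (0, 0)) H2).
Variables (d : R) (al al1 al2 be be1 be2 : R -> R) (t x f g fu r gv : R -> R -> R).
Hypotheses (Hd : 0 < d)
  (CS : core_solution (a_const (eta p r0) V1 V2) (b_0 p rs r0) da db (kap0 p r0 V1 / eta p r0) (/ eta p r0)
    (lam4 p rs) (mu4 p rs) (k1 p S1 V1) (k2 p S2 V2) (kap4 p rs S1) (KK4 p rs S2 r0 V1 V2)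
    (G1 p rs S1 H1) (G2 p rs S2 H2) d al al1 al2 be be1 be2 t x f g fu r gv).

Let lam u v := c_in p rs (al u) (be v).
Let mu u v := c_out p rs (al u) (be v).
Let half (z : Plane) := (al (fst z) + be (snd z)) / 2.
(** At the origin the derivatives in [u] and [v] are [0] and [2] for [x + eta0 t], and [- 2 kap0]
    and [0] for [x - eta0 t]. So [m] is half the smaller dominant entry. *)
Let m := Rmin 1 (kap0 p r0 V1).

Lemma eta_r0 : 0 < eta p r0.
Proof. apply eta_pos; auto. apply HI. Qed.

Lemma kap0_pos : 0 < kap0 p r0 V1.
Proof. destruct (bounds HI) as (h1 & h2 & _). unfold kap0. apply Rdiv_lt_0_compat; lra. Qed.

Lemma m_pos : 0 < m.
Proof. apply Rmin_glb_lt; [lra|apply kap0_pos]. Qed.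

Lemma Cdiff_al : Cdiff 2 (Sq d) (fun z => al (fst z)).
Proof.
apply (@Cdiff_comp_linear Plane R_NormedModule 2 (Sq d) (fun u => Rabs u < d) fst al).
- apply is_linear_fst.
- intros z Hz; apply Hz.
- apply Cdiff_2 with al1 al2, (cs_al CS).
Qed.

Lemma Cdiff_be : Cdiff 2 (Sq d) (fun z => be (snd z)).
Proof.
apply (@Cdiff_comp_linear Plane R_NormedModule 2 (Sq d) (fun u => Rabs u < d) snd be).
- apply is_linear_snd.
- intros z Hz; apply Hz.
- apply Cdiff_2 with be1 be2, (cs_be CS).
Qed.

Lemma Cdiff_half : Cdiff 2 (Sq d) half.
Proof. apply Cdiff_mult; [|apply Cdiff_const]. apply Cdiff_plus; [apply Cdiff_al|apply Cdiff_be]. Qed.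

Lemma Cdiff_f : Cdiff 1 (Sq d) (fun z => f (fst z) (snd z)).
Proof. apply (@Cdiff_partials 0 d f fu r (cs_f CS)); apply cont_on_Cdiff, CS. Qed.

Lemma Cdiff_g : Cdiff 1 (Sq d) (fun z => g (fst z) (snd z)).
Proof. apply (@Cdiff_partials 0 d g r gv (cs_g CS)); apply cont_on_Cdiff, CS. Qed.

Lemma Cdiff_t : (forall z, Sq d z -> filterdiff (fun z : Plane => t (fst z) (snd z)) (locally z)
     (fun h => fst h * f (fst z) (snd z) + snd h * g (fst z) (snd z))) /\
  Cdiff 2 (Sq d) (fun z => t (fst z) (snd z)).
Proof. exact (Cdiff_partials (cs_t CS) Cdiff_f Cdiff_g). Qed.

Section Regular.
Variable e : R.
Hypotheses (He : 0 < e <= d) (HR : forall z, Sq e z -> Phi_range p rs (half z)).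

Lemma Sq_incl z : Sq e z -> Sq d z.
Proof. intros [h1 h2]; split; lra. Qed.

Lemma Cdiff_eta_rho : Cdiff 2 (Sq e) (fun z => eta p (rho p rs (al (fst z)) (be (snd z)))).
Proof.
apply (Cdiff_ext (V := Plane)) with (f := fun z : Plane => eta p (Phi_inv p rs (half z))).
{ intros z _; rewrite rho_Phi_inv; auto. }
apply (@Cdiff_comp1 Plane (Sq e) 2 (eta p) (fun z => Phi_inv p rs (half z)) (fun r => 0 < r)).
- apply Cdiff_eta; auto.
- apply (@Cdiff_comp1 Plane (Sq e) 2 (Phi_inv p rs) half (Phi_range p rs)); auto.
  + apply Cdiff_Phi_inv; auto.
  + apply Cdiff_sub with (2 := Cdiff_half). apply Sq_incl.
- intros z Hz. apply Phi_inv_spec; auto.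
Qed.

Lemma Cdiff_vel : Cdiff 2 (Sq e) (fun z => vel (al (fst z)) (be (snd z))).
Proof.
apply Cdiff_sub with (D := Sq d); [apply Sq_incl|].
apply Cdiff_mult; [|apply Cdiff_const]. apply Cdiff_minus; [apply Cdiff_al|apply Cdiff_be].
Qed.

Lemma Cdiff_lam : Cdiff 2 (Sq e) (fun z => lam (fst z) (snd z)).
Proof. apply Cdiff_minus; [apply Cdiff_vel|apply Cdiff_eta_rho]. Qed.
Lemma Cdiff_mu : Cdiff 2 (Sq e) (fun z => mu (fst z) (snd z)).
Proof. apply Cdiff_plus; [apply Cdiff_vel|apply Cdiff_eta_rho]. Qed.

Lemma partials_x u v : Rabs u < e -> Rabs v < e ->
  is_derive (fun u => x u v) u (lam u v * f u v) /\ is_derive (fun v => x u v) v (mu u v * g u v).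
Proof. intros h1 h2; apply (cs_x CS); lra. Qed.

Lemma Cdiff_x : (forall z, Sq e z -> filterdiff (fun z : Plane => x (fst z) (snd z)) (locally z)
     (fun h => fst h * (lam (fst z) (snd z) * f (fst z) (snd z)) + snd h * (mu (fst z) (snd z) * g (fst z) (snd z)))) /\
  Cdiff 2 (Sq e) (fun z => x (fst z) (snd z)).
Proof.
apply (Cdiff_partials (Fu := fun u v => lam u v * f u v) (Fv := fun u v => mu u v * g u v) partials_x);
 apply Cdiff_mult.
- apply Cdiff_pred, Cdiff_lam.
- apply Cdiff_sub with (2 := Cdiff_f); apply Sq_incl.
- apply Cdiff_pred, Cdiff_mu.
- apply Cdiff_sub with (2 := Cdiff_g); apply Sq_incl.
Qed.

End Regular.

Lemma lam_0 : lam 0 0 = - eta p r0.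
Proof.
unfold lam. destruct (cs_0 CS) as (-> & -> & _). rewrite <- (lam_base Hp Hrs HI). reflexivity.
Qed.
Lemma mu_0 : mu 0 0 = eta p r0.
Proof.
unfold mu. destruct (cs_0 CS) as (-> & -> & _). rewrite <- (mu_base Hp Hrs HI). reflexivity.
Qed.

Lemma half_near : exists e, 0 < e <= d /\ forall z, Sq e z -> Phi_range p rs (half z).
Proof.
apply Sq_of_locally; auto. apply (near_origin Hd Cdiff_half). apply locally_Phi_range; auto.
exists r0; split; [apply HI|]. unfold half; simpl. destruct (cs_0 CS) as (-> & -> & _).
symmetry; apply half_b_0.
Qed.

Lemma locally_lt (y c : R) : y < c -> locally y (fun s => s < c).
Proof.
intros H; assert (H' : 0 < c - y) by lra; exists (mkposreal _ H'); intros s Hs.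
change (Rabs (s - y) < c - y) in Hs. apply Rabs_def2 in Hs; lra.
Qed.
Lemma locally_gt (y c : R) : c < y -> locally y (fun s => c < s).
Proof.
intros H; assert (H' : 0 < y - c) by lra; exists (mkposreal _ H'); intros s Hs.
change (Rabs (s - y) < y - c) in Hs. apply Rabs_def2 in Hs; lra.
Qed.

(** The open conditions on the size of the triangle, which hold at the origin and hence near it:
    positivity of [t_u], [t_v] and [mu - lam] for the Jacobian, diagonal dominance for injectivity,
    and the ball in which the conditions on the shocks are known. *)
Record good (e : R) (rr : posreal) : Prop := {
  gd_e : 0 < e <= d;
  gd_half : forall z, Sq e z -> Phi_range p rs (half z);
  gd_f : forall u v, Rabs u < e -> Rabs v < e -> 0 < f u v;
  gd_g : forall u v, Rabs u < e -> Rabs v < e -> 0 < g u v;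
  gd_lm : forall u v, Rabs u < e -> Rabs v < e -> lam u v < mu u v;
  gd_bd : forall u v, Rabs u < e -> Rabs v < e ->
     Rabs (lam u v * f u v + eta p r0 * f u v) <= m / 2 /\ m <= Rabs (mu u v * g u v + eta p r0 * g u v) /\
     Rabs (mu u v * g u v - eta p r0 * g u v) <= m / 2 /\ m <= Rabs (lam u v * f u v - eta p r0 * f u v);
  gd_ball : forall u v, Rabs u < e -> Rabs v < e ->
     ball (base p rs r0) rr (mk (al u) (be v) (t u v) (x u v)) }.

Lemma good_exists rr : exists e, good e rr.
Proof.
destruct half_near as (d1 & Hd1 & Hh).
assert (P1 : 0 < d1) by lra.
assert (Inc : forall z, Sq d1 z -> Sq d z) by (intros z [h1 h2]; split; lra).
assert (Hf := Cdiff_sub _ _ _ _ Inc Cdiff_f). assert (Hg := Cdiff_sub _ _ _ _ Inc Cdiff_g).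
assert (Ha := Cdiff_sub _ _ _ _ Inc Cdiff_al). assert (Hb := Cdiff_sub _ _ _ _ Inc Cdiff_be).
assert (Ht := Cdiff_sub _ _ _ _ Inc (proj2 Cdiff_t)). assert (Hx := proj2 (Cdiff_x Hd1 Hh)).
assert (Hl := Cdiff_pred (Cdiff_lam Hd1 Hh)). assert (Hm := Cdiff_pred (Cdiff_mu Hd1 Hh)).
destruct (cs_0 CS) as (a0 & b0 & _ & _ & t0 & x0 & f0 & g0).
assert (L0 := lam_0). assert (M0 := mu_0). assert (Pe := eta_r0). assert (Pk := kap0_pos). assert (Pm := m_pos).
assert (m1 : m <= 1) by apply Rmin_l. assert (m2 : m <= kap0 p r0 V1) by apply Rmin_r.
assert (K1 := near_origin P1 Hf (P := fun y => 0 < y)).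
assert (K2 := near_origin P1 Hg (P := fun y => 0 < y)).
assert (K3 := near_origin P1 (Cdiff_minus _ _ _ _ Hm Hl) (P := fun y => 0 < y)).
assert (K4 := near_origin P1 (Cdiff_mult _ _ _ _ (Cdiff_plus _ _ _ _ Hl (Cdiff_const _ _ (eta p r0))) Hf) (P := ball 0 (m / 2))).
assert (K5 := near_origin P1 (Cdiff_mult _ _ _ _ (Cdiff_plus _ _ _ _ Hm (Cdiff_const _ _ (eta p r0))) Hg) (P := fun y => m < y)).
assert (K6 := near_origin P1 (Cdiff_mult _ _ _ _ (Cdiff_minus _ _ _ _ Hm (Cdiff_const _ _ (eta p r0))) Hg) (P := ball 0 (m / 2))).
assert (K7 := near_origin P1 (Cdiff_mult _ _ _ _ (Cdiff_minus _ _ _ _ Hl (Cdiff_const _ _ (eta p r0))) Hf) (P := fun y => y < - m)).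
assert (B1 := near_origin P1 Ha (locally_ball _ rr)). assert (B2 := near_origin P1 Hb (locally_ball _ rr)).
assert (B3 := near_origin P1 Ht (locally_ball _ rr)). assert (B4 := near_origin P1 Hx (locally_ball _ rr)).
simpl in K1, K2, K3, K4, K5, K6, K7, B1, B2, B3, B4.
rewrite L0, f0 in *. rewrite M0, g0 in *. rewrite a0 in B1. rewrite b0 in B2. rewrite t0 in B3. rewrite x0 in B4.
assert (Hm2 : 0 < m / 2) by lra.
assert (k1' := K1 (locally_pos (Rdiv_lt_0_compat _ _ Pk Pe))).
assert (k2' := K2 (locally_pos (Rinv_0_lt_compat _ Pe))).
assert (k3' := K3 (locally_pos (x := eta p r0 - - eta p r0) ltac:(lra))).
assert (Z1 : (- eta p r0 + eta p r0) * (kap0 p r0 V1 / eta p r0) = 0) by ring.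
assert (Z2 : (eta p r0 + eta p r0) * / eta p r0 = 2) by (field; lra).
assert (Z3 : (eta p r0 - eta p r0) * / eta p r0 = 0) by ring.
assert (Z4 : (- eta p r0 - eta p r0) * (kap0 p r0 V1 / eta p r0) = - 2 * kap0 p r0 V1) by (field; lra).
rewrite Z1 in K4. rewrite Z2 in K5. rewrite Z3 in K6. rewrite Z4 in K7.
assert (k4' := K4 (locally_ball (0 : R_UniformSpace) (mkposreal _ Hm2))).
assert (k5' := K5 (locally_gt (y := 2) (c := m) ltac:(lra))).
assert (k6' := K6 (locally_ball (0 : R_UniformSpace) (mkposreal _ Hm2))).
assert (k7' := K7 (locally_lt (y := - 2 * kap0 p r0 V1) (c := - m) ltac:(lra))).
assert (near_and : forall P Q : Plane -> Prop, locally ((0, 0) : Plane) P -> locally ((0, 0) : Plane) Q ->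
  locally ((0, 0) : Plane) (fun z => P z /\ Q z)) by (intros; apply filter_and; auto).
assert (A := near_and _ _ k1' (near_and _ _ k2' (near_and _ _ k3' (near_and _ _ k4' (near_and _ _ k5'
  (near_and _ _ k6' (near_and _ _ k7' (near_and _ _ B1 (near_and _ _ B2 (near_and _ _ B3 B4)))))))))).
destruct (Sq_of_locally P1 A) as (e & He & HA).
assert (HA' : forall u v, Rabs u < e -> Rabs v < e -> _) by (intros u v h1 h2; exact (HA (u, v) (conj h1 h2))).
simpl in HA'. clear - He Hd1 Hh HA' Pm.
exists e; split.
- lra.
- intros z [h1 h2]; apply Hh; split; lra.
- intros u v h1 h2. apply (HA' u v h1 h2).
- intros u v h1 h2. apply (HA' u v h1 h2).
- intros u v h1 h2. assert (K := proj1 (proj2 (proj2 (HA' u v h1 h2)))). lra.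
- intros u v h1 h2. destruct (HA' u v h1 h2) as (_ & _ & _ & q1 & q2 & q3 & q4 & _).
  rewrite <- !Rmult_plus_distr_r, <- !Rmult_minus_distr_r.
  change (Rabs ((lam u v + eta p r0) * f u v - 0) < m / 2) in q1. change (Rabs ((mu u v - eta p r0) * g u v - 0) < m / 2) in q3.
  rewrite Rminus_0_r in q1, q3.
  repeat split; try lra.
  + rewrite Rabs_pos_eq; lra.
  + rewrite Rabs_left; lra.
- intros u v h1 h2. destruct (HA' u v h1 h2) as (_ & _ & _ & _ & _ & _ & _ & q1 & q2 & q3 & q4).
  split; split; assumption.
Qed.

Section Final.
Variables (e : R) (rr : posreal).
Hypotheses (GD : good e rr)
  (NL : forall z, cone 1 (k1 p S1 V1) z -> ball (base p rs r0) rr z ->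
    dom S1 (snd z) /\
    lam4 p rs z < speed4 p rs S1 z < c_in p rs (astar p rs S1 (snd z)) (bstar p rs S1 (snd z)) /\
    J p rs (G1 p rs S1 H1 z) (pr 1 z) (astar p rs S1 (snd z)) (bstar p rs S1 (snd z)) = 0)
  (NR : forall z, cone (-1) (k2 p S2 V2) z -> ball (base p rs r0) rr z ->
    dom S2 (snd z) /\
    c_out p rs (astar p rs S2 (snd z)) (bstar p rs S2 (snd z)) < speed4 p rs S2 z < mu4 p rs z /\
    J p rs (pr 0 z) (G2 p rs S2 H2 z) (astar p rs S2 (snd z)) (bstar p rs S2 (snd z)) = 0).
Variable eps : R.
Hypothesis Heps : 0 < eps < e.

Let a := a_const (eta p r0) V1 V2.
Let T : Plane -> Prop := Tri a eps.
Let al' (z : Plane) : R := al (fst z).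
Let be' (z : Plane) : R := be (snd z).
Let t' (z : Plane) : R := t (fst z) (snd z).
Let x' (z : Plane) : R := x (fst z) (snd z).

Lemma Tri_Sq z : T z -> Sq e z.
Proof.
assert (K : forall u v : R, 0 <= u -> u <= v -> v <= u / a -> u / a <= eps -> Rabs u < e /\ Rabs v < e).
{ intros; split; apply Rabs_def1; lra. }
intros (h1 & h2 & h3 & h4); apply K; auto.
Qed.

Lemma Tri_left u : Icc 0 (a * eps) u -> T (u, u).
Proof.
destruct (a_bounds HI) as [a1 a2]. fold a in a1, a2. intros [h1 h2]; unfold T, Tri; simpl.
assert (K : u / a <= eps) by (apply Rmult_le_reg_r with a; auto; replace (u / a * a) with u by (field; lra); lra).
repeat split; try lra.
apply Rmult_le_reg_r with a; auto. replace (u / a * a) with u by (field; lra). nra.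
Qed.

Lemma Tri_right v : Icc 0 eps v -> T (a * v, v).
Proof.
destruct (a_bounds HI) as [a1 a2]. fold a in a1, a2. intros [h1 h2]; unfold T, Tri; simpl.
replace (a * v / a) with v by (field; lra). repeat split; try lra; nra.
Qed.

Lemma Tri_origin : T (0, 0).
Proof.
replace 0 with (a * 0) at 1 by ring. apply Tri_right. split; lra.
Qed.

Lemma T_unique z : T z -> has_unique_diff T z.
Proof. apply Tri_unique; [apply (a_bounds HI)|lra]. Qed.

Lemma T_diff (F l : Plane -> R) z : T z -> filterdiff F (locally z) l -> filterdiff F (within T (locally z)) l.
Proof. intros; apply wdiff_locally; auto. Qed.

Lemma diff_t z : Sq e z -> filterdiff t' (locally z) (fun h => fst h * f (fst z) (snd z) + snd h * g (fst z) (snd z)).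
Proof. intros Hz. apply Cdiff_t. apply (Sq_incl (gd_e GD) Hz). Qed.

Lemma diff_x z : Sq e z -> filterdiff x' (locally z)
  (fun h => fst h * (lam (fst z) (snd z) * f (fst z) (snd z)) + snd h * (mu (fst z) (snd z) * g (fst z) (snd z))).
Proof. intros Hz. apply (Cdiff_x (gd_e GD) (gd_half GD)), Hz. Qed.

Lemma diff_al z : Sq e z -> filterdiff al' (locally z) (fun h => fst h * al1 (fst z)).
Proof.
intros Hz. apply (filterdiff_comp' (U := Plane) (V := R_NormedModule) (W := R_NormedModule) fst al z fst (fun y => y * al1 (fst z))).
- apply filterdiff_linear, is_linear_fst.
- apply (cs_al CS). apply (Sq_incl (gd_e GD) Hz).
Qed.

Lemma diff_be z : Sq e z -> filterdiff be' (locally z) (fun h => snd h * be1 (snd z)).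
Proof.
intros Hz. apply (filterdiff_comp' (U := Plane) (V := R_NormedModule) (W := R_NormedModule) snd be z snd (fun y => y * be1 (snd z))).
- apply filterdiff_linear, is_linear_snd.
- apply (cs_be CS). apply (Sq_incl (gd_e GD) Hz).
Qed.

Lemma partials_eq (F : Plane -> R) (Fu Fv : R) z : T z -> filterdiff F (locally z) (fun h => fst h * Fu + snd h * Fv) ->
  d1 T F z = Fu /\ d2 T F z = Fv.
Proof.
intros Hz HF. assert (K := T_diff Hz HF). unfold d1, d2.
rewrite !(@dwithin_eq Plane T z F _ (T_unique Hz) K). simpl; split; ring.
Qed.

Lemma d_t z : T z -> d1 T t' z = f (fst z) (snd z) /\ d2 T t' z = g (fst z) (snd z).
Proof. intros Hz; apply partials_eq; auto. apply diff_t, Tri_Sq, Hz. Qed.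
Lemma d_x z : T z -> d1 T x' z = lam (fst z) (snd z) * f (fst z) (snd z) /\ d2 T x' z = mu (fst z) (snd z) * g (fst z) (snd z).
Proof. intros Hz; apply partials_eq; auto. apply diff_x, Tri_Sq, Hz. Qed.
Lemma d_al z : T z -> d1 T al' z = al1 (fst z) /\ d2 T al' z = 0.
Proof.
intros Hz; apply partials_eq; auto. eapply filterdiff_ext_lin. apply diff_al, Tri_Sq, Hz.
intros y; simpl. rewrite Rmult_0_r, Rplus_0_r; auto.
Qed.
Lemma d_be z : T z -> d1 T be' z = 0 /\ d2 T be' z = be1 (snd z).
Proof.
intros Hz; apply partials_eq; auto. eapply filterdiff_ext_lin. apply diff_be, Tri_Sq, Hz.
intros y; simpl. rewrite Rmult_0_r, Rplus_0_l; auto.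
Qed.

Lemma curve_t b (h : R -> R) c s : 0 < b -> Icc 0 b s -> is_derive h s c -> Sq e (h s, s) ->
  deriv_on (Icc 0 b) (fun s => t' (h s, s)) s = c * f (h s) s + g (h s) s /\
  deriv_on (Icc 0 b) (fun s => x' (h s, s)) s = c * (lam (h s) s * f (h s) s) + mu (h s) s * g (h s) s.
Proof.
intros Hb Hs Hh Hz; split; apply deriv_on_eq; auto; unfold t', x'; simpl.
- apply (curve_derive Hh (diff_t Hz)).
- apply (@curve_derive x (fun u v => lam u v * f u v) (fun u v => mu u v * g u v) h s c Hh (diff_x Hz)).
Qed.

Lemma left_state u : Icc 0 (a * eps) u -> let z := mk (al u) (be u) (t u u) (x u u) in
  f u u = kap4 p rs S1 z * g u u /\ dom S1 (t u u, x u u) /\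
  lam u u < speed4 p rs S1 z < c_in p rs (astar p rs S1 (t u u, x u u)) (bstar p rs S1 (t u u, x u u)) /\
  J p rs (al u) (be u) (astar p rs S1 (t u u, x u u)) (bstar p rs S1 (t u u, x u u)) = 0.
Proof.
intros Hu z. destruct (Tri_Sq (Tri_left Hu)) as [q _]; simpl in q.
assert (He := gd_e GD).
assert (q' : 0 <= u < d) by (destruct Hu; apply Rabs_def2 in q; lra).
destruct (cs_left CS q') as (C & E1 & E2). fold z in C, E1, E2.
destruct (NL C (gd_ball GD q q)) as (D & L & JJ).
split; auto. split; auto. split; auto. rewrite <- E2 in JJ. exact JJ.
Qed.

Lemma right_state v : Icc 0 eps v -> let z := mk (al (a * v)) (be v) (t (a * v) v) (x (a * v) v) in
  g (a * v) v = KK4 p rs S2 r0 V1 V2 z * f (a * v) v /\ dom S2 (t (a * v) v, x (a * v) v) /\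
  c_out p rs (astar p rs S2 (t (a * v) v, x (a * v) v)) (bstar p rs S2 (t (a * v) v, x (a * v) v)) < speed4 p rs S2 z < mu (a * v) v /\
  J p rs (al (a * v)) (be v) (astar p rs S2 (t (a * v) v, x (a * v) v)) (bstar p rs S2 (t (a * v) v, x (a * v) v)) = 0.
Proof.
intros Hv z. destruct (Tri_Sq (Tri_right Hv)) as [q1 q2]; simpl in q1, q2.
assert (He := gd_e GD).
assert (q' : 0 <= v < d) by (destruct Hv; apply Rabs_def2 in q2; lra).
destruct (cs_right CS q') as (C & E1 & E2). fold a z in C, E1, E2.
destruct (NR C (gd_ball GD q1 q2)) as (D & L & JJ).
split; auto. split; auto. split; auto. rewrite <- E2 in JJ. exact JJ.
Qed.

Lemma interaction_solved : shock_interaction p rs S1 S2 a (b_0 p rs r0) da db V1 V2 eps al' be' t' x'.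
Proof.
assert (Pe := eta_r0). destruct (a_bounds HI) as [a1 a2]. fold a in a1, a2.
assert (Pae : 0 < a * eps) by (apply Rmult_lt_0_compat; lra).
destruct (cs_0 CS) as (c1 & c2 & c3 & c4 & c5 & c6 & c7 & c8).
assert (SB : forall S, speed_at p rs S al' be' t' x' (0, 0) = speed4 p rs S (base p rs r0)).
{ intros S; unfold speed_at, al', be', t', x'; simpl. rewrite c1, c2, c5, c6. reflexivity. }
split.
- intros z Hz. exact (gd_half GD (Tri_Sq Hz)).
- intros z Hz. fold T. rewrite (proj1 (d_x Hz)), (proj1 (d_t Hz)). reflexivity.
- intros z Hz. fold T. rewrite (proj2 (d_x Hz)), (proj2 (d_t Hz)). reflexivity.
- intros z Hz. apply (d_al Hz).
- intros z Hz. apply (d_be Hz).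
- intros u Hu. apply (left_state Hu).
- intros v Hv. apply (right_state Hv).
(* Derivatives along the diagonal are sums of partial derivatives; [t_u = kap4 t_v] turns them into
   the shock condition, and [lam < V] keeps the denominator of [kap4] away from zero. *)
- intros u Hu. destruct (@curve_t (a * eps) (fun s => s) 1 u Pae Hu (is_derive_id u) (Tri_Sq (Tri_left Hu))) as [E1 E2].
  rewrite E1, E2. destruct (left_state Hu) as (E & _ & [L1 _] & _).
  change (speed_at p rs S1 al' be' t' x' (u, u)) with (speed4 p rs S1 (mk (al u) (be u) (t u u) (x u u))).
  rewrite E. unfold kap4.
  change (lam4 p rs (mk (al u) (be u) (t u u) (x u u))) with (lam u u). change (mu4 p rs (mk (al u) (be u) (t u u) (x u u))) with (mu u u).
  set (w := speed4 p rs S1 (mk (al u) (be u) (t u u) (x u u))) in *. clearbody w. field. lra.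
- intros v Hv. destruct (@curve_t eps (fun s => a * s) a v (proj1 Heps) Hv (derive_scal_id a v) (Tri_Sq (Tri_right Hv))) as [E1 E2].
  rewrite E1, E2. destruct (right_state Hv) as (E & _ & [_ L1] & _).
  change (speed_at p rs S2 al' be' t' x' (a * v, v)) with (speed4 p rs S2 (mk (al (a * v)) (be v) (t (a * v) v) (x (a * v) v))).
  rewrite E. unfold KK4. fold a.
  change (lam4 p rs (mk (al (a * v)) (be v) (t (a * v) v) (x (a * v) v))) with (lam (a * v) v).
  change (mu4 p rs (mk (al (a * v)) (be v) (t (a * v) v) (x (a * v) v))) with (mu (a * v) v).
  set (w := speed4 p rs S2 (mk (al (a * v)) (be v) (t (a * v) v) (x (a * v) v))) in *. clearbody w. field. lra.
- intros u Hu z. apply (left_state Hu).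
- intros v Hv z. apply (right_state Hv).
- exact c1.
- exact c2.
- fold T. rewrite (proj1 (d_al Tri_origin)). exact c3.
- fold T. rewrite (proj2 (d_be Tri_origin)). exact c4.
- rewrite SB. exact (speed1_base Hp Hrs HS1 HI).
- rewrite SB. exact (speed2_base Hp Hrs HS2 HI).
- exact c5.
- exact c6.
- fold T. rewrite (proj2 (d_x Tri_origin)). simpl. rewrite mu_0, c8. field. lra.
- intros u Hu z. apply (left_state Hu).
- intros v Hv z. apply (right_state Hv).
Qed.

Lemma C2_sub (F : Plane -> R) (D : Plane -> Prop) : (forall z, T z -> D z) -> Cdiff 2 D F -> Ck (V := Plane) 2 T F.
Proof. intros HD HF. apply Cdiff_Ck. apply T_unique. apply Cdiff_sub with (2 := HF); auto. Qed.

Lemma Tri_d z : T z -> Sq d z.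
Proof. intros Hz. exact (Sq_incl (gd_e GD) (Tri_Sq Hz)). Qed.

Lemma regularity : Ck (V := Plane) 2 T al' /\ Ck (V := Plane) 2 T be' /\ Ck (V := Plane) 2 T t' /\ Ck (V := Plane) 2 T x'.
Proof.
split; [|split; [|split]].
- exact (C2_sub Tri_d Cdiff_al).
- exact (C2_sub Tri_d Cdiff_be).
- exact (C2_sub Tri_d (proj2 Cdiff_t)).
- exact (C2_sub Tri_Sq (proj2 (Cdiff_x (gd_e GD) (gd_half GD)))).
Qed.

Lemma jacobian_neq0 z : T z -> jacobian T t' x' z <> 0.
Proof.
intros Hz; unfold jacobian. destruct (d_t Hz) as [-> ->]. destruct (d_x Hz) as [-> ->].
destruct (Tri_Sq Hz) as [h1 h2].
assert (Pf := gd_f GD h1 h2). assert (Pg := gd_g GD h1 h2). assert (Pl := gd_lm GD h1 h2).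
set (F := f (fst z) (snd z)) in *. set (G := g (fst z) (snd z)) in *.
set (L := lam (fst z) (snd z)) in *. set (M := mu (fst z) (snd z)) in *.
replace (F * (M * G) - G * (L * F)) with (F * G * (M - L)) by ring.
apply Rgt_not_eq. apply Rmult_lt_0_compat; [apply Rmult_lt_0_compat; auto|lra].
Qed.

Lemma C2_of_tx (F : Plane -> R) : Cdiff 2 (Sq d) F -> C2_function_of T t' x' F.
Proof.
intros HF.
assert (Pm := m_pos). assert (Pe := eta_r0).
assert (Inc : forall z, T z -> Sq e z) by apply Tri_Sq.
assert (Cl := Cdiff_sub _ _ _ _ Inc (Cdiff_pred (Cdiff_lam (gd_e GD) (gd_half GD)))).
assert (Cm := Cdiff_sub _ _ _ _ Inc (Cdiff_pred (Cdiff_mu (gd_e GD) (gd_half GD)))).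
assert (Cf := Cdiff_sub _ _ _ _ Tri_d Cdiff_f). assert (Cg := Cdiff_sub _ _ _ _ Tri_d Cdiff_g).
assert (Pos : forall z, T z -> 0 < f (fst z) (snd z) /\ 0 < g (fst z) (snd z) /\ 0 < mu (fst z) (snd z) - lam (fst z) (snd z)).
{ intros z Hz; destruct (Tri_Sq Hz) as [h1 h2].
  assert (Pf := gd_f GD h1 h2). assert (Pg := gd_g GD h1 h2). assert (Pl := gd_lm GD h1 h2). lra. }
assert (Ci : forall h, Cdiff 1 T h -> (forall z, T z -> h z <> 0) -> Cdiff 1 T (fun z => / h z)).
{ intros h Ch Nh. exact (@Cdiff_comp1 Plane T 1 Rinv h (fun y => y <> 0) (Cdiff_Rinv 1) Ch Nh). }
assert (If := Ci _ (Cdiff_mult _ _ _ _ Cf (Cdiff_minus _ _ _ _ Cm Cl))).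
assert (Ig := Ci _ (Cdiff_mult _ _ _ _ Cg (Cdiff_minus _ _ _ _ Cm Cl))).
simpl in If, Ig.
assert (Jf : Cdiff 1 T (fun z => / (f (fst z) (snd z) * (mu (fst z) (snd z) - lam (fst z) (snd z))))).
{ apply If; intros z Hz; destruct (Pos z Hz) as (q1 & q2 & q3). apply Rgt_not_eq, Rmult_lt_0_compat; auto. }
assert (Jg : Cdiff 1 T (fun z => / (g (fst z) (snd z) * (mu (fst z) (snd z) - lam (fst z) (snd z))))).
{ apply Ig; intros z Hz; destruct (Pos z Hz) as (q1 & q2 & q3). apply Rgt_not_eq, Rmult_lt_0_compat; auto. }
(* The matrix with rows [(f, g)] and [(lam f, mu g)] has determinant [f g (mu - lam)]; the last four
   functions are the entries of its inverse. *)
apply (@C2_inverse T t' x' (4 * (1 + eta p r0) / m)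
  (fun z => f (fst z) (snd z)) (fun z => g (fst z) (snd z))
  (fun z => lam (fst z) (snd z) * f (fst z) (snd z)) (fun z => mu (fst z) (snd z) * g (fst z) (snd z))
  (fun z => mu (fst z) (snd z) * / (f (fst z) (snd z) * (mu (fst z) (snd z) - lam (fst z) (snd z))))
  (fun z => - 1 * / (f (fst z) (snd z) * (mu (fst z) (snd z) - lam (fst z) (snd z))))
  (fun z => (0 - lam (fst z) (snd z)) * / (g (fst z) (snd z) * (mu (fst z) (snd z) - lam (fst z) (snd z))))
  (fun z => / (g (fst z) (snd z) * (mu (fst z) (snd z) - lam (fst z) (snd z)))));
 try (intros z Hz; destruct (Pos z Hz) as (q1 & q2 & q3); field; lra).
- apply Rmult_le_pos; [lra|]. apply Rlt_le, Rinv_0_lt_compat; auto.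
- intros z z' Hz Hz'. destruct (Tri_Sq Hz) as [h1 h2]. destruct (Tri_Sq Hz') as [h3 h4].
  apply (@dominant_injective e m (eta p r0) t x f g (fun u v => lam u v * f u v) (fun u v => mu u v * g u v)); auto.
  + intros u v b1 b2. assert (He := gd_e GD). apply (cs_t CS); lra.
  + intros u v b1 b2. apply (partials_x (gd_e GD)); auto.
  + apply (gd_bd GD).
- intros z Hz. apply T_diff; auto. apply diff_t, Tri_Sq, Hz.
- intros z Hz. apply T_diff; auto. apply diff_x, Tri_Sq, Hz.
- apply T_unique.
- apply Cdiff_sub with (2 := HF). apply Tri_d.
- apply Cdiff_mult; auto.
- apply Cdiff_mult; auto using Cdiff_const.
- apply Cdiff_mult; auto. apply Cdiff_minus; auto using Cdiff_const.
- auto.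
Qed.

End Final.
End Solution.

Unset Implicit Arguments.

Theorem theorem1 :
  forall (p : R -> R) (rs : R) (S1 S2 : ahead) (r0 V1 V2 : R),
    pressure_law p -> 0 < rs ->
    ahead_left p S1 -> ahead_right p S2 ->
    interaction_point p S1 S2 r0 V1 V2 ->
    let a := a_const (eta p r0) V1 V2 in
    let b0 := beta_of p rs r0 0 in
  forall (H1 H2 : R * R * R -> R) (da db : R),
    implicit_left p rs b0 (astar p rs S1 (0, 0)) (bstar p rs S1 (0, 0)) H1 ->
    implicit_right p rs b0 (astar p rs S2 (0, 0)) (bstar p rs S2 (0, 0)) H2 ->
    initial_slopes p rs S1 S2 r0 V1 V2 H1 H2 da db ->
  exists eps0 eps1 : R, 0 < eps0 /\ 0 < eps1 /\
    forall eps : R, 0 < eps <= eps0 ->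
      exists al be t x : R * R -> R,
        shock_interaction p rs S1 S2 a b0 da db V1 V2 eps al be t x /\
        Ck 2 (Tri a eps) al /\ Ck 2 (Tri a eps) be /\
        Ck 2 (Tri a eps) t /\ Ck 2 (Tri a eps) x /\
        (eps <= eps1 ->
           (forall z, Tri a eps z -> jacobian (Tri a eps) t x z <> 0) /\
           C2_function_of (Tri a eps) t x al /\
           C2_function_of (Tri a eps) t x be).
Proof.
intros p rs S1 S2 r0 V1 V2 Hp Hrs HS1 HS2 HI a b0 H1 H2 da db HH1 HH2 Hsl.
destruct (existence Hp Hrs HS1 HS2 HI HH1 HH2 Hsl)
  as (d & al & al1 & al2 & be & be1 & be2 & t & x & f & g & fu & r & gv & Hd & CS).
destruct (left_shock_near Hp Hrs HS1 HI HH1) as [rho1 NL].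
destruct (right_shock_near Hp Hrs HS2 HI HH2) as [rho2 NR].
destruct (posreal_min (rho1 :: rho2 :: nil)) as [rr Hrr].
assert (L1 : rr <= rho1) by (apply Hrr; simpl; auto).
assert (L2 : rr <= rho2) by (apply Hrr; simpl; auto).
assert (NL' := fun z C B => NL z C (ball_le _ _ _ L1 _ B)).
assert (NR' := fun z C B => NR z C (ball_le _ _ _ L2 _ B)).
destruct (good_exists Hp Hrs HI Hd CS rr) as [e GD].
assert (He := gd_e GD).
(* Half of [e] makes [eps < e] strict; the same bound serves the claims about the Jacobian. *)
exists (e / 2), (e / 2); split; [lra|split; [lra|]].
intros eps Heps. assert (He' : 0 < eps < e) by lra.
exists (fun z => al (fst z)), (fun z => be (snd z)), (fun z => t (fst z) (snd z)), (fun z => x (fst z) (snd z)).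
split; [exact (interaction_solved Hp Hrs HS1 HS2 HI CS GD NL' NR' He')|].
destruct (regularity Hp Hrs HI CS GD He') as (R1 & R2 & R3 & R4).
split; [exact R1|split; [exact R2|split; [exact R3|split; [exact R4|]]]].
intros _; split; [exact (jacobian_neq0 Hp Hrs HI CS GD He')|split].
- exact (C2_of_tx Hp Hrs HI CS GD He' (Cdiff_al CS)).
- exact (C2_of_tx Hp Hrs HI CS GD He' (Cdiff_be CS)).
Qed.
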